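(* Let $d>6$ and let $\mathsf{E}(\mathbb{Z}^d)$ be either the nearest-neighbor or the spread-out edge set, and suppose that the critical two-point function estimates hold: there are constants $C>c>0$ with $c|x|^{2-d}\le \mathbb{P}_{p_c}(0\leftrightarrow x)\le C|x|^{2-d}$ for all $x\in\mathbb{Z}^d$. Write $\mathbb{P}=\mathbb{P}_{p_c}$. Suppose that, for each $n\geq 1$, $V_n, D_n\subseteq\mathbb{Z}^d$ satisfy $(V_n\cup D_n)\cap B(n)=\varnothing$ and are such that $0$ and some vertex of $V_n$ are in the same connected component of the graph $\mathbb{Z}^d\setminus D_n$. Then the limit $$\nu(\cdot):=\lim_{n\to\infty}\mathbb{P}\big(\,\cdot\mid 0\xleftrightarrow{\mathbb{Z}^d\setminus D_n}V_n\big)$$ exists in the sense of weak convergence of probability measures on $\{0,1\}^{\mathsf{E}(\mathbb{Z}^d)}$.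
   Context: The nearest-neighbor edge set is $\{\{x,y\}:\|x-y\|_1=1\}$; the spread-out edge set with parameter $\Lambda\ge 1$ is $\{\{x,y\}:0<\|x-y\|_\infty\le\Lambda\}$. $\mathbb{P}_p$ is the product measure on $\{0,1\}^{\mathsf{E}(\mathbb{Z}^d)}$ (product topology) under which the coordinates $\omega_e$ are i.i.d. Bernoulli$(p)$; an edge $e$ is open if $\omega_e=1$. $p_c\in(0,1)$ is the critical probability: $p_c=\inf\{p:\mathbb{P}_p(\text{the open cluster of }0\text{ is infinite})>0\}$. $|\cdot|$ is the Euclidean norm, with the convention $|0|^{a}=1$ for negative $a$. $B(n)=[-n,n]^d\cap\mathbb{Z}^d$. $x\leftrightarrow y$ means that $x$ and $y$ are joined by a path of open edges. For $A\subseteq\mathbb{Z}^d$, $x\xleftrightarrow{A}V$ means that $x$ is joined to some vertex of $V$ by a path of open edges all of whose vertices lie in $A$. $\mathbb{Z}^d\setminus D_n$ is regarded as the subgraph of $(\mathbb{Z}^d,\mathsf{E}(\mathbb{Z}^d))$ induced by that vertex set. *)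

(* Defs.v *)
From HB Require Import structures.
From mathcomp Require Import all_boot all_order all_algebra finmap.
From mathcomp Require Import all_classical all_reals all_analysis.

Set Implicit Arguments.
Unset Strict Implicit.
Unset Printing Implicit Defensive.

Import Order.TTheory GRing.Theory Num.Theory.
Import numFieldNormedType.Exports.

Local Open Scope classical_set_scope.
Local Open Scope ring_scope.

Notation Zd d := 'rV[int]_d.

Definition l1norm d (x : Zd d) : nat := (\sum_(i < d) `|x 0%R i|)%N.
Definition linfnorm d (x : Zd d) : nat := (\max_(i < d) `|x 0%R i|)%N.

Definition enorm (R : realType) d (x : Zd d) : R :=
  Num.sqrt (\sum_(i < d) (x 0 i)%:~R ^+ 2).

(* The value at x = 0 is the convention |0|^a = 1, used for negative a; the
   library has 0 ^ a = 0 for a < 0. *)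
Definition enorm_pow (R : realType) d (x : Zd d) (a : int) : R :=
  if x == 0 then 1 else enorm R x ^ a.

Definition box d (n : nat) : set (Zd d) :=
  [set x | forall i, - n%:Z <= x 0 i <= n%:Z].

(* An undirected edge {x, y} is the finite set [fset x; y]. *)
Definition nn_edges d : set {fset Zd d} :=
  [set [fset x.1; x.2]%fset | x in [set x : Zd d * Zd d |
     l1norm (x.1 - x.2) = 1%N]].

Definition spread_out_edges (R : realType) d (Lambda : R) : set {fset Zd d} :=
  [set [fset x.1; x.2]%fset | x in [set x : Zd d * Zd d |
     (0 < linfnorm (x.1 - x.2))%N /\ (linfnorm (x.1 - x.2))%:R <= Lambda]].

Arguments box d n : clear implicits.
Arguments nn_edges d : clear implicits.
Arguments spread_out_edges {R} d Lambda.

(* There is a path from x to y that uses edges of S and whose vertices, both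
   endpoints included, all lie in A. *)
Definition joined d (S : set {fset Zd d}) (A : set (Zd d)) (x y : Zd d) : Prop :=
  exists p : seq (Zd d),
    [/\ path (fun u v => `[< S [fset u; v]%fset >]) x p,
        last x p = y & forall z, z \in x :: p -> A z].

Section percolation.
Context (d : nat) (E : set {fset Zd d}).

(* {0,1}^E with the product topology *)
Definition config : Type := {ptws E -> bool}.

HB.instance Definition _ := Topological.on config.
HB.instance Definition _ := isPointed.Build config (fun=> false).

Definition open_edges (omega : config) : set {fset Zd d} :=
  [set val e | e in [set e : E | omega e]].

Definition joined_to (A V : set (Zd d)) (x : Zd d) : set config :=
  [set omega | exists2 v, V v & joined (open_edges omega) A x v].

Definition connected_to (x y : Zd d) : set config :=
  [set omega | joined (open_edges omega) setT x y].

Definition cluster (omega : config) (x : Zd d) : set (Zd d) :=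
  [set y | connected_to x y omega].

End percolation.

Arguments joined_to {d} E A V x.
Arguments connected_to {d} E x y.

Notation borel T := (g_sigma_algebraType (@open (T : ptopologicalType))).

Lemma open_open_edge d (E : set {fset Zd d}) (e : {fset Zd d}) :
  open [set omega : config E | open_edges omega e].
Proof.
have [Ee|nEe] := pselect (E e); last first.
  rewrite (_ : mkset _ = set0); first exact: open0.
  by apply/seteqP; split=> // omega [e' _ e'E]; apply: nEe; rewrite -e'E;
     apply: set_valP.
pose e0 : E := exist _ e (mem_set Ee).
rewrite (_ : mkset _ = (fun omega : config E => omega e0) @^-1` [set true]).
  apply: open_comp; last exact: discrete_open.
  by move=> omega _; exact: (@proj_continuous _ (fun _ : E => bool) e0).
apply/seteqP; split=> omega /=.
  by move=> [e' oe' e'e]; have -> : e0 = e' by apply: val_inj.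
by move=> oe0; exists e0.
Qed.

Lemma open_joined_to d (E : set {fset Zd d}) (A V : set (Zd d)) (x : Zd d) :
  open (joined_to E A V x).
Proof.
have opath y (p : seq (Zd d)) : open [set omega : config E |
    path (fun u v => `[< open_edges omega [fset u; v]%fset >]) y p].
  elim: p y => [|z p IH] y /=.
    by rewrite (_ : mkset _ = setT); [exact: openT|apply/seteqP; split].
  rewrite (_ : mkset _ = [set omega | open_edges omega [fset y; z]%fset] `&`
    [set omega : config E |
      path (fun u v => `[< open_edges omega [fset u; v]%fset >]) z p]).
    by apply: openI; [exact: open_open_edge|exact: IH].
  by apply/seteqP; split=> omega /=; [move=> /andP[/asboolP]|
     move=> [/asboolP -> ->]].
rewrite (_ : joined_to _ _ _ _ = \bigcup_(p in [set p : seq (Zd d) |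
    V (last x p) /\ forall z, z \in x :: p -> A z]) [set omega : config E |
    path (fun u v => `[< open_edges omega [fset u; v]%fset >]) x p]).
  by apply: bigcup_open => p _; exact: opath.
apply/seteqP; split=> omega /=.
  by move=> [v Vv [p [pp lp Ap]]]; exists p => //=; rewrite lp.
by move=> [p [Vp Ap] pp]; exists (last x p) => //; exists p.
Qed.

Lemma measurable_joined_to d (E : set {fset Zd d}) (A V : set (Zd d))
    (x : Zd d) :
  measurable (joined_to E A V x : set (borel (config E))).
Proof. by apply: sub_sigma_algebra; exact: open_joined_to. Qed.
Arguments measurable_joined_to {d} E A V x.

(* P is the law under which the coordinates are i.i.d. Bernoulli(p): it agrees
   with the product of the one-coordinate laws on finite-dimensional
   rectangles. *)
Definition is_bernoulli_product (R : realType) d (E : set {fset Zd d}) (p : R)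
    (P : probability (borel (config E)) R) : Prop :=
  forall (s : {fset E}) (B : E -> set bool),
    P [set omega : config E | forall e, e \in s -> B e (omega e)] =
    (\prod_(e <- s) fine (bernoulli_prob p (B e)))%:E.

Definition critical_probability (R : realType) d (E : set {fset Zd d})
    (P : R -> probability (borel (config E)) R) : R :=
  inf [set p | 0 <= p <= 1 /\
    (0 < P p [set omega : config E | infinite_set (cluster omega 0)])%E].

(* A |-> P (A `&` H) / P H; the last argument of mnormalize only matters when
   P H = 0. *)
Definition conditional (R : realType) dis (T : measurableType dis)
    (P : probability T R) (H : set T) (mH : measurable H) : probability T R :=
  mnormalize (mrestr P mH) P.

Definition weak_cvg (R : realType) (T : ptopologicalType)
    (mu : nat -> probability (borel T) R) (nu : probability (borel T) R) : Prop :=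
  forall f : T -> R, continuous f -> [bounded f x | x in [set: T]] ->
    (\int[mu n]_x (f x)%:E)%E @[n --> \oo] --> (\int[nu]_x (f x)%:E)%E.

(* Main.v *)
Require Import Defs.
From HB Require Import structures.
From mathcomp Require Import all_boot all_order all_algebra finmap.
From mathcomp Require Import all_classical all_reals all_analysis.
From mathcomp.analysis Require Import measurable_realfun.
From mathcomp Require Import perm ring lra zify.

Set Implicit Arguments.
Unset Strict Implicit.
Unset Printing Implicit Defensive.

Import Order.TTheory GRing.Theory Num.Theory.
Import numFieldNormedType.Exports.

Local Open Scope classical_set_scope.
Local Open Scope ring_scope.

(** The Aizenman-Kesten-Newman two-arm bound, combined with gluing two points at
    distance r at a cost exp(-C (log r)^2), makes the one-arm probability at p_c
    decay.  By a tree-splitting argument and the BK inequality, large clusters in a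
    box are very unlikely, so that the clusters met below are sparse, and a sparse
    set can be avoided: since [d > 6], 0 is still joined to the far set V outside
    such a set with a probability comparable to the unrestricted one.  Hence, given
    0 <-> V, with conditional probability bounded below the connection goes through a
    fully open ball Q outside a box, Q being joined to V off the cluster of the box
    in the complement of Q.  Exploring that cluster separates the inner event
    0 <-> Q, which ignores V, from the outer one, which depends on it only through a
    bounded factor.  So the oscillation of P(F | 0 <-> V off D), for a local event F
    and over all V and D far from 0, contracts by a fixed factor from one scale to a
    larger one, and the conditional probabilities of local events converge.  The
    limit measure is the image of Lebesgue measure under nested intervals of [0, 1)
    indexed by finite prefixes of a configuration; weak convergence follows since
    continuous functions on {0,1}^E are uniformly close to local ones. *)

(** Exponents decide everything. Let r = 2^(3i). The sum of the two-point function over pairs of a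
    box of side r is of order r^(d+2), so clusters with more than r^((d+2)/2) vertices are rare. The
    size allowed below is r^(d - 7/3), and the kernel r^(2-d) beats it by r^(-1/3) = 2^(-i), which
    is summable over scales. The inequality (d+2)/2 < d - 7/3 means d > 20/3: this is where d > 6
    enters, d being an integer, and the exponent [3 * d - 7] met throughout is 3(d - 7/3). The
    obstacle is that gluing is dearer than any power of the distance. A comparison at a fixed small
    error therefore needs radii like 2^(C i^2), and it is affordable only because tree splitting
    makes oversized clusters doubly exponentially unlikely in i. The balls that are forced open have
    a fixed radius for the same reason. All estimates live in finite boxes and are uniform in the
    box, so that V_n and D_n enter only through a set A that contains a large ball and a target V
    that misses it; the infinite-volume measure is reached at the end by monotone limits. *)

(** * Finite product measures *)

(* [Ex p s f] is the expectation of [f w], where [w] is the random set of those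
   entries of [s] that are kept, each independently with probability [p]. *)
Fixpoint Ex (R : realType) (I : eqType) (p : R) (s : seq I) (f : set I -> R) : R :=
  if s is e :: s' then
    (1 - p) * Ex p s' f + p * Ex p s' (fun w => f (e |` w))
  else f set0.

Definition Pr (R : realType) (I : eqType) (p : R) (s : seq I)
    (X : set I -> Prop) : R := Ex p s (fun w => `[< X w >]%:R).

Definition increasing (I : Type) (X : set I -> Prop) :=
  forall w w', w `<=` w' -> X w -> X w'.

Definition depends_on (I T : Type) (U : set I) (f : set I -> T) :=
  forall w, f w = f (w `&` U).

(** Disjoint occurrence in the sense of van den Berg and Kesten; for increasing events, a set of
    open edges that satisfies the event by itself is a witness of it. *)
Definition disj_occ (I : Type) (X Y : set I -> Prop) : set I -> Prop :=
  fun w => exists w1 w2, [/\ w1 `<=` w, w2 `<=` w, w1 `&` w2 = set0, X w1 & Y w2].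

Section ex_basics.
Context (R : realType) (I : eqType) (p : R).
Implicit Types (s : seq I) (f g : set I -> R) (X Y Z : set I -> Prop).

Lemma Ex_cst s c : Ex p s (fun=> c) = c.
Proof. by elim: s => //= e s ->; ring. Qed.

Lemma ExD s f g : Ex p s (fun w => f w + g w) = Ex p s f + Ex p s g.
Proof. by elim: s f g => //= e s IH f g; rewrite !IH; ring. Qed.

Lemma ExZ s c f : Ex p s (fun w => c * f w) = c * Ex p s f.
Proof. by elim: s f => //= e s IH f; rewrite !IH; ring. Qed.

Lemma ExZr s c f : Ex p s (fun w => f w * c) = Ex p s f * c.
Proof. by elim: s f => //= e s IH f; rewrite !IH; ring. Qed.

Lemma ExB s f g : Ex p s (fun w => f w - g w) = Ex p s f - Ex p s g.
Proof. by elim: s f g => //= e s IH f g; rewrite !IH; ring. Qed.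

Lemma Ex_sum (J : Type) (r : seq J) (Q : pred J) s (F : J -> set I -> R) :
  Ex p s (fun w => \sum_(j <- r | Q j) F j w) = \sum_(j <- r | Q j) Ex p s (F j).
Proof.
elim: r => [|j r IH].
  rewrite big_nil -[RHS](Ex_cst s); congr Ex; apply/funext => w.
  by rewrite big_nil.
rewrite big_cons -IH; case Qj : (Q j).
  by rewrite -ExD; congr Ex; apply/funext => w; rewrite big_cons Qj.
by congr Ex; apply/funext => w; rewrite big_cons Qj.
Qed.

Lemma eq_Ex s f g : (forall w, w `<=` [set` s] -> f w = g w) -> Ex p s f = Ex p s g.
Proof.
elim: s f g => [|e s IH] f g fg /=; first exact: fg.
congr (_ * _ + _ * _); apply: IH => w ws; apply: fg.
  by move=> x /ws /=; rewrite in_cons => ->; rewrite orbT.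
move=> x /= [->|/ws /=]; first by rewrite mem_head.
by rewrite in_cons => ->; rewrite orbT.
Qed.

Lemma Ex_cat s1 s2 f :
  Ex p (s1 ++ s2) f = Ex p s1 (fun w1 => Ex p s2 (fun w2 => f (w1 `|` w2))).
Proof.
elim: s1 f => [|e s IH] f /=; last first.
  rewrite !IH; congr (_ * _ + _ * _); congr Ex; apply/funext => w.
  by congr Ex; apply/funext => w'; rewrite setUA.
by congr Ex; apply/funext => w; rewrite set0U.
Qed.

Lemma Ex_perm s1 s2 f : perm_eq s1 s2 -> Ex p s1 f = Ex p s2 f.
Proof.
elim: s1 s2 f => [|e s1 IH] s2 f.
  by rewrite perm_sym => /perm_nilP ->.
move=> p12; have es2 : e \in s2 by rewrite -(perm_mem p12) mem_head.
have [s3 [s4 s2E]] : exists s3 s4, s2 = s3 ++ e :: s4.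
  by case/splitPr: es2 => s3 s4; exists s3, s4.
have p1 : perm_eq s1 (s3 ++ s4).
  by rewrite -(perm_cons e) (permPl p12) s2E perm_catC /= perm_cons perm_catC.
rewrite /= (IH _ _ p1) (IH _ (fun w => _) p1) s2E !Ex_cat /=.
rewrite -!ExZ -ExD; apply: eq_Ex => w _.
congr (_ * _ + _ * _); congr Ex; apply/funext => w'.
by rewrite setUCA.
Qed.

Lemma Ex_map (J : eqType) (phi : I -> J) s (f : set J -> R) :
  Ex p (map phi s) f = Ex p s (fun w => f (phi @` w)).
Proof.
elim: s f => [|e s IH] f /=; first by rewrite image_set0.
rewrite !IH; congr (_ * _ + _ * _); congr Ex; apply/funext => w.
by rewrite image_setU image_set1.
Qed.

Lemma dependsE (T : Type) (U : set I) (f : set I -> T) w w' :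
  depends_on U f -> w `&` U = w' `&` U -> f w = f w'.
Proof. by move=> fU ww'; rewrite fU ww' -fU. Qed.

Lemma depends_add (T : Type) (U : set I) (f : set I -> T) e :
  depends_on U f -> depends_on U (fun w => f (e |` w)).
Proof.
move=> fU w; apply: (dependsE fU); rewrite !setIUl.
by rewrite -setIA setIid.
Qed.

Lemma depends_notin (T : Type) (U : set I) (f : set I -> T) e w :
  depends_on U f -> ~ U e -> f (e |` w) = f w.
Proof.
move=> fU Ue; apply: (dependsE fU); rewrite setIUl.
rewrite (_ : [set e] `&` U = set0) ?set0U//.
by apply/seteqP; split => // x [->].
Qed.

Lemma depends_sub (T : Type) (U U' : set I) (f : set I -> T) :
  U `<=` U' -> depends_on U f -> depends_on U' f.
Proof.
move=> UU' fU w; apply: (dependsE fU); rewrite -setIA.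
by congr (_ `&` _); apply/seteqP; split=> x; [move=> Ux; split=> //; exact: UU'|move=> []].
Qed.

(** Each coordinate outside [U] contributes the total mass (1 - p) + p = 1. *)
Lemma Ex_filter s (U : pred I) f : depends_on [set` U] f ->
  Ex p s f = Ex p [seq e <- s | U e] f.
Proof.
elim: s f => //= e s IH f fU; case: ifPn => Ue /=.
  by rewrite (IH f fU) (IH _ (depends_add e fU)).
rewrite (IH f fU) [X in _ + p * X](_ : _ = Ex p s f).
  by rewrite (IH f fU); ring.
by apply: eq_Ex => w _; rewrite (depends_notin _ fU (negP Ue)).
Qed.

Lemma Ex_indep s (U U' : set I) f g : U `&` U' = set0 ->
  depends_on U f -> depends_on U' g ->
  Ex p s (fun w => f w * g w) = Ex p s f * Ex p s g.
Proof.
move=> UU'; elim: s f g => //= e s IH f g fU gU.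
have [Ue|nUe] := pselect (U e).
  have gE w : g (e |` w) = g w.
    apply: depends_notin gU _ => U'e.
    by have : (U `&` U') e by []; rewrite UU'.
  rewrite IH//; under [X in _ + p * X = _]eq_Ex => w _ do rewrite gE.
  rewrite (IH _ _ (depends_add e fU) gU); under [X in _ = _ * (_ + p * X)]eq_Ex => w _ do rewrite gE.
  by ring.
have fE w : f (e |` w) = f w by apply: depends_notin fU _.
rewrite IH//; under [X in _ + p * X = _]eq_Ex => w _ do rewrite fE.
rewrite (IH _ _ fU (depends_add e gU)); under [X in _ = (_ + p * X) * _]eq_Ex => w _ do rewrite fE.
by ring.
Qed.

End ex_basics.

Section ex_order.
Context (R : realType) (I : eqType) (p : R) (p01 : 0 <= p <= 1).
Implicit Types (s : seq I) (f g : set I -> R) (X Y Z : set I -> Prop).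

Let p0 : 0 <= p. Proof. by case/andP: p01. Qed.
Let q0 : 0 <= 1 - p. Proof. by rewrite subr_ge0; case/andP: p01. Qed.

Lemma Ex_ge0 s f : (forall w, w `<=` [set` s] -> 0 <= f w) -> 0 <= Ex p s f.
Proof.
elim: s f => [|e s IH] f f0 /=; first exact: f0.
apply: addr_ge0; apply: mulr_ge0 => //; apply: IH => w ws; apply: f0.
  by move=> x /ws /=; rewrite in_cons => ->; rewrite orbT.
move=> x /= [->|/ws /=]; first by rewrite mem_head.
by rewrite in_cons => ->; rewrite orbT.
Qed.

Lemma le_Ex s f g : (forall w, w `<=` [set` s] -> f w <= g w) -> Ex p s f <= Ex p s g.
Proof. by move=> fg; rewrite -subr_ge0 -ExB; apply: Ex_ge0 => w ws; rewrite subr_ge0 fg. Qed.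

Lemma Pr_ge0 s X : 0 <= Pr p s X.
Proof. by apply: Ex_ge0 => w _; rewrite ler0n. Qed.

Lemma Pr_le1 s X : Pr p s X <= 1.
Proof. by rewrite -[leRHS](Ex_cst p s); apply: le_Ex => w _; rewrite lern1 leq_b1. Qed.

Lemma le_Pr s X Y : (forall w, w `<=` [set` s] -> X w -> Y w) -> Pr p s X <= Pr p s Y.
Proof.
move=> XY; apply: le_Ex => w ws; rewrite ler_nat.
by case: asboolP => //= Xw; rewrite asboolT//; exact: XY.
Qed.

Lemma Pr_true s X : (forall w, X w) -> Pr p s X = 1.
Proof. by move=> XT; rewrite -[RHS](Ex_cst p s); apply: eq_Ex => w _; rewrite asboolT. Qed.

Lemma Pr_false s X : (forall w, ~ X w) -> Pr p s X = 0.
Proof. by move=> XF; rewrite -[RHS](Ex_cst p s); apply: eq_Ex => w _; rewrite asboolF. Qed.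

Lemma Pr_not s X : Pr p s (fun w => ~ X w) = 1 - Pr p s X.
Proof.
rewrite -[X in X - _](Ex_cst p s) -ExB; apply: eq_Ex => w _.
by rewrite asbool_neg; case: asboolP => _ /=; rewrite ?subr0 ?subrr.
Qed.

Lemma Pr_union (J : eqType) (r : seq J) s X (Y : J -> set I -> Prop) :
  (forall w, w `<=` [set` s] -> X w -> exists2 j, j \in r & Y j w) ->
  Pr p s X <= \sum_(j <- r) Pr p s (Y j).
Proof.
move=> XY; rewrite -Ex_sum; apply: le_Ex => w ws.
case: asboolP => [/(XY _ ws) [j jr Yj]|_]; last by apply: sumr_ge0 => *; rewrite ler0n.
rewrite (big_rem j jr)/= asboolT// lerDl.
by apply: sumr_ge0 => *; rewrite ler0n.
Qed.

Lemma Pr_split s X Y Z : (forall w, w `<=` [set` s] -> X w -> Y w \/ Z w) ->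
  Pr p s X <= Pr p s Y + Pr p s Z.
Proof.
move=> XYZ; rewrite -ExD; apply: le_Ex => w ws.
case: asboolP => [/(XYZ _ ws)[|] h|_]; last by rewrite addr_ge0 ?ler0n.
  by rewrite (@asboolT (Y w))// lerDl ler0n.
by rewrite (@asboolT (Z w))// lerDr ler0n.
Qed.

Lemma Pr_indep s (U U' : set I) X Y : U `&` U' = set0 ->
  depends_on U X -> depends_on U' Y ->
  Pr p s (fun w => X w /\ Y w) = Pr p s X * Pr p s Y.
Proof.
move=> UU' XU YU; rewrite -(Ex_indep p s UU').
- by apply: eq_Ex => w _; rewrite asbool_and; case: asboolP; case: asboolP; rewrite /= ?mulr1 ?mulr0.
- by move=> w; rewrite -XU.
- by move=> w; rewrite -YU.
Qed.

Lemma incr_add X e : increasing X -> increasing (fun w => X (e |` w)).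
Proof. by move=> iX w w' ww'; apply: iX; apply: setUS. Qed.

Lemma le_Ex_add s f e : (forall w w', w `<=` w' -> f w <= f w') ->
  Ex p s f <= Ex p s (fun w => f (e |` w)).
Proof. by move=> fi; apply: le_Ex => w _; apply: fi; exact: subsetUr. Qed.

(** Harris' inequality, by revealing one coordinate: the conditional means of both functions
    increase with it, and the covariance that this coordinate contributes is p(1 - p)(a' - a)(b' -
    b). *)
Lemma FKG s f g : (forall w w', w `<=` w' -> f w <= f w') ->
  (forall w w', w `<=` w' -> g w <= g w') ->
  Ex p s f * Ex p s g <= Ex p s (fun w => f w * g w).
Proof.
elim: s f g => //= e s IH f g fi gi.
have H1 := IH _ _ fi gi.
have H2 := IH (fun w => f (e |` w)) (fun w => g (e |` w))
  (fun w w' ww' => fi _ _ (setUS ww')) (fun w w' ww' => gi _ _ (setUS ww')).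
have H3 := le_Ex_add s e fi; have H4 := le_Ex_add s e gi.
apply: (@le_trans _ _ ((1 - p) * (Ex p s f * Ex p s g) +
    p * (Ex p s (fun w => f (e |` w)) * Ex p s (fun w => g (e |` w))))).
  rewrite -subr_ge0; set a := Ex p s f; set b := Ex p s g.
  set a' := Ex _ _ _; set b' := Ex _ _ _.
  rewrite (_ : _ - _ = p * (1 - p) * ((a' - a) * (b' - b))); last by ring.
  by rewrite !mulr_ge0 // subr_ge0.
by apply: lerD; apply: ler_wpM2l.
Qed.

Lemma Pr_FKG s X Y : increasing X -> increasing Y ->
  Pr p s X * Pr p s Y <= Pr p s (fun w => X w /\ Y w).
Proof.
move=> iX iY; apply: (le_trans (FKG s (f := fun w => _%:R) (g := fun w => _%:R) _ _)).
- move=> w w' ww'; rewrite ler_nat; case: asboolP => // Xw.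
  by rewrite asboolT//; exact: iX Xw.
- move=> w w' ww'; rewrite ler_nat; case: asboolP => // Xw.
  by rewrite asboolT//; exact: iY Xw.
- apply: le_Ex => w _; rewrite -natrM ler_nat asbool_and.
  by case: asboolP; case: asboolP.
Qed.

(* The pair of disjoint witnesses is treated jointly, so that one coordinate can
   be revealed at a time. *)
Lemma BK_pair s (Phi : set I -> set I -> Prop) :
  (forall w1 w1' w2 w2', w1 `<=` w1' -> w2 `<=` w2' -> Phi w1 w2 -> Phi w1' w2') ->
  Pr p s (fun w => exists w1 w2, [/\ w1 `<=` w, w2 `<=` w, w1 `&` w2 = set0 & Phi w1 w2])
  <= Ex p s (fun w1 => Pr p s (Phi w1)).
Proof.
elim: s Phi => [|e s IH] Phi iPhi.
  rewrite /Pr /= ler_nat; case: asboolP => // -[w1 [w2 [w10 w20 _ h]]].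
  by rewrite asboolT//; apply: iPhi h.
rewrite {1}/Pr /=.
set m := fun w : set I => _.
(* When [e] is open, at most one of two disjoint witnesses uses it, so it may be granted to one of
   them only. *)
pose Psi w1 w2 := Phi (e |` w1) w2 \/ Phi w1 (e |` w2).
have iPsi w1 w1' w2 w2' : w1 `<=` w1' -> w2 `<=` w2' -> Psi w1 w2 -> Psi w1' w2'.
  by move=> h1 h2 [h|h]; [left|right]; apply: iPhi h => //; exact: setUS.
have mPsi w : (exists w1 w2, [/\ w1 `<=` e |` w, w2 `<=` e |` w, w1 `&` w2 = set0 & Phi w1 w2]) ->
    exists w1 w2, [/\ w1 `<=` w, w2 `<=` w, w1 `&` w2 = set0 & Psi w1 w2].
  move=> [w1 [w2 [h1 h2 d h]]].
  have De (v : set I) : v `<=` e |` w -> v `\ e `<=` w.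
    by move=> hv x [vx xe]; case: (hv _ vx).
  have Dsub (v : set I) : v `<=` e |` (v `\ e).
    by move=> x vx; have [->|] := eqVneq x e; [left|move=> /eqP xe; right].
  have dd : (w1 `\ e) `&` (w2 `\ e) = set0.
    by apply/seteqP; split=> // x [[x1 _] [x2 _]]; rewrite -d; split.
  exists (w1 `\ e), (w2 `\ e); split; [exact: De|exact: De|exact: dd|].
  have [w1e|nw1e] := pselect (w1 e).
    left; apply: iPhi h; first exact: Dsub.
    move=> x w2x; split=> // xe; rewrite /= in xe; subst x.
    by have : (w1 `&` w2) e by []; rewrite d.
  right; apply: iPhi h; last exact: Dsub.
  by move=> x w1x; split=> // xe; rewrite /= in xe; subst x.
apply: (@le_trans _ _ ((1 - p) * Ex p s (fun w1 => Pr p s (Phi w1)) +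
                       p * Ex p s (fun w1 => Pr p s (Psi w1)))).
  apply: lerD; apply: ler_wpM2l => //; first exact: IH.
  apply: (le_trans _ (IH _ iPsi)); apply: le_Ex => w _; rewrite ler_nat.
  by case: asboolP => // /mPsi h; rewrite asboolT.
(* On the right [e] is sampled twice, independently. What remains is the pointwise inequality (1-p)
   a + p max(b, c) <= (1-p)^2 a + p(1-p)(b + c) + p^2 g between the indicators named below. *)
rewrite [leRHS]/= -!ExZ -!ExD; apply: le_Ex => w1 _.
rewrite /Pr /= -!ExZ -!ExD -!ExZ -!ExD; apply: le_Ex => w2 _.
set a := Phi w1 w2; set b := Phi w1 (e |` w2).
set c := Phi (e |` w1) w2; set g := Phi (e |` w1) (e |` w2).
have ab : a -> b by apply: iPhi => //; exact: subsetUr.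
have ac : a -> c by apply: iPhi => //; exact: subsetUr.
have bg : b -> g by apply: iPhi => //; exact: subsetUr.
have cg : c -> g by apply: iPhi => //; exact: subsetUr.
rewrite (_ : Psi w1 w2 = (c \/ b)) //.
have [ha|na] := pselect a.
  rewrite (asboolT ha) (asboolT (ab ha)) (asboolT (ac ha)) (asboolT (bg (ab ha))).
  by rewrite asboolT; [rewrite /=; nra|left; exact: ac].
rewrite (asboolF na).
have [hb|nb] := pselect b.
  rewrite (asboolT hb) (asboolT (bg hb)) asboolT; last by right.
  by case: asboolP => _ /=; have := p0; have := q0; nra.
rewrite (asboolF nb).
have [hc|nc] := pselect c.
  rewrite (asboolT hc) (asboolT (cg hc)) asboolT; last by left.
  by rewrite /=; have := p0; have := q0; nra.
rewrite (asboolF nc) asboolF; last by case.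
by case: asboolP => _ /=; have := p0; have := q0; nra.
Qed.

Lemma BK s X Y : increasing X -> increasing Y ->
  Pr p s (disj_occ X Y) <= Pr p s X * Pr p s Y.
Proof.
move=> iX iY; apply: (le_trans (y := Pr p s (fun w => exists w1 w2,
    [/\ w1 `<=` w, w2 `<=` w, w1 `&` w2 = set0 & X w1 /\ Y w2]))).
  by apply: le_Pr => w _ [w1 [w2 [h1 h2 d hX hY]]]; exists w1, w2.
apply: (le_trans (BK_pair s (Phi := fun w1 w2 => X w1 /\ Y w2) _)).
  by move=> w1 w1' w2 w2' h1 h2 [hX hY]; split; [exact: iX hX|exact: iY hY].
rewrite /Pr -ExZr; apply: le_Ex => w _; rewrite -ExZ; apply: le_Ex => w' _.
by rewrite -natrM ler_nat asbool_and; case: asboolP; case: asboolP.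
Qed.

Lemma Pr_subseq s s' X : subseq s s' -> increasing X -> Pr p s X <= Pr p s' X.
Proof.
elim: s' s X => [|e s' IH] s X; first by rewrite subseq0 => /eqP ->.
have step t Y : increasing Y -> Pr p t Y <= Pr p t (fun w => Y (e |` w)).
  by move=> iY; apply: le_Pr => w _; apply: iY; exact: subsetUr.
have PrE Y : Pr p (e :: s') Y = (1 - p) * Pr p s' Y + p * Pr p s' (fun w => Y (e |` w)) by [].
have key t : increasing X -> Pr p t X <= Pr p s' X -> Pr p t X <= Pr p (e :: s') X.
  by move=> iX; rewrite PrE; have := step s' X iX; move: p0 q0; nra.
case: s => [|e' s] /= h iX; first by apply: key => //; apply: IH (sub0seq _) _.
move: h; case: eqP => [<- h|_ h].
  rewrite /Pr /= -/(Pr _ _ _) -/(Pr _ _ _) -/(Pr _ _ _) -/(Pr _ _ _).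
  have e1 := IH _ _ h iX; have e2 := IH _ _ h (incr_add (e := e') iX).
  by apply: lerD; apply: ler_wpM2l.
by apply: key => //; exact: IH.
Qed.

Lemma Pr_sub s s' X : uniq s -> {subset s <= s'} -> increasing X ->
  Pr p s X <= Pr p s' X.
Proof.
move=> us ss' iX; have [t [ts' pt]] : exists t, subseq t s' /\ perm_eq s t.
  exists (undup [seq e <- s' | e \in s]); split.
    exact: subseq_trans (undup_subseq _) (filter_subseq _ _).
  apply: uniq_perm => //; first exact: undup_uniq.
  by move=> e; rewrite mem_undup mem_filter; case es: (e \in s) => //=; rewrite ss'.
by rewrite /Pr (Ex_perm _ _ pt); exact: Pr_subseq.
Qed.

Definition pivotal X e : set I -> Prop := fun w => X (e |` w) /\ ~ X (w `\ e).

(* A Poincare inequality. *)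
Lemma pivotal_sum s X : uniq s -> increasing X ->
  Pr p s X * (1 - Pr p s X) <= \sum_(e <- s) Pr p s (pivotal X e).
Proof.
elim: s X => [|e s IH] X us iX.
  by rewrite big_nil /Pr /=; case: asboolP => _ /=; rewrite ?subrr ?mulr0 ?mul0r.
case/andP: us => es us.
have iXe : increasing (fun w => X (e |` w)) by exact: incr_add.
have H0 := IH X us iX; have H1 := IH _ us iXe.
rewrite big_cons.
set a := Pr p s X in H0 *; set b := Pr p s (fun w => X (e |` w)) in H1 *.
have ab : a <= b by apply: le_Pr => w _; apply: iX; exact: subsetUr.
have -> : Pr p (e :: s) X = (1 - p) * a + p * b by [].
have pe : Pr p (e :: s) (pivotal X e) = b - a.
  have E w : w `<=` [set` s] -> `[< X (e |` w) /\ ~ X (w `\ e) >]%:R =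
       `[< X (e |` w) >]%:R - `[< X w >]%:R :> R.
    move=> ws; rewrite asbool_and asbool_neg.
    have -> : w `\ e = w.
      apply/seteqP; split=> [x []//|x wx]; split=> // xe; move: (ws _ wx).
      by rewrite /= xe (negPf es).
    have : X w -> X (e |` w) by apply: iX; exact: subsetUr.
    case: asboolP => h1; case: asboolP => h2 h /=; rewrite ?subrr ?subr0 ?sub0r//.
    by case: h1; exact: h.
  rewrite /Pr /= (eq_Ex p E) ExB -/(Pr _ _ _) -/(Pr p s X).
  under [X in _ + p * X]eq_Ex.
    move=> w ws; rewrite (_ : pivotal X e (e |` w) = pivotal X e w); last first.
      rewrite /pivotal setUA setUid; congr (_ /\ ~ X _); apply/seteqP; split.
        by move=> x [[xe|wx] nxe].
      by move=> x [wx xe]; split=> //; right.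
    rewrite E//; over.
  by rewrite /= ExB -/(Pr _ _ _) -/(Pr p s X) -/b -/a; ring.
have E1 : \sum_(e' <- s) Pr p (e :: s) (pivotal X e') =
   (1 - p) * \sum_(e' <- s) Pr p s (pivotal X e') +
   p * \sum_(e' <- s) Pr p s (pivotal (fun w => X (e |` w)) e').
  rewrite !mulr_sumr -big_split /=; apply: eq_big_seq => e' e's.
  rewrite {1}/Pr /=; congr (_ + _ * _); apply: eq_Ex => w _; congr (nat_of_bool _)%:R.
  rewrite /pivotal setUCA; congr asbool; congr (_ /\ ~ X _).
  have ee' : e != e' by apply: contraNneq es => ->.
  apply/seteqP; split.
    by move=> x [[->|wx] xe]; [left|right; split].
  move=> x [->|[wx xe]]; split=> //; [by left| |by right].
  by move=> /= h; move: ee'; rewrite h eqxx.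
rewrite E1 pe.
have a0 : 0 <= a := Pr_ge0 s X.
have b1 : b <= 1 := Pr_le1 s (fun w => X (e |` w)).
have := ler_wpM2l q0 H0; have := ler_wpM2l p0 H1.
(* Total variance: conditioning on [e] leaves the extra term p(1-p)(b-a)^2, which is at most b - a,
   the probability that [e] is pivotal. *)
have : p * (1 - p) * (b - a) ^+ 2 <= b - a.
  have ba0 : 0 <= b - a by rewrite subr_ge0.
  have pq : 0 <= p * (1 - p) <= 1.
    by rewrite mulr_ge0//= mulr_ile1//; [case/andP: p01|rewrite lerBlDr lerDl].
  have ba1 : b - a <= 1 by lra.
  rewrite expr2 mulrA -[leRHS]mul1r ler_wpM2r// mulr_ile1//; by case/andP: pq.
by nra.
Qed.

End ex_order.

(** * Open paths *)

Notation edge d := {fset Zd d}.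

Fixpoint pedges d (x : Zd d) (p : seq (Zd d)) : set (edge d) :=
  if p is y :: p' then [fset x; y]%fset |` pedges y p' else set0.

Definition inside d (A : set (Zd d)) : set (edge d) :=
  [set e : edge d | forall z, z \in e -> A z].

Definition touching d (A : set (Zd d)) : set (edge d) :=
  [set e : edge d | exists2 z, z \in e & A z].

Definition joined_set d (w : set (edge d)) (A : set (Zd d)) (x : Zd d)
    (B : set (Zd d)) : Prop := exists2 v, B v & joined w A x v.

Section paths.
Context (d : nat).
Implicit Types (x y z u v : Zd d) (A B C : set (Zd d)) (w : set (edge d)).
Implicit Types (p q : seq (Zd d)).

Lemma path_pedges w x p :
  path (fun u v => `[< w [fset u; v]%fset >]) x p <-> pedges x p `<=` w.
Proof.
elim: p x => [|z p IH] x /=; first by split=> // _ e.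
split; first by move=> /andP[/asboolP wz /IH h] e [->//|/h].
move=> h; apply/andP; split; first by apply/asboolP; apply: h; left.
by apply/IH => e he; apply: h; right.
Qed.

Lemma joinedP w A x y : joined w A x y <->
  exists p, [/\ pedges x p `<=` w, last x p = y & forall z, z \in x :: p -> A z].
Proof. by split=> -[p [h1 h2 h3]]; exists p; split=> //; apply/path_pedges. Qed.

Lemma joined_refl w A x : A x -> joined w A x x.
Proof. by move=> Ax; exists [::]; split=> // z; rewrite inE => /eqP ->. Qed.

Lemma joined_inl w A x y : joined w A x y -> A x.
Proof. by case=> p [_ _]; apply; rewrite mem_head. Qed.

Lemma joined_inr w A x y : joined w A x y -> A y.
Proof. by case=> p [_ <-]; apply; exact: mem_last. Qed.

Lemma joined_mono w w' A A' x y : w `<=` w' -> A `<=` A' ->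
  joined w A x y -> joined w' A' x y.
Proof.
move=> ww' AA' /joinedP [p [h1 h2 h3]]; apply/joinedP; exists p; split=> //.
  exact: subset_trans ww'.
by move=> z /h3 /AA'.
Qed.

Lemma joined_incr A x y : increasing (fun w => joined w A x y).
Proof. by move=> w w' ww'; exact: joined_mono. Qed.

Lemma joined_set_mono w w' A A' B B' x : w `<=` w' -> A `<=` A' -> B `<=` B' ->
  joined_set w A x B -> joined_set w' A' x B'.
Proof. by move=> h1 h2 h3 [v /h3 Bv /(joined_mono h1 h2)]; exists v. Qed.

Lemma joined_set_incr A B x : increasing (fun w => joined_set w A x B).
Proof. by move=> w w' ww'; exact: joined_set_mono. Qed.

Lemma pedges_cat x p q : pedges x (p ++ q) = pedges x p `|` pedges (last x p) q.
Proof. by elim: p x => [|y p IH] x /=; rewrite ?set0U// IH setUA. Qed.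

Lemma pedges_rev x p : pedges (last x p) (rev (belast x p)) = pedges x p.
Proof.
elim: p x => [|y p IH] x //=; rewrite rev_cons -cats1 pedges_cat IH /=.
rewrite setU0 setUC; congr (_ |` _); rewrite (_ : last _ _ = y) 1?fsetUC//.
by case: p {IH} => [|z p]//=; rewrite rev_cons last_rcons.
Qed.

Lemma joined_sym w A x y : joined w A x y -> joined w A y x.
Proof.
move=> /joinedP [p [h1 h2 h3]]; apply/joinedP; exists (rev (belast x p)).
rewrite -h2 pedges_rev; split=> //.
  by case: p {h1 h2 h3} => [|z p]//=; rewrite rev_cons last_rcons.
move=> z; rewrite inE mem_rev => /orP[/eqP ->|/mem_belast]; last exact: h3.
by apply: h3; exact: mem_last.
Qed.

Lemma joined_trans w A y x z : joined w A x y -> joined w A y z -> joined w A x z.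
Proof.
move=> /joinedP [p [h1 h2 h3]] /joinedP[q [k1 k2 k3]]; apply/joinedP.
exists (p ++ q); rewrite pedges_cat h2 last_cat h2; split=> //.
  by move=> e [/h1|/k1].
move=> t; rewrite inE mem_cat orbA -in_cons => /orP[/h3//|tq].
by apply: k3; rewrite inE tq orbT.
Qed.

Lemma joined1 w A x y : A x -> A y -> w [fset x; y]%fset -> joined w A x y.
Proof.
move=> Ax Ay wxy; apply/joinedP; exists [:: y]; split=> //=.
  by move=> e [->|].
by move=> z; rewrite !inE => /orP[]/eqP->.
Qed.

Lemma pedges_vertex x p (e : edge d) z : pedges x p e -> z \in e -> z \in x :: p.
Proof.
elim: p x => [|y p IH] x //= [->|/IH h ze]; first by rewrite !inE orbA => ->.
by rewrite inE h ?orbT.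
Qed.

Lemma pedges_vertex_tail x p (e : edge d) : pedges x p e -> exists2 z, z \in e & z \in p.
Proof.
elim: p x => [|y p IH] x //= [->|/IH [z ze zp]].
  by exists y; rewrite ?mem_head// !inE eqxx orbT.
by exists z => //; rewrite inE zp orbT.
Qed.

Lemma pedges_uniq_disj x p q : uniq (x :: p ++ q) ->
  pedges x p `&` pedges (last x p) q = set0.
Proof.
rewrite -cat_cons cat_uniq => /and3P[_ /hasPn h _].
apply/seteqP; split=> // e [ep /pedges_vertex_tail [z ze zq]].
by have := h _ zq; rewrite /= (pedges_vertex ep ze).
Qed.

Lemma joined_uniqP w A x y : joined w A x y <->
  exists p, [/\ pedges x p `<=` w, last x p = y, forall z, z \in x :: p -> A z
   & uniq (x :: p)].
Proof.
split; last by move=> [p [h1 h2 h3 _]]; apply/joinedP; exists p.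
move=> [p [h1 h2 h3]]; case/shortenP: h1 h2 => p' h1 u sub h2.
exists p'; split=> //.
  exact/path_pedges.
move=> z; rewrite inE => /orP[/eqP ->|zp]; apply: h3; first exact: mem_head.
by rewrite inE sub ?orbT.
Qed.

Lemma pedges_inside x p A : (forall z, z \in x :: p -> A z) -> pedges x p `<=` inside A.
Proof. by move=> h e ep z ze; apply: h; exact: pedges_vertex ep ze. Qed.

Lemma joined_depends A x y : depends_on (inside A) (fun w => joined w A x y).
Proof.
move=> w; apply/propext; split; last by apply: joined_mono => //; exact: subIsetl.
move=> /joinedP [p [h1 h2 h3]]; apply/joinedP; exists p; split=> //.
by move=> e ep; split; [exact: h1|exact: pedges_inside h3 _ ep].
Qed.

Lemma joined_set_depends A x B : depends_on (inside A) (fun w => joined_set w A x B).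
Proof.
move=> w; apply/propext; split=> -[v Bv h]; exists v => //.
  by rewrite -joined_depends.
by rewrite joined_depends.
Qed.

Lemma split_first (P : pred (Zd d)) x p : has P (x :: p) ->
  exists p1 p2, [/\ p = p1 ++ p2, P (last x p1) & forall z, z \in belast x p1 -> ~~ P z].
Proof.
elim: p x => [|y p IH] x /=.
  by rewrite orbF => Px; exists [::], [::].
have [Px _|nPx] := boolP (P x); first by exists [::], (y :: p).
move=> /IH [p1 [p2 [-> h1 h2]]]; exists (y :: p1), p2; split=> // z /=.
by rewrite inE => /orP[/eqP ->|/h2].
Qed.

Lemma split_last (P : pred (Zd d)) x p : has P (x :: p) ->
  exists p1 p2, [/\ p = p1 ++ p2, P (last x p1) & forall z, z \in p2 -> ~~ P z].
Proof.
elim/last_ind: p => [|p y IH] /=; first by rewrite orbF => Px; exists [::], [::].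
have [Py _|nPy] := boolP (P y).
  by exists (rcons p y), [::]; rewrite cats0 last_rcons; split.
rewrite has_rcons (negPf nPy) /= => /IH [p1 [p2 [-> h1 h2]]].
exists p1, (rcons p2 y); rewrite rcons_cat; split=> // z.
by rewrite mem_rcons inE => /orP[/eqP ->|/h2].
Qed.

(** The path from [z] is cut at its first vertex on the other path. Each of its edges then has an
    end off that path, hence is not an edge of it. *)
Lemma hair w B z x p a : joined w B z a -> a \in x :: p ->
  exists q, [/\ pedges z q `<=` w, last z q \in x :: p,
    pedges z q `&` pedges x p = set0 & forall t, t \in z :: q -> B t].
Proof.
move=> /joinedP [q [h1 h2 h3]] ap.
have : has (mem (x :: p)) (z :: q) by apply/hasP; exists a => //=; rewrite -h2 mem_last.
move=> /split_first [q1 [q2 [qE l1 l2]]]; exists q1; split=> //.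
- by move=> e eq1; apply: h1; rewrite qE pedges_cat; left.
- apply/seteqP; split=> // e [e1 e2].
  have [t te tb] : exists2 t, t \in e & t \in belast z q1.
    rewrite -pedges_rev in e1; have [t te] := pedges_vertex_tail e1.
    by rewrite mem_rev; exists t.
  by have := l2 _ tb; rewrite /= (pedges_vertex e2 te).
- by move=> t tq; apply: h3; rewrite qE -cat_cons mem_cat tq.
Qed.

(** If a simple open path meets [C], cutting it at a vertex of [C] gives two edge-disjoint
    halves. *)
Lemma joined_avoid w A C x y : joined w A x y ->
  joined w (A `\` C) x y \/ exists2 u, C u &
  disj_occ (fun w => joined w A x u) (fun w => joined w A u y) w.
Proof.
move=> /joined_uniqP [p [h1 h2 h3 h4]].
have [/split_first[p1 [p2 [pE l1 _]]]|nh] := boolP (has (fun z => `[< C z >]) (x :: p)).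
  right; exists (last x p1); first exact/asboolP.
  exists (pedges x p1), (pedges (last x p1) p2); split.
  - by apply: subset_trans h1; rewrite pE pedges_cat; exact: subsetUl.
  - by apply: subset_trans h1; rewrite pE pedges_cat; exact: subsetUr.
  - by apply: pedges_uniq_disj; rewrite -pE.
  - by apply/joinedP; exists p1; split=> // z zp; apply: h3; rewrite pE -cat_cons mem_cat zp.
  - apply/joinedP; exists p2; split=> //; first by rewrite -last_cat -pE.
    move=> z; rewrite inE => /orP[/eqP->|zp]; apply: h3; rewrite pE -cat_cons mem_cat.
      by rewrite mem_last.
    by rewrite zp orbT.
left; apply/joinedP; exists p; split=> // z zp; split; first exact: h3.
by move=> Cz; move/hasPn: nh => /(_ _ zp); rewrite asboolT.
Qed.

End paths.

(** * The sup norm *)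

Definition dist d (x y : Zd d) : nat := linfnorm (x - y).
Definition ball d (u : Zd d) (r : nat) : set (Zd d) := [set x | (dist x u <= r)%N].

Section geometry.
Context (d : nat).
Implicit Types (x y z u v t : Zd d) (r s n : nat).

Lemma distP x y r : (dist x y <= r)%N <-> forall i, (`|x 0 i - y 0 i| <= r%:Z)%R.
Proof.
rewrite /dist /linfnorm; split.
  move=> /bigmax_leqP h i; have := h i isT; rewrite !mxE.
  by rewrite -lez_nat abszE.
by move=> h; apply/bigmax_leqP => i _; rewrite -lez_nat abszE !mxE.
Qed.

Lemma distxx x : dist x x = 0%N.
Proof. by apply/eqP; rewrite -leqn0; apply/distP => i; rewrite subrr normr0. Qed.

Lemma distC x y : dist x y = dist y x.
Proof.
suff h (a b : Zd d) : (dist a b <= dist b a)%N by apply/eqP; rewrite eqn_leq !h.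
apply: (iffRL (distP a b _)) => i; rewrite distrC; exact: (iffLR (distP b a _) (leqnn _)).
Qed.

Lemma dist_triangle y x z : (dist x z <= dist x y + dist y z)%N.
Proof.
apply/distP => i; have h1 := iffLR (distP x y _) (leqnn _) i.
have h2 := iffLR (distP y z _) (leqnn _) i.
by rewrite PoszD (le_trans (ler_distD (y 0 i) _ _))// lerD.
Qed.

Lemma dist_eq0 x y : (dist x y == 0%N) = (x == y).
Proof.
apply/idP/idP => [|/eqP->]; last by rewrite distxx.
rewrite -leqn0 => /distP h; apply/eqP/rowP => i.
by have := h i; rewrite normr_le0 subr_eq0 => /eqP.
Qed.

Lemma distDr x y t : dist (x + t) (y + t) = dist x y.
Proof. by rewrite /dist opprD addrACA subrr addr0. Qed.

Lemma ball_center u r : ball u r u.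
Proof. by rewrite /ball /= distxx. Qed.

Lemma ball_sub u v r s : (dist u v + r <= s)%N -> ball u r `<=` ball v s.
Proof.
move=> h x /= xu; apply: leq_trans h; rewrite addnC.
by apply: leq_trans (dist_triangle u _ _) _; rewrite leq_add2r.
Qed.

Lemma ball_subr u r s : (r <= s)%N -> ball u r `<=` ball u s.
Proof. by move=> rs; apply: ball_sub; rewrite distxx. Qed.

Definition balls u r : seq (Zd d) :=
  [seq \row_i (u 0 i + (nat_of_ord (f i))%:Z - r%:Z) |
     f : {ffun 'I_d -> 'I_(r.*2.+1)} <- enum {ffun 'I_d -> 'I_(r.*2.+1)}].

Lemma mem_balls u r x : (x \in balls u r) = (dist x u <= r)%N.
Proof.
apply/idP/idP.
  move=> /mapP [f _ ->]; apply/distP => i; rewrite mxE.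
  have := ltn_ord (f i); move: (nat_of_ord _) => k kr; rewrite ler_norml; lia.
move=> /distP h; apply/mapP.
have {}h i : (- r%:Z <= x 0 i - u 0 i <= r%:Z)%R by rewrite -ler_norml.
have hb (i : 'I_d) : (absz (x 0 i - u 0 i + r%:Z)%R < r.*2.+1)%N by have := h i; lia.
exists [ffun i => Ordinal (hb i)]; first by rewrite mem_enum.
by apply/rowP => i; rewrite mxE ffunE /=; have := h i; lia.
Qed.

Lemma balls_uniq u r : uniq (balls u r).
Proof.
rewrite map_inj_uniq ?enum_uniq// => f g /rowP h; apply/ffunP => i.
by apply: val_inj; have := h i; rewrite !mxE /=; lia.
Qed.

Lemma size_balls u r : size (balls u r) = (r.*2.+1 ^ d)%N.
Proof. by rewrite size_map -cardE card_ffun !card_ord. Qed.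

Lemma ballsE u r : [set` balls u r] = ball u r.
Proof. by apply/seteqP; split=> x; rewrite /= mem_balls. Qed.

End geometry.

(** * Percolation in finite boxes *)

(** The symmetries of the lattice that fix the origin. For an involutive [s] the inverse is again of
    this form, with signs [b \o s]. *)
Definition signed_perm d (s : 'I_d -> 'I_d) (b : 'I_d -> bool) (x : Zd d) : Zd d :=
  \row_i (if b i then - x 0 (s i) else x 0 (s i)).

(** All that the argument uses of the nearest-neighbor and spread-out edge sets; [edge_axis] says
    that the nearest-neighbor edges are among them. *)
Record lattice_edges d (E : set (edge d)) (L0 : nat) : Prop := LatticeEdges {
  edge_range : forall e, E e ->
    exists x y, [/\ e = [fset x; y]%fset, x != y & (dist x y <= L0)%N];
  edge_shift : forall x y t : Zd d, E [fset x; y]%fset -> E [fset (x + t)%R; (y + t)%R]%fset;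
  edge_sym : forall s b x y, involutive s -> E [fset x; y]%fset ->
    E [fset signed_perm s b x; signed_perm s b y]%fset;
  edge_axis : forall (x : Zd d) i, E [fset x; (x + delta_mx 0 i)%R]%fset;
  edge_range_gt0 : (0 < L0)%N }.

Definition edges_in d (E : set (edge d)) (u : Zd d) (r : nat) : seq (edge d) :=
  undup [seq e <- [seq [fset x; y]%fset | x <- balls u r, y <- balls u r] | `[< E e >]].

Definition emap d (phi : Zd d -> Zd d) (e : edge d) : edge d :=
  [fset phi z | z in e]%fset.

(** The kernel |x - y|^(2-d) up to constants. The shift by one makes it equal to 1 on the diagonal,
    in agreement with the convention for the power of 0. *)
Definition kap (R : realType) d (x y : Zd d) : R := ((dist x y).+1%:R ^+ (d - 2))^-1.
Arguments kap {R d} x y.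

Section graph.
Context (R : realType) (d : nat) (p : R) (E : set (edge d)) (L0 : nat).
Context (hE : lattice_edges E L0) (p01 : 0 <= p <= 1).
Implicit Types (x y z u v t : Zd d) (A B C : set (Zd d)) (w : set (edge d)).

Local Notation EI := (edges_in E).

Lemma edges_in_uniq u r : uniq (EI u r).
Proof. exact: undup_uniq. Qed.

Lemma mem_edges_in u r e : e \in EI u r <-> E e /\ inside (ball u r) e.
Proof.
rewrite mem_undup mem_filter; split.
  move=> /andP[/asboolP Ee /allpairsP[[x y] /= [xr yr eE]]]; split=> //.
  rewrite eE => z; rewrite !inE => /orP[]/eqP ->; by rewrite /ball /= -mem_balls.
move=> [Ee ie]; rewrite asboolT//=; apply/allpairsP.
have [x [y [eE _ _]]] := edge_range hE Ee; exists (x, y); split=> //=.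
  by rewrite mem_balls; apply: ie; rewrite eE !inE eqxx.
by rewrite mem_balls; apply: ie; rewrite eE !inE eqxx orbT.
Qed.

Lemma emap2 phi x y : emap phi [fset x; y]%fset = [fset phi x; phi y]%fset.
Proof.
apply/fsetP => z; rewrite !inE; apply/imfsetP/orP => [[t /=]|].
  by rewrite !inE => /orP[]/eqP -> ->; rewrite eqxx; [left|right].
by move=> [/eqP->|/eqP->]; [exists x|exists y] => //=; rewrite !inE eqxx ?orbT.
Qed.

Lemma joined_map (phi : Zd d -> Zd d) w A x y : joined w A x y ->
  joined (emap phi @` w) (phi @` A) (phi x) (phi y).
Proof.
move=> /joinedP [q [h1 h2 h3]]; apply/joinedP; exists (map phi q); split.
- elim: q x h1 {h2 h3} => [x _ e //|z q IH x /= h1 e [->|]].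
    by rewrite -emap2; exists [fset x; z]%fset => //; apply: h1; left.
  by apply: IH => e' he'; apply: h1; right.
- by rewrite last_map h2.
- by move=> z; rewrite -map_cons => /mapP[t th ->]; exists t => //; exact: h3.
Qed.

Lemma Pr_local u r N X : ball u r `<=` ball 0 N ->
  depends_on (inside (ball u r)) X -> Pr p (EI 0 N) X = Pr p (EI u r) X.
Proof.
move=> uN dX; rewrite /Pr.
pose U : pred (edge d) := fun e => `[< inside (ball u r) e >].
rewrite (@Ex_filter _ _ _ _ U).
  apply: Ex_perm; apply: uniq_perm; rewrite ?filter_uniq ?edges_in_uniq// => e.
  rewrite mem_filter; apply/andP/idP.
    by move=> [/asboolP ie /mem_edges_in [Ee _]]; apply/mem_edges_in.
  move=> /mem_edges_in [Ee ie]; split; first exact/asboolP.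
  by apply/mem_edges_in; split=> // z /ie /uN.
move=> w; rewrite {1}dX; congr (nat_of_bool (asbool (X _)))%:R.
by apply/seteqP; split=> e [we /asboolP ue]; split=> //; exact/asboolP.
Qed.

Lemma edges_in_mono u r v s : ball u r `<=` ball v s -> {subset EI u r <= EI v s}.
Proof.
move=> uv e /mem_edges_in [Ee ie]; apply/mem_edges_in; split=> // z /ie; exact: uv.
Qed.

Lemma Pr_mono u r v s X : ball u r `<=` ball v s -> increasing X ->
  Pr p (EI u r) X <= Pr p (EI v s) X.
Proof.
move=> uv; apply: Pr_sub => //; first exact: edges_in_uniq.
exact: edges_in_mono.
Qed.

Lemma Pr_le_local u r N X : depends_on (inside (ball u r)) X -> increasing X ->
  Pr p (EI 0 N) X <= Pr p (EI u r) X.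
Proof.
move=> dX iX; rewrite -(@Pr_local u r (N + dist u 0 + r)%N) //.
  by apply: Pr_mono => //; apply: ball_subr; rewrite -addnA leq_addr.
by apply: ball_sub; rewrite -addnA leq_addl.
Qed.

Lemma Pr_auto (phi psi : Zd d -> Zd d) u r X : cancel phi psi -> cancel psi phi ->
  (forall e, E e -> E (emap phi e)) -> (forall e, E e -> E (emap psi e)) ->
  (forall x, ball u r x -> ball (phi u) r (phi x)) ->
  (forall x, ball (phi u) r x -> ball u r (psi x)) ->
  Pr p (EI (phi u) r) X = Pr p (EI u r) (fun w => X (emap phi @` w)).
Proof.
move=> K K' Ephi Epsi B1 B2; rewrite /Pr -(Ex_map p (emap phi) _ (fun w => `[< X w >]%:R)); apply: Ex_perm.
have eK e : emap psi (emap phi e) = e.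
  apply/fsetP => z; apply/imfsetP/idP => [[t /= /imfsetP[t' /= t'e ->] ->]|ze].
    by rewrite K.
  by exists (phi z); rewrite ?K//=; apply/imfsetP; exists z.
have eK' e : emap phi (emap psi e) = e.
  apply/fsetP => z; apply/imfsetP/idP => [[t /= /imfsetP[t' /= t'e ->] ->]|ze].
    by rewrite K'.
  by exists (psi z); rewrite ?K'//=; apply/imfsetP; exists z.
apply: uniq_perm; rewrite ?edges_in_uniq//.
  by rewrite map_inj_uniq ?edges_in_uniq//; exact: can_inj eK.
move=> e; apply/idP/mapP.
  move=> /mem_edges_in [Ee ie]; exists (emap psi e); last by rewrite eK'.
  apply/mem_edges_in; split; first exact: Epsi.
  by move=> z /imfsetP[t /= te ->]; apply: B2; exact: ie.
move=> [e' /mem_edges_in[Ee' ie'] ->]; apply/mem_edges_in; split; first exact: Ephi.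
by move=> z /imfsetP[t /= te ->]; apply: B1; exact: ie'.
Qed.

Lemma edge_shift_emap t e : E e -> E (emap (fun z => z + t) e).
Proof.
move=> Ee; have [x [y [eE _ _]]] := edge_range hE Ee.
by rewrite eE emap2; apply: (edge_shift hE); rewrite -eE.
Qed.

Lemma Pr_shift t u r X :
  Pr p (EI (u + t) r) X = Pr p (EI u r) (fun w => X (emap (fun z => z + t) @` w)).
Proof.
apply: (@Pr_auto (fun z => z + t) (fun z => z - t)).
- by move=> z; rewrite addrK.
- by move=> z; rewrite subrK.
- exact: edge_shift_emap.
- exact: edge_shift_emap.
- by move=> x; rewrite /ball /= distDr.
- by move=> x; rewrite /ball /= -[in X in _ -> X](distDr _ _ t) subrK.
Qed.

Lemma Pr_joined_shift t u r A x y :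
  Pr p (EI u r) (fun w => joined w A x y) <=
  Pr p (EI (u + t) r) (fun w => joined w [set z | A (z - t)] (x + t) (y + t)).
Proof.
rewrite Pr_shift; apply: le_Pr => // w _ /(joined_map (fun z => z + t)).
by apply: joined_mono => // z [z' Az' <-] /=; rewrite addrK.
Qed.

Lemma Pr_joined_ball_shift t u r x y :
  Pr p (EI u r) (fun w => joined w (ball u r) x y) <=
  Pr p (EI (u + t) r) (fun w => joined w (ball (u + t) r) (x + t) (y + t)).
Proof.
apply: (le_trans (Pr_joined_shift t _ _ _ _ _)); apply: le_Pr => // w _.
apply: joined_mono => // z /=; by rewrite /ball /= -(distDr _ _ t) subrK.
Qed.

Lemma kap_gt0 x y : 0 < kap x y :> R.
Proof. by rewrite invr_gt0 exprn_gt0 ?ltr0n. Qed.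

Lemma kap_ge0 x y : 0 <= kap x y :> R.
Proof. exact: ltW (kap_gt0 _ _). Qed.

Lemma kapC x y : kap x y = kap y x :> R.
Proof. by rewrite /kap distC. Qed.

Lemma kap_le1 x y : kap x y <= 1 :> R.
Proof. by rewrite invf_le1 ?exprn_gt0 ?ltr0n// exprn_ege1// ler1n. Qed.

Lemma kap_comp x y x' y' a : ((dist x' y').+1 <= a * (dist x y).+1)%N ->
  kap x y <= a%:R ^+ (d - 2) * kap x' y' :> R.
Proof.
move=> h; rewrite /kap ler_pdivlMr ?exprn_gt0 ?ltr0n//.
rewrite mulrC ler_pdivrMr ?exprn_gt0 ?ltr0n// -exprMn.
by rewrite lerXn2r ?nnegrE ?ler0n// ?mulr_ge0 ?ler0n// -natrM ler_nat.
Qed.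

Lemma kap_far x y r : (r <= dist x y)%N -> kap x y <= (r.+1%:R ^+ (d - 2))^-1 :> R.
Proof.
move=> h; rewrite lef_pV2 ?posrE ?exprn_gt0 ?ltr0n//.
by rewrite lerXn2r ?nnegrE ?ler0n// ler_nat.
Qed.

Lemma kap_near x y r : (dist x y <= r)%N -> (r.+1%:R ^+ (d - 2))^-1 <= kap x y :> R.
Proof.
move=> h; rewrite lef_pV2 ?posrE ?exprn_gt0 ?ltr0n//.
by rewrite lerXn2r ?nnegrE ?ler0n// ler_nat.
Qed.

Context (d2 : (2 < d)%N).

Lemma sum_ge0_le (T : eqType) (r : seq T) (F : T -> R) (M : R) :
  (forall x : T, x \in r -> F x <= M) -> \sum_(x <- r) F x <= (size r)%:R * M.
Proof.
move=> h; rewrite -sum1_size natr_sum mulr_suml big_seq [leRHS]big_seq.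
by apply: ler_sum => x xr; rewrite mul1r h.
Qed.

Lemma ler_sum_sub (T : eqType) (r1 r2 : seq T) (P1 P2 : pred T) (F : T -> R) :
  uniq r1 -> uniq r2 -> (forall x : T, x \in r1 -> P1 x -> x \in r2 /\ P2 x) ->
  (forall x : T, 0 <= F x) ->
  \sum_(x <- r1 | P1 x) F x <= \sum_(x <- r2 | P2 x) F x.
Proof.
move=> u1 u2 sub F0; rewrite -big_filter -[leRHS]big_filter.
have u1' : uniq [seq x <- r1 | P1 x] by rewrite filter_uniq.
have u2' : uniq [seq x <- r2 | P2 x] by rewrite filter_uniq.
rewrite [leRHS](bigID (mem [seq x <- r1 | P1 x])) /=.
rewrite -[leLHS]addr0 lerD//; last by apply: sumr_ge0.
rewrite -[leRHS]big_filter le_eqVlt; apply/orP; left; apply/eqP; apply: perm_big.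
apply: uniq_perm => //; first by rewrite filter_uniq.
move=> x; rewrite [RHS]mem_filter; case: (boolP (_ \in _)) => //= xr1.
move: xr1; rewrite mem_filter => /andP[P1x xr]; have [xr2 P2x] := sub _ xr P1x.
by rewrite mem_filter P2x xr2.
Qed.

Lemma size_balls_le u j : (size (balls u (2 ^ j)) <= 4 ^ d * 2 ^ (j * d))%N.
Proof.
rewrite size_balls expnM -expnMn leq_exp2r; last by lia.
have : (0 < 2 ^ j)%N by rewrite expn_gt0.
lia.
Qed.

(** A dyadic shell at scale j has about 2^(jd) points of weight 2^(-j(d-2)), hence contributes 4^j;
    the last shell dominates. *)
Lemma kap_sum_center u j :
  \sum_(x <- balls u (2 ^ j)) kap u x <= (8 ^+ d * 4 ^+ j : R).
Proof.
elim: j => [|j IH].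
  apply: (le_trans (sum_ge0_le (M := 1) _)); first by move=> x _; exact: kap_le1.
  rewrite mulr1 expr0 mulr1 (le_trans (y := (4 ^ d * 2 ^ (0 * d))%:R))//.
    by rewrite ler_nat size_balls_le.
  by rewrite muln1 natrX lerXn2r ?nnegrE// ler_nat.
rewrite (bigID (fun x => (dist x u <= 2 ^ j)%N)) /=.
apply: (@le_trans _ _ (8 ^+ d * 4 ^+ j + 4 ^+ d * 2 ^+ (j.+1 * d) * (2 ^+ j ^+ (d - 2))^-1)).
  apply: lerD.
    apply: le_trans IH; apply: ler_sum_sub; rewrite ?balls_uniq//.
      by move=> x; rewrite !mem_balls.
    by move=> x; exact: kap_ge0.
  rewrite -big_filter; apply: (le_trans (sum_ge0_le (M := (2 ^+ j ^+ (d - 2))^-1) _)).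
    move=> x; rewrite mem_filter -ltnNge => /andP[h _].
    apply: (le_trans (kap_far (r := 2 ^ j) _)); first by rewrite distC ltnW.
    rewrite lef_pV2 ?posrE ?exprn_gt0 ?ltr0n// lerXn2r ?nnegrE ?exprn_ge0//.
    by rewrite -natrX ler_nat.
  rewrite ler_wpM2r ?invr_ge0 ?exprn_ge0//.
  apply: (@le_trans _ _ (size (balls u (2 ^ j.+1)))%:R).
    by rewrite ler_nat size_filter count_size.
  by rewrite -!natrX -natrM ler_nat size_balls_le.
have -> : 4 ^+ d * 2 ^+ (j.+1 * d) * (2 ^+ j ^+ (d - 2))^-1 = 8 ^+ d * 4 ^+ j :> R.
  have -> : (4 : R) = 2 ^+ 2 by ring.
  have -> : (8 : R) = 2 ^+ 3 by ring.
  apply: (canLR (mulfK _)); first by rewrite !expf_neq0 ?pnatr_eq0.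
  rewrite -!exprM -!exprD; congr (_ ^+ _); nia.
rewrite [4 ^+ j.+1]exprS; have := exprn_ge0 d (ler0n R 8); have := exprn_ge0 j (ler0n R 4).
by nra.
Qed.

(** If [v] is close to the ball, the ball lies in a larger one centered at [v]; if it is far, every
    term is at most 2^(-j(d-2)). *)
Lemma kap_sum v u j :
  \sum_(x <- balls u (2 ^ j)) kap v x <= (8 ^+ d * 16 * 4 ^+ j : R).
Proof.
have [h|h] := leqP (dist v u) (2 ^ j.+1).
  apply: (le_trans (y := \sum_(x <- balls v (2 ^ j.+2)) kap v x)).
    apply: ler_sum_sub; rewrite ?balls_uniq//; last by move=> x; exact: kap_ge0.
    move=> x; rewrite !mem_balls => xu _; split=> //.
    apply: leq_trans (dist_triangle u _ _) _; rewrite distC in h.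
    by move: xu h; rewrite !expnS; lia.
  by apply: (le_trans (kap_sum_center _ _)); rewrite !exprS; lra.
apply: (le_trans (sum_ge0_le (M := (2 ^+ j ^+ (d - 2))^-1) _)).
  move=> x; rewrite mem_balls => xu.
  apply: (le_trans (kap_far (r := 2 ^ j) _)).
    have := dist_triangle x v u; move: h xu; rewrite expnS; lia.
  rewrite lef_pV2 ?posrE ?exprn_gt0 ?ltr0n// lerXn2r ?nnegrE ?exprn_ge0//.
  by rewrite -natrX ler_nat.
apply: (@le_trans _ _ (4 ^+ d * 2 ^+ (j * d) * (2 ^+ j ^+ (d - 2))^-1)).
  rewrite ler_wpM2r ?invr_ge0 ?exprn_ge0//.
  by rewrite -!natrX -natrM ler_nat size_balls_le.
have -> : 4 ^+ d * 2 ^+ (j * d) * (2 ^+ j ^+ (d - 2))^-1 = 4 ^+ d * 4 ^+ j :> R.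
  have -> : (4 : R) = 2 ^+ 2 by ring.
  apply: (canLR (mulfK _)); first by rewrite !expf_neq0 ?pnatr_eq0.
  rewrite -!exprM -!exprD; congr (_ ^+ _); nia.
rewrite ler_wpM2r ?exprn_ge0// (@le_trans _ _ (8 ^+ d))//.
  by rewrite lerXn2r ?nnegrE// ler_nat.
by rewrite ler_peMr ?exprn_ge0// ler1n.
Qed.

End graph.

(** Finite-volume form of the hypothesis. The upper bound is uniform in the box. The lower bound is
    localized: for points of a fixed box the connection is already made inside some larger fixed
    box, so that it survives the removal of anything far away. *)
Record two_point (R : realType) d (p : R) (E : set (edge d)) (c C : R) : Prop := TwoPoint {
  tp_up : forall N (x y : Zd d),
    Pr p (edges_in E 0 N) (fun w => joined w setT x y) <= C * kap x y;
  tp_lo : forall M, exists N0, forall N, (N0 <= N)%N -> forall x y : Zd d,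
    ball 0 M x -> ball 0 M y ->
    c * kap x y <= Pr p (edges_in E 0 N) (fun w => joined w (ball 0 N0) x y) }.

(** * Cutting paths where they leave a set *)

Section exits.
Context (d : nat).
Implicit Types (x y z u v t : Zd d) (A B C : set (Zd d)) (w : set (edge d)).

(** A simple path is cut at its first vertex outside [B]. Neither half uses the crossing edge, so
    that the three pieces are edge-disjoint. *)
Lemma first_exit w A B x y : joined w A x y -> B x -> ~ B y ->
  exists a b, [/\ B a, ~ B b, w [fset a; b]%fset &
    disj_occ (fun w => joined w (A `&` B) x a) (fun w => joined w A b y) w].
Proof.
move=> /joined_uniqP [q [h1 h2 h3 h4]] Bx By.
have : has (fun z => ~~ `[< B z >]) (x :: q).
  by apply/hasP; exists y; [rewrite -h2 mem_last|apply/asboolP].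
move=> /split_first [q1 [q2 [qE /asboolP l1 l2]]].
case/lastP: q1 qE l1 l2 => [|q1 b] qE l1 l2; first by case: l1.
rewrite last_rcons in l1; rewrite belast_rcons in l2.
exists (last x q1), b; split=> //.
- by have := l2 _ (mem_last x q1); rewrite negbK => /asboolP.
- apply: h1; rewrite qE pedges_cat -cats1 pedges_cat /=; left; right; by left.
exists (pedges x q1), (pedges b q2); split.
- by apply: subset_trans h1; rewrite qE !pedges_cat -cats1 pedges_cat => e; left; left.
- by apply: subset_trans h1; rewrite qE !pedges_cat last_rcons => e; right.
- apply/seteqP; split=> // e [e1 e2].
  have := pedges_uniq_disj (x := x) (p := rcons q1 b) (q := q2); rewrite -qE => /(_ h4).
  move=> <-; split; last by rewrite last_rcons.
  by rewrite -cats1 pedges_cat; left.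
- apply/joinedP; exists q1; split=> // z zq; split.
    by apply: h3; rewrite qE -cats1 -catA -cat_cons mem_cat zq.
  by have := l2 _ zq; rewrite negbK => /asboolP.
- apply/joinedP; exists q2; split=> //; first by rewrite -h2 qE last_cat last_rcons.
  move=> z zq; apply: h3; rewrite qE -cats1 -catA -cat_cons mem_cat.
  by apply/orP; right.
Qed.

Lemma disj_occ_mono (X X' Y Y' : set (edge d) -> Prop) w :
  (forall w, X w -> X' w) -> (forall w, Y w -> Y' w) ->
  disj_occ X Y w -> disj_occ X' Y' w.
Proof. by move=> XX YY [w1 [w2 [h1 h2 h3 /XX h4 /YY h5]]]; exists w1, w2. Qed.

Lemma disj_occC (X Y : set (edge d) -> Prop) w : disj_occ X Y w -> disj_occ Y X w.
Proof. by move=> [w1 [w2 [h1 h2 h3 h4 h5]]]; exists w2, w1; rewrite setIC. Qed.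

(** The last exit from [B] is the first exit of the reversed path from the complement of [B]. *)
Lemma last_exit w A B x y : joined w A x y -> B x -> ~ B y ->
  exists a b, [/\ B a, ~ B b, w [fset a; b]%fset &
    disj_occ (fun w => joined w A x a) (fun w => joined w (A `\` B) b y) w].
Proof.
move=> /joined_sym h Bx By; have := @first_exit _ _ (~` B) _ _ h By (fun f => f Bx).
move=> [a [b [h1 h2 h3 h4]]]; exists b, a; split=> //.
- by apply: contrapT.
- by rewrite fsetUC.
- apply: disj_occC; apply: disj_occ_mono h4 => w'; last exact: joined_sym.
  by move=> /joined_sym; rewrite setDE.
Qed.

Definition exits (E : set (edge d)) (L0 : nat) (u : Zd d) (r : nat) : seq (Zd d * Zd d) :=
  [seq yv <- [seq (y, v) | y <- balls u r, v <- balls u (r + L0)] |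
    `[< E [fset yv.1; yv.2]%fset /\ ~ ball u r yv.2 >]].

End exits.

(** * Moving along a coordinate axis at polynomial cost *)

Section axis.
Context (R : realType) (d : nat) (p : R) (E : set (edge d)) (L0 : nat).
Context (hE : lattice_edges E L0) (p01 : 0 < p < 1) (d6 : (6 < d)%N).
Context (c C : R) (c0 : 0 < c) (cC : c < C) (tp : two_point p E c C).
Implicit Types (x y z u v t : Zd d) (A B : set (Zd d)) (w : set (edge d)).

Local Notation EI := (edges_in E).

Let p01' : 0 <= p <= 1. Proof. by case/andP: p01 => /ltW -> /ltW ->. Qed.
Let p0 : 0 < p. Proof. by case/andP: p01. Qed.
Let C0 : 0 < C. Proof. exact: lt_trans c0 cC. Qed.

Lemma edge_dist x y : E [fset x; y]%fset -> (dist x y <= L0)%N.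
Proof.
move=> /(edge_range hE) [a [b [eE ab h]]].
have : x \in [fset a; b]%fset by rewrite -eE !inE eqxx.
have : y \in [fset a; b]%fset by rewrite -eE !inE eqxx orbT.
rewrite !inE => /orP[]/eqP -> /orP[]/eqP -> //; rewrite ?distxx//.
by rewrite distC.
Qed.

Lemma mem_exits u r y v : (y, v) \in exits E L0 u r <->
  [/\ ball u r y, ~ ball u r v & E [fset y; v]%fset].
Proof.
rewrite mem_filter; split.
  move=> /andP[/asboolP /= [Ee nv] /allpairsP[[a b] /= [ha hb [ya _]]]].
  by split=> //; rewrite /ball /= -mem_balls ya.
move=> [yu vu Ee]; rewrite asboolT//=; apply/allpairsP; exists (y, v); split=> //=.
  by rewrite mem_balls.
rewrite mem_balls (leq_trans (dist_triangle y _ _))// addnC leq_add//.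
by rewrite distC; exact: edge_dist.
Qed.

Lemma exits_uniq u r : uniq (exits E L0 u r).
Proof.
by apply: filter_uniq; apply: allpairs_uniq; rewrite ?balls_uniq// => -[a b] [a' b'] _ _ [-> ->].
Qed.

Definition axv (i : 'I_d) (k : int) : Zd d := \row_j (if j == i then k else 0).

Lemma dist_axv x i k : dist x (x + axv i k) = `|k|%N.
Proof.
apply/eqP; rewrite eqn_leq; apply/andP; split.
  apply/distP => j; rewrite !mxE opprD addrA subrr sub0r normrN.
  by case: (j == i); rewrite ?normr0 ?abszE.
have := iffLR (distP x (x + axv i k) _) (leqnn _) i.
by rewrite !mxE eqxx opprD addrA subrr sub0r normrN -abszE.
Qed.

Lemma axvD x i k l : x + axv i (k + l) = x + axv i k + axv i l.
Proof. by apply/rowP => j; rewrite !mxE; case: (j == i); lia. Qed.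

Lemma Pr_edge (I : eqType) (s : seq I) e : e \in s -> p <= Pr p s (fun w : set I => w e).
Proof.
elim: s => // e' s IH; rewrite inE => /orP[/eqP <-|es].
  rewrite /Pr /= [X in _ + p * X](_ : _ = 1); last first.
    by rewrite -[RHS](Ex_cst p s); apply: eq_Ex => w _; rewrite asboolT//; left.
  rewrite mulr1 lerDr mulr_ge0 ?Pr_ge0//; by case/andP: p01'; rewrite subr_ge0.
have h := IH es.
have h' : p <= Pr p s (fun w : set I => (e' |` w) e).
  by apply: le_trans h _; apply: le_Pr => // w _ we; right.
rewrite /Pr /= -/(Pr _ _ _) -/(Pr p s (fun w : set I => (e' |` w) e)).
have q0 : 0 <= 1 - p by case/andP: p01'; rewrite subr_ge0.
rewrite {1}(_ : p = (1 - p) * p + p * p); last by ring.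
by apply: lerD; apply: ler_wpM2l => //; exact: ltW.
Qed.

Lemma Pr_joined_trans (s : seq (edge d)) A x y z :
  Pr p s (fun w => joined w A x y) * Pr p s (fun w => joined w A y z) <=
  Pr p s (fun w => joined w A x z).
Proof.
apply: (le_trans (Pr_FKG p01' s (@joined_incr _ A x y) (@joined_incr _ A y z))).
by apply: le_Pr => // w _ [h1 h2]; exact: joined_trans h2.
Qed.

Lemma straight A u r x i (b : bool) n :
  (forall k : nat, (k <= n)%N ->
    (A `&` ball u r) (x + axv i (if b then k%:Z else - k%:Z))) ->
  p ^+ n <= Pr p (EI u r) (fun w => joined w A x (x + axv i (if b then n%:Z else - n%:Z))).
Proof.
elim: n => [|n IH] h.
  rewrite expr0 Pr_true// => w; rewrite oppr0 if_same.
  rewrite (_ : x + axv i 0 = x); last by apply/rowP => j; rewrite !mxE if_same addr0.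
  by apply: joined_refl; have [] := h 0%N isT; rewrite oppr0 if_same (_ : x + axv i 0 = x)//;
    apply/rowP => j; rewrite !mxE if_same addr0.
have {}IH := IH (fun k hk => h k (leqW hk)).
rewrite exprSr; apply: (le_trans (ler_pM _ _ IH (lexx p))); rewrite ?exprn_ge0 ?(ltW p0)//.
set y := x + _; set z := x + _.
apply: (le_trans _ (Pr_joined_trans (EI u r) A x y z)).
rewrite ler_wpM2l ?Pr_ge0//.
have [Ay uy] : (A `&` ball u r) y by apply: h; lia.
have [Az uz] : (A `&` ball u r) z by apply: h; lia.
apply: (le_trans (Pr_edge (s := EI u r) (e := [fset y; z]%fset) _)).
  apply/(mem_edges_in hE); split; last by move=> t; rewrite !inE => /orP[]/eqP ->.
  rewrite /z /y; case: (b).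
    rewrite (_ : x + axv i n.+1%:Z = x + axv i n%:Z + delta_mx 0 i); first exact: edge_axis hE _ _.
    by apply/rowP => j; rewrite !mxE; case: (j == i); rewrite /=; lia.
  rewrite fsetUC (_ : x + axv i (- n%:Z) = x + axv i (- n.+1%:Z) + delta_mx 0 i).
    exact: edge_axis hE _ _.
  by apply/rowP => j; rewrite !mxE; case: (j == i); rewrite /=; lia.
by apply: le_Pr => // w _; exact: joined1.
Qed.

(* Otherwise the two-point function would be too small. *)
Lemma exit_sum r : c / (C * 2 ^+ (d - 2)) <=
  \sum_(yv <- exits E L0 0 r) Pr p (EI 0 r) (fun w => joined w (ball 0 r) 0 yv.1).
Proof.
have dgt0 : (0 < d)%N by lia.
pose i0 : 'I_d := Ordinal dgt0.
(* The target is so far that, seen from it, every exit point of the ball is at a distance comparable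
   with that of the origin, within a factor 2. *)
pose m := (3 * r + 2 * L0)%N; pose x := 0 + axv i0 m%:Z.
have dx : dist x 0 = m by rewrite distC dist_axv.
have [N0 hN0] := tp_lo tp m.
pose N := (N0 + r)%N.
have h1 : c * kap 0 x <= Pr p (EI 0 N) (fun w => joined w setT 0 x).
  apply: (le_trans (hN0 N _ _ _ _ _)); rewrite /ball /= ?distxx ?dx ?leq_addr//.
  by apply: le_Pr => // w _; exact: joined_mono.
rewrite ler_pdivrMr ?mulr_gt0 ?exprn_gt0// mulr_suml.
rewrite -(ler_pM2r (kap_gt0 R 0 x)) mulr_suml; apply: (le_trans h1).
have h2 : Pr p (EI 0 N) (fun w => joined w setT 0 x) <=
    \sum_(yv <- exits E L0 0 r) Pr p (EI 0 N)
      (disj_occ (fun w => joined w (ball 0 r) 0 yv.1) (fun w => joined w setT yv.2 x)).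
  apply: Pr_union => // w ws /(first_exit (B := ball 0 r))[].
  - exact: ball_center.
  - by rewrite /ball /= dx /m; have := edge_range_gt0 hE; lia.
  move=> a [b [ha hb wab hd]]; exists (a, b).
    apply/mem_exits; split=> //.
    by have /(mem_edges_in hE)[] := ws _ wab.
  by apply: disj_occ_mono hd => // w'; apply: joined_mono => // z [].
apply: (le_trans h2); rewrite big_seq [leRHS]big_seq; apply: ler_sum => -[y v] /mem_exits[hy hv Ee] /=.
apply: (le_trans (BK p01' _ (@joined_incr _ _ _ _) (@joined_incr _ _ _ _))).
rewrite (Pr_local p hE (u := 0) (r := r)); last exact: joined_depends.
  rewrite -mulrA ler_wpM2l ?Pr_ge0//; apply: (le_trans (tp_up tp N v x)).
  rewrite -mulrA ler_wpM2l ?(ltW C0)//; apply: kap_comp.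
  rewrite distC dx; have := edge_dist Ee; have := dist_triangle v x 0; rewrite dx.
  have := dist_triangle y v 0; rewrite (distC v y) (distC x v); move: hy; rewrite /ball /=.
  by rewrite /m; lia.
by apply: ball_subr; rewrite leq_addl.
Qed.

Lemma dist_signed s b x : involutive s -> dist (signed_perm s b x) 0 = dist x 0.
Proof.
move=> si.
suff le y : (dist (signed_perm s b y) 0 <= dist y 0)%N.
  apply/eqP; rewrite eqn_leq le /=.
  apply/distP => i; have := iffLR (distP (signed_perm s b x) 0 _) (leqnn _) (s i).
  by rewrite !mxE si; case: (b _); lia.
apply/distP => i; have := iffLR (distP y 0 _) (leqnn _) (s i).
by rewrite !mxE; case: (b _); lia.
Qed.

Lemma Pr_signed s b r y : involutive s -> 
  Pr p (EI 0 r) (fun w => joined w (ball 0 r) 0 y) <=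
  Pr p (EI 0 r) (fun w => joined w (ball 0 r) 0 (signed_perm s b y)).
Proof.
move=> si; pose phi := signed_perm s b; pose psi : Zd d -> Zd d := signed_perm s (fun i => b (s i)).
have phi0 : phi 0 = 0 by apply/rowP => i; rewrite !mxE oppr0 if_same.
have K1 : cancel phi psi by move=> x; apply/rowP => i; rewrite !mxE si; case: (b _); rewrite ?opprK.
have K2 : cancel psi phi by move=> x; apply/rowP => i; rewrite !mxE si; case: (b _); rewrite ?opprK.
have Ee b' e : E e -> E (emap (signed_perm s b') e).
  move=> Ee; have [x [x' [eE _ _]]] := edge_range hE Ee.
  by rewrite eE emap2; apply: (edge_sym hE) => //; rewrite -eE.
rewrite -[in leRHS]phi0 (Pr_auto p hE (phi := phi) (psi := psi)) //.
- apply: le_Pr => // w _ /(joined_map phi); rewrite phi0; apply: joined_mono => //.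
  by move=> z [z' hz' <-]; rewrite /ball /= dist_signed.
- exact: Ee.
- exact: Ee.
- by move=> x; rewrite /ball /= phi0 dist_signed.
- by move=> x; rewrite /ball /= phi0 dist_signed.
Qed.

Lemma half_pow (K : R) : 0 < K -> exists n : nat, 2^-1 ^+ n <= K.
Proof.
move=> K0; have [n hn] := ltr_add_invr K0; exists n.
rewrite add0r in hn; apply: le_trans (ltW hn).
rewrite exprVn lef_pV2 ?posrE ?exprn_gt0 ?ltr0n// -natrX ler_nat.
exact: ltn_expl.
Qed.

Lemma half_pow_le m n : (n <= m)%N -> 2^-1 ^+ m <= 2^-1 ^+ n :> R.
Proof. by move=> nm; apply: ler_wiXn2l => //; rewrite ?invr_ge0// invf_le1// ler1n. Qed.

Lemma half_powVn j n : 2^-1 ^+ (j * n) = ((2 ^ j)%:R ^+ n)^-1 :> R.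
Proof. by rewrite natrX -exprM exprVn. Qed.

Lemma size_exits_le u s j k : (s.*2 <= 2 ^ j)%N -> (2 * L0 < 2 ^ k)%N ->
  (size (exits E L0 u s) <= 2 ^ ((j + k + 2) * (2 * d)))%N.
Proof.
move=> sj hk; rewrite size_filter (leq_trans (count_size _ _))// size_allpairs !size_balls.
have [a0 b0] : (0 < 2 ^ j /\ 0 < 2 ^ k)%N by rewrite !expn_gt0.
have h : ((s + L0).*2.+1 <= 2 ^ (j + k + 2))%N.
  rewrite !expnD; move: a0 b0 sj hk; move: (2 ^ j)%N (2 ^ k)%N => a b; clear.
  move=> a0 b0 sj hk; have : (a <= a * b)%N by rewrite leq_pmulr.
  have : (b <= a * b)%N by rewrite leq_pmull.
  by move: (a * b)%N; lia.
have h1 : (s.*2.+1 <= 2 ^ (j + k + 2))%N by apply: leq_trans h; rewrite ltnS leq_double leq_addr.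
rewrite (_ : ((j + k + 2) * (2 * d) = (j + k + 2) * d + (j + k + 2) * d)%N); last by ring.
by rewrite expnD leq_mul// expnM leq_exp2r// ; move: d6; clear; lia.
Qed.

(** Some exit point [y] of the ball of radius m/2 is reached from its center with probability at
    least a constant over the number of exits, by [exit_sum]. Up to symmetry its i-th coordinate is
    the large one, and reflecting the other coordinates gives [y'] with y + y' on the axis. The two
    moves are composed by Harris' inequality and at most 2 L0 unit steps are added. The cost is a
    power of 2^j. *)
Lemma axis_move : exists K : nat, forall j m u r A x i (b : bool),
  (0 < m <= 2 ^ j)%N -> ball x m `<=` A `&` ball u r ->
  2^-1 ^+ (K * j.+1) <= Pr p (EI u r) (fun w => joined w A x
     (x + axv i (if b then m%:Z else - m%:Z))).
Proof.
have c1gt0 : 0 < c / (C * 2 ^+ (d - 2)) by rewrite divr_gt0 ?mulr_gt0 ?exprn_gt0.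
have [K1 hK1] := half_pow c1gt0.
have [K2 hK2] := half_pow p0.
have [K3 hK3] : exists K3, (2 * L0 < 2 ^ K3)%N by exists (2 * L0)%N; exact: ltn_expl.
pose K := (2 * (K1 + 2 * d * (K3 + 2)) + K2 * (2 * L0 + 1))%N; exists K.
move=> j m u r A x i b /andP[m0 mj] hx.
set s := m./2.
pose nex := size (exits E L0 0 s).
have sm : (s.*2 <= m)%N by rewrite /s -[X in (_ <= X)%N]odd_double_half leq_addl.
have nexle : (nex <= 2 ^ ((j + K3 + 2) * (2 * d)))%N := size_exits_le 0 (leq_trans sm mj) hK3.
have [y [h [hh hy]]] : exists y (h : nat), [/\ (h <= s)%N, (s < h + L0)%N & 2^-1 ^+ (K1 + (j + K3 + 2) * (2 * d)) <=
   Pr p (EI 0 s) (fun w => joined w (ball 0 s) 0 y) /\ y 0 i = (if b then h%:Z else - h%:Z)].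
  have [[y v] yv hyv] : exists2 yv, yv \in exits E L0 0 s &
      2^-1 ^+ (K1 + (j + K3 + 2) * (2 * d)) <=
      Pr p (EI 0 s) (fun w => joined w (ball 0 s) 0 yv.1).
    apply: contrapT => hn.
    have {}hn : forall yv, yv \in exits E L0 0 s ->
      Pr p (EI 0 s) (fun w => joined w (ball 0 s) 0 yv.1) < 2^-1 ^+ (K1 + (j + K3 + 2) * (2 * d)).
      by move=> yv hyv; rewrite ltNge; apply/negP => h; apply: hn; exists yv.
    have := exit_sum s; apply/negP; rewrite -ltNge.
    have [nex0|nex0] := posnP nex.
      by rewrite (size0nil nex0) big_nil.
    apply: (@lt_le_trans _ _ (nex%:R * 2^-1 ^+ (K1 + (j + K3 + 2) * (2 * d)))).
      rewrite /nex -sum1_size natr_sum mulr_suml.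
      under [ltRHS]eq_bigr do rewrite mul1r.
      rewrite big_seq [ltRHS]big_seq; apply: ltr_sum => //.
      apply/hasP; move: nex0; rewrite /nex; case: (exits E L0 0 s) => // a l _.
      by exists a; rewrite ?mem_head.
    rewrite exprD mulrCA; apply: le_trans hK1; rewrite ler_piMr ?exprn_ge0 ?invr_ge0//.
    rewrite half_powVn -natrX ler_pdivrMr ?ltr0n ?expn_gt0// mul1r ler_nat.
    by apply: leq_trans nexle _; rewrite expnM.
  move/mem_exits: yv => [ys vs Ee].
  have sL : (s < dist y 0 + L0)%N.
    have := edge_dist Ee; have := dist_triangle y v 0; rewrite (distC v y).
    by move: vs => /negP; rewrite -ltnNge; clear; lia.
  have [k hk] : exists k : 'I_d, `|y 0%R k|%N = dist y 0.
    have cd : (0 < #|'I_d|)%N by rewrite card_ord; move: d6; clear; lia.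
    have [k hk] := bigop.eq_bigmax (fun i : 'I_d => `|y 0%R i|%N) cd.
    by exists k; rewrite -hk /dist /linfnorm subr0.
  (* The largest coordinate of the exit point is moved to position [i] and given the sign prescribed
     by [b]. *)
  exists (signed_perm (tperm k i) (fun l => if b then y 0 k < 0 else 0 < y 0 k) y), `|y 0%R k|%N.
  split; [by rewrite hk|by rewrite hk|split].
    apply: (le_trans hyv); apply: Pr_signed; exact: tpermK.
  by rewrite mxE tpermR; move: (y 0 k) => a; clear; case: (b); case: ifP => h; lia.
case: hy => hsL [hy hyi].
(* All coordinates but the i-th change sign, so that they cancel in y + y'. *)
pose y' := signed_perm id (fun l => l != i) y.
have yy' : y + y' = axv i (if b then (h.*2)%:Z else - (h.*2)%:Z).
  apply/rowP => l; rewrite !mxE; case: eqP => [->|_] /=; last by rewrite subrr.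
  by rewrite hyi; case: (b); clear; lia.
have ys : (dist y 0 <= s)%N.
  have : 0 < Pr p (EI 0 s) (fun w => joined w (ball 0 s) 0 y).
    by apply: lt_le_trans hy; rewrite exprn_gt0 ?invr_gt0.
  apply: contraTT => hn; rewrite -leNgt Pr_false// => w /joined_inr.
  by rewrite /ball /=; apply/negP.
have hy' : 2^-1 ^+ (K1 + (j + K3 + 2) * (2 * d)) <=
   Pr p (EI 0 s) (fun w => joined w (ball 0 s) 0 y').
  by apply: (le_trans hy); exact: Pr_signed.
have sub1 : ball x s `<=` A `&` ball u r by apply: subset_trans hx; apply: ball_subr; move: sm; clear; lia.
have sub2 : ball (x + y) s `<=` A `&` ball u r.
  apply: subset_trans hx; apply: ball_sub; rewrite -[X in dist _ X](addr0 x) addrC (addrC x).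
  by rewrite distDr (leq_trans _ sm)// -addnn leq_add2r.
have step (z z' : Zd d) : ball z s `<=` A `&` ball u r ->
   Pr p (EI 0 s) (fun w => joined w (ball 0 s) 0 z') <=
   Pr p (EI u r) (fun w => joined w A z (z + z')).
  move=> hz; apply: (le_trans (Pr_joined_ball_shift hE p01' z 0 s 0 z')).
  rewrite !add0r (addrC z').
  apply: (le_trans (y := Pr p (EI z s) (fun w => joined w A z (z + z')))).
    by apply: le_Pr => // w _; apply: joined_mono => // t /hz[].
  by apply: (Pr_mono hE p01'); [move=> t /hz[]|exact: joined_incr].
have hd2 := le_trans hy (step x y sub1).
have hd3 := le_trans hy' (step (x + y) y' sub2).
have e1 : x + y + y' = x + axv i (if b then (h.*2)%:Z else - (h.*2)%:Z) by rewrite -addrA yy'.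
rewrite e1 in hd3.
have hm : (h.*2 <= m)%N by rewrite (leq_trans _ sm)// leq_double.
set z := x + axv _ _ in hd3.
have zA (k : nat) : (k <= m - h.*2)%N -> (A `&` ball u r) (z + axv i (if b then k%:Z else - k%:Z)).
  move=> hk; apply: hx; rewrite /ball /= distC /z -axvD dist_axv; move: hm hk; case: (b); clear=> hm hk; lia.
have hd4 := @straight A u r z i b (m - h.*2) zA.
have e2 : z + axv i (if b then (m - h.*2)%N%:Z else - (m - h.*2)%N%:Z) =
   x + axv i (if b then m%:Z else - m%:Z).
  by rewrite /z -axvD; congr (_ + axv _ _); move: hm; case: (b); clear=> hm; lia.
rewrite e2 in hd4.
apply: (le_trans _ (Pr_joined_trans _ _ _ z _)).
apply: (le_trans _ (ler_pM _ _ (Pr_joined_trans _ _ _ (x + y) _) (lexx _))); rewrite ?mulr_ge0 ?Pr_ge0//.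
have ge0h n : 0 <= 2^-1 ^+ n :> R by rewrite exprn_ge0 ?invr_ge0.
apply: (le_trans _ (ler_pM _ _ (ler_pM _ _ hd2 hd3) hd4)); rewrite ?mulr_ge0 ?exprn_ge0 ?invr_ge0 ?(ltW p0)//.
apply: (le_trans _ (ler_wpM2l _ (_ : 2^-1 ^+ (K2 * (m - h.*2)) <= _))); rewrite ?mulr_ge0//; last first.
  by rewrite exprM lerXn2r ?nnegrE ?(ltW p0)// exprn_ge0 ?invr_ge0.
rewrite -!exprD; apply: half_pow_le.
have : (m - h.*2 <= 2 * L0)%N.
  have := odd_double_half m; rewrite -/s; move: hsL hh; case: (odd m); move: (s) => s0; clear; lia.
rewrite /K; move: (m - h.*2)%N => l ll.
have -> : ((2 * (K1 + 2 * d * (K3 + 2)) + K2 * (2 * L0 + 1)) * j.+1 =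
  2 * K1 * j.+1 + 4 * d * K3 * j.+1 + 8 * d * j.+1 + K2 * (2 * L0 + 1) * j.+1)%N by ring.
have -> : (K1 + (j + K3 + 2) * (2 * d) + (K1 + (j + K3 + 2) * (2 * d)) + K2 * l =
  2 * K1 + 4 * d * K3 + (4 * d * j + 8 * d) + K2 * l)%N by ring.
have le1 a : (a <= a * j.+1)%N by rewrite leq_pmulr.
rewrite !leq_add ?le1//; first by rewrite mulnS [(8 * d * j)%N]mulnAC; clear; lia.
by rewrite (leq_trans _ (le1 _))// leq_mul2l (leq_trans ll) ?orbT// leq_addr.
Qed.

End axis.

(** * Gluing two points *)

Section glue.
Context (R : realType) (d : nat) (p : R) (E : set (edge d)) (L0 : nat).
Context (hE : lattice_edges E L0) (p01 : 0 < p < 1) (d6 : (6 < d)%N).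
Context (c C : R) (c0 : 0 < c) (cC : c < C) (tp : two_point p E c C).
Implicit Types (x y z u v t : Zd d) (A B : set (Zd d)) (w : set (edge d)).

Local Notation EI := (edges_in E).

Let p01' : 0 <= p <= 1. Proof. by case/andP: p01 => /ltW -> /ltW ->. Qed.
Let p0 : 0 < p. Proof. by case/andP: p01. Qed.

(** Interpolation from [u] to [z] one coordinate at a time: consecutive points differ by an axis
    move. *)
Definition mix u z n : Zd d := \row_i (if (i < n)%N then z 0 i else u 0 i).

Lemma mix0 u z : mix u z 0 = u.
Proof. by apply/rowP => i; rewrite mxE. Qed.

Lemma mixd u z : mix u z d = z.
Proof. by apply/rowP => i; rewrite mxE ltn_ord. Qed.

Lemma mixS u z (i : 'I_d) : mix u z i.+1 = mix u z i + axv i (z 0 i - u 0 i).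
Proof.
apply/rowP => j; rewrite !mxE ltnS leq_eqVlt -val_eqE /=.
by case: (ltngtP j i) => //= h; rewrite ?addr0// (ord_inj h) addrC subrK.
Qed.

Lemma ball_mix o r u z n : ball o r u -> ball o r z -> ball o r (mix u z n).
Proof.
move=> /distP h1 /distP h2; apply/distP => i.
by rewrite mxE; case: ifP.
Qed.

Lemma coord_path (s : seq (edge d)) A u z (q : R) : 0 <= q -> A u ->
  (forall i : 'I_d, q <= Pr p s (fun w => joined w A (mix u z i) (mix u z i.+1))) ->
  q ^+ d <= Pr p s (fun w => joined w A u z).
Proof.
move=> q0 Au h; suff H n : (n <= d)%N -> q ^+ n <= Pr p s (fun w => joined w A u (mix u z n)).
  by have := H d (leqnn d); rewrite mixd.
elim: n => [_|n IH nd].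
  by rewrite mix0 expr0 Pr_true// => w; exact: joined_refl.
apply: (le_trans _ (Pr_joined_trans p01 s A u (mix u z n) _)).
rewrite exprSr ler_pM ?exprn_ge0//; first by apply: IH; exact: ltnW.
exact: (h (Ordinal nd)).
Qed.

Local Notation half := (2^-1 : R).

Lemma half_ge0 n : 0 <= half ^+ n.
Proof. by rewrite exprn_ge0 ?invr_ge0. Qed.

Lemma half_le1 n : half ^+ n <= 1.
Proof. by rewrite exprn_ile1 ?invr_ge0// invf_le1 ?ler1n. Qed.

(** Induction on the scale. The point [a] lies in a ball of half the radius around some [z], to
    which it is joined by induction; then [d] axis moves of length 2^j lead from [z] to the center.
    The costs 2^(-C j) of the scales multiply to 2^(-C j^2), the origin of the quasi-polynomial cost
    of gluing. *)
Lemma glue_center : exists K : nat, forall j u a v r A,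
  ball u (2 ^ j) `<=` A `&` ball v r -> ball u (2 ^ j) a ->
  half ^+ (K * j.+1 ^ 2) <= Pr p (EI v r) (fun w => joined w A a u).
Proof.
have [K0 hK0] := axis_move hE p01 d6 c0 cC tp.
have [K2 hK2] := half_pow p0.
pose K := (K0 * d + K2 * d)%N; exists K; elim=> [|j IH] u a v r A hu au.
  apply: (@le_trans _ _ (p ^+ d)).
    apply: (@le_trans _ _ (half ^+ (K2 * d))); first by apply: half_pow_le; rewrite /K; lia.
    by rewrite exprM lerXn2r ?nnegrE ?half_ge0 ?(ltW p0).
  have Aa : (A `&` ball v r) a by exact: hu.
  apply: coord_path; [exact: ltW|by case: Aa|move=> i].
  have ms n : (A `&` ball v r) (mix a u n).
    by apply: hu; apply: ball_mix => //; exact: ball_center.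
  have hi := iffLR (distP a u 1) au i.
  have [e|[k ke]] : u 0 i - a 0 i = 0 \/ exists b : bool, u 0 i - a 0 i = (if b then 1%:Z else - 1%:Z).
    have [|[|]] : u 0 i - a 0 i = 0 \/ u 0 i - a 0 i = 1 \/ u 0 i - a 0 i = -1 by clear -hi; lia.
    - by left.
    - by move=> ->; right; exists true.
    - by move=> ->; right; exists false.
  - rewrite mixS e Pr_true; first by case/andP: p01 => _ /ltW.
    move=> w; rewrite (_ : axv i 0 = 0) ?addr0; last by apply/rowP => l; rewrite !mxE if_same.
    by apply: joined_refl; have [] := ms i.
  - rewrite mixS ke -[leLHS]expr1; apply: (straight hE p01 d6 c0 cC (n := 1)) => n n1.
    have [->|->] : n = 0%N \/ n = 1%N by lia.
      rewrite (_ : _ + _ = mix a u i) //; apply/rowP => l; rewrite !mxE.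
      by case: (k); rewrite ?oppr0 if_same addr0.
    by rewrite -ke -mixS.
pose k := (2 ^ j)%N; have k0 : (0 < k)%N by rewrite expn_gt0.
(* Each coordinate of [z] is that of [u], or differs from it by k on the side of [a]. *)
pose z : Zd d := \row_i (if a 0 i - u 0 i > k%:Z then u 0 i + k%:Z
   else if a 0 i - u 0 i < - k%:Z then u 0 i - k%:Z else u 0 i).
have az : ball z k a.
  apply/distP => i; have := iffLR (distP a u _) au i; rewrite !mxE expnS -/k.
  by case: ltP => ?; [|case: ltP => ?]; rewrite ?ler_norml; lia.
have zu : ball u k z.
  apply/distP => i; rewrite !mxE.
  by case: ltP => ?; [|case: ltP => ?]; rewrite ?ler_norml; lia.
have kk : (k + k <= 2 ^ j.+1)%N by rewrite expnS -/k; lia.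
have h1 : half ^+ (K * j.+1 ^ 2) <= Pr p (EI v r) (fun w => joined w A a z).
  apply: IH => //; apply: subset_trans hu; apply: ball_sub.
  by apply: leq_trans kk; rewrite leq_add2r.
apply: (le_trans _ (Pr_joined_trans p01 (EI v r) A a z u)).
have h2 : (half ^+ (K0 * j.+1)) ^+ d <= Pr p (EI v r) (fun w => joined w A z u).
  have ms n : (A `&` ball v r) (mix z u n).
    apply: hu; apply: ball_mix; last exact: ball_center.
    by apply: ball_subr zu; apply: leq_trans kk; rewrite leq_addl.
  apply: coord_path; [exact: half_ge0|by have [] := ms 0%N; rewrite mix0|].
  move=> i; have ball_ms : ball (mix z u i) k `<=` A `&` ball v r.
    apply: subset_trans hu; apply: ball_sub; apply: leq_trans kk; rewrite leq_add2r.
    by apply: ball_mix => //; exact: ball_center.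
  have [e|[b be]] : u 0 i - z 0 i = 0 \/ exists b : bool, u 0 i - z 0 i = (if b then k%:Z else - k%:Z).
    rewrite !mxE; case: ltP => ?; first by right; exists false; lia.
    case: ltP => ?; first by right; exists true; lia.
    by left; lia.
  - rewrite mixS e Pr_true ?half_le1//.
    move=> w; rewrite (_ : axv i 0 = 0) ?addr0; last by apply/rowP => l; rewrite !mxE if_same.
    by apply: joined_refl; have [] := ms i.
  - by rewrite mixS be; apply: hK0 => //; rewrite k0 /= leqnn.
apply: (le_trans _ (ler_pM _ _ h1 h2)); rewrite ?exprn_ge0 ?half_ge0 ?invr_ge0//.
rewrite -exprM -exprD; apply: half_pow_le; rewrite /K.
have -> : (j.+2 ^ 2 = j.+1 ^ 2 + 2 * j.+1 + 1)%N by rewrite -addn1 sqrnD; clear; lia.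
rewrite !mulnDr mulnDl -!addnA leq_add2l; clear; lia.
Qed.

(** The cost depends on the distance of the two points and not on the ball in which they are joined:
    both are joined to the center of a ball of radius 2^j that contains them and lies in the given
    one, or, if 2^j is larger, to the center of the given ball. *)
Lemma glue_ball : exists K : nat, forall j l u y v N,
  ball u (2 ^ l) `<=` ball 0 N -> ball u (2 ^ l) y -> ball u (2 ^ l) v ->
  (dist y v <= 2 ^ j)%N ->
  half ^+ (K * j.+1 ^ 2) <= Pr p (EI 0 N) (fun w => joined w (ball u (2 ^ l)) y v).
Proof.
have [K hK] := glue_center; exists (2 * K)%N => j l u y v N uN uy uv yv.
have via k o : ball o (2 ^ k) `<=` ball u (2 ^ l) -> (k <= j)%N ->
   ball o (2 ^ k) y -> ball o (2 ^ k) v ->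
   half ^+ (2 * K * j.+1 ^ 2) <= Pr p (EI 0 N) (fun w => joined w (ball u (2 ^ l)) y v).
  move=> ou kj oy ov.
  apply: (le_trans _ (Pr_joined_trans p01 _ _ _ o _)).
  have sub : ball o (2 ^ k) `<=` ball u (2 ^ l) `&` ball 0 N.
    by move=> t /ou h; split=> //; exact: uN.
  have hv : half ^+ (K * k.+1 ^ 2) <= Pr p (EI 0 N) (fun w => joined w (ball u (2 ^ l)) o v).
    by apply: (le_trans (hK _ _ _ _ _ _ sub ov)); apply: le_Pr => // w _; exact: joined_sym.
  apply: (le_trans _ (ler_pM _ _ (hK _ _ _ _ _ _ sub oy) hv)); rewrite ?half_ge0//.
  rewrite -exprD; apply: half_pow_le.
  have : (k.+1 ^ 2 <= j.+1 ^ 2)%N by rewrite leq_exp2r.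
  nia.
have [jl|lj] := leqP j l; last by apply: (via l u) => //; exact: ltnW.
pose k := (2 ^ j)%N; have kl : (k <= 2 ^ l)%N by rewrite leq_exp2l.
pose m := (2 ^ l - k)%N.
(* The point of the ball of radius 2^l - 2^j around [u] nearest to [y], coordinate by coordinate. *)
pose o : Zd d := \row_i (if y 0 i - u 0 i > m%:Z then u 0 i + m%:Z
   else if y 0 i - u 0 i < - m%:Z then u 0 i - m%:Z else y 0 i).
apply: (via j o) => //.
- apply: ball_sub; rewrite -[leqRHS](subnK kl) leq_add2r.
  apply/distP => i; rewrite !mxE; have := iffLR (distP y u _) uy i.
  by case: ltP => ?; [|case: ltP => ?]; rewrite ?ler_norml; rewrite /m in o *; lia.
- apply/distP => i; rewrite !mxE; have := iffLR (distP y u _) uy i.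
  by case: ltP => ?; [|case: ltP => ?]; rewrite ?ler_norml; rewrite /m in o *; lia.
- apply/distP => i; rewrite !mxE; have := iffLR (distP y u _) uy i.
  have := iffLR (distP v u _) uv i; have := iffLR (distP y v _) yv i.
  by case: ltP => ?; [|case: ltP => ?]; rewrite ?ler_norml; rewrite /m in o *; lia.
Qed.

End glue.

Section glue2.
Context (R : realType) (d : nat) (p : R) (E : set (edge d)) (L0 : nat).
Context (hE : lattice_edges E L0) (p01 : 0 < p < 1) (d6 : (6 < d)%N).
Context (c C : R) (c0 : 0 < c) (cC : c < C) (tp : two_point p E c C).
Implicit Types (x y z u v t : Zd d) (A B : set (Zd d)) (w : set (edge d)).

Local Notation EI := (edges_in E).

Let p01' : 0 <= p <= 1. Proof. by case/andP: p01 => /ltW -> /ltW ->. Qed.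
Let p0 : 0 < p. Proof. by case/andP: p01. Qed.

Local Notation half := (2^-1 : R).

Lemma notin_ball k y : ~ ball 0 k y -> exists (i : 'I_d) (b : bool),
  k%:Z < (if b then y 0 i else - y 0 i).
Proof.
move=> h; apply: contrapT => hn; apply: h; apply/distP => i.
rewrite mxE subr0 ler_norml; apply/andP; split; rewrite leNgt; apply/negP => h;
  apply: hn; exists i; by [exists false; lia|exists true; lia].
Qed.

Definition sgv (b : bool) (k : nat) : int := if b then k%:Z else - k%:Z.

Lemma sqrn_addS j a : ((j + a).+1 ^ 2 <= a.+1 ^ 2 * j.+1 ^ 2)%N.
Proof. by rewrite -expnMn leq_exp2r//; lia. Qed.

Lemma sgv_add (b : bool) (a : int) (k q : nat) : k%:Z < (if b then a else - a) ->
  k%:Z + q%:Z < (if b then a + sgv b q else - (a + sgv b q)).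
Proof. by rewrite /sgv; case: b; lia. Qed.

(** Outside the box {|x| <= k}, [y] can be pushed away in direction [(i, b)] and [v] in direction
    [(i', b')]. Both points receive both shifts, in opposite orders, so that the shifted points
    again differ by v - y and stay far from the box on the way between them. Opposite faces are
    excluded because the shifts would cancel. *)
Let glue_out_corner : exists K : nat, forall j k N A y v i b i' b',
  ball y (2 ^ (j + 5)) `<=` A `&` ball 0 N ->
  k%:Z < (if b then y 0 i else - y 0 i) -> k%:Z < (if b' then v 0 i' else - v 0 i') ->
  (i = i' -> b = b') -> (dist y v <= 2 ^ j)%N ->
  half ^+ (K * j.+1 ^ 2) <= Pr p (EI 0 N) (fun w => joined w (A `\` ball 0 k) y v).
Proof.
have [K hK] := glue_center hE p01 d6 c0 cC tp.
have [K0 hK0] := axis_move hE p01 d6 c0 cC tp.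
pose K1 := (18 * K + 6 * K0 + K0 * d)%N.
exists K1 => j k N A y v i b i' b' yA hy hv ib yv.
pose O := A `\` ball 0 k; pose q := (2 ^ (j + 2))%N.
have e2 : (2 ^ (j + 5) = 8 * q)%N by rewrite /q !expnD; lia.
have e3 : (q = 4 * 2 ^ j)%N by rewrite /q !expnD; lia.
have q0 : (0 < q)%N by rewrite expn_gt0.
have okball t r l (s : bool) : (dist t y + r <= 8 * q)%N ->
    (k%:Z + r%:Z < (if s then t 0 l else - t 0 l)) -> ball t r `<=` O `&` ball 0 N.
  move=> h1 h2 t' t't; have [At' Nt'] : (A `&` ball 0 N) t'.
    by apply: yA; apply: ball_sub t't; rewrite e2.
  split=> //; split=> // /distP/(_ l); rewrite mxE subr0.
  by have := iffLR (distP t' t _) t't l; move: h2; case: (s); rewrite ?ler_norml; lia.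
(* [v2 - v1 = v - y]; every intermediate point keeps a distance from the box that leaves room for
   the balls of the axis moves. *)
pose u1 := y + axv i (sgv b q); pose v1 := u1 + axv i' (sgv b' q).
pose u2 := v + axv i' (sgv b' q); pose v2 := u2 + axv i (sgv b q).
have du1 : dist u1 y = q by rewrite distC dist_axv /sgv; case: (b); lia.
have dv1 : (dist v1 y <= 2 * q)%N.
  apply: leq_trans (dist_triangle u1 _ _) _; rewrite du1 distC dist_axv /sgv.
  by case: (b'); clear; lia.
have du2 : (dist u2 y <= q + 2 ^ j)%N.
  apply: leq_trans (dist_triangle v _ _) _; rewrite distC dist_axv (distC v) leq_add//.
  by rewrite /sgv; case: (b'); clear; lia.
have dv2 : (dist v2 y <= 2 * q + 2 ^ j)%N.
  apply: leq_trans (dist_triangle u2 _ _) _; rewrite distC dist_axv.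
  rewrite (_ : `|sgv b q|%N = q); last by rewrite /sgv; case: (b); clear; lia.
  by rewrite mul2n -addnn -addnA leq_add2l.
have B1 : ball u1 q `<=` O `&` ball 0 N.
  apply: (okball _ _ i b); first by rewrite du1; lia.
  by rewrite !mxE eqxx; exact: sgv_add.
have B2 : ball u2 q `<=` O `&` ball 0 N.
  apply: (okball _ _ i' b'); first by move: du2; lia.
  by rewrite !mxE eqxx; exact: sgv_add.
have s1 : half ^+ (K * (j + 2).+1 ^ 2) <= Pr p (EI 0 N) (fun w => joined w O y u1).
  by apply: hK => //; rewrite /ball /= distC du1.
have s2 : half ^+ (K * (j + 2).+1 ^ 2) <= Pr p (EI 0 N) (fun w => joined w O u2 v).
  apply: (le_trans (hK _ _ v _ _ _ B2 _)).
    by rewrite /ball /= dist_axv /sgv; case: (b'); rewrite /q; lia.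
  by apply: le_Pr => // w _; exact: joined_sym.
have s3 : half ^+ (K0 * (j + 2).+1) <= Pr p (EI 0 N) (fun w => joined w O u1 v1).
  by apply: hK0 => //; rewrite q0 /= leqnn.
have s4 : half ^+ (K0 * (j + 2).+1) <= Pr p (EI 0 N) (fun w => joined w O v2 u2).
  apply: (le_trans (hK0 (j + 2)%N q 0 N O u2 i b _ B2)); first by rewrite q0 /= leqnn.
  by apply: le_Pr => // w _; exact: joined_sym.
have s5 : (half ^+ (K0 * j.+1)) ^+ d <= Pr p (EI 0 N) (fun w => joined w O v1 v2).
  have diff l : v2 0 l - v1 0 l = v 0 l - y 0 l by rewrite !mxE; ring.
  have hl l : `|v 0 l - y 0 l| <= (2 ^ j)%N%:Z.
    by have := iffLR (distP y v _) yv l; rewrite distrC.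
  have mxl n l : (mix v1 v2 n 0 l = v1 0 l \/ mix v1 v2 n 0 l = v1 0 l + (v 0 l - y 0 l)).
    by rewrite mxE; case: ifP => _; [right|left] => //; rewrite -diff; ring.
  have dm n : (dist (mix v1 v2 n) y <= 2 * q + 2 ^ j)%N.
    by apply: ball_mix => //; apply: leq_trans dv1 _; exact: leq_addr.
  have Bn n : ball (mix v1 v2 n) (2 ^ j) `<=` O `&` ball 0 N.
    apply: (okball _ _ i b); first by rewrite (leq_trans (leq_add (dm n) (leqnn _)))// e3; move: (2 ^ j)%N; clear; lia.
    have hli := hl i; rewrite ler_norml in hli.
    have v1i : (if b then v1 0 i else - v1 0 i) >= (if b then y 0 i else - y 0 i) + q%:Z.
      rewrite !mxE eqxx; have [ii|ii] := eqVneq i i'; rewrite ?(negPf ii) -?(ib ii) /sgv;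
        by move: (y 0 i) (q) => a1 a2; clear; case: (b); lia.
    case: (mxl n i) => ->; move: v1i hy hli e3; move: (v1 0 i) (y 0 i) (v 0 i) (q) (2 ^ j)%N => a1 a2 a3 a4 a5; clear; case: (b); lia.
  apply: (coord_path p01); rewrite ?half_ge0//.
    by have [] := Bn 0%N (mix v1 v2 0) (ball_center _ _); rewrite mix0.
  move=> l; rewrite mixS diff; have := hl l; set g := v 0 l - y 0 l => hg.
  have [g0|g0] := eqVneq g 0.
    rewrite Pr_true ?half_le1// => w.
    rewrite g0 (_ : axv l 0 = 0) ?addr0; last by apply/rowP => l'; rewrite !mxE if_same.
    by apply: joined_refl; have [] := Bn l (mix v1 v2 l) (ball_center _ _).
  have hgE (a : int) : a = if 0 <= a then `|a|%N%:Z else - `|a|%N%:Z by clear; case: (lerP 0 a); lia.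
  have hg' : (`|g| <= 2 ^ j)%N by rewrite -lez_nat abszE.
  rewrite {1}(hgE g).
  apply: hK0; first by rewrite absz_gt0 g0.
  by apply: subset_trans (Bn l); exact: ball_subr.
have T t t' t'' a b0 : 0 <= a -> 0 <= b0 -> a <= Pr p (EI 0 N) (fun w => joined w O t t') ->
   b0 <= Pr p (EI 0 N) (fun w => joined w O t' t'') ->
   a * b0 <= Pr p (EI 0 N) (fun w => joined w O t t'').
  by move=> ? ? ? ?; apply: (le_trans _ (Pr_joined_trans p01 _ _ _ t' _)); exact: ler_pM.
have h0 n : 0 <= half ^+ n by exact: half_ge0.
have s13 := T _ _ _ _ _ (h0 _) (h0 _) s1 s3.
have s135 := T _ _ _ _ _ (mulr_ge0 (h0 _) (h0 _)) (exprn_ge0 _ (h0 _)) s13 s5.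
have s1354 := T _ _ _ _ _ (mulr_ge0 (mulr_ge0 (h0 _) (h0 _)) (exprn_ge0 _ (h0 _))) (h0 _) s135 s4.
apply: le_trans (T _ _ _ _ _ _ (h0 _) s1354 s2); last first.
  by rewrite !mulr_ge0// exprn_ge0.
rewrite -exprM -!exprD; apply: half_pow_le; rewrite /K1.
have := sqrn_addS j 2; have : (j.+1 <= j.+1 ^ 2)%N by rewrite leq_pmull.
have : (1 <= j.+1 ^ 2)%N by rewrite expn_gt0.
move: (j.+1 ^ 2)%N ((j + 2).+1 ^ 2)%N => a b1; rewrite -addSn; move: j.+1 => j1; clear => a0 ja ba.
have h1 : (K * b1 <= 9 * (K * a))%N by rewrite (leq_trans (leq_mul (leqnn K) ba))// mulnCA.
have h2 : (K0 * j1 <= K0 * a)%N by rewrite leq_mul.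
have h2' : (K0 <= K0 * a)%N by rewrite leq_pmulr.
have h3 : (K0 * (j1 + 2) <= 3 * (K0 * a))%N.
  by rewrite mulnDr; move: h2 h2'; move: (K0 * a)%N (K0 * j1)%N; clear; lia.
have h4 : (K0 * j1 * d <= K0 * d * a)%N by rewrite mulnAC leq_mul.
by move: h1 h3 h4; clear; lia.
Qed.

(** The remaining case is that of opposite faces. Then the box is smaller than 2^j, and one goes
    around it through a point [t] beyond a third face; each of the two parts is a corner case. *)
Lemma glue_out : exists K : nat, forall j k N A y v,
  ball y (2 ^ (j + 8)) `<=` A `&` ball 0 N -> ~ ball 0 k y -> ~ ball 0 k v ->
  (dist y v <= 2 ^ j)%N ->
  half ^+ (K * j.+1 ^ 2) <= Pr p (EI 0 N) (fun w => joined w (A `\` ball 0 k) y v).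
Proof.
have [K hK] := glue_out_corner; exists (18 * K)%N => j k N A y v yA ky kv yv.
have hhalf m : (m <= 18 * K * j.+1 ^ 2)%N -> half ^+ (18 * K * j.+1 ^ 2) <= half ^+ m.
  by move=> h; exact: half_pow_le.
have [i [b hy]] := notin_ball ky; have [i' [b' hv]] := notin_ball kv.
have sub t n : (dist t y + n <= 2 ^ (j + 8))%N -> ball t n `<=` A `&` ball 0 N.
  by move=> h; apply: subset_trans yA; exact: ball_sub.
have [ib|nib] := pselect (i = i' -> b = b').
  apply: (le_trans _ (hK j k N A y v i b i' b' _ hy hv ib yv)).
    by apply: hhalf; rewrite -mulnA leq_pmull.
  by apply: sub; rewrite distxx leq_exp2l//; lia.
have [ii bb] : i = i' /\ b != b'.
  have [ii|/eqP ii] := eqVneq i i'; last by case: nib.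
  by split=> //; apply/eqP => bb; apply: nib.
have k2 : (2 * k < 2 ^ j)%N.
  have := iffLR (distP y v _) yv i; rewrite ler_norml.
  by move: hy hv; rewrite -ii; case: (b) bb; case: (b') => //; lia.
have [l li] : exists l : 'I_d, l != i.
  have d0 : (0 < d)%N by lia. have d1 : (1 < d)%N by lia.
  have [e|] := eqVneq i (Ordinal d0); first by exists (Ordinal d1); rewrite e.
  by rewrite eq_sym => h; exists (Ordinal d0).
(* Along [l] the point moves away from 0, so that a shift by 2^(j+1) clears the box. *)
pose bl := 0 <= y 0 l.
pose t := y + axv l (sgv bl (2 ^ j.+1)).
have dty : dist t y = (2 ^ j.+1)%N by rewrite distC dist_axv /sgv; case: (bl); lia.
have ht : k%:Z < (if bl then t 0 l else - t 0 l).
  rewrite !mxE eqxx /sgv /bl expnS; move: (y 0 l) k2; move: (2 ^ j)%N; clear.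
  by move=> m a k2; case: (lerP 0 a) => h; lia.
apply: (le_trans _ (Pr_joined_trans p01 _ _ _ t _)).
have h1 : half ^+ (K * (j.+1).+1 ^ 2) <= Pr p (EI 0 N) (fun w => joined w (A `\` ball 0 k) y t).
  apply: (hK _ _ _ _ _ _ i b l bl) => //.
  - by apply: sub; rewrite distxx leq_exp2l//; lia.
  - by move=> il; rewrite il eqxx in li.
  - by rewrite distC dty.
have h2 : half ^+ (K * (j.+2).+1 ^ 2) <= Pr p (EI 0 N) (fun w => joined w (A `\` ball 0 k) t v).
  apply: (hK _ _ _ _ _ _ l bl i' b') => //.
  - by apply: sub; rewrite dty !expnD !expnS; lia.
  - by move=> il; rewrite il ii eqxx in li.
  - by apply: leq_trans (dist_triangle y _ _) _; rewrite dty !expnS; lia.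
apply: (le_trans _ (ler_pM _ _ h1 h2)); rewrite ?half_ge0//.
rewrite -exprD; apply: hhalf.
by have := sqrn_addS j 1; have := sqrn_addS j 2; rewrite !addnS addn0; clear; nia.
Qed.

End glue2.

(** * The Aizenman-Kesten-Newman two-arm bound *)

Section tilting.
Context (R : realType) (I : eqType).
Implicit Types (s : seq I) (f : set I -> R) (p t u : R).

(** The product is the density of the Bernoulli law of parameter p + t p(1-p) with respect to that
    of parameter p, since (1-p)(1 - tp) and p(1 + t(1-p)) are its two weights. *)
Lemma Ex_tilt p t s f : uniq s ->
  Ex p s (fun w => f w *
    \prod_(e <- s) (if `[< w e >] then 1 + t * (1 - p) else 1 - t * p)) =
  Ex (p + t * (p * (1 - p))) s f.
Proof.
elim: s f => [|e s IH] f /=; first by rewrite big_nil mulr1.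
move=> /andP[es us]; rewrite -!IH// -!ExZ -!ExD; apply: eq_Ex => w ws.
rewrite !big_cons asboolF; last by move=> /ws/=; apply/negP.
rewrite asboolT; last by left.
have -> : \prod_(j <- s) (if `[< (e |` w) j >] then 1 + t * (1 - p) else 1 - t * p) =
   \prod_(j <- s) (if `[< w j >] then 1 + t * (1 - p) else 1 - t * p).
  apply: eq_big_seq => j js; congr (if _ then _ else _); apply: asbool_equiv_eq.
  by split=> [[je|]|]//; [move: es; rewrite -je js|right].
by ring.
Qed.

(** For |v| <= b <= 1/2 one has 1 + v >= exp(v - 2 b^2); the product of exponentials is then bounded
    below by exp(x) >= 1 + x. *)
Lemma prod_tilt_ge (J : Type) (s : seq J) (Q : pred J) (u : J -> R) (b : R) :
  (forall e, `|u e| <= b) -> b <= 2^-1 ->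
  \sum_(e <- s | Q e) u e - 2 * b ^+ 2 * (count Q s)%:R <= \prod_(e <- s | Q e) (1 + u e).
Proof.
move=> ub b2.
have h v : `|v| <= b -> expR (v - 2 * b ^+ 2) <= 1 + v.
  move=> vb; have [v1 v2] : - b <= v /\ v <= b by split; move: vb; rewrite ler_norml => /andP[].
  have v0 : 0 < 1 + v by lra.
  have -> : v - 2 * b ^+ 2 = - (- v + 2 * b ^+ 2) by ring.
  rewrite expRN -[leRHS]invrK lef_pV2 ?posrE ?expR_gt0 ?invr_gt0//.
  apply: le_trans (expR_ge1Dx _); rewrite -[leLHS]mul1r ler_pdivrMr//.
  have : v ^+ 2 <= b ^+ 2 by rewrite !expr2; nra.
  rewrite !expr2; nra.
apply: (@le_trans _ _ (\prod_(e <- s | Q e) expR (u e - 2 * b ^+ 2))); last first.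
  by apply: ler_prod => e _; rewrite expR_ge0 h.
rewrite -expR_sum; apply: le_trans (expR_ge1Dx _).
by rewrite big_split /= [X in _ <= _ + (_ + X)]big_const_seq iter_addr_0 mulr_natr mulNrn; lra.
Qed.

End tilting.

Section clusters.
Context (R : realType) (d : nat) (p : R) (p01 : 0 < p < 1).
Context (V : seq (Zd d)) (uV : uniq V) (F : seq (edge d)) (uF : uniq F).
Context (hF : forall e, e \in F -> exists x y, [/\ e = [fset x; y]%fset, x \in V & y \in V]).
Context (B : set (Zd d)).
Implicit Types (x y z : Zd d) (w : set (edge d)) (e : edge d) (K : seq (Zd d)).

Let p01' : 0 <= p <= 1. Proof. by case/andP: p01 => /ltW -> /ltW ->. Qed.

Definition con w x y := joined w [set` V] x y.
Definition clu w x := [seq y <- V | `[< con w x y >]].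
Definition arm w x := joined_set w [set` V] x B.
Definition mts w x e := `[< touching (con w x) e >].
Definition arm_edge w e := exists2 z, z \in e & arm w z.
Definition two_arms w e := exists a b, [/\ e = [fset a; b]%fset, arm w a, arm w b & ~ con w a b].
(** A centered count: exploring the cluster of [x] edge by edge, each examined edge adds p minus its
    indicator, which has mean 0. *)
Definition excess w x : R := \sum_(e <- F | mts w x e) (p - `[< w e >]%:R).

Lemma cluE w x : clu w x = [seq y <- V | `[< con w x y >]]. Proof. by []. Qed.

Lemma mem_clu w x y : (y \in clu w x) = `[< con w x y >].
Proof.
rewrite mem_filter; case: asboolP => //= h.
by have := joined_inr h.
Qed.

Lemma con_refl w x : x \in V -> con w x x. Proof. by move=> xV; exact: joined_refl. Qed.
Lemma con_sym w x y : con w x y -> con w y x. Proof. exact: joined_sym. Qed.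
Lemma con_trans w y x z : con w x y -> con w y z -> con w x z. Proof. exact: joined_trans. Qed.

Lemma clu_eq w x y : con w x y -> clu w x = clu w y.
Proof.
move=> xy; apply: eq_filter => z; apply: asbool_equiv_eq; split.
  by apply: con_trans; exact: con_sym.
exact: con_trans.
Qed.

Lemma arm_con w x y : con w x y -> arm w y -> arm w x.
Proof. by move=> xy [v Bv yv]; exists v => //; exact: con_trans yv. Qed.

Lemma size_clu_gt0 w x : x \in V -> (0 < size (clu w x))%N.
Proof.
by move=> xV; rewrite size_filter -has_count; apply/hasP; exists x => //; apply/asboolP; exact: con_refl.
Qed.

Lemma sum_clu w a : a \in V ->
  \sum_(x <- V | `[< con w a x >]) (size (clu w x))%:R^-1 = 1 :> R.
Proof.
move=> aV; rewrite (eq_bigr (fun=> (size (clu w a))%:R^-1)); last first.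
  by move=> x /asboolP ax; rewrite (clu_eq ax).
rewrite big_const_seq iter_addr_0 -size_filter -/(clu w a) -[_ *+ _]mulr_natr mulVf//.
by rewrite pnatr_eq0 -lt0n size_clu_gt0.
Qed.

Lemma sum_clu_arm w a : a \in V ->
  \sum_(x <- V | `[< arm w x >] && `[< con w a x >]) (size (clu w x))%:R^-1 =
  `[< arm w a >]%:R :> R.
Proof.
move=> aV; case: asboolP => ha.
  rewrite -[RHS](sum_clu w aV); apply: eq_bigl => x; apply: andb_idl => /asboolP ax.
  by apply/asboolP; apply: arm_con ha; exact: con_sym.
rewrite big_pred0// => x; apply/negP => /andP[/asboolP hx /asboolP ax]; apply: ha.
exact: arm_con hx.
Qed.

(** The weight 1 / |cluster| makes a sum over vertices count clusters. An edge touches one cluster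
    with an arm, or two exactly when both ends have arms and lie in different clusters, whence the
    two indicators. *)
Lemma arm_count w e : w `<=` [set` F] -> e \in F ->
  \sum_(x <- V | `[< arm w x >]) (mts w x e)%:R / (size (clu w x))%:R =
  `[< arm_edge w e >]%:R + `[< two_arms w e >]%:R :> R.
Proof.
move=> wF /hF [a [b [-> aV bV]]].
have tE x : mts w x [fset a; b]%fset = `[< con w a x >] || `[< con w b x >].
  rewrite -asbool_or; apply: asbool_equiv_eq; split.
    by move=> [z]; rewrite !inE => /orP[]/eqP -> h; [left|right]; exact: con_sym.
  by case=> h; [exists a|exists b]; rewrite ?inE ?eqxx ?orbT//; exact: con_sym.
have eE : arm_edge w [fset a; b]%fset <-> arm w a \/ arm w b.
  split; first by move=> [z]; rewrite !inE => /orP[]/eqP -> h; [left|right].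
  by case=> h; [exists a|exists b]; rewrite ?inE ?eqxx ?orbT.
rewrite (eq_bigr (fun x => if mts w x [fset a; b]%fset then (size (clu w x))%:R^-1 else 0)); last first.
  by move=> x _; case: ifP => _; rewrite ?mul1r ?mul0r.
rewrite -big_mkcondr /=.
have [ab|nab] := pselect (con w a b).
  have tw : ~ two_arms w [fset a; b]%fset.
    move=> [a' [b' [e1 _ _ h]]]; apply: h.
    have : a' \in [fset a; b]%fset by rewrite e1 !inE eqxx.
    have : b' \in [fset a; b]%fset by rewrite e1 !inE eqxx orbT.
    rewrite !inE => /orP[]/eqP -> /orP[]/eqP -> //; try exact: con_refl.
    exact: con_sym.
  rewrite (asboolF tw) addr0 (asbool_equiv_eq eE) (@asbool_equiv_eq _ (arm w a)); last first.
    by split; [case=> // h; exact: arm_con h|left].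
  rewrite -(sum_clu_arm w aV); apply: eq_bigl => x; rewrite tE.
  congr (_ && _); apply/orb_idr => /asboolP bx; apply/asboolP; exact: con_trans bx.
have -> : `[< two_arms w [fset a; b]%fset >] = `[< arm w a >] && `[< arm w b >].
  rewrite -asbool_and; apply: asbool_equiv_eq; split; last by move=> [h1 h2]; exists a, b.
  move=> [a' [b' [e1 h1 h2 _]]].
  have : a \in [fset a'; b']%fset by rewrite -e1 !inE eqxx.
  have : b \in [fset a'; b']%fset by rewrite -e1 !inE eqxx orbT.
  by rewrite !inE => /orP[]/eqP -> /orP[]/eqP ->.
rewrite (asbool_equiv_eq eE) asbool_or.
have -> : (`[< arm w a >] || `[< arm w b >])%:R + (`[< arm w a >] && `[< arm w b >])%:R =
   `[< arm w a >]%:R + `[< arm w b >]%:R :> R.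
  by case: `[< _ >]; case: `[< _ >]; rewrite /= ?addr0 ?add0r.
rewrite -(sum_clu_arm w aV) -(sum_clu_arm w bV) [RHS]addrC.
rewrite (bigID (fun x => `[< con w b x >])) /=; congr (_ + _); apply: eq_bigl => x;
  rewrite tE; case: `[< arm w x >] => //=.
  by case: asboolP => //=; case: asboolP.
case: asboolP => /= [ax|//]; case: asboolP => //= bx.
by case: nab; apply: con_trans ax _; exact: con_sym.
Qed.

Lemma excess_sum w : w `<=` [set` F] ->
  \sum_(x <- V | `[< arm w x >]) excess w x / (size (clu w x))%:R =
  \sum_(e <- F) (p - `[< w e >]%:R) * (`[< arm_edge w e >]%:R + `[< two_arms w e >]%:R).
Proof.
move=> wF; rewrite /excess.
under eq_bigr do rewrite big_mkcond mulr_suml.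
rewrite exchange_big /= big_seq [RHS]big_seq; apply: eq_bigr => e eF.
rewrite -arm_count// mulr_sumr; apply: eq_bigr => x _.
by case: (mts w x e); rewrite ?mul0r ?mulr0 ?mul1r.
Qed.

Lemma Pr_edgeE (I : eqType) (s : seq I) (e : I) : uniq s -> e \in s ->
  Ex p s (fun w : set I => `[< w e >]%:R) = p.
Proof.
move=> us es; rewrite (Ex_perm _ _ (perm_to_rem es)) /=.
rewrite (@eq_Ex _ _ p _ _ (fun=> 0)); last first.
  move=> w ws; rewrite asboolF// => /ws/=; rewrite mem_rem_uniqF//.
rewrite [X in _ + _ * X](@eq_Ex _ _ p _ _ (fun=> 1)); last first.
  by move=> w ws; rewrite asboolT//; left.
by rewrite !Ex_cst mulr0 mulr1 add0r.
Qed.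

(** If the arm uses [e], the part of it after the last visit to an end of [e] is an arm of that end
    that does not use [e]. *)
Lemma arm_remove w e x : e \in F -> arm w x -> arm (w `\ e) x \/ arm_edge (w `\ e) e.
Proof.
move=> eF [v Bv /joined_uniqP [q [h1 h2 h3 h4]]].
have [eq|neq] := pselect (pedges x q e); last first.
  left; exists v => //; apply/joinedP; exists q; split=> // e' he'; split; first exact: h1.
  by move=> e'e; apply: neq; rewrite -e'e.
right; have hh : has (fun z => z \in e) (x :: q).
  have [a [b [eE _ _]]] := hF eF.
  by apply/hasP; exists a; [apply: pedges_vertex eq _|]; rewrite eE !inE eqxx.
have [q1 [q2 [qE l1 l2]]] := split_last hh; exists (last x q1) => //; exists v => //.
apply/joinedP; exists q2; split.
- move=> e' he'; split; first by apply: h1; rewrite qE pedges_cat; right.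
  move=> e'e; have [z ze zq] := pedges_vertex_tail he'; rewrite e'e in ze.
  by have := l2 _ zq; rewrite ze.
- by rewrite -h2 qE last_cat.
- by move=> z hz; apply: h3; rewrite qE -cat_cons mem_cat; move: hz; rewrite inE => /orP[/eqP ->|->];
    rewrite ?mem_last ?orbT.
Qed.

(** By [arm_remove], whether some end of [e] has an arm does not depend on the state of [e]. *)
Lemma arm_edge_indep e : e \in F ->
  Ex p F (fun w => (p - `[< w e >]%:R) * `[< arm_edge w e >]%:R) = 0.
Proof.
move=> eF; rewrite (@Ex_indep _ _ p F [set e] (~` [set e])).
- by rewrite ExB Ex_cst Pr_edgeE// subrr mul0r.
- by rewrite setICr.
- by move=> w; congr (_ - _%:R); congr nat_of_bool; apply: asbool_equiv_eq; split=> [?|[]].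
- move=> w; congr (_%:R); congr nat_of_bool; apply: asbool_equiv_eq; rewrite -setDE; split.
    by move=> [z ze hz]; have [h|//] := arm_remove eF hz; exists z.
  by move=> [z ze hz]; exists z => //; apply: joined_set_mono hz => // ? [].
Qed.

Lemma two_arms_closed w e : e \in F -> two_arms w e -> ~ w e.
Proof.
move=> eF [a [b [eE ha hb nab]]] we; apply: nab.
have [va _ ja] := ha; have [vb _ jb] := hb.
by apply: joined1; rewrite -?eE//; [exact: joined_inl ja|exact: joined_inl jb].
Qed.

(** The [arm_edge] terms of [excess_sum] have mean 0, and an edge with two arms is closed, so that
    its factor p - 0 is p. The two-arm probabilities are thus expressed by the excesses, which large
    deviations control. *)
Lemma two_arms_excess :
  p * \sum_(e <- F) Pr p F (fun w => two_arms w e) =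
  Ex p F (fun w => \sum_(x <- V | `[< arm w x >]) excess w x / (size (clu w x))%:R).
Proof.
rewrite (eq_Ex p (fun w wF => excess_sum wF)) Ex_sum mulr_sumr.
rewrite big_seq [RHS]big_seq; apply: eq_bigr => e eF.
transitivity (Ex p F (fun w => (p - `[< w e >]%:R) * `[< arm_edge w e >]%:R + p * `[< two_arms w e >]%:R)).
  by rewrite ExD arm_edge_indep// add0r ExZ.
apply: eq_Ex => w _; rewrite mulrDr; congr (_ + _).
case: (asboolP (two_arms w e)) => h; last by rewrite !mulr0.
by rewrite asboolF ?subr0//; exact: two_arms_closed.
Qed.

(** A path inside the cluster uses only edges that touch it, and an edge that enlarges the cluster
    would touch it too. *)
Lemma clu_depends x K : x \in V -> depends_on (touching [set` K]) (fun w => clu w x = K).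
Proof.
move=> xV w; have sub : w `&` touching [set` K] `<=` w by move=> ? [].
have le y : con (w `&` touching [set` K]) x y -> con w x y by exact: joined_mono.
apply: propext; split=> KE; rewrite -[RHS]KE.
  apply/esym; apply: eq_filter => y; apply: asbool_equiv_eq; split; last exact: le.
  move=> /joinedP [q [h1 h2 h3]]; apply/joinedP; exists q; split=> // e he; split; first exact: h1.
  have [z ze zq] := pedges_vertex_tail he; exists z => //=; rewrite -KE mem_clu; apply/asboolP.
  have zxq : z \in x :: q by rewrite inE zq orbT.
  have hz : has (pred1 z) (x :: q) by apply/hasP; exists z => //=; exact: eqxx.
  have [q1 [q2 [qE /eqP l1 _]]] := split_first hz.
  apply/joinedP; exists q1; split=> //.
    by apply: subset_trans h1; rewrite qE pedges_cat; left.
  by move=> t ht; apply: h3; rewrite qE -cat_cons mem_cat ht.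
have Kc y : y \in K -> con w x y by rewrite -{1}KE mem_clu => /asboolP/le.
apply: eq_filter => y; apply: asbool_equiv_eq; split=> [xy|]; last exact: le.
apply/asboolP; rewrite -mem_clu KE; apply: contrapT => yK.
have xK : x \in K by rewrite -KE mem_clu; apply/asboolP; exact: con_refl.
have [a [b [Ka Kb wab [w1 [w2 [_ _ _ _ /joined_inl bV]]]]]] := first_exit (B := [set` K]) xy xK yK.
apply: Kb => /=.
rewrite -KE mem_clu; apply/asboolP; apply: (con_trans (y := a)).
  by apply/asboolP; rewrite -mem_clu KE.
apply: joined1 => //; last by split=> //; exists a => //; rewrite !inE eqxx.
by have := Kc _ Ka => /joined_inr.
Qed.

End clusters.

Section cluster_bound.
Context (R : realType) (d : nat) (p : R) (p01 : 0 < p < 1).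
Context (V : seq (Zd d)) (uV : uniq V) (F : seq (edge d)) (uF : uniq F).
Context (hF : forall e, e \in F -> exists x y, [/\ e = [fset x; y]%fset, x \in V & y \in V]).
Context (B : set (Zd d)) (D : nat).
Context (hD : forall x, x \in V -> (count (fun e : edge d => x \in e) F <= D)%N).
Implicit Types (x y z : Zd d) (w : set (edge d)) (e : edge d) (K : seq (Zd d)) (t : R).

Let p01' : 0 <= p <= 1. Proof. by case/andP: p01 => /ltW -> /ltW ->. Qed.

Local Notation clu := (clu V).
Local Notation mts := (mts V).
Local Notation arm := (arm V B).
Local Notation excess := (excess p V F).
Local Notation two_arms := (two_arms V B).

(** The likelihood ratio of the tilted parameter against [p], restricted to the edges that the
    exploration of the cluster of [x] examines; it behaves like exp(-t * excess). *)
Definition lik t w x : R :=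
  \prod_(e <- F | mts w x e) (if `[< w e >] then 1 + t * (1 - p) else 1 - t * p).

(** The expectation is split according to the cluster [K] of [x]. Since {cluster = K} is decided by
    the edges touching [K], tilting these edges gives its probability at the tilted parameter, and
    these probabilities add up to 1. *)
Lemma Ex_lik t x : x \in V -> Ex p F (fun w => lik t w x) = 1.
Proof.
move=> xV; pose r (b : bool) := if b then 1 + t * (1 - p) else 1 - t * p.
pose Ks := undup [seq mask (val m) V | m <- enum {: (size V).-tuple bool}].
have memKs w : clu w x \in Ks.
  rewrite mem_undup; apply/mapP; exists (map_tuple (fun y => `[< con V w x y >]) (in_tuple V)).
    by rewrite mem_enum.
  by rewrite /= cluE filter_mask.
have one (f : set (edge d) -> seq (Zd d) -> R) w :
    \sum_(K <- Ks) `[< clu w x = K >]%:R * f w K = f w (clu w x).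
  rewrite (bigD1_seq (clu w x)) ?undup_uniq//= asboolT// mul1r big1 ?addr0// => K /eqP h.
  by rewrite asboolF ?mul0r// => h'; apply: h.
pose Q K e := `[< touching [set` K] e >].
have mE w e : mts w x e = Q (clu w x) e.
  apply: asbool_equiv_eq; rewrite (_ : con V w x = [set` clu w x])//.
  by apply/seteqP; split=> z /=; rewrite mem_clu => h; apply/asboolP.
rewrite (eq_Ex p (g := fun w => \sum_(K <- Ks) `[< clu w x = K >]%:R *
    \prod_(e <- F | Q K e) r `[< w e >])); last first.
  move=> w _; rewrite (one (fun w K => \prod_(e <- F | Q K e) r `[< w e >])).
  by apply: eq_bigl => e; rewrite mE.
rewrite Ex_sum.
transitivity (\sum_(K <- Ks) Ex (p + t * (p * (1 - p))) F (fun w => `[< clu w x = K >]%:R * 1)); last first.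
  by rewrite -Ex_sum -[RHS](Ex_cst (p + t * (p * (1 - p))) F); apply: eq_Ex => w _; rewrite (one (fun _ _ => 1)).
apply: eq_bigr => K _.
have dep w : `[< clu w x = K >]%:R = `[< clu (w `&` touching [set` K]) x = K >]%:R :> R.
  by rewrite -(clu_depends K xV).
have QE : [set` Q K] = touching [set` K].
  by apply/seteqP; split=> e; [move/asboolP|move=> ?; apply/asboolP].
rewrite (@Ex_filter _ _ _ F (Q K)); last first.
  move=> w; rewrite QE -dep; congr (_ * _); apply: eq_bigr => e /asboolP Qe.
  by congr r; apply: asbool_equiv_eq; split=> [|[]].
under eq_Ex => w _ do rewrite -big_filter.
rewrite Ex_tilt ?filter_uniq// -(@Ex_filter _ _ _ F (Q K)).
  by apply: eq_Ex => w _; rewrite mulr1.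
by move=> w; rewrite QE -dep.
Qed.

Lemma count_mts w x : (count (mts w x) F <= D * size (clu w x))%N.
Proof.
apply: (@leq_trans (\sum_(z <- clu w x) count (fun e => z \in e) F)%N).
  rewrite -sum1_count big_mkcond.
  under [leqRHS]eq_bigr do rewrite -sum1_count big_mkcond.
  rewrite exchange_big /=; apply: leq_sum => e _; rewrite /mts; case: asboolP => // -[z ze xz].
  rewrite (big_rem z) /=; first by rewrite ze.
  by rewrite mem_clu; apply/asboolP.
apply: (@leq_trans (\sum_(z <- clu w x) D)%N); last by rewrite big_const_seq iter_addn_0 count_predT.
by rewrite big_seq [leqRHS]big_seq; apply: leq_sum => z; rewrite mem_filter => /andP[_ /hD].
Qed.

Lemma lik_ge t w x : `|t| <= 2^-1 ->
  - t * excess w x - 2 * t ^+ 2 * (D * size (clu w x))%N%:R <= lik t w x /\ 0 <= lik t w x.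
Proof.
move=> t2; have [p0 p1] : 0 < p /\ p < 1 by apply/andP.
pose u e := if `[< w e >] then t * (1 - p) else - (t * p).
have ub e : `|u e| <= `|t|.
  rewrite /u; case: asboolP => _; rewrite ?normrN normrM ler_piMr// ger0_norm; lra.
have likE : lik t w x = \prod_(e <- F | mts w x e) (1 + u e).
  by apply: eq_bigr => e _; rewrite /u; case: ifP.
have su : \sum_(e <- F | mts w x e) u e = - t * excess w x.
  rewrite mulr_sumr; apply: eq_bigr => e _; rewrite /u; case: asboolP => _ /=; ring.
split; last first.
  rewrite likE; apply: prodr_ge0 => e _; have := ub e; rewrite ler_norml => /andP[]; lra.
rewrite likE; apply: le_trans (prod_tilt_ge F (mts w x) ub t2); rewrite su real_normK ?num_real//.
have : (count (mts w x) F)%:R <= (D * size (clu w x))%N%:R :> R by rewrite ler_nat count_mts.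
have := sqr_ge0 t; nra.
Qed.

Lemma norm_excess w x : `|excess w x| <= (D * size (clu w x))%N%:R.
Proof.
have [p0 p1] : 0 < p /\ p < 1 by apply/andP.
apply: (le_trans (ler_norm_sum _ _ _)); apply: (le_trans (y := \sum_(e <- F | mts w x e) 1)).
  by apply: ler_sum => e _; case: asboolP => _ /=; rewrite ler_norml; lra.
by rewrite big_const_seq iter_addr_0 ler_nat count_mts.
Qed.

(** In a cluster with at least [n] vertices the excess per vertex is at most 2tD plus likelihood
    ratios over t n, whose mean is known by [Ex_lik]. Smaller clusters get the trivial bound [D] per
    vertex and concern only the vertices of [nr], which will be those near the boundary. *)
Lemma two_arms_sum (nr : pred (Zd d)) (n : nat) t : (0 < n)%N -> 0 < t <= 2^-1 ->
  (forall w x, w `<=` [set` F] -> x \in V -> arm w x -> (size (clu w x) < n)%N -> nr x) ->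
  p * \sum_(e <- F) Pr p F (fun w => two_arms w e) <=
  D%:R * (count nr V)%:R + (size V)%:R * (2 * t * D%:R + 2 / (t * n%:R)).
Proof.
move=> n0 /andP[t0 t2] hnear; rewrite two_arms_excess//.
have tn0 : 0 < t * n%:R by rewrite mulr_gt0 ?ltr0n.
pose G x w := D%:R * (nr x)%:R + 2 * t * D%:R + (lik t w x + lik (- t) w x) / (t * n%:R).
apply: (@le_trans _ _ (Ex p F (fun w => \sum_(x <- V) G x w))); last first.
  rewrite Ex_sum (eq_big_seq (fun x => D%:R * (nr x)%:R + (2 * t * D%:R + 2 / (t * n%:R)))); last first.
    by move=> x xV; rewrite /G ExD Ex_cst ExZr ExD !Ex_lik// addrA.
  rewrite big_split /= -mulr_sumr; apply: lerD; last by rewrite big_const_seq iter_addr_0 count_predT [leRHS]mulr_natl.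
  by rewrite ler_wpM2l// -natr_sum -sum1_count [in leRHS]big_mkcond ler_nat leq_sum// => x _; case: (nr x).
apply: le_Ex => // w wF; rewrite big_mkcond big_seq [leRHS]big_seq; apply: ler_sum => x xV.
have tn : `|- t| <= 2^-1 by rewrite normrN gtr0_norm.
have [l1 l2] := lik_ge w x tn.
have [l3 l4] : - t * excess w x - 2 * t ^+ 2 * (D * size (clu w x))%N%:R <= lik t w x /\ 0 <= lik t w x.
  by apply: lik_ge; rewrite gtr0_norm.
have D0 : 0 <= D%:R :> R by [].
have G0 : 0 <= 2 * t * D%:R by rewrite !mulr_ge0// ltW.
have G1 : 0 <= (lik t w x + lik (- t) w x) / (t * n%:R) by rewrite divr_ge0 ?addr_ge0// ltW.
have K0 : 0 < (size (clu w x))%:R :> R by rewrite ltr0n size_clu_gt0.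
case: asboolP => ax; last by rewrite /G !addr_ge0// mulr_ge0.
have [sn|ns] := ltnP (size (clu w x)) n.
  rewrite /G (hnear w x)// mulr1 -addrA; apply: ler_wpDr; first exact: addr_ge0.
  rewrite ler_pdivrMr//; apply: le_trans (ler_norm _) _; apply: le_trans (norm_excess _ _) _.
  by rewrite natrM.
rewrite /G -addrA; apply: ler_wpDl; first by rewrite mulr_ge0.
rewrite ler_pdivrMr// mulrDl.
(* The bound [lik_ge] at -t, divided by t. *)
have h1 : excess w x <= 2 * t * D%:R * (size (clu w x))%:R + (lik t w x + lik (- t) w x) / t.
  rewrite -(ler_pM2l t0) mulrDr (mulrC t (_ / t)) divfK ?gt_eqF//.
  rewrite sqrrN natrM opprK in l1; rewrite expr2 in l1; nra.
have hn : 1 <= n%:R^-1 * (size (clu w x))%:R :> R by rewrite ler_pdivlMl ?ltr0n// mulr1 ler_nat.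
apply: (le_trans h1); rewrite lerD2l invfM mulrA -[leRHS]mulrA; apply: ler_peMr hn.
by rewrite divr_ge0 ?addr_ge0// ltW.
Qed.

End cluster_bound.

(** * Two arms in a box around an edge *)

Section twoarm_box.
Context (R : realType) (d : nat) (p : R) (E : set (edge d)) (L0 : nat).
Context (hE : lattice_edges E L0) (p01 : 0 < p < 1).
Implicit Types (x y z u v t : Zd d) (A B : set (Zd d)) (w : set (edge d)).

Local Notation EI := (edges_in E).

Let p01' : 0 <= p <= 1. Proof. by case/andP: p01 => /ltW -> /ltW ->. Qed.
Let p0 : 0 < p. Proof. by case/andP: p01. Qed.

(** A path can leave the ball only from this layer, as edges have range at most [L0]. Thus [reach]
    replaces leaving the ball by an event of the edges inside it. *)
Definition layer u r : set (Zd d) := [set z | (r < dist z u + L0)%N].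
Definition reach w u r x := joined_set w (ball u r) x (layer u r).
Definition twoarm w u r x y := [/\ reach w u r x, reach w u r y & ~ joined w (ball u r) x y].

Lemma reach_incr u r x : increasing (fun w => reach w u r x).
Proof. exact: joined_set_incr. Qed.

Lemma reach_depends u r x : depends_on (inside (ball u r)) (fun w => reach w u r x).
Proof. exact: joined_set_depends. Qed.

Lemma exit_reach w A u r x v : w `<=` E -> joined w A x v -> ball u r x -> ~ ball u r v ->
  reach w u r x.
Proof.
move=> wE /first_exit h hx /(h _ hx) [a [b [ha hb wab [w1 [w2 [h1 _ _ h2 _]]]]]].
exists a; last by apply: joined_mono h2 => // z [].
have := edge_dist hE (wE _ wab); have := dist_triangle a b u; rewrite (distC b a).
by move: hb; rewrite /ball /layer /= => /negP; rewrite -ltnNge; clear; lia.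
Qed.

Lemma joined_stay w A B x y : joined w A x y -> joined w (A `&` B) x y \/
  exists2 v, ~ B v & joined w A x v.
Proof.
move=> /(joined_avoid (~` B))[h|[v Bv [w1 [w2 [h1 _ _ h2 _]]]]].
  by left; apply: joined_mono h => // z [Az /contrapT].
by right; exists v => //; apply: joined_mono h2.
Qed.

(** A path to the layer of the larger ball either leaves the smaller one, hence meets its layer, or
    stays inside and ends in its layer by the triangle inequality. *)
Lemma reach_shrink w u r v s x : w `<=` E -> (dist u v + r <= s)%N -> ball u r x ->
  reach w v s x -> reach w u r x.
Proof.
move=> wE uvs ux [z lz /(@joined_stay _ _ (ball u r))[h|[t ht h]]]; last first.
  exact: exit_reach h ux ht.
exists z; last by apply: joined_mono h => // ? [].
move: lz uvs; rewrite /layer /=; have := dist_triangle u z v.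
by move: (dist _ _) (dist _ _) (dist _ _); clear; lia.
Qed.

Lemma twoarm_shrink w u r v s x y : w `<=` E -> (dist u v + r <= s)%N -> ball u r x -> ball u r y ->
  twoarm w v s x y -> twoarm w u r x y.
Proof.
move=> wE uvs ux uy [h1 h2 h3]; split; [exact: reach_shrink h1|exact: reach_shrink h2|].
by apply: contra_not h3; apply: joined_mono => //; exact: ball_sub.
Qed.

Lemma edges_inE u r w : w `<=` [set` EI u r] -> w `<=` E.
Proof. by move=> h e /h /(mem_edges_in hE)[]. Qed.

Lemma twoarm_depends u r x y : depends_on (inside (ball u r)) (fun w => twoarm w u r x y).
Proof.
move=> w; have h x' : reach w u r x' = reach (w `&` inside (ball u r)) u r x' by rewrite -reach_depends.
by rewrite /twoarm -!h {1}(@joined_depends _ (ball u r) x y w).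
Qed.

Lemma joined_shiftE w u r x y t :
  joined (emap (fun z => z + t) @` w) (ball (u + t) r) (x + t) (y + t) <-> joined w (ball u r) x y.
Proof.
split; last first.
  move=> /(joined_map (fun z => z + t)); apply: joined_mono => // z [z' hz' <-].
  by rewrite /ball /= distDr.
move=> /(joined_map (fun z => z - t)); rewrite !addrK; apply: joined_mono; last first.
  by move=> z [z' hz' <-]; rewrite /ball /= -[X in (X <= _)%N](distDr _ _ t) subrK.
move=> e [e' [e'' we'' <-] <-]; rewrite (_ : emap _ _ = e'')//.
apply/fsetP => z; apply/imfsetP/idP => /=.
  by move=> [z' /imfsetP[z'' /= h ->] ->]; rewrite addrK.
move=> h; exists (z + t); last by rewrite addrK.
by apply/imfsetP; exists z.
Qed.

Lemma reach_shiftE w u r x t :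
  reach (emap (fun z => z + t) @` w) (u + t) r (x + t) <-> reach w u r x.
Proof.
split.
  move=> [z lz h]; exists (z - t).
    by move: lz; rewrite /layer /= -[X in (_ < X + _)%N -> _](distDr _ _ (- t)) addrK.
  by apply/(joined_shiftE _ _ _ _ _ t); rewrite subrK.
move=> [z lz h]; exists (z + t); last exact/joined_shiftE.
by rewrite /layer /= distDr.
Qed.

Lemma twoarm_shift u r x y t :
  Pr p (EI (u + t) r) (fun w => twoarm w (u + t) r (x + t) (y + t)) =
  Pr p (EI u r) (fun w => twoarm w u r x y).
Proof.
rewrite (Pr_shift p hE); apply: eq_Ex => w _; congr ((nat_of_bool _)%:R); apply: asbool_equiv_eq.
split=> -[h1 h2 h3]; split.
- by move/reach_shiftE: h1.
- by move/reach_shiftE: h2.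
- by move=> h; apply: h3; exact/joined_shiftE.
- exact/reach_shiftE.
- exact/reach_shiftE.
- by move=> /joined_shiftE.
Qed.

Lemma Pr_local_eq u r v s X : ball u r `<=` ball v s -> depends_on (inside (ball u r)) X ->
  Pr p (EI v s) X = Pr p (EI u r) X.
Proof.
move=> uv dX; pose N := (dist v 0 + s)%N.
have vN : ball v s `<=` ball 0 N by exact: ball_sub.
rewrite -(Pr_local p hE (u := v) (N := N))//; last first.
  by apply: depends_sub dX => e h z /h /uv.
exact: (Pr_local p hE (subset_trans uv vN) dX).
Qed.

Lemma degree_le r x : (count (fun e : edge d => x \in e) (EI 0 r) <= L0.*2.+1 ^ d)%N.
Proof.
rewrite -(size_balls x L0) -size_filter -(size_map (fun y => [fset x; y]%fset)).
apply: uniq_leq_size; first by rewrite filter_uniq// edges_in_uniq.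
move=> e; rewrite mem_filter => /andP[xe /(mem_edges_in hE)[/(edge_range hE)[a [b [eE _ ab]]] _]].
move: xe; rewrite eE !inE => /orP[]/eqP ->; apply/mapP.
  by exists b => //; rewrite mem_balls distC.
by exists a; rewrite ?mem_balls// fsetUC.
Qed.

Lemma pedges_dist x q : pedges x q `<=` E -> (dist x (last x q) <= L0 * size q)%N.
Proof.
elim: q x => [|y q IH] x h /=; first by rewrite distxx.
apply: (leq_trans (dist_triangle y _ _)); rewrite mulnS leq_add//.
  by apply: (edge_dist hE); apply: h; left.
by apply: IH => e he; apply: h; right.
Qed.

Lemma exprn_diff_le (a b : R) n : 0 <= b <= a -> a ^+ n.+1 - b ^+ n.+1 <= n.+1%:R * (a - b) * a ^+ n.
Proof.
move=> /andP[b0 ba]; have a0 := le_trans b0 ba; elim: n => [|n IH].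
  by rewrite !expr1 expr0 mulr1 mul1r.
have h1 : b ^+ n.+1 <= a ^+ n.+1 by rewrite lerXn2r.
have h2 : a * (a ^+ n.+1 - b ^+ n.+1) <= a * (n.+1%:R * (a - b) * a ^+ n) by rewrite ler_wpM2l.
have h3 : (a - b) * b ^+ n.+1 <= (a - b) * a ^+ n.+1 by rewrite ler_wpM2l// subr_ge0.
rewrite [in leLHS]exprS [b ^+ n.+2]exprS.
have -> : a * a ^+ n.+1 - b * b ^+ n.+1 = a * (a ^+ n.+1 - b ^+ n.+1) + (a - b) * b ^+ n.+1 by ring.
apply: (le_trans (lerD h2 h3)); rewrite le_eqVlt; apply/orP; left; apply/eqP.
by rewrite [a ^+ n.+1]exprS -[n.+2]addn1 natrD; ring.
Qed.

Lemma count_far m r : (m <= r)%N -> count (fun x : Zd d => (m < dist x 0)%N) (balls 0 r) =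
  (r.*2.+1 ^ d - m.*2.+1 ^ d)%N.
Proof.
move=> mr; rewrite -(size_balls 0 r) -(size_balls (0 : Zd d) m).
rewrite -(count_predC (fun x : Zd d => (m < dist x 0)%N) (balls 0 r)).
rewrite (_ : size (balls 0 m) = count (predC (fun x : Zd d => (m < dist x 0)%N)) (balls 0 r)) ?addnK//.
rewrite -size_filter; apply: perm_size; apply: uniq_perm; rewrite ?filter_uniq ?balls_uniq// => x.
rewrite mem_filter !mem_balls /= -leqNgt; apply/idP/andP => [h|[]//].
by split=> //; exact: leq_trans mr.
Qed.

(** The parameters r = k^3, n = k^2, t = 1/k make the three errors equal in order: the boundary
    fraction n L0 / r, the linear term t and the term 1/(t n) are all of order 1/k. *)
Lemma box_two_arms (k : nat) : (1 < k)%N -> (L0 <= k)%N ->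
  p * \sum_(e <- EI 0 (k ^ 3)) Pr p (EI 0 (k ^ 3)) (fun w => two_arms (balls 0 (k ^ 3)) (layer 0 (k ^ 3)) w e) <=
  ((L0.*2.+1 ^ d)%:R * (d%:R * L0%:R + 2) + 2) * ((k ^ 3).*2.+1)%:R ^+ d / k%:R.
Proof.
move=> k1 Lk; set r := (k ^ 3)%N; pose n := (k ^ 2)%N; set D := (L0.*2.+1 ^ d)%N.
have k0 : (0 : R) < k%:R by rewrite ltr0n; exact: ltnW.
have nr : (n * L0 <= r)%N by rewrite /r expnSr leq_mul.
pose nrr := fun x : Zd d => (r - n * L0 < dist x 0)%N.
have hD x : x \in balls 0 r -> (count (fun e : edge d => x \in e) (EI 0 r) <= D)%N.
  by move=> _; exact: degree_le.
have hF e : e \in EI 0 r -> exists x y, [/\ e = [fset x; y]%fset, x \in balls 0 r & y \in balls 0 r].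
  move=> /(mem_edges_in hE)[/(edge_range hE)[a [b [eE _ _]]] ie]; exists a, b; rewrite !mem_balls.
  by split=> //; apply: ie; rewrite eE !inE eqxx ?orbT.
pose tt0 : R := k%:R^-1.
have ht : 0 < tt0 <= 2^-1 by rewrite /tt0 invr_gt0 k0 lef_pV2 ?posrE// ler_nat.
have n0 : (0 < n)%N by rewrite expn_gt0 ltnW.
have := two_arms_sum p01 (edges_in_uniq _ _ _) hF hD (nr := nrr) n0 ht (B := layer 0 r).
move=> /(_ _) h; apply: (le_trans (h _)) => {h}.
  move=> w x wF xr [z lz /joined_uniqP[q [h1 h2 h3 h4]]] sn; rewrite /nrr.
  (* A simple path lies in the cluster. A cluster with fewer than [n] vertices thus has an arm of
     fewer than [n] steps, and its start is within n L0 of the boundary. *)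
  have sq : (size q < n)%N.
    apply: leq_ltn_trans sn; apply: (@leq_trans (size (x :: q))) => //; apply: uniq_leq_size => // t tq.
    rewrite mem_clu; apply/asboolP.
    have ht' : has (pred1 t) (x :: q) by apply/hasP; exists t => //=; exact: eqxx.
    have [q1 [q2 [qE /eqP l1 _]]] := split_first ht'; apply/joinedP; exists q1; split=> //.
      by apply: subset_trans h1; rewrite qE pedges_cat; left.
    by move=> a ha; apply: h3; rewrite qE -cat_cons mem_cat ha.
  have := pedges_dist (subset_trans h1 (edges_inE wF)); rewrite h2 => dq.
  have lq : (L0 * size q + L0 <= n * L0)%N by rewrite -mulnSr mulnC leq_mul2r sq orbT.
  have := dist_triangle x z 0; rewrite (distC z x); move: lz dq lq nr; rewrite /layer /=.
  by move: (L0 * size q)%N (n * L0)%N; clear; lia.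
have rn : ((2 * n * k)%:R <= (r.*2.+1)%:R :> R).
  by rewrite ler_nat /n /r -mulnA -expnSr -mul2n ltnW.
have d0 : (d = 0 \/ exists d', d = d'.+1)%N by case: (d) => [|d']; [left|right; exists d'].
have cnt : (count nrr (balls 0 r))%:R <= d%:R * L0%:R * (r.*2.+1)%:R ^+ d / k%:R :> R.
  rewrite /nrr count_far ?leq_subr//.
  have le : ((r - n * L0).*2.+1 <= r.*2.+1)%N by rewrite ltnS leq_double leq_subr.
  rewrite natrB; last by case: d0 => [->|[d' ->]]; rewrite ?expn0 ?leq_exp2r.
  rewrite !natrX; case: d0 => [d0|[d' dE]]; first by rewrite d0 !expr0 subrr !mul0r.
  rewrite dE ler_pdivlMr//.
  have := @exprn_diff_le (r.*2.+1)%:R ((r - n * L0).*2.+1)%:R d'; rewrite ler_nat le ler0n => /(_ isT) h.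
  apply: (le_trans (ler_wpM2r (ltW k0) h)).
  have -> : (r.*2.+1)%:R - ((r - n * L0).*2.+1)%:R = (2 * n * L0)%:R :> R.
    by rewrite -natrB//; congr (_%:R); move: nr; rewrite -[(2 * n * L0)%N]mulnA; move: (n * L0)%N; clear; lia.
  set A := (r.*2.+1)%:R in rn *.
  have -> : d'.+1%:R * (2 * n * L0)%:R * A ^+ d' * k%:R = d'.+1%:R * L0%:R * A ^+ d' * (2 * n * k)%:R.
    by rewrite !natrM; ring.
  have -> : d'.+1%:R * L0%:R * A ^+ d'.+1 = d'.+1%:R * L0%:R * A ^+ d' * A by rewrite exprS; ring.
  by apply: ler_wpM2l => //; rewrite !mulr_ge0// exprn_ge0.
apply: (le_trans (lerD (ler_wpM2l (ler0n _ _) cnt) (lexx _))).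
rewrite size_balls natrX -/D le_eqVlt; apply/orP; left; apply/eqP.
have -> : (2 / (tt0 * n%:R) = 2 / k%:R :> R).
  by rewrite /n /tt0 natrX; field; rewrite gt_eqF.
rewrite /tt0.
ring.
Qed.

(** Averaging over translations: the event in a ball of radius 2r around an interior vertex of the
    ball of radius r implies the event in that ball, so the probability is at most the mean over the
    edges bounded by [box_two_arms]. *)
Lemma two_arm_decay : exists2 Ct : R, 0 < Ct & forall (k : nat) v, (1 < k)%N -> (2 * L0 <= k)%N ->
  E [fset 0; v]%fset -> Pr p (EI 0 (2 * k ^ 3)) (fun w => twoarm w 0 (2 * k ^ 3) 0 v) <= Ct / k%:R.
Proof.
pose Ct0 : R := ((L0.*2.+1 ^ d)%:R * (d%:R * L0%:R + 2) + 2).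
have Ct0gt0 : 0 < Ct0 by rewrite /Ct0 ltr_wpDl// mulr_ge0// addr_ge0// mulr_ge0.
exists (3 ^+ d * Ct0 / p); first by rewrite divr_gt0// mulr_gt0// exprn_gt0.
move=> k v k1 Lk Ev; set a := Pr _ _ _; set r := (k ^ 3)%N.
have k0 : (0 : R) < k%:R by rewrite ltr0n; exact: ltnW.
have kr : (k <= r)%N by rewrite /r expnS leq_pmulr// expn_gt0 ltnW.
have Lr : (2 * L0 <= r)%N by exact: leq_trans kr.
have L0k : (L0 <= k)%N by apply: leq_trans Lk; rewrite leq_pmull.
have L0r : (L0 <= r)%N by exact: leq_trans kr.
have v0 : v != 0.
  have [x [y [eE xy _]]] := edge_range hE Ev; apply: contraNneq xy => v0.
  have : x \in [fset 0; v]%fset by rewrite eE !inE eqxx.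
  have : y \in [fset 0; v]%fset by rewrite eE !inE eqxx orbT.
  by rewrite v0 !inE !orbb => /eqP -> /eqP ->.
have main x : x \in balls 0 (r - L0) -> a <= Pr p (EI 0 r) (fun w => two_arms (balls 0 r) (layer 0 r) w [fset x; (x + v)%R]%fset).
  rewrite mem_balls => xr.
  have Ex : E [fset x; (x + v)%R]%fset by have := edge_shift hE x Ev; rewrite add0r addrC.
  have bx : ball 0 r x by apply: leq_trans xr _; exact: leq_subr.
  have bxv : ball 0 r (x + v).
    apply: (leq_trans (dist_triangle x _ _)); rewrite -(subnKC L0r) leq_add// distC.
    by have := edge_dist hE Ex.
  rewrite /a -(twoarm_shift 0 _ 0 v x) !add0r addrC.
  have s1 : ball x (2 * r) `<=` ball 0 (3 * r).
    by apply: ball_sub; rewrite (mulSn 2) leq_add2r.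
  have s2 : ball (0 : Zd d) r `<=` ball 0 (3 * r) by apply: ball_subr; rewrite leq_pmull.
  rewrite -(Pr_local_eq s1); last exact: twoarm_depends.
  apply: (@le_trans _ _ (Pr p (EI 0 (3 * r)) (fun w => twoarm w 0 r x (x + v)))).
    apply: le_Pr => // w /edges_inE wE; apply: twoarm_shrink => //.
    by rewrite distC mul2n -addnn leq_add2r.
  rewrite (Pr_local_eq s2); last exact: twoarm_depends.
  apply: le_Pr => // w _ [h1 h2 h3]; exists x, (x + v).
  by rewrite /arm /con ballsE.
have sum : (size (balls (0 : Zd d) (r - L0)))%:R * a <=
   \sum_(e <- EI 0 r) Pr p (EI 0 r) (fun w => two_arms (balls 0 r) (layer 0 r) w e).
  apply: (@le_trans _ _ (\sum_(e <- [seq [fset x; (x + v)%R]%fset | x <- balls 0 (r - L0)])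
     Pr p (EI 0 r) (fun w => two_arms (balls 0 r) (layer 0 r) w e))).
    rewrite big_map -[in leLHS]sum1_size natr_sum mulr_suml big_seq [leRHS]big_seq.
    by apply: ler_sum => x /main; rewrite mul1r.
  apply: ler_sum_sub; rewrite ?edges_in_uniq//.
  - rewrite map_inj_in_uniq ?balls_uniq// => x y _ _ /= xy.
    have : x \in [fset y; (y + v)%R]%fset by rewrite -xy !inE eqxx.
    rewrite !inE => /orP[/eqP//|/eqP xE].
    have : x + v \in [fset y; (y + v)%R]%fset by rewrite -xy !inE eqxx orbT.
    rewrite !inE => /orP[/eqP h|/eqP/addIr//].
    move: h; rewrite xE -addrA => /eqP; rewrite -subr_eq0 addrAC subrr add0r => /eqP vv.
    case/eqP: v0; apply/rowP => i; move/rowP: vv => /(_ i); rewrite !mxE.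
    by move: (v 0 i); clear => z; lia.
  - move=> e /mapP[x xr ->] _; split=> //; apply/(mem_edges_in hE).
    have Ex : E [fset x; (x + v)%R]%fset by have := edge_shift hE x Ev; rewrite add0r addrC.
    move: xr; rewrite mem_balls => xr.
    split=> // z; rewrite !inE => /orP[]/eqP ->; first by apply: leq_trans xr _; exact: leq_subr.
    apply: (leq_trans (dist_triangle x _ _)); rewrite -(subnKC L0r) leq_add// distC.
    by have := edge_dist hE Ex.
  - by move=> e; exact: Pr_ge0.
have := box_two_arms k1 L0k; rewrite -/r -/Ct0 => h.
have h2 : p * ((size (balls (0 : Zd d) (r - L0)))%:R * a) <= Ct0 * (r.*2.+1)%:R ^+ d / k%:R.
  by apply: le_trans h; rewrite ler_pM2l.
have hr : (r.*2.+1)%:R ^+ d <= 3 ^+ d * (size (balls (0 : Zd d) (r - L0)))%:R :> R.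
  rewrite size_balls natrX -exprMn lerXn2r ?nnegrE ?mulr_ge0// -natrM ler_nat.
  by move: Lr; clear; lia.
have s0 : 0 < (size (balls (0 : Zd d) (r - L0)))%:R :> R by rewrite ltr0n size_balls expn_gt0.
rewrite -(ler_pM2l (mulr_gt0 p0 s0)) -mulrA; apply: (le_trans h2).
have -> : p * (size (balls (0 : Zd d) (r - L0)))%:R * (3 ^+ d * Ct0 / p / k%:R) =
   Ct0 * (3 ^+ d * (size (balls (0 : Zd d) (r - L0)))%:R) / k%:R.
  by field; rewrite !gt_eqF.
by rewrite ler_pM2r ?invr_gt0// ler_pM2l.
Qed.

End twoarm_box.

(** * From the ends of one edge to two distant points *)

Section surgery.
Context (R : realType) (d : nat) (p : R) (E : set (edge d)) (L0 : nat).
Context (hE : lattice_edges E L0) (p01 : 0 < p < 1).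
Implicit Types (x y z u v t : Zd d) (A B : set (Zd d)) (w : set (edge d)).

Local Notation EI := (edges_in E).

Let p01' : 0 <= p <= 1. Proof. by case/andP: p01 => /ltW -> /ltW ->. Qed.
Let q0 : 0 < 1 - p. Proof. by rewrite subr_gt0; case/andP: p01. Qed.

Lemma Pr_and (I : eqType) (s : seq I) (Q : Prop) (X : set I -> Prop) :
  Pr p s (fun W : set I => Q /\ X W) = `[< Q >]%:R * Pr p s X.
Proof.
case: asboolP => h; rewrite ?mul1r ?mul0r.
  by apply: eq_Ex => w _; congr ((nat_of_bool _)%:R); apply: asbool_equiv_eq; split=> [[]|].
by apply: Pr_false => w [].
Qed.

(** The event no longer depends on [e], which is closed with probability 1 - p independently of
    it. *)
Lemma Pr_remove (I : eqType) (s : seq I) (e : I) (X : set I -> Prop) : uniq s -> e \in s ->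
  Pr p s (fun W : set I => X (W `\ e)) <= Pr p s X / (1 - p).
Proof.
move=> us es; rewrite ler_pdivlMr// mulrC.
have -> : 1 - p = Pr p s (fun W : set I => ~ W e) by rewrite Pr_not /Pr Pr_edgeE.
rewrite -(@Pr_indep _ _ p s [set e] (~` [set e])).
- apply: le_Pr => // w _ [we]; rewrite (_ : w `\ e = w)//.
  by apply/seteqP; split=> f; [case|move=> wf; split=> // fe; apply: we; rewrite -fe].
- by rewrite setICr.
- by move=> w; apply: propext; split=> h; contra: h; [case|].
- by move=> w; congr X; apply/seteqP; split=> f; [case=> wf nf; split=> //; split|case=> -[]].
Qed.

(** A path that needs the edge is cut before its first and after its last visit to the ends of the
    edge. *)
Lemma pivotal_joined w A a b x y : A x -> A y -> 
  pivotal (fun w => joined w A a b) [fset x; y]%fset w ->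
  exists x' y', [/\ (x' = x /\ y' = y) \/ (x' = y /\ y' = x),
    joined (w `\ [fset x; y]%fset) A a x' & joined (w `\ [fset x; y]%fset) A y' b].
Proof.
move=> Ax Ay []; set e := [fset x; y]%fset => /joinedP[q [h1 h2 h3]] nj.
have eq : pedges a q e.
  apply: contrapT => ne; apply: nj; apply/joinedP; exists q; split=> // f hf; split.
    by case: (h1 _ hf) => // fe; rewrite fe in hf.
  by move=> fe; rewrite fe in hf.
have hh : has (fun z => z \in e) (a :: q).
  by apply/hasP; exists x; [apply: pedges_vertex eq _|]; rewrite !inE eqxx.
have [q1 [q2 [qE l1 l2]]] := split_first hh; have [q3 [q4 [qE' l3 l4]]] := split_last hh.
have j1 : joined (w `\ e) A a (last a q1).
  apply/joinedP; exists q1; split=> // [f hf|z zq]; last by apply: h3; rewrite qE -cat_cons mem_cat zq.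
  have fe : f <> e.
    move=> fe; have [b0 hb0] : exists2 z, z \in belast a q1 & z \in e.
      rewrite -pedges_rev in hf; have [z ze zr] := pedges_vertex_tail hf.
      by exists z; rewrite -?fe// -mem_rev.
    by move=> hz; have := l2 _ hb0; rewrite hz.
  by split=> //; have [] : ([set e] `|` w) f by apply: h1; rewrite qE pedges_cat; left.
have j2 : joined (w `\ e) A (last a q3) b.
  apply/joinedP; exists q4; split=> [f hf||z zq].
  - have fe : f <> e by move=> fe; have [z ze zr] := pedges_vertex_tail hf; have := l4 _ zr; rewrite -fe ze.
    by split=> //; have [] : ([set e] `|` w) f by apply: h1; rewrite qE' pedges_cat; right.
  - by rewrite -h2 qE' last_cat.
  - apply: h3; rewrite qE' -cat_cons mem_cat; move: zq; rewrite inE => /orP[/eqP ->|->]; last by rewrite orbT.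
    by rewrite mem_last.
exists (last a q1), (last a q3); split=> //.
have ne : last a q1 <> last a q3 by move=> ee; apply: nj; apply: joined_trans j1 _; rewrite ee.
by move: l1 l3 ne; rewrite !inE => /orP[]/eqP -> /orP[]/eqP -> // ?; [left|right].
Qed.

Lemma twoarmC w u r x y : twoarm L0 w u r x y -> twoarm L0 w u r y x.
Proof. by move=> [h1 h2 h3]; split=> // /joined_sym. Qed.

(** Two arms from distant points of the ball leave it for the last time at points [a] and [b] that
    are not joined. Given the edges outside the ball these would be joined with probability at least
    [q]; by the Poincare inequality their disconnection is thus bounded by the expected number of
    pivotal edges. Once closed, a pivotal edge has two arms from its ends, which has probability at
    most [b / (1 - p)]. *)
Lemma surgery k R0 (b q : R) a0 b0 : (2 * k + L0 < R0)%N -> 0 < q ->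
  (forall x y, ball 0 k x -> ball 0 k y -> q <= Pr p (EI 0 k) (fun w => joined w (ball 0 k) x y)) ->
  (forall x y, ball 0 k x -> ball 0 k y -> E [fset x; y]%fset ->
     Pr p (EI 0 R0) (fun w => twoarm L0 w 0 R0 x y) <= b) ->
  ball 0 k a0 -> ball 0 k b0 ->
  Pr p (EI 0 R0) (fun w => twoarm L0 w 0 R0 a0 b0) <=
  (size (balls (0 : Zd d) k))%:R ^+ 2 * (q^-1 * ((size (EI 0 k))%:R * (b / (1 - p)))).
Proof.
move=> kR qgt0 hq hb ka0 kb0.
have kR' : (k <= R0)%N by move: kR; clear; lia.
have sub : ball (0 : Zd d) k `<=` ball 0 R0 by exact: ball_subr.
pose Q w a b := reach L0 (w `\` inside (ball 0 k)) 0 R0 a /\ reach L0 (w `\` inside (ball 0 k)) 0 R0 b.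
pose X a b w := joined w (ball 0 R0) a b.
(* After its last exit from the small ball an arm uses no edge inside it. *)
have last_ w x : w `<=` E -> ball 0 k x -> reach L0 w 0 R0 x -> exists2 a, a \in balls 0 k &
    X x a w /\ reach L0 (w `\` inside (ball 0 k)) 0 R0 a.
  move=> wE kx [z lz /last_exit h]; have zk : ~ ball 0 k z.
    by move: lz kR; rewrite /layer /ball /=; move: (dist z 0); clear=> n h1 h2 h3; lia.
  have [a [c [ha hc wac [w1 [w2 [h1 h2 _ h3 h4]]]]]] := h _ kx zk; exists a.
    by rewrite mem_balls.
  split; first exact: joined_mono h3.
  exists z => //; apply: (@joined_trans _ _ _ c).
    apply: joined1; first by exact: sub.
      by have [] := joined_inl h4.
    by split=> // /(_ c); rewrite !inE eqxx orbT => /(_ isT).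
  rewrite joined_depends in h4; apply: joined_mono h4 => [e [/h2 we ie]|? []//].
  split=> //; have [x' [y' [eE _ _]]] := edge_range hE (wE _ we).
  move=> /(_ x'); have := ie x'; rewrite eE !inE eqxx => /(_ isT) [_ nx] /(_ isT).
  exact: nx.
apply: (@le_trans _ _ (\sum_(ab <- [seq (a, b') | a <- balls 0 k, b' <- balls 0 k])
    Pr p (EI 0 R0) (fun w => Q w ab.1 ab.2 /\ ~ X ab.1 ab.2 w))).
  apply: Pr_union => // w /(edges_inE hE) wE [/(last_ _ _ wE ka0)[a ak [xa ra]] /(last_ _ _ wE kb0)[a' ak' [xb rb]] nj].
  exists (a, a'); first by apply/allpairsP; exists (a, a').
  split=> //= aa; apply: nj; apply: joined_trans xa _; apply: joined_trans aa _; exact: joined_sym.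
have -> : (size (balls (0 : Zd d) k))%:R ^+ 2 =
    (size [seq (a, b') | a <- balls (0 : Zd d) k, b' <- balls (0 : Zd d) k])%:R :> R.
  by rewrite size_allpairs natrM expr2.
apply: sum_ge0_le => -[x y] /allpairsP[[x' y'] /= [xk yk [-> ->]]] {x y}.
move: x' y' xk yk => x y; rewrite !mem_balls => kx ky.
pose sin := EI 0 k; pose sout := [seq e <- EI 0 R0 | e \notin sin].
have perm : perm_eq (EI 0 R0) (sout ++ sin).
  apply: uniq_perm; rewrite ?edges_in_uniq//.
    rewrite cat_uniq filter_uniq ?edges_in_uniq//= andbT; apply/hasPn => e es.
    by rewrite mem_filter es.
  move=> e; rewrite mem_cat mem_filter; case: (boolP (e \in sin)) => //= es; last by rewrite orbF.
 by rewrite (edges_in_mono hE sub es).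
have Qout w1 w2 : w2 `<=` [set` sin] -> Q (w1 `|` w2) x y = Q w1 x y.
  move=> h2; rewrite /Q setDUl (_ : w2 `\` _ = set0) ?setU0//.
  by apply/seteqP; split=> // e [/h2 /(mem_edges_in hE)[]].
have step (w1 : set (edge d)) : w1 `<=` [set` sout] ->
    Pr p sin (fun w2 => Q (w1 `|` w2) x y /\ ~ X x y (w1 `|` w2)) <=
    q^-1 * \sum_(e <- sin) Pr p sin (fun w2 => Q (w1 `|` w2) x y /\ pivotal (X x y) e (w1 `|` w2)).
  move=> hw1; pose X1 (w2 : set (edge d)) := X x y (w1 `|` w2).
  have X1i : increasing X1.
    by move=> w2 w2' h; apply: joined_mono => // e []; [left|right; exact: h].
  have -> : Pr p sin (fun w2 => Q (w1 `|` w2) x y /\ ~ X x y (w1 `|` w2)) =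
      Pr p sin (fun w2 => Q w1 x y /\ ~ X1 w2) by apply: eq_Ex => w2 h2; rewrite Qout.
  rewrite Pr_and Pr_not.
  have pX : q <= Pr p sin X1.
    apply: (le_trans (hq _ _ kx ky)); apply: le_Pr => // w2 _.
    by apply: joined_mono => // e; right.
  (* P(1 - P) is at most the expected number of pivotal edges, and P >= [q] whatever the edges
     outside are. *)
  have h : 1 - Pr p sin X1 <= q^-1 * \sum_(e <- sin) Pr p sin (pivotal X1 e).
    rewrite ler_pdivlMl//; apply: le_trans (pivotal_sum p01' (edges_in_uniq _ _ _) X1i).
    by rewrite ler_wpM2r// subr_ge0 Pr_le1.
  apply: (le_trans (ler_wpM2l (ler0n _ _) h)); rewrite mulrCA ler_pM2l ?invr_gt0// mulr_sumr.
  rewrite big_seq [leRHS]big_seq; apply: ler_sum => e es; rewrite -Pr_and; apply: le_Pr => // w2 h2.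
  move=> [h3 [h4 h5]]; rewrite Qout//; split=> //; split.
    by move: h4; rewrite /X1 setUCA.
  move: h5; rewrite /X1 setDUl (_ : w1 `\ e = w1)//.
  apply/seteqP; split=> [f []//|f wf]; split=> // fe.
  by have := hw1 _ wf; rewrite /= mem_filter fe es.
rewrite /Pr (Ex_perm _ _ perm) Ex_cat.
apply: (le_trans (le_Ex p01' step)); rewrite ExZ ler_pM2l ?invr_gt0// Ex_sum.
apply: sum_ge0_le => e es.
rewrite -(Ex_cat p sout sin (fun w => `[< Q w x y /\ pivotal (X x y) e w >]%:R)).
rewrite -(Ex_perm _ _ perm) -/(Pr p (EI 0 R0) (fun w => Q w x y /\ pivotal (X x y) e w)).
have /(mem_edges_in hE)[Ee ie] := es.
have [z [z' [eE _ _]]] := edge_range hE Ee.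
have kz : ball 0 k z by apply: ie; rewrite eE !inE eqxx.
have kz' : ball 0 k z' by apply: ie; rewrite eE !inE eqxx orbT.
have eR : e \in EI 0 R0 by rewrite (edges_in_mono hE sub es).
apply: (@le_trans _ _ (Pr p (EI 0 R0) (fun w => twoarm L0 (w `\ e) 0 R0 z z'))); last first.
  apply: (le_trans (Pr_remove (fun W => twoarm L0 W 0 R0 z z') (edges_in_uniq _ _ _) eR)).
  by rewrite ler_pM2r ?invr_gt0//; apply: hb; rewrite -?eE.
apply: le_Pr => // w _ [[ra rb] piv].
have nj : ~ X x y (w `\ e) by case: piv.
have rsub x' : reach L0 (w `\` inside (ball 0 k)) 0 R0 x' -> reach L0 (w `\ e) 0 R0 x'.
  by apply: joined_set_mono => // f [wf nf]; split=> // fe; apply: nf; rewrite fe.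
rewrite eE in piv; have [x' [y' [xy j1 j2]]] := pivotal_joined (sub _ kz) (sub _ kz') piv.
rewrite -eE in j1 j2.
have T : twoarm L0 (w `\ e) 0 R0 x' y'.
  split; last by move=> j3; apply: nj; apply: joined_trans j1 _; exact: joined_trans j3 j2.
    have [t lt jt] := rsub _ ra; exists t => //; apply: joined_trans jt; exact: joined_sym.
  by have [t lt jt] := rsub _ rb; exists t => //; apply: joined_trans jt.
by case: xy => -[<- <-] //; exact: twoarmC.
Qed.

End surgery.

(** * Decay of the one-arm probability *)

Section one_arm.
Context (R : realType) (d : nat) (p : R) (E : set (edge d)) (L0 : nat).
Context (hE : lattice_edges E L0) (p01 : 0 < p < 1) (d6 : (6 < d)%N).
Context (c C : R) (c0 : 0 < c) (cC : c < C) (tp : two_point p E c C).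
Implicit Types (x y z u v t : Zd d) (A B : set (Zd d)) (w : set (edge d)).

Local Notation EI := (edges_in E).
Local Notation half := (2^-1 : R).

Let p01' : 0 <= p <= 1. Proof. by case/andP: p01 => /ltW -> /ltW ->. Qed.
Let q0 : 0 < 1 - p. Proof. by rewrite subr_gt0; case/andP: p01. Qed.
Let C0 : 0 < C. Proof. exact: lt_trans c0 cC. Qed.

Lemma size_EI_le k : (size (EI 0 k) <= size (balls (0 : Zd d) k) ^ 2)%N.
Proof.
by rewrite (leq_trans (size_undup _))// size_filter (leq_trans (count_size _ _))// size_allpairs.
Qed.

(** By Harris' inequality, the square of the arm probability bounds below the probability that 0 and
    a point at distance 2^j both have arms. Then either they are joined, which has probability of
    order 2^(-j(d-2)) <= 2^(-5j), or there are two arms. The scale [m] is chosen so that the bound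
    2^(-m) for two arms absorbs the volume factor 2^(4jd) and the gluing cost 2^(K(j+2)^2) and still
    leaves 2^(-5j). *)
Lemma reach_sq : exists K m0 : nat, exists2 C3 : R, 0 < C3 & forall j m,
  m = (4 * (j * d) + K * j.+2 ^ 2 + 5 * j + m0)%N ->
  Pr p (EI 0 (2 ^ (3 * m + 3))) (fun w => reach L0 w 0 (2 ^ (3 * m + 3)) 0) ^+ 2 <= C3 * half ^+ (5 * j).
Proof.
have [K hK] := glue_ball hE p01 d6 c0 cC tp.
have [Ct Ct0 hCt] := two_arm_decay hE p01.
have [m1 hm1] : exists m1, (2 * L0 < 2 ^ m1)%N by exists (2 * L0)%N; exact: ltn_expl.
exists K, m1.+1; exists (C + (4 ^ d)%:R ^+ 4 * Ct / (1 - p)).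
  by rewrite addr_gt0// divr_gt0// mulr_gt0// exprn_gt0// ltr0n expn_gt0.
move=> j m mE.
(* The ball of radius [R0] contains the balls of radius 2 (2^m)^3, that of the two-arm bound, around
   all points of the ball of radius [k]. *)
pose k := (2 ^ j)%N; pose R0 := (2 ^ (3 * m + 2))%N.
have R0E : (2 ^ (3 * m + 3) = 2 * R0)%N by rewrite /R0 -expnS; congr (2 ^ _)%N; clear; lia.
rewrite R0E; set pi := Pr _ _ _.
have k1 : (1 < 2 ^ m)%N by rewrite -{1}(expn0 2) ltn_exp2l// mE; clear; lia.
have Lm : (2 * L0 <= 2 ^ m)%N.
  by apply: (leq_trans (ltnW hm1)); rewrite leq_exp2l// mE; clear; lia.
have rhoE : (2 * (2 ^ m) ^ 3 = 2 ^ (3 * m + 1))%N by rewrite -expnM -expnS mulnC addn1.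
have jrho : (2 ^ j <= 2 ^ (3 * m))%N by rewrite leq_exp2l// mE; clear; lia.
have mrho : (2 ^ m <= 2 ^ (3 * m))%N by rewrite leq_exp2l// ; clear; lia.
have R0rho : (R0 = 4 * 2 ^ (3 * m))%N by rewrite /R0 addn2 !expnS mulnA.
have hkR : (2 * k + L0 < R0)%N.
  by move: jrho mrho Lm R0rho k1; rewrite -/k; move: (2 ^ (3 * m))%N (2 ^ m)%N; clear; lia.
have krho : (k + 2 ^ (3 * m + 1) <= R0)%N.
  by move: jrho R0rho; rewrite addn1 expnS -/k; move: (2 ^ (3 * m))%N; clear; lia.
have Lrho : (L0 <= 2 ^ (3 * m + 1))%N.
  by move: mrho Lm; rewrite addn1 expnS; move: (2 ^ (3 * m))%N (2 ^ m)%N; clear; lia.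
have d0 : (0 < d)%N by move: d6; clear; lia.
pose x0 := 0 + axv (Ordinal d0) k%:Z.
have dx0 : dist x0 0 = k by rewrite distC dist_axv.
have kR0 : (k <= R0)%N by move: hkR; clear; lia.
have sub4 : ball x0 (2 * R0) `<=` ball 0 (4 * R0).
  by apply: ball_sub; rewrite dx0; move: kR0; clear; lia.
have sub2 : ball (0 : Zd d) (2 * R0) `<=` ball 0 (4 * R0) by apply: ball_subr; clear; lia.
have sub1 : ball (0 : Zd d) R0 `<=` ball 0 (4 * R0) by apply: ball_subr; clear; lia.
have pi1 : Pr p (EI 0 (4 * R0)) (fun w => reach L0 w 0 (2 * R0) 0) = pi.
  by rewrite (Pr_local_eq p hE sub2)//; exact: reach_depends.
have pi2 : Pr p (EI 0 (4 * R0)) (fun w => reach L0 w x0 (2 * R0) x0) = pi.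
  rewrite (Pr_local_eq p hE sub4); last exact: reach_depends.
  rewrite -[in LHS](add0r x0) (Pr_shift p hE) /pi; apply: eq_Ex => w _.
  by congr ((nat_of_bool _)%:R); apply: asbool_equiv_eq; exact: reach_shiftE.
have two : Pr p (EI 0 R0) (fun w => twoarm L0 w 0 R0 0 x0) <=
    (size (balls (0 : Zd d) k))%:R ^+ 2 * ((half ^+ (K * j.+2 ^ 2))^-1 *
     ((size (EI 0 k))%:R * ((Ct / (2 ^ m)%:R) / (1 - p)))).
  have hK0 : 0 < half ^+ (K * j.+2 ^ 2) by rewrite exprn_gt0// invr_gt0.
  apply: (surgery hE p01 hkR) => //.
  - move=> x y kx ky; apply: (hK j.+1 j) => //; apply: (leq_trans (dist_triangle 0 _ _)).
    by rewrite expnS mul2n -addnn leq_add// distC.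
  - move=> x y kx ky Exy; have hs : ball x (2 * (2 ^ m) ^ 3) `<=` ball 0 R0.
      by apply: ball_sub; rewrite rhoE; apply: leq_trans krho; rewrite leq_add2r.
    apply: (@le_trans _ _ (Pr p (EI 0 R0) (fun w => twoarm L0 w x (2 * (2 ^ m) ^ 3) x y))).
      apply: le_Pr => // w /(edges_inE hE) wE; apply: (twoarm_shrink hE) => //.
      - by rewrite distC rhoE; apply: leq_trans krho; rewrite leq_add2r distC.
      - exact: ball_center.
      - by rewrite /ball /= rhoE distC; apply: leq_trans Lrho; have := edge_dist hE Exy.
    rewrite (Pr_local_eq p hE hs); last exact: twoarm_depends.
    have := twoarm_shift p hE 0 (2 * (2 ^ m) ^ 3) 0 (y - x) x; rewrite !add0r subrK => ->.
    apply: hCt => //; have := edge_shift hE (- x) Exy; by rewrite subrr.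
  - exact: ball_center.
  - by rewrite /ball /= dx0.
have key : pi ^+ 2 <= C * kap 0 x0 + Pr p (EI 0 R0) (fun w => twoarm L0 w 0 R0 0 x0).
  rewrite expr2 -{1}pi1 -{1}pi2.
  apply: (le_trans (Pr_FKG p01' _ (@reach_incr _ L0 _ _ _) (@reach_incr _ L0 _ _ _))).
  apply: (@le_trans _ _ (Pr p (EI 0 (4 * R0)) (fun w => joined w setT 0 x0) +
     Pr p (EI 0 (4 * R0)) (fun w => twoarm L0 w 0 R0 0 x0))).
    apply: Pr_split => // w /(edges_inE hE) wE [r1 r2].
    have [j0|nj] := pselect (joined w (ball 0 R0) 0 x0).
      by left; apply: joined_mono j0.
    right; split=> //.
      by apply: (reach_shrink hE wE _ _ r1); [rewrite distxx; clear; lia|exact: ball_center].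
    apply: (reach_shrink hE wE _ _ r2); first by rewrite distC dx0; move: kR0; clear; lia.
    by rewrite /ball /= dx0.
  apply: lerD; first exact: (tp_up tp).
  by rewrite (Pr_local_eq p hE sub1)//; exact: twoarm_depends.
apply: (le_trans key); rewrite mulrDl; apply: lerD.
  rewrite ler_pM2l//; apply: (le_trans (kap_far R (r := k) _)); first by rewrite distC dx0.
  rewrite exprVn lef_pV2 ?posrE ?exprn_gt0 ?ltr0n// -!natrX ler_nat.
  apply: (@leq_trans (k ^ (d - 2))); last by rewrite leq_exp2r//; move: d6; clear; lia.
  by rewrite /k -expnM leq_exp2l// mulnC leq_mul2l; move: d6; clear; lia.
apply: (le_trans two).
set S := size (balls _ _).
have S1 : S%:R <= (4 ^ d)%:R * 2 ^+ (j * d) :> R by rewrite -natrX -natrM ler_nat; apply: (size_balls_le p01'); move: d6; clear; lia.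
have S2 : (size (EI 0 k))%:R <= S%:R ^+ 2 :> R by rewrite -natrX ler_nat; exact: size_EI_le.
have hS0 : 0 <= S%:R :> R by [].
have t0 : 0 < Ct / (2 ^ m)%:R / (1 - p) by rewrite !divr_gt0// ltr0n expn_gt0.
have q1 : 0 < half ^+ (K * j.+2 ^ 2) by rewrite exprn_gt0// invr_gt0.
apply: (@le_trans _ _ (S%:R ^+ 4 * ((half ^+ (K * j.+2 ^ 2))^-1 * (Ct / (2 ^ m)%:R / (1 - p))))).
  rewrite [S%:R ^+ 4](_ : _ = S%:R ^+ 2 * S%:R ^+ 2); last by rewrite -exprD.
  rewrite -[leRHS]mulrA ler_wpM2l ?sqr_ge0// [leRHS]mulrCA ler_pM2l ?invr_gt0// ler_pM2r//.
have S4 : S%:R ^+ 4 <= (4 ^ d)%:R ^+ 4 * 2 ^+ (4 * (j * d)) :> R.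
  by rewrite (mulnC 4%N) exprM -exprMn lerXn2r ?nnegrE ?mulr_ge0 ?exprn_ge0// exprn_ge0.
apply: (le_trans (ler_wpM2r _ S4)).
  by rewrite mulr_ge0 ?ltW// invr_gt0.
have -> : (2 ^ m)%:R = 2 ^+ (4 * (j * d)) * 2 ^+ (K * j.+2 ^ 2) * 2 ^+ (5 * j) * 2 ^+ m1.+1 :> R.
  by rewrite natrX mE !exprD.
rewrite !exprVn invrK.
have h2 n : 2 ^+ n != 0 :> R by rewrite expf_neq0// pnatr_eq0.
have m1ge1 : 1 <= 2 ^+ m1.+1 :> R by rewrite exprn_ege1// ler1n.
have -> : (4 ^ d)%:R ^+ 4 * 2 ^+ (4 * (j * d)) * (2 ^+ (K * j.+2 ^ 2) *
     (Ct / (2 ^+ (4 * (j * d)) * 2 ^+ (K * j.+2 ^ 2) * 2 ^+ (5 * j) * 2 ^+ m1.+1) / (1 - p))) =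
   (4 ^ d)%:R ^+ 4 * Ct / (1 - p) * (2 ^+ (5 * j))^-1 / 2 ^+ m1.+1.
  by field; rewrite !h2 gt_eqF.
rewrite ler_pdivrMr ?exprn_gt0// ler_peMr// mulr_ge0 ?invr_ge0 ?exprn_ge0//.
by rewrite divr_ge0 ?(ltW q0)// mulr_ge0 ?exprn_ge0// ltW.
Qed.

(** Square root of [reach_sq]. The radius needed for 4^(-i) is 2^(C i^2) because of the gluing cost:
    the decay is only exp(-c sqrt(log r)), slower than any power. *)
Lemma one_arm : exists C1 : nat, exists2 C2 : R, 0 < C2 & forall i N x r,
  (2 ^ (C1 * i.+1 ^ 2) <= r)%N ->
  Pr p (EI 0 N) (fun w => joined_set w setT x (~` ball x r)) <= C2 * 4^-1 ^+ i.
Proof.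
have [K [m0 [C3 C30 h]]] := reach_sq.
exists (3 * (4 * d + 4 * K + 5 + m0) + 3)%N; exists (1 + C3); first by rewrite addr_gt0.
move=> i N x r hr; pose m := (4 * (i * d) + K * i.+2 ^ 2 + 5 * i + m0)%N.
have {h} := h i m erefl; set r' := (2 ^ (3 * m + 3))%N => h.
have r'r : (r' <= r)%N.
  apply: leq_trans hr; rewrite leq_exp2l// /m.
  have h1 : (i.+2 ^ 2 <= 4 * i.+1 ^ 2)%N by rewrite -[4%N]/(2 ^ 2)%N -expnMn leq_exp2r//; clear; lia.
  have h2 : (i <= i.+1 ^ 2)%N by rewrite (@leq_trans i.+1)// leq_pmulr.
  have h3 : (0 < i.+1 ^ 2)%N by rewrite expn_gt0.
  move: h1 h2 h3; move: (i.+1 ^ 2)%N (i.+2 ^ 2)%N => a b h1 h2 h3.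
  have : (i * d <= a * d)%N by rewrite leq_mul2r h2 orbT.
  have : (K * b <= K * (4 * a))%N by rewrite leq_mul2l h1 orbT.
  have : (m0 <= m0 * a)%N by rewrite leq_pmulr.
  by move: h2 h3; clear; lia.
set pi := Pr p (EI 0 r') _ in h.
apply: (@le_trans _ _ pi).
  apply: (@le_trans _ _ (Pr p (EI 0 N) (fun w => reach L0 w x r' x))).
    apply: le_Pr => // w /(edges_inE hE) wE [v xv h'].
    apply: (exit_reach hE wE h'); first exact: ball_center.
    by apply: contra_not xv; apply: ball_subr.
  apply: (le_trans (Pr_le_local hE p01' _ (@reach_depends _ _ _ _ _) (@reach_incr _ _ _ _ _))).
  rewrite -[in leLHS](add0r x) (Pr_shift p hE) /pi le_eqVlt; apply/orP; left; apply/eqP.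
  by apply: eq_Ex => w _; congr ((nat_of_bool _)%:R); apply: asbool_equiv_eq; exact: reach_shiftE.
have pi0 : 0 <= pi by exact: Pr_ge0.
have h4 : 0 < (4^-1 : R) ^+ i by rewrite exprn_gt0// invr_gt0.
have h5 : half ^+ (5 * i) <= (4^-1 : R) ^+ i * 4^-1 ^+ i.
  have h6 : half ^+ 5 <= 4^-1 * 4^-1 by rewrite !exprS expr0; lra.
  rewrite -exprMn exprM lerXn2r// nnegrE; by rewrite ?exprn_ge0 ?mulr_ge0 ?invr_ge0.
rewrite leNgt; apply/negP => hlt.
have : pi ^+ 2 <= C3 * (4^-1 ^+ i * 4^-1 ^+ i).
  by apply: (le_trans h); rewrite ler_pM2l.
rewrite leNgt => /negP; apply; rewrite expr2.
set a := 4^-1 ^+ i in h4 hlt *.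
have : (1 + C3) * a * ((1 + C3) * a) < pi * pi by apply: ltr_pM => //; rewrite mulr_ge0 ?ltW ?addr_gt0.
apply: le_lt_trans; have : 0 < a * a by rewrite mulr_gt0.
nra.
Qed.

End one_arm.

(** * Splitting a cluster into two disjoint large pieces *)

Section splitting.
Context (d : nat) (A : set (Zd d)).
Implicit Types (x y z v : Zd d) (w : set (edge d)) (tr : seq (Zd d * Zd d)).

Definition verts r tr : seq (Zd d) := r :: map fst tr.

(* The head of the list is the vertex attached last, hence a leaf. *)
Fixpoint is_tree r tr : Prop :=
  if tr is vp :: tr' then
    [/\ is_tree r tr', vp.1 \notin verts r tr', vp.2 \in verts r tr' & A vp.1]
  else A r.

Definition tree_edges tr : set (edge d) := [set e | exists2 vp, vp \in tr & e = [fset vp.1; vp.2]%fset].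

Lemma tree_edges_cons v y tr : tree_edges ((v, y) :: tr) = [fset v; y]%fset |` tree_edges tr.
Proof.
apply/seteqP; split=> e.
  by move=> [vp]; rewrite inE => /orP[/eqP -> ->|h ->]; [left|right; exists vp].
by case=> [->|[vp h ->]]; [exists (v, y)|exists vp]; rewrite // inE ?eqxx ?h ?orbT.
Qed.

Lemma tree_edges_verts r tr e z : is_tree r tr -> tree_edges tr e -> z \in e -> z \in verts r tr.
Proof.
elim: tr => [|[v y] tr IH]; first by move=> _ [].
move=> [/= h1 h2 h3 _]; rewrite tree_edges_cons => -[->|/(IH h1) h /h].
  by rewrite !inE => /orP[]/eqP ->; rewrite ?eqxx ?orbT//; move: h3; rewrite inE => /orP[->|->]; rewrite ?orbT.
by rewrite !inE => /orP[->|->]; rewrite ?orbT.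
Qed.

Lemma tree_joined r tr z : is_tree r tr -> z \in verts r tr -> joined (tree_edges tr) A r z.
Proof.
elim: tr z => [|[v y] tr IH] z /=.
  by move=> Ar; rewrite /verts /= inE => /eqP ->; exact: joined_refl.
move=> [/= h1 h2 h3 Av]; have sub : tree_edges tr `<=` tree_edges ((v, y) :: tr).
  by rewrite tree_edges_cons => e he; right.
have jy := IH _ h1 h3.
rewrite /verts /= !inE orbCA => /orP[/eqP ->|h]; last first.
  by apply: joined_mono (IH z h1 _) => //; rewrite /verts inE.
apply: (joined_trans (y := y)); first exact: joined_mono jy.
apply: joined1 => //; first exact: joined_inr jy.
by rewrite fsetUC tree_edges_cons; left.
Qed.

Lemma tree_extend w r tr a q : is_tree r tr -> tree_edges tr `<=` w -> a \in verts r tr ->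
  pedges a q `<=` w -> (forall z, z \in a :: q -> A z) ->
  exists tr', [/\ is_tree r tr', tree_edges tr' `<=` w, {subset verts r tr <= verts r tr'} &
    last a q \in verts r tr'].
Proof.
elim: q tr a => [|b q IH] tr a ht hw ha hq hA /=; first by exists tr; split.
have Ab : A b by apply: hA; rewrite !inE eqxx orbT.
have hq' : pedges b q `<=` w by move=> e he; apply: hq; right.
have hA' z : z \in b :: q -> A z by move=> hz; apply: hA; rewrite inE hz orbT.
have [hb|hb] := boolP (b \in verts r tr); first exact: (IH tr b).
have [] // := IH ((b, a) :: tr) b _ _ _ hq' hA'.
- by rewrite tree_edges_cons => e [->|/hw//]; apply: hq; left; rewrite fsetUC.
- by rewrite /verts /= !inE eqxx orbT.
move=> tr' [h1 h2 h3 h4]; exists tr'; split=> // z hz; apply: h3.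
by move: hz; rewrite /verts /= !inE => /orP[->|->]; rewrite ?orbT.
Qed.

(** A subtree of the open cluster that contains all marks, grown by adding one path after the other;
    a vertex already in the tree is not attached again. *)
Lemma tree_span w r (ys : seq (Zd d)) : A r -> (forall y, y \in ys -> joined w A r y) ->
  exists tr, [/\ is_tree r tr, tree_edges tr `<=` w & {subset ys <= verts r tr}].
Proof.
move=> Ar; elim: ys => [|y ys IH] h; first by exists [::]; split=> // e [].
have [|tr [h1 h2 h3]] := IH; first by move=> z zy; apply: h; rewrite inE zy orbT.
have /joinedP[q [q1 q2 q3]] := h y (mem_head _ _).
have [|tr' [h4 h5 h6 h7]] := tree_extend h1 h2 _ q1 q3; first exact: mem_head.
exists tr'; split=> // z; rewrite inE => /orP[/eqP ->|/h3/h6//]; by rewrite -q2.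
Qed.

Definition big (L : seq (Zd d)) n w := exists x, (n <= count (fun y => `[< joined w A x y >]) L)%N.

Lemma big_incr L n : increasing (big L n).
Proof.
move=> w w' ww' [x hx]; exists x; apply: leq_trans hx _; apply: sub_count => y /asboolP h.
by apply/asboolP; apply: joined_mono h.
Qed.

Section merge.
Context (L : seq (Zd d)) (n : nat) (w : set (edge d)) (ys : seq (Zd d)).
Context (ysL : exists P : pred (Zd d), ys = [seq y <- L | P y]).

Let big_sub w' x (P : pred (Zd d)) : (forall y, P y -> y \in ys -> joined w' A x y) ->
  (n <= count P ys)%N -> big L n w'.
Proof.
move=> h hn; exists x; apply: leq_trans hn _; have [Q ysE] := ysL.
rewrite -size_filter ysE -filter_predI size_filter; rewrite (@eq_in_count _ _ (fun y => [&& P y, Q y & y \in L])); last by move=> y yL /=; rewrite yL andbT.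
by apply: sub_count => y /and3P[Py Qy yL]; apply/asboolP/h => //; rewrite ysE mem_filter Qy.
Qed.

(* Leaves are merged into their parents until some vertex carries between [n] and
   [2 n] marks: [W] is the set of edges already merged, [h] and [g] tell by which
   vertex an edge and a mark are carried. *)
Lemma merge tr r (W : set (edge d)) (h : edge d -> Zd d) (g : Zd d -> Zd d) :
  is_tree r tr -> tree_edges tr `<=` w -> W `<=` w -> tree_edges tr `&` W = set0 ->
  (forall y, y \in ys -> g y \in verts r tr) ->
  (forall y, y \in ys -> joined (W `&` [set e | h e = g y]) A (g y) y) ->
  (forall v, v \in verts r tr -> (count (fun y => g y == v) ys < n)%N) ->
  (3 * n <= size ys)%N ->
  disj_occ (big L n) (big L n) w.
Proof.
elim: tr W h g => [|[v u] tr IH] W h g ht hw hW hd hg hj hn h3.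
  have := hn r (mem_head _ _); suff -> : count (fun y => g y == r) ys = size ys by move: h3; clear; lia.
  by apply/eqP; rewrite -all_count; apply/allP => y /hg; rewrite /verts /= inE.
case: ht => /= h1 h2 h4 Av; have vu : v != u by apply: contraNneq h2 => ->.
rewrite tree_edges_cons in hw hd; set e0 := [fset v; u]%fset in hw hd.
have we0 : w e0 by apply: hw; left.
have te0 : ~ tree_edges tr e0.
  by move=> /(tree_edges_verts (z := v) h1); rewrite !inE eqxx => /(_ isT); apply/negP.
have We0 : ~ W e0 by move=> We0; have : set0 e0 by rewrite -hd; split=> //; left.
have hd' : tree_edges tr `&` W = set0 by apply/seteqP; split=> // e [he We]; rewrite -hd; split=> //; right.
have Au : A u by exact: joined_inr (tree_joined h1 h4).
have cvu : count (fun y => (g y == v) || (g y == u)) ys =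
    (count (fun y => g y == v) ys + count (fun y => g y == u) ys)%N.
  rewrite -count_predUI [X in (_ + X)%N](_ : _ = 0%N) ?addn0//.
  apply/eqP; rewrite -leqn0 -ltnS -[X in (_ < X.+1)%N](count_pred0 ys) ltnS; apply: sub_count => y /andP[/= /eqP -> ].
  by rewrite (negPf vu).
have inu : u \in verts r ((v, u) :: tr).
  by move: h4; rewrite /verts /= !inE => /orP[->|->]; rewrite ?orbT.
have inv : v \in verts r ((v, u) :: tr) by rewrite /verts /= !inE eqxx orbT.
have j0 y w' : y \in ys -> (g y == v) || (g y == u) -> 
    e0 |` (W `&` [set e | h e = v \/ h e = u]) `<=` w' -> joined w' A u y.
  move=> yys /orP[]/eqP gy hw'.
    apply: (joined_trans (y := v)).
      by apply: joined1 => //; apply: hw'; left; rewrite fsetUC.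
    rewrite -gy; apply: joined_mono (hj _ yys) => // e [We he]; apply: hw'; right; split=> //.
    by left; rewrite -gy.
  rewrite -gy; apply: joined_mono (hj _ yys) => // e [We he]; apply: hw'; right; split=> //.
  by right; rewrite -gy.
(* If leaf and parent together carry at least [n] marks, their merged edges with [e0] form the first
   piece. Each carries fewer than [n], so more than [n] of the 3n marks remain, hanging on the rest
   of the tree, whose edges are disjoint from these. *)
have [large|small] := leqP n (count (fun y => (g y == v) || (g y == u)) ys).
  exists (e0 |` (W `&` [set e | h e = v \/ h e = u])), (tree_edges tr `|` (W `&` [set e | h e <> v /\ h e <> u])).
  split.
  - by move=> e [->//|[/hW]].
  - by move=> e [he|[/hW//]]; apply: hw; right.
  - apply/seteqP; split=> // e [[->|[We [hev|heu]]] [he|[We' [nv nu]]]] //.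
    + by rewrite -hd'.
    + by rewrite -hd'.
  - by apply: (big_sub (x := u) _ large) => y hy yys; apply: j0.
  - apply: (big_sub (x := r) (P := fun y => ~~ ((g y == v) || (g y == u)))) => [y hy yys|].
      have gt : g y \in verts r tr.
        by have := hg _ yys; rewrite /verts /= !inE orbCA => /orP[gv|->//]; rewrite gv in hy.
      apply: (joined_trans (y := g y)).
        by apply: joined_mono (tree_joined h1 gt) => // e he; left.
      apply: joined_mono (hj _ yys) => // e [We he]; right; split=> //.
      by move: hy; rewrite negb_or /= he => /andP[/eqP ? /eqP ?].
    have := count_predC (fun y => (g y == v) || (g y == u)) ys; rewrite /predC /=.
    move: (hn _ inu) (hn _ inv) h3; rewrite cvu; clear.
    by move: (count _ _) (count _ _) (count _ _) (size _) => a b' c' s; lia.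
(* Otherwise the leaf disappears: its marks, its merged edges and [e0] are now carried by its
   parent. *)
apply: (IH (e0 |` W) (fun e => if (e == e0) || (h e == v) then u else h e)
  (fun y => if g y == v then u else g y)) => //.
- by move=> e he; apply: hw; right.
- by move=> e [->//|/hW].
- apply/seteqP; split=> // e [he [ee|We]]; first by apply: te0; rewrite -ee.
  by rewrite -hd'; split.
- move=> y /hg; case: (eqVneq (g y) v) => // gv; rewrite /verts /= !inE orbCA (negPf gv) /= => h5.
  exact: h5.
- move=> y yys; case: (eqVneq (g y) v) => gv.
    apply: j0 => //; first by rewrite gv eqxx.
    move=> e [->|[We he]]; first by split; [left|rewrite /= eqxx].
    split; first by right.
    by rewrite /=; case: ifP => // /negbT; rewrite negb_or => /andP[_ /eqP hv]; case: he.
  apply: joined_mono (hj _ yys) => // e [We he]; split; first by right.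
  rewrite /= he (negPf gv) orbF; case: eqP => // ee; by case: We0; rewrite -ee.
- move=> v' hv'; have [->|nvu] := eqVneq v' u.
    apply: leq_ltn_trans small; apply: sub_count => y /=; case: (eqVneq (g y) v) => //= _ ->; rewrite ?orbT.
  have hv2 : v' \in verts r ((v, u) :: tr).
    by move: hv'; rewrite /verts /= !inE => /orP[->|->]; rewrite ?orbT.
  apply: leq_ltn_trans (hn _ hv2); apply: sub_count => y /=; case: (eqVneq (g y) v) => //= _.
  by rewrite eq_sym (negPf nvu).
Qed.

End merge.

(** At the start every vertex carries at most its own mark; [1 < n] makes this less than [n], as the
    merging requires. *)
Lemma big_split3 L n w : uniq L -> (1 < n)%N -> big L (3 * n) w -> disj_occ (big L n) (big L n) w.
Proof.
move=> uL n1 [x hx]; pose P y := `[< joined w A x y >]; pose ys := [seq y <- L | P y].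
have Ax : A x.
  have : (0 < count P L)%N by apply: leq_trans hx; rewrite muln_gt0 /= ltnW.
  by rewrite -has_count => /hasP[y _ /asboolP /joined_inl].
have [|tr [h1 h2 h3]] := @tree_span w x ys Ax.
  by move=> y; rewrite mem_filter => /andP[/asboolP].
apply: (@merge L n w ys _ tr x set0 (fun=> x) id) => //.
- by exists P.
- by rewrite setI0.
- by move=> y yys; apply: joined_refl; move: yys; rewrite mem_filter => /andP[/asboolP/joined_inr].
- move=> v _; apply: leq_ltn_trans n1; apply: (@leq_trans (count_mem v L)); last by rewrite count_uniq_mem// leq_b1.
  by rewrite /ys count_filter; apply: sub_count => y /= /andP[].
- by rewrite size_filter.
Qed.

End splitting.

(** * Large clusters in a box *)

Section max_cluster.
Context (R : realType) (d : nat) (p : R) (E : set (edge d)) (L0 : nat).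
Context (hE : lattice_edges E L0) (p01 : 0 < p < 1) (d6 : (6 < d)%N).
Context (c C : R) (c0 : 0 < c) (cC : c < C) (tp : two_point p E c C).
Implicit Types (x y z u v t : Zd d) (A B : set (Zd d)) (w : set (edge d)).

Local Notation EI := (edges_in E).
Local Notation half := (2^-1 : R).

Let p01' : 0 <= p <= 1. Proof. by case/andP: p01 => /ltW -> /ltW ->. Qed.
Let C0 : 0 < C. Proof. exact: lt_trans c0 cC. Qed.

(** Each tripling of the size squares the probability, by splitting and the BK inequality. *)
Lemma big_iter A N u s n j : (1 < n)%N ->
  Pr p (EI 0 N) (big A (balls u s) (3 ^ j * n)) <= Pr p (EI 0 N) (big A (balls u s) n) ^+ (2 ^ j).
Proof.
move=> n1; elim: j => [|j IH]; first by rewrite mul1n expr1.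
apply: (@le_trans _ _ (Pr p (EI 0 N) (disj_occ (big A (balls u s) (3 ^ j * n)) (big A (balls u s) (3 ^ j * n))))).
  apply: le_Pr => // w _; rewrite expnS -mulnA; apply: big_split3; first exact: balls_uniq.
  by apply: leq_trans n1 _; rewrite leq_pmull// expn_gt0.
apply: (le_trans (BK p01' _ (@big_incr _ _ _ _) (@big_incr _ _ _ _))).
by rewrite expnSr exprM expr2 ler_pM// Pr_ge0.
Qed.

(** A cluster with [n] marks contains n^2 ordered pairs of joined marks. *)
Lemma big_markov A N u s n : (0 < n)%N ->
  Pr p (EI 0 N) (big A (balls u s) n) * n%:R ^+ 2 <=
  \sum_(x <- balls u s) \sum_(y <- balls u s) C * kap x y.
Proof.
move=> n0; rewrite /Pr -ExZr.
apply: (@le_trans _ _ (Ex p (EI 0 N) (fun w => \sum_(x <- balls u s) \sum_(y <- balls u s) `[< joined w setT x y >]%:R))).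
  apply: le_Ex => // w _; case: asboolP => [[x hx]|_]; last first.
    by rewrite mul0r sumr_ge0// => x _; apply: sumr_ge0.
  rewrite mul1r; pose P y := `[< joined w A x y >].
  apply: (@le_trans _ _ (\sum_(a <- balls u s | P a) \sum_(b <- balls u s | P b) 1)).
    rewrite [leRHS](eq_bigr (fun=> (count P (balls u s))%:R)); last by move=> a _; rewrite big_const_seq iter_addr_0.
    rewrite big_const_seq iter_addr_0 -[leRHS]mulr_natr -natrM -natrX ler_nat -mulnn.
    by rewrite leq_mul.
  rewrite [leRHS](bigID P) /=; apply: ler_wpDr; first by rewrite sumr_ge0// => a _; apply: sumr_ge0.
  apply: ler_sum => a /asboolP Pa; rewrite [leRHS](bigID P) /=; apply: ler_wpDr; first by rewrite sumr_ge0.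
  apply: ler_sum => b /asboolP Pb; rewrite asboolT//.
  by apply: joined_mono (joined_trans (joined_sym Pa) Pb).
rewrite Ex_sum; apply: ler_sum => x _; rewrite Ex_sum; apply: ler_sum => y _.
exact: (tp_up tp).
Qed.

(** The second moment makes clusters of size 2^m, with 2m about 3i(d+2), have probability at most
    1/2. About i/4 triplings multiply the size by less than 2^(i/2) and turn 1/2 into a double
    exponential. That 3i(d+2)/2 + i/2 <= i(3d-7) is exactly d >= 7. *)
Lemma max_cluster : exists a : nat, forall i A N u, (4 * a <= i)%N ->
  Pr p (EI 0 N) (big A (balls u (2 ^ (3 * i))) (2 ^ (i * (3 * d - 7)))) <=
  half ^+ (2 ^ (i %/ 4 - a)).
Proof.
have d2 : (2 < d)%N by move: d6; clear; lia.
have [a1 ha1] : exists a1 : nat, C * ((4 ^ d)%:R * (8 ^+ d * 16)) <= 2 ^+ a1.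
  have h0 : 0 <= C * ((4 ^ d)%:R * (8 ^+ d * 16)) by rewrite !mulr_ge0 ?exprn_ge0// ltW.
  have := archi_boundP h0; set b := Num.bound _ => hb; exists b; apply: (le_trans (ltW hb)).
  by rewrite -natrX ler_nat ltnW// ltn_expl.
exists (a1 + 4)%N => i A N u hi.
(* The least order of [m] for which 2^(2m) exceeds twice the sum over pairs; the subtraction of a1 +
   4 in [j] makes room for the constants. *)
pose m := ((3 * i * (d + 2) + a1 + 1) %/ 2 + 1)%N; pose j := (i %/ 4 - (a1 + 4))%N.
have m1 : (1 < 2 ^ m)%N by rewrite -{1}(expn0 2) ltn_exp2l// /m addn1.
have sum : \sum_(x <- balls u (2 ^ (3 * i))) \sum_(y <- balls u (2 ^ (3 * i))) C * kap x y <=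
    2 ^+ a1 * 2 ^+ (3 * i * (d + 2)).
  apply: (@le_trans _ _ (\sum_(x <- balls u (2 ^ (3 * i))) C * (8 ^+ d * 16 * 4 ^+ (3 * i)))).
    by apply: ler_sum => x _; rewrite -mulr_sumr ler_pM2l//; exact: (kap_sum p01').
  rewrite big_const_seq iter_addr_0 count_predT -[leLHS]mulr_natl.
  apply: (@le_trans _ _ ((4 ^ d * 2 ^ (3 * i * d))%N%:R * (C * (8 ^+ d * 16 * 4 ^+ (3 * i))))).
    by apply: ler_wpM2r; [rewrite !mulr_ge0 ?exprn_ge0// ltW|rewrite ler_nat; exact: (size_balls_le p01')].
  rewrite natrM (natrX _ 2) (_ : 4 = 2 ^+ 2 :> R); last by rewrite expr2 -natrM.
  rewrite -[in 2 ^+ 2 ^+ _]exprM.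
  have -> : (4 ^ d)%:R * 2 ^+ (3 * i * d) * (C * (8 ^+ d * 16 * 2 ^+ (2 * (3 * i)))) =
     C * ((4 ^ d)%:R * (8 ^+ d * 16)) * (2 ^+ (3 * i * d) * 2 ^+ (2 * (3 * i))) by ring.
  rewrite -exprD (_ : (3 * i * d + 2 * (3 * i) = 3 * i * (d + 2))%N); last by ring.
  by apply: ler_wpM2r => //; rewrite exprn_ge0.
have base : Pr p (EI 0 N) (big A (balls u (2 ^ (3 * i))) (2 ^ m)) <= half.
  have m0 : (0 < 2 ^ m)%N by exact: ltnW.
  have := le_trans (@big_markov A N u (2 ^ (3 * i)) _ m0) sum.
  rewrite -ler_pdivlMr ?exprn_gt0 ?ltr0n// => h; apply: (le_trans h).
  rewrite ler_pdivrMr ?exprn_gt0 ?ltr0n// ler_pdivlMl// (natrX _ 2 m) -exprM -exprD -exprS ler_eXn2l ?ltr1n//.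
  by rewrite /m; clear; lia.
apply: (@le_trans _ _ (Pr p (EI 0 N) (big A (balls u (2 ^ (3 * i))) (3 ^ j * 2 ^ m)))).
  apply: le_Pr => // w _ [x hx]; exists x; apply: leq_trans hx.
  apply: (@leq_trans (4 ^ j * 2 ^ m)); first by apply: leq_mul => //; case: (j) => [//|j']; rewrite leq_exp2r.
  rewrite (_ : 4 = 2 ^ 2)%N// -expnM -expnD leq_exp2l// /m /j.
  have e1 : (3 * i * (d + 2) = 3 * (i * d) + 6 * i)%N by ring.
  have e2 : (i * (3 * d - 7) = 3 * (i * d) - 7 * i)%N by rewrite mulnBr; congr (_ - _)%N; ring.
  have : (i * 7 <= i * d)%N by rewrite leq_mul2l d6 orbT.
  by rewrite e1 e2; move: hi; move: (i * d)%N; clear; lia.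
apply: (le_trans (big_iter A N u (2 ^ (3 * i)) j m1)).
by apply: lerXn2r => //; rewrite nnegrE ?Pr_ge0// invr_ge0.
Qed.

End max_cluster.

(** * The number of further arms, given one arm *)

Section ring0.
Context (R : realType) (d : nat) (p : R) (E : set (edge d)) (L0 : nat).
Context (hE : lattice_edges E L0) (p01 : 0 < p < 1).
Implicit Types (x y z u v t : Zd d) (A B O W : set (Zd d)) (w : set (edge d)).

Local Notation EI := (edges_in E).

Let p01' : 0 <= p <= 1. Proof. by case/andP: p01 => /ltW -> /ltW ->. Qed.

Lemma joined_set_trans w A x y B : joined w A x y -> joined_set w A y B -> joined_set w A x B.
Proof. by move=> xy [v Bv yv]; exists v => //; exact: joined_trans yv. Qed.

Lemma Pr_joined_set_trans s A x y B :
  Pr p s (fun w => joined w A x y) * Pr p s (fun w => joined_set w A y B) <=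
  Pr p s (fun w => joined_set w A x B).
Proof.
apply: (le_trans (Pr_FKG p01' s (@joined_incr _ A x y) (@joined_set_incr _ A B y))).
by apply: le_Pr => // w _ [h1 h2]; exact: joined_set_trans h2.
Qed.

(** If some path from [z] in its arm's cluster meets the path from [y], a hair joins [z] to a vertex
    [x] of that path. Either the hair is long (leaves the ball of radius [r]), or the path is long
    before [x] (leaves the ball of radius [s]), or [y] and [z] are joined locally. In the first two
    cases the long piece and an arm to [W0] are disjoint. *)
Lemma arm_dichotomy w u y z r s A O W0 W :
  (r <= s)%N -> joined_set w O y W0 -> joined_set w A z W ->
  [\/ disj_occ (fun w => joined_set w O y W0) (fun w => joined_set w A z W) w,
      disj_occ (fun w => joined_set w O y W0) (fun w => joined_set w setT z (~` ball u r)) w,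
      exists2 x, (O `&` ball u r) x &
        disj_occ (fun w => joined_set w O x W0) (fun w => joined_set w setT y (~` ball u s)) w |
      joined w (ball u s) y z].
Proof.
move=> rs [v Wv /joined_uniqP[q [q1 q2 q3 q4]]] [v' Wv' jz].
have [[b [bz hb]]|no] := pselect (exists b, joined w A z b /\ b \in y :: q); last first.
  constructor 1; have /joinedP[q' [h1 h2 h3]] := jz.
  exists (pedges y q), (pedges z q'); split=> //.
  - apply/seteqP; split=> // e [e1 e2]; case: no.
    have [b be bq] := pedges_vertex_tail e2.
    exists b; split; last exact: pedges_vertex e1 be.
    have hb : has (pred1 b) (z :: q') by apply/hasP; exists b; rewrite ?inE ?bq ?orbT//=; exact: eqxx.
    have [a1 [a2 [aE /eqP l1 _]]] := split_first hb; apply/joinedP; exists a1; split=> //.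
      by apply: subset_trans h1; rewrite aE pedges_cat; left.
    by move=> t ht; apply: h3; rewrite aE -cat_cons mem_cat ht.
  - by exists v => //; apply/joinedP; exists q; split.
  - by exists v' => //; apply/joinedP; exists q'; split.
have [q' [h1 h2 h3 h4]] := hair bz hb.
have jy : joined (pedges y q) O y v by apply/joinedP; exists q; split.
have jz' : joined (pedges z q') setT z (last z q') by apply/joinedP; exists q'; split.
have [jzr|[t ut jt]] := @joined_stay _ _ _ (ball u r) _ _ jz'; last first.
  constructor 2; exists (pedges y q), (pedges z q'); split=> //.
  - by rewrite setIC.
  - by exists v.
  - by exists t.
set x := last z q' in h2 jzr.
have ux : ball u r x by have [] := joined_inr jzr.
have hx : has (pred1 x) (y :: q) by apply/hasP; exists x => //=; exact: eqxx.
have [a1 [a2 [aE /eqP l1 _]]] := split_first hx.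
have jyx : joined (pedges y a1) setT y x by apply/joinedP; exists a1; split.
have jxv : joined (pedges x a2) O x v.
  apply/joinedP; exists a2; split=> //; first by rewrite -q2 aE last_cat l1.
  move=> t ht; apply: q3; rewrite aE -cat_cons mem_cat; move: ht; rewrite inE => /orP[/eqP ->|->].
    by rewrite -l1 mem_last.
  by rewrite orbT.
have Ox : O x by exact: joined_inl jxv.
have w1 : pedges y a1 `<=` w by apply: subset_trans q1; rewrite aE pedges_cat; left.
have w2 : pedges x a2 `<=` w by apply: subset_trans q1; rewrite aE pedges_cat l1; right.
have [jys|[t ut jt]] := @joined_stay _ _ _ (ball u s) _ _ jyx; last first.
  constructor 3; exists x => //; exists (pedges x a2), (pedges y a1); split=> //.
  - by rewrite setIC -l1; apply: pedges_uniq_disj; rewrite -aE.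
  - by exists v.
  - by exists t.
constructor 4; apply: (joined_trans (y := x)).
  by apply: joined_mono jys => // t' [].
apply: joined_sym; apply: joined_mono jzr => // t' [_]; exact: ball_subr.
Qed.

(** The four cases of [arm_dichotomy] summed over z. Disjoint arms factor by the BK inequality; long
    hairs and long initial pieces cost arm probabilities; local connections are at most [n] unless
    the cluster of [y] is oversized. The divisions by [q'] and [q] come from moving the start of an
    arm back to [y] by gluing. *)
Lemma ring0 N u y (s r' r n : nat) A O W0 W (q' q pi1 pi2 pib : R) :
  0 < q' -> 0 < q -> (r' <= r)%N ->
  (forall x, (O `&` ball u r') x -> q' <= Pr p (EI 0 N) (fun w => joined w O y x)) ->
  (forall x, (O `&` ball u r) x -> q <= Pr p (EI 0 N) (fun w => joined w O y x)) ->
  (forall z, ball u s z -> Pr p (EI 0 N) (fun w => joined_set w setT z (~` ball u r')) <= pi1) ->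
  Pr p (EI 0 N) (fun w => joined_set w setT y (~` ball u r)) <= pi2 ->
  Pr p (EI 0 N) (big (ball u r) (balls u s) n) <= pib ->
  ball u r y ->
  \sum_(z <- balls u s) Pr p (EI 0 N) (fun w => joined_set w O y W0 /\ joined_set w A z W) <=
  Pr p (EI 0 N) (fun w => joined_set w O y W0) *
   (n%:R + (size (balls u s))%:R * (pi1 + (size (balls u r'))%:R * pi2 / q' + (size (balls u r))%:R * pib / q) +
    \sum_(z <- balls u s) Pr p (EI 0 N) (fun w => joined_set w A z W)).
Proof.
move=> q'0 q0 rr hq' hq hpi1 hpi2 hpib uy; set P := Pr p (EI 0 N); set g := P _; set S := (size _)%:R.
pose G x := P (fun w => joined_set w O x W0).
(* Harris' inequality: an arm from [x] becomes an arm from [y] at the price of joining [y] to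
   [x]. *)
have Gq (r0 : nat) (a : R) x : 0 < a -> (forall x, (O `&` ball u r0) x -> a <= P (fun w => joined w O y x)) ->
    (O `&` ball u r0) x -> G x <= g / a.
  move=> a0 ha hx; rewrite ler_pdivlMr// mulrC.
  by apply: le_trans (Pr_joined_set_trans _ O y x W0); rewrite ler_wpM2r ?Pr_ge0// ha.
have g0 : 0 <= g by exact: Pr_ge0.
have pi20 : 0 <= pi2 by apply: le_trans hpi2; exact: Pr_ge0.
have pib0 : 0 <= pib by apply: le_trans hpib; exact: Pr_ge0.
pose delta w := exists2 x, x \in balls u r' & O x /\
   disj_occ (fun w => joined_set w O x W0) (fun w => joined_set w setT y (~` ball u r)) w.
have hdelta : P delta <= (size (balls u r'))%:R * (g / q' * pi2).
  apply: (@le_trans _ _ (\sum_(x <- balls u r') P (fun w => O x /\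
   disj_occ (fun w => joined_set w O x W0) (fun w => joined_set w setT y (~` ball u r)) w))).
    by apply: Pr_union => // w _ [x hx h]; exists x.
  apply: sum_ge0_le => x; rewrite mem_balls => ux; rewrite /P Pr_and; case: asboolP => Ox; last first.
    by rewrite mul0r mulr_ge0// divr_ge0// ltW.
  rewrite mul1r; apply: (le_trans (BK p01' _ (@joined_set_incr _ _ _ _) (@joined_set_incr _ _ _ _))).
  by apply: ler_pM; rewrite ?Pr_ge0//; apply: (Gq r').
have hkap : \sum_(z <- balls u s) P (fun w => joined_set w O y W0 /\ joined w (ball u r) y z) <=
    n%:R * g + S * ((size (balls u r))%:R * (g / q * pib)).
  rewrite /P /Pr -Ex_sum.
  apply: (@le_trans _ _ (Ex p (EI 0 N) (fun w => n%:R * `[< joined_set w O y W0 >]%:R +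
     S * `[< joined_set w O y W0 /\ big (ball u r) (balls u s) n w >]%:R))).
    apply: le_Ex => // w _; rewrite (eq_bigr (fun z => `[< joined_set w O y W0 >]%:R *
       `[< joined w (ball u r) y z >]%:R)); last first.
      by move=> z _; rewrite asbool_and -natrM mulnb.
    rewrite -mulr_sumr; case: asboolP => h; last by rewrite !mul0r mulr0 add0r mulr_ge0.
    rewrite mul1r mulr1 -natr_sum (_ : (\sum_(z <- _) _)%N = count (fun z => `[< joined w (ball u r) y z >]) (balls u s)); last first.
      by rewrite -sum1_count [RHS]big_mkcond; apply: eq_bigr => z _; case: asboolP.
    have [cn|nc] := leqP (count (fun z => `[< joined w (ball u r) y z >]) (balls u s)) n.
      by apply: ler_wpDr; rewrite ?mulr_ge0// ler_nat.
    rewrite asboolT; last by split=> //; exists y; exact: ltnW.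
    by rewrite mulr1; apply: ler_wpDl => //; rewrite ler_nat count_size.
  rewrite ExD !ExZ lerD2l ler_wpM2l//.
  rewrite -/(Pr p (EI 0 N) (fun w => joined_set w O y W0 /\ big (ball u r) (balls u s) n w)).
  (* The oversized cluster is seen inside the ball and the arm of [y] after its last exit from the
     ball, so that the two are independent. This is why the arm is restarted at the exit point
     [x]. *)
  pose Y x w := joined_set (w `\` inside (ball u r)) O x W0.
  apply: (@le_trans _ _ (\sum_(x <- balls u r) P (fun w => O x /\ (Y x w /\ big (ball u r) (balls u s) n w)))).
    apply: Pr_union => // w /(edges_inE hE) wE [[v Wv jv] hb].
    have [uv|nuv] := pselect (ball u r v).
      exists v; first by rewrite mem_balls.
      have Ov := joined_inr jv; split=> //; split=> //; exists v => //; exact: joined_refl.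
    have [a [b [ha hb' wab [w1 [w2 [h1 h2 _ h3 h4]]]]]] := last_exit jv uy nuv.
    exists a; first by rewrite mem_balls.
    split; first exact: joined_inr h3.
    split=> //; exists v => //; apply: (joined_trans (y := b)).
      apply: joined1; [exact: joined_inr h3|by have [] := joined_inl h4|].
      by split=> // /(_ b); rewrite !inE eqxx orbT => /(_ isT).
    rewrite joined_depends in h4; apply: joined_mono h4 => [e [/h2 we ie]|? []//].
    split=> //; have [x' [y' [eE _ _]]] := edge_range hE (wE _ we).
    move=> /(_ x'); have := ie x'; rewrite eE !inE eqxx => /(_ isT) [_ nx] /(_ isT).
    exact: nx.
  apply: sum_ge0_le => x; rewrite mem_balls => ux; rewrite /P Pr_and; case: asboolP => Ox; last first.
    by rewrite mul0r mulr_ge0// divr_ge0// ltW.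
  rewrite mul1r /P (@Pr_indep _ _ p _ (~` inside (ball u r)) (inside (ball u r))).
  - apply: ler_pM; rewrite ?Pr_ge0//; apply: le_trans (Gq r q x q0 hq (conj Ox ux)).
    by apply: le_Pr => // w _; apply: joined_set_mono => // ? [].
  - by rewrite setICl.
  - by move=> w; rewrite /Y; congr joined_set; apply/seteqP; split=> e [h1 h2]; [split|case: h1].
  - move=> w; apply: propext; have cE x' : count (fun z => `[< joined w (ball u r) x' z >]) (balls u s) =
        count (fun z => `[< joined (w `&` inside (ball u r)) (ball u r) x' z >]) (balls u s).
      by apply: eq_count => z; rewrite -joined_depends.
    by split=> -[x' hx']; exists x'; move: hx'; rewrite cE.
apply: (@le_trans _ _ (\sum_(z <- balls u s) (g * P (fun w => joined_set w A z W) + g * pi1 + P delta +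
   P (fun w => joined_set w O y W0 /\ joined w (ball u r) y z)))).
  rewrite big_seq [leRHS]big_seq; apply: ler_sum => z; rewrite mem_balls => uz.
  apply: (@le_trans _ _ (P (disj_occ (fun w => joined_set w O y W0) (fun w => joined_set w A z W)) +
     P (disj_occ (fun w => joined_set w O y W0) (fun w => joined_set w setT z (~` ball u r'))) + P delta +
     P (fun w => joined_set w O y W0 /\ joined w (ball u r) y z))).
    pose X1 := disj_occ (fun w => joined_set w O y W0) (fun w => joined_set w A z W).
    pose X2 := disj_occ (fun w => joined_set w O y W0) (fun w => joined_set w setT z (~` ball u r')).
    pose X4 w := joined_set w O y W0 /\ joined w (ball u r) y z.
    apply: (@le_trans _ _ (P (fun w => (X1 w \/ X2 w) \/ delta w) + P X4)).
      apply: Pr_split => // w _ [h1 h2]; have [h|h|[x [Ox ux] h]|h] := arm_dichotomy u rr h1 h2.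
      - by left; left; left.
      - by left; left; right.
      - by left; right; exists x; rewrite ?mem_balls.
      - by right.
    rewrite lerD2r; apply: (@le_trans _ _ (P (fun w => X1 w \/ X2 w) + P delta)); first exact: Pr_split.
    by rewrite lerD2r; exact: Pr_split.
  rewrite lerD2r lerD2r; apply: lerD.
    exact: (BK p01' _ (@joined_set_incr _ _ _ _) (@joined_set_incr _ _ _ _)).
  apply: (le_trans (BK p01' _ (@joined_set_incr _ _ _ _) (@joined_set_incr _ _ _ _))).
  by rewrite ler_wpM2l// hpi1.
rewrite !big_split /= -mulr_sumr !big_const_seq !iter_addr_0 !count_predT.
have natE a : a *+ size (balls u s) = S * a by rewrite mulr_natl.
rewrite !natE.
apply: (le_trans (lerD (lerD (lexx _) (ler_wpM2l (ler0n _ _) hdelta)) hkap)).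
by rewrite le_eqVlt; apply/orP; left; apply/eqP; field; rewrite !gt_eqF.
Qed.

End ring0.

(** * Polynomially bounded scales *)

Section growth.
Local Open Scope nat_scope.
Implicit Types f g : nat -> nat.

Definition poly_le f := exists M k, forall n, f n <= M * n.+1 ^ k.

Lemma poly_cst a : poly_le (fun=> a).
Proof. by exists a, 0 => n; rewrite expn0 muln1. Qed.

Lemma poly_id : poly_le id.
Proof. by exists 1, 1 => n; rewrite mul1n expn1. Qed.

Lemma poly_add f g : poly_le f -> poly_le g -> poly_le (fun n => f n + g n).
Proof.
move=> [M [k hf]] [M' [k' hg]]; exists (M + M'), (k + k') => n; rewrite mulnDl.
apply: leq_add; [apply: leq_trans (hf n) _|apply: leq_trans (hg n) _]; rewrite leq_mul2l.
  by rewrite leq_pexp2l ?orbT// leq_addr.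
by rewrite leq_pexp2l ?orbT// leq_addl.
Qed.

Lemma poly_mul f g : poly_le f -> poly_le g -> poly_le (fun n => f n * g n).
Proof.
move=> [M [k hf]] [M' [k' hg]]; exists (M * M'), (k + k') => n.
by rewrite expnD mulnACA leq_mul.
Qed.

Lemma poly_exp f : poly_le f -> poly_le (fun n => f n ^ 2).
Proof. by move=> hf; have := poly_mul hf hf. Qed.

Lemma leq_exp2r_l m n k : m <= n -> m ^ k <= n ^ k.
Proof. by move=> mn; case: k => [//|k]; rewrite leq_exp2r. Qed.

(** The nested radii have exponents polynomial in the scale, whereas oversized clusters have
    probability 2^(-2^(i/4 - a)); this comparison makes all losses affordable. *)
Lemma poly_exp2 M k a : exists i0, forall i, i0 <= i -> M * i.+1 ^ k <= 2 ^ (i %/ 4 - a).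
Proof.
pose k1 := k.+1; pose b := M * 4 ^ k * (2 * k1) ^ k.
exists (4 * (2 * (a + b) + 1)) => i hi; pose t := i %/ 4.
have it : i.+1 <= 4 * t.+1 by rewrite /t; clear; lia.
have tb : 2 * (a + b) + 1 <= t by move: hi; rewrite /t; clear; lia.
have tk : t.+1 <= 2 * k1 * 2 ^ (t %/ (2 * k1)).
  apply: (@leq_trans (2 * k1 * (t %/ (2 * k1)).+1)); last by rewrite leq_mul2l ltn_expl ?orbT.
  by rewrite mulnC ltn_ceil.
have h1 : i.+1 ^ k <= 4 ^ k * ((2 * k1) ^ k * 2 ^ (t %/ 2)).
  apply: (@leq_trans ((4 * t.+1) ^ k)); first exact: leq_exp2r_l.
  rewrite expnMn leq_mul2l; apply/orP; right.
  apply: (@leq_trans ((2 * k1 * 2 ^ (t %/ (2 * k1))) ^ k)); first exact: leq_exp2r_l.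
  rewrite expnMn leq_mul2l -expnM leq_exp2l//; apply/orP; right.
  rewrite divnMA mulnC; apply: leq_trans (leq_trunc_div _ k1); rewrite mulnC leq_mul2l.
  by apply/orP; right.
apply: (@leq_trans (b * 2 ^ (t %/ 2))); first by rewrite /b -!mulnA leq_mul2l h1 orbT.
apply: (@leq_trans (2 ^ b * 2 ^ (t %/ 2))); first by rewrite leq_mul2r ltnW ?orbT// ltn_expl.
by rewrite -expnD leq_exp2l// -/t; move: tb; clear; move: (b) (t) => b0 t0; lia.
Qed.

End growth.

(** * The bounds on further arms at all scales *)

Section ring.
Context (R : realType) (d : nat) (p : R) (E : set (edge d)) (L0 : nat).
Context (hE : lattice_edges E L0) (p01 : 0 < p < 1) (d6 : (6 < d)%N).
Context (c C : R) (c0 : 0 < c) (cC : c < C) (tp : two_point p E c C).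
Implicit Types (x y z u v t : Zd d) (A B O W : set (Zd d)) (w : set (edge d)).

Local Notation EI := (edges_in E).
Local Notation half := (2^-1 : R).

Let p01' : 0 <= p <= 1. Proof. by case/andP: p01 => /ltW -> /ltW ->. Qed.

Lemma exp2_add a b : (2 ^ a + 2 ^ b <= 2 ^ (a + b + 1))%N.
Proof.
rewrite addn1 expnS mul2n -addnn leq_add// leq_exp2l//; first exact: leq_addr.
exact: leq_addl.
Qed.

Lemma ring_bound K : exists i0 : nat, exists J : nat -> nat, forall i I N u y A O W0 W,
  (i0 <= i)%N -> (i <= I)%N -> (I <= 7 * d * i)%N -> ball u (2 ^ (3 * I.+1)) y -> O y ->
  (forall x j, O x -> ball u (2 ^ J I) x -> (dist y x <= 2 ^ j)%N -> (j <= (J I).+1)%N ->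
     half ^+ (K * j.+1 ^ 2) <= Pr p (EI 0 N) (fun w => joined w O y x)) ->
  \sum_(z <- balls u (2 ^ (3 * i))) Pr p (EI 0 N) (fun w => joined_set w O y W0 /\ joined_set w A z W) <=
  Pr p (EI 0 N) (fun w => joined_set w O y W0) *
   (4 * 2 ^+ (i * (3 * d - 7)) +
    \sum_(z <- balls u (2 ^ (3 * i))) Pr p (EI 0 N) (fun w => joined_set w A z W)).
Proof.
have d2 : (2 < d)%N by move: d6; clear; lia.
have [C1 [C2 C20 arm1]] := one_arm hE p01 d6 c0 cC tp.
have [a hbad] := max_cluster p01 d6 c0 cC tp.
have [a1 ha1] : exists a1 : nat, C2 <= 2 ^+ a1.
  have h0 := ltW C20; have := archi_boundP h0; set b := Num.bound _ => hb; exists b; apply: (le_trans (ltW hb)).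
  by rewrite -natrX ler_nat ltnW// ltn_expl.
(* Chosen in succession: 4^(-i1) beats the number of points z; [j1] is the radius at which arms have
   that probability; 4^(-i2) beats moreover the volume and the gluing cost at scale [j1]; [j2] is
   its radius; [f] collects the volume and gluing cost at scale [j2], to be beaten by the cluster
   bound. *)
pose a0 := (4 * d + a1)%N.
pose i1 I := (3 * d * I + a0)%N.
pose j1 I := (C1 * (i1 I + 1) ^ 2 + 3 * I + 4)%N.
pose i2 I := (3 * d * I + j1 I * d + K * (j1 I + 2) ^ 2 + a0)%N.
pose j2 I := (C1 * (i2 I + 1) ^ 2 + 3 * I + 4 + j1 I)%N.
pose f I := (4 * d + 3 * d * I + j2 I * d + K * (j2 I + 2) ^ 2)%N.
have pi1 : poly_le i1 by do ?[exact: poly_cst|exact: poly_id|apply: poly_add|apply: poly_mul|apply: poly_exp].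
have pj1 : poly_le j1 by do ?[exact: pi1|exact: poly_cst|exact: poly_id|apply: poly_add|apply: poly_mul|apply: poly_exp].
have pi2 : poly_le i2 by do ?[exact: pj1|exact: poly_cst|exact: poly_id|apply: poly_add|apply: poly_mul|apply: poly_exp].
have pj2 : poly_le j2 by do ?[exact: pj1|exact: pi2|exact: poly_cst|exact: poly_id|apply: poly_add|apply: poly_mul|apply: poly_exp].
have [M [k hf]] : poly_le f by do ?[exact: pj2|exact: poly_cst|exact: poly_id|apply: poly_add|apply: poly_mul|apply: poly_exp].
have [i0 hi0] := poly_exp2 (M * (7 * d) ^ k) k a.
exists (i0 + 4 * a)%N, j2 => i I N u y A O W0 W hi iI Ii uy Oy glue.
have fi : (f I <= 2 ^ (i %/ 4 - a))%N.
  apply: leq_trans (hi0 i (leq_trans (leq_addr _ _) hi)).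
  apply: (leq_trans (hf I)); rewrite -mulnA leq_mul2l -expnMn; apply/orP; right.
  apply: leq_exp2r_l; rewrite mulnS; apply: (@leq_trans (7 * d * i).+1); first by rewrite ltnS.
  by rewrite -[X in (X <= _)%N]add1n leq_add2r muln_gt0 /= ltnW// ltnW.
have i4a : (4 * a <= i)%N by apply: leq_trans hi; rewrite leq_addl.
have big0 := hbad i (ball u (2 ^ j2 I)) N u i4a.
have j12 : (j1 I <= j2 I)%N by rewrite /j2 leq_addl.
have q0 n : 0 < half ^+ n by rewrite exprn_gt0// invr_gt0.
have uy1 : (dist y u <= 2 ^ j1 I)%N.
  by apply: leq_trans uy _; rewrite leq_exp2l// /j1; clear; lia.
have uy2 : (dist y u <= 2 ^ j2 I)%N by apply: leq_trans uy1 _; rewrite leq_exp2l.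
have dyx x j : (dist y u <= 2 ^ j)%N -> ball u (2 ^ j) x -> (dist y x <= 2 ^ j.+1)%N.
  by move=> h1 h2; apply: leq_trans (dist_triangle u _ _) _; rewrite expnS mul2n -addnn leq_add// distC.
have hq' x : (O `&` ball u (2 ^ j1 I)) x -> half ^+ (K * (j1 I).+2 ^ 2) <= Pr p (EI 0 N) (fun w => joined w O y x).
  move=> [Ox ux]; apply: (glue x (j1 I).+1) => //; last exact: dyx.
  by apply: ball_subr ux; rewrite leq_exp2l.
have hq x : (O `&` ball u (2 ^ j2 I)) x -> half ^+ (K * (j2 I).+2 ^ 2) <= Pr p (EI 0 N) (fun w => joined w O y x).
  by move=> [Ox ux]; apply: (glue x (j2 I).+1) => //; exact: dyx.
have exits_ i' z r s : (2 ^ (C1 * i'.+1 ^ 2) + r <= s)%N -> ball u r z ->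
    Pr p (EI 0 N) (fun w => joined_set w setT z (~` ball u s)) <= C2 * 4^-1 ^+ i'.
  move=> h1 h2; apply: (le_trans _ (arm1 i' N z _ (leqnn _))); apply: le_Pr => // w _.
  apply: joined_set_mono => // t; apply: contra_not; apply: ball_sub.
  by apply: leq_trans h1; rewrite addnC leq_add2l.
have hpi1 z : ball u (2 ^ (3 * i)) z ->
    Pr p (EI 0 N) (fun w => joined_set w setT z (~` ball u (2 ^ j1 I))) <= C2 * 4^-1 ^+ i1 I.
  apply: exits_; apply: (leq_trans (exp2_add _ _)); rewrite leq_exp2l// /j1 (addn1 (i1 I)).
  by move: iI; move: (C1 * _)%N; clear; lia.
have hpi2 : Pr p (EI 0 N) (fun w => joined_set w setT y (~` ball u (2 ^ j2 I))) <= C2 * 4^-1 ^+ i2 I.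
  apply: (exits_ _ _ _ _ _ uy); apply: (leq_trans (exp2_add _ _)); rewrite leq_exp2l// /j2 (addn1 (i2 I)).
  by move: (C1 * _)%N (j1 I); clear; lia.
have jj : (2 ^ j1 I <= 2 ^ j2 I)%N by rewrite leq_exp2l.
apply: (le_trans (@ring0 _ _ _ _ _ hE p01 N u y (2 ^ (3 * i)) (2 ^ j1 I) (2 ^ j2 I) _ A O W0 W _ _ _ _ _
  (q0 _) (q0 _) jj hq' hq hpi1 hpi2 big0 uy2)).
apply: ler_wpM2l; first exact: Pr_ge0.
rewrite lerD2r natrX.
have n1 : 1 <= 2 ^+ (i * (3 * d - 7)) :> R by rewrite exprn_ege1// ler1n.
suff h3 : (size (balls u (2 ^ (3 * i))))%:R * (C2 * 4^-1 ^+ i1 I +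
    (size (balls u (2 ^ j1 I)))%:R * (C2 * 4^-1 ^+ i2 I) / half ^+ (K * (j1 I).+2 ^ 2) +
    (size (balls u (2 ^ j2 I)))%:R * half ^+ (2 ^ (i %/ 4 - a)) / half ^+ (K * (j2 I).+2 ^ 2)) <= 3.
  by apply: (le_trans (lerD (lexx _) h3)); lra.
have Sz j : (size (balls u (2 ^ j)))%:R <= 2 ^+ (2 * d + j * d) :> R.
  rewrite exprD exprM (_ : 2 ^+ 2 = 4 :> R); last by rewrite expr2 -natrM.
  by rewrite -!natrX -natrM ler_nat; apply: (size_balls_le p01').
have h4 n : (4^-1 : R) ^+ n = (2 ^+ (2 * n))^-1.
  by rewrite exprVn exprM (_ : 2 ^+ 2 = 4 :> R)// expr2 -natrM.
have hV n : half ^+ n = (2 ^+ n)^-1 by rewrite exprVn.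
have nz n : 2 ^+ n != 0 :> R by rewrite expf_neq0// pnatr_eq0.
have p2 n : 0 < 2 ^+ n :> R by rewrite exprn_gt0.
have le2 m n : (m <= n)%N -> 2 ^+ m <= 2 ^+ n :> R by move=> mn; rewrite ler_eXn2l// ltr1n.
have S0 j : 0 <= (size (balls u (2 ^ j)))%:R :> R by [].
rewrite !mulrDr !h4 !hV !invrK; apply: (@le_trans _ _ (1 + 1 + 1)); last by lra.
apply: lerD; first apply: lerD.
- rewrite mulrA ler_pdivrMr// mul1r.
  apply: (le_trans (ler_pM _ _ (Sz _) ha1)) => //; first exact: ltW.
  rewrite -exprD; apply: le2; rewrite /i1 /a0.
  have : (3 * i * d <= 3 * d * I)%N by rewrite mulnAC leq_mul2l iI orbT.
  by move: (3 * i * d)%N (3 * d * I)%N; clear; lia.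
- have := ler_pM _ _ (ler_pM _ _ (Sz (3 * i)%N) (Sz (j1 I))) ha1 => /(_ (mulr_ge0 (S0 _) (S0 _)) (ltW C20) (S0 _) (S0 _)) h.
  have -> : (size (balls u (2 ^ (3 * i))))%:R * ((size (balls u (2 ^ j1 I)))%:R * (C2 / 2 ^+ (2 * i2 I)) * 2 ^+ (K * (j1 I).+2 ^ 2)) =
    (size (balls u (2 ^ (3 * i))))%:R * (size (balls u (2 ^ j1 I)))%:R * C2 * 2 ^+ (K * (j1 I).+2 ^ 2) / 2 ^+ (2 * i2 I) :> R by ring.
  rewrite ler_pdivrMr// mul1r; apply: (le_trans (ler_wpM2r (ltW (p2 _)) h)).
  rewrite -!exprD; apply: le2; rewrite /i2 /a0 (addn2 (j1 I)).
  have : (3 * i * d <= 3 * d * I)%N by rewrite mulnAC leq_mul2l iI orbT.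
  by move: (3 * i * d)%N (3 * d * I)%N (j1 I * d)%N (K * _)%N; clear; lia.
- have h := ler_pM (S0 _) (S0 _) (Sz (3 * i)%N) (Sz (j2 I)).
  have -> : (size (balls u (2 ^ (3 * i))))%:R * ((size (balls u (2 ^ j2 I)))%:R / 2 ^+ (2 ^ (i %/ 4 - a)) * 2 ^+ (K * (j2 I).+2 ^ 2)) =
    (size (balls u (2 ^ (3 * i))))%:R * (size (balls u (2 ^ j2 I)))%:R * 2 ^+ (K * (j2 I).+2 ^ 2) / 2 ^+ (2 ^ (i %/ 4 - a)) :> R by ring.
  rewrite ler_pdivrMr// mul1r; apply: (le_trans (ler_wpM2r (ltW (p2 _)) h)).
  rewrite -!exprD; apply: le2; apply: leq_trans fi; rewrite /f (addn2 (j2 I)).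
  have : (3 * i * d <= 3 * d * I)%N by rewrite mulnAC leq_mul2l iI orbT.
  by move: (3 * i * d)%N (3 * d * I)%N (j2 I * d)%N (K * _)%N; clear; lia.
Qed.

End ring.

(** * Exploration of clusters *)

Section explore.
Context (R : realType) (I T : eqType) (p : R).

(** The domain Markov property: given the explored object [t], found by looking only at [U t], the
    unexplored edges keep their law. *)
Lemma Ex_explore (s : seq I) (D : set I -> T) (Ds : seq T) (U : T -> set I) (a b : T -> set I -> R) :
  uniq Ds -> (forall w, D w \in Ds) ->
  (forall t, depends_on (U t) (fun w => D w = t)) ->
  (forall t, depends_on (U t) (a t)) -> (forall t, depends_on (~` U t) (b t)) ->
  Ex p s (fun w => a (D w) w * b (D w) w) =
  \sum_(t <- Ds) Ex p s (fun w => `[< D w = t >]%:R * a t w) * Ex p s (b t).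
Proof.
move=> uD hD dD da db.
rewrite (@eq_Ex _ _ p s _ (fun w => \sum_(t <- Ds) (`[< D w = t >]%:R * a t w) * b t w)); last first.
  move=> w _; rewrite (bigD1_seq (D w)) //= asboolT// mul1r big1 ?addr0// => t /eqP h.
  by rewrite asboolF ?mul0r// => h'; apply: h.
rewrite Ex_sum; apply: eq_bigr => t _; apply: (@Ex_indep _ _ p s (U t) (~` U t)).
- by rewrite setICr.
- by move=> w; rewrite -da; congr (_%:R * _); congr nat_of_bool; rewrite [in LHS]dD.
- exact: db.
Qed.

End explore.

Section hull.
Context (d : nat).
Implicit Types (x y z u v : Zd d) (A B W : set (Zd d)) (w : set (edge d)) (D : seq (Zd d)).

(** The cluster of [W] in [B], as a list filtered from a fixed one, so that it takes finitely many
    values, those of [hulls]. *)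
Definition hull N B W w : seq (Zd d) := [seq z <- balls 0 N | `[< joined_set w B z W >]].

Definition hulls N : seq (seq (Zd d)) :=
  undup [seq mask (val m) (balls 0 N) | m <- enum {: (size (balls (0 : Zd d) N)).-tuple bool}].

Lemma hulls_uniq N : uniq (hulls N). Proof. exact: undup_uniq. Qed.

Lemma mem_hulls N B W w : hull N B W w \in hulls N.
Proof.
rewrite mem_undup; apply/mapP; exists (map_tuple (fun z => `[< joined_set w B z W >]) (in_tuple (balls 0 N))).
  by rewrite mem_enum.
by rewrite /= /hull filter_mask.
Qed.

Lemma mem_hull N B W w z : B `<=` ball 0 N -> (z \in hull N B W w) = `[< joined_set w B z W >].
Proof.
move=> BN; rewrite mem_filter mem_balls; case: asboolP => //= -[v _ /joined_inl Bz].
exact: BN.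
Qed.

(** A path from the hull to [W] stays in the hull, and an edge of [B] that enlarges the hull would
    touch it. *)
Lemma hull_depends N B W D : B `<=` ball 0 N ->
  depends_on (touching [set` D] `&` inside B) (fun w => hull N B W w = D).
Proof.
move=> BN w; set U := touching _ `&` inside _; have sub : w `&` U `<=` w by move=> ? [].
apply: propext; split=> DE; rewrite -[RHS]DE; apply: eq_filter => z; apply: asbool_equiv_eq; split.
- exact: (joined_set_mono sub (fun _ h => h) (fun _ h => h)).
- move=> [v Wv /joinedP[q [q1 q2 q3]]]; exists v => //; apply/joinedP; exists q; split=> // e he.
  split; first exact: q1.
  split; last exact: pedges_inside q3 _ he.
  have [t te tq] := pedges_vertex_tail he; exists t => //=; rewrite -DE mem_hull//; apply/asboolP.
  have tzq : t \in z :: q by rewrite inE tq orbT.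
  have ht : has (pred1 t) (z :: q) by apply/hasP; exists t => //=; exact: eqxx.
  have [a1 [a2 [aE /eqP l1 _]]] := split_first ht.
  exists v => //; apply/joinedP; exists a2; split.
  + by apply: subset_trans q1; rewrite aE pedges_cat l1; right.
  + by rewrite -q2 aE last_cat l1.
  + move=> b hb; apply: q3; rewrite aE -cat_cons mem_cat; move: hb; rewrite inE => /orP[/eqP ->|->].
      by rewrite -l1 mem_last.
    by rewrite orbT.
- move=> [v Wv jv]; apply/asboolP; rewrite -(mem_hull W (w `&` U) z BN) DE; apply: contrapT => nD.
  have Dv : v \in D by rewrite -DE mem_hull//; apply/asboolP; exists v => //; apply: joined_refl; exact: joined_inr jv.
  have [a [b [na nb wab [w1 [w2 [_ _ _ j1 j2]]]]]] := first_exit (B := ~` [set` D]) jv nD (fun f => f Dv).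
  have Db : b \in D by apply: contrapT.
  have Ba : B a by have [] := joined_inr j1.
  have Bb : B b by exact: joined_inl j2.
  apply: na => /=; rewrite -DE mem_hull//; apply/asboolP.
  have := Db; rewrite -DE mem_hull// => /asboolP[v' Wv' j3]; exists v' => //.
  apply: joined_trans j3; apply: joined1 => //; split=> //; split.
    by exists b => //; rewrite !inE eqxx orbT.
  by move=> t; rewrite !inE => /orP[]/eqP ->.
- exact: (joined_set_mono sub (fun _ h => h) (fun _ h => h)).
Qed.

End hull.

(** * Kernel sums over dyadic shells *)

Section sums.
Context (R : realType) (d : nat) (p : R) (E : set (edge d)) (L0 : nat).
Context (hE : lattice_edges E L0) (p01 : 0 < p < 1) (d6 : (6 < d)%N).
Context (c C : R) (c0 : 0 < c) (cC : c < C) (tp : two_point p E c C).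
Implicit Types (x y z u v t : Zd d) (A B O W : set (Zd d)) (w : set (edge d)).

Local Notation EI := (edges_in E).
Local Notation half := (2^-1 : R).

Let p01' : 0 <= p <= 1. Proof. by case/andP: p01 => /ltW -> /ltW ->. Qed.

Lemma sum_shell (u : Zd d) (f : Zd d -> R) a b r : (forall x, 0 <= f x) -> (a <= b)%N ->
  \sum_(z <- balls u b | (r < dist z u)%N) f z <=
  \sum_(z <- balls u a | (r < dist z u)%N) f z + \sum_(z <- balls u b | (a < dist z u)%N) f z.
Proof.
move=> f0 ab; rewrite (bigID (fun z => (dist z u <= a)%N)) /=; apply: lerD.
  apply: ler_sum_sub; rewrite ?balls_uniq// => x _ /andP[h1 h2].
  by rewrite mem_balls.
apply: ler_sum_sub; rewrite ?balls_uniq// => x xb /andP[h1 h2].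
by rewrite ltnNge h2.
Qed.

(** On the shell at scale m the first kernel is at most 2^(-5m), since d - 2 >= 5, and the second
    sums to order 4^m; of the resulting 2^(-3m) only 2^(-m) is kept. *)
Lemma conv_far : exists2 Cv : R, 0 < Cv & forall N j (z a : Zd d),
  \sum_(y <- balls 0 N | (2 ^ j < dist y z)%N) kap z y * kap y a <= Cv * half ^+ j.
Proof.
have d2 : (2 < d)%N by move: d6; clear; lia.
pose Cs : R := 8 ^+ d * 16 * 4; have Cs0 : 0 < Cs by rewrite /Cs !mulr_gt0// exprn_gt0.
exists (Cs * 2); first by rewrite mulr_gt0.
move=> N j z a.
have f0 (y : Zd d) : 0 <= kap z y * kap y a :> R by rewrite mulr_ge0// kap_ge0.
suff H l : \sum_(y <- balls z (2 ^ (j + l)) | (2 ^ j < dist y z)%N) kap z y * kap y a <=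
    Cs * 2 * (half ^+ j - half ^+ (j + l)).
  pose l := (N + dist 0 z)%N; apply: (le_trans (y := \sum_(y <- balls z (2 ^ (j + l)) | (2 ^ j < dist y z)%N) kap z y * kap y a)).
    apply: ler_sum_sub; rewrite ?balls_uniq// => x; rewrite mem_balls => xN h; rewrite mem_balls; split=> //.
    apply: (leq_trans (dist_triangle 0 _ _)); apply: (@leq_trans l); first by rewrite leq_add2r.
    by apply: ltnW; apply: leq_trans (ltn_expl l (ltnSn 1)) _; rewrite leq_exp2l// leq_addl.
  apply: (le_trans (H l)); apply: ler_wpM2l; first by rewrite mulr_ge0// ltW.
  by rewrite lerBlDr lerDl exprn_ge0// invr_ge0.
elim: l => [|l IH].
  rewrite addn0 subrr mulr0 big_seq_cond big1// => y /andP[]; rewrite mem_balls => h.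
  by rewrite ltnNge h.
have jl : (2 ^ (j + l) <= 2 ^ (j + l.+1))%N by rewrite leq_exp2l// leq_add2l.
apply: (le_trans (@sum_shell z (fun y => kap z y * kap y a) _ _ (2 ^ j) f0 jl)).
have -> : half ^+ j - half ^+ (j + l.+1) = half ^+ j - half ^+ (j + l) + half * half ^+ (j + l).
  by rewrite addnS exprS; lra.
rewrite mulrDr; apply: lerD; first exact: IH.
set m := (j + l)%N.
apply: (@le_trans _ _ (\sum_(y <- balls z (2 ^ (j + l.+1))) (half ^+ (m * 5) * kap a y))).
  rewrite [leRHS](bigID (fun y => (2 ^ m < dist y z)%N)) /=; apply: ler_wpDr.
    by apply: sumr_ge0 => y _; rewrite mulr_ge0 ?kap_ge0// exprn_ge0// invr_ge0.
  apply: ler_sum => y h; rewrite (kapC _ y a) ler_wpM2r ?kap_ge0//.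
  apply: (le_trans (kap_far R (r := 2 ^ m) _)); first by rewrite distC ltnW.
  rewrite exprVn lef_pV2 ?posrE ?exprn_gt0 ?ltr0n// exprM.
  apply: (@le_trans _ _ ((2 ^ m).+1%:R ^+ 5)).
    by rewrite -natrX lerXn2r ?nnegrE// ler_nat.
  by apply: ler_weXn2l; [rewrite ler1n|move: d6; clear; lia].
rewrite -mulr_sumr; apply: (le_trans (ler_wpM2l _ (kap_sum p01' d2 a z (j + l.+1)))).
  by rewrite exprn_ge0// invr_ge0.
rewrite -/m (addnS j l) -/m [4 ^+ _]exprS (_ : 4 = 2 ^+ 2 :> R); last by rewrite expr2 -natrM.
rewrite -[2 ^+ 2 ^+ m]exprM /Cs (_ : (m * 5 = 2 * m + m + 2 * m)%N); last by clear; lia.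
clearbody m; move: (2 * m)%N => m2; rewrite !exprD [half ^+ m2]exprVn.
have h1 : 0 < 2 ^+ m2 :> R by rewrite exprn_gt0.
have h2 : 0 < half ^+ m by rewrite exprn_gt0// invr_gt0.
have h3 : (2 ^+ m2)^-1 <= 1 :> R by rewrite invf_le1// exprn_ege1// ler1n.
have -> : (2 ^+ m2)^-1 * half ^+ m * (2 ^+ m2)^-1 * (8 ^+ d * 16 * (2 ^+ 2 * 2 ^+ m2)) =
  (8 ^+ d * 16 * 4) * half ^+ m * (2 ^+ m2)^-1.
  have -> : 2 ^+ 2 = 4 :> R by rewrite expr2 -natrM.
  by field; rewrite gt_eqF.
have h4 : 0 <= 8 ^+ d * 16 * 4 * half ^+ m :> R by rewrite !mulr_ge0 ?exprn_ge0// invr_ge0.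
apply: (le_trans (ler_wpM2l h4 h3)); rewrite mulr1 -[leRHS]mulrA.
have -> : 2 * (half * half ^+ m) = half ^+ m by rewrite mulrA divff ?mul1r// pnatr_eq0.
by [].
Qed.

(** A shell at scale 2^(3i) has kernel 2^(-3i(d-2)) and, by [ring_bound], at most order 2^(i(3d-7))
    further arms in mean; the product is 2^(-i), and the first scale [s0] dominates. *)
Lemma ring_sum K : exists i0 : nat, exists J : nat -> nat, forall s0 m II N u y A O W0 W,
  (i0 <= s0)%N -> O y ->
  (forall i, (s0 < i <= m)%N -> [/\ (i <= II i)%N, (II i <= 7 * d * i)%N, ball u (2 ^ (3 * (II i).+1)) y &
    forall x j, O x -> ball u (2 ^ J (II i)) x -> (dist y x <= 2 ^ j)%N -> (j <= (J (II i)).+1)%N ->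
     half ^+ (K * j.+1 ^ 2) <= Pr p (EI 0 N) (fun w => joined w O y x)]) ->
  (forall i, (s0 < i <= m)%N -> \sum_(z <- balls u (2 ^ (3 * i))) Pr p (EI 0 N) (fun w => joined_set w A z W) <=
    2 ^+ (i * (3 * d - 7))) ->
  \sum_(z <- balls u (2 ^ (3 * m)) | (2 ^ (3 * s0) < dist z u)%N)
     kap u z * Pr p (EI 0 N) (fun w => joined_set w O y W0 /\ joined_set w A z W) <=
  10 * 2 ^+ (3 * d - 7) * half ^+ s0 * Pr p (EI 0 N) (fun w => joined_set w O y W0).
Proof.
have [i0 [J hJ]] := ring_bound hE p01 d6 c0 cC tp K.
exists i0, J => s0 m II N u y A O W0 W is0 Oy hII hA.
set g := Pr _ _ _; have g0 : 0 <= g by exact: Pr_ge0.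
pose F z := kap u z * Pr p (EI 0 N) (fun w => joined_set w O y W0 /\ joined_set w A z W).
have F0 z : 0 <= F z by rewrite mulr_ge0 ?kap_ge0 ?Pr_ge0.
have K0 : 0 <= 10 * 2 ^+ (3 * d - 7) :> R by rewrite mulr_ge0// exprn_ge0.
have e0 n : 0 <= half ^+ n by rewrite exprn_ge0// invr_ge0.
have [ms|sm] := leqP m s0.
  rewrite big_seq_cond big1 ?mulr_ge0 ?exprn_ge0 ?invr_ge0// => z /andP[]; rewrite mem_balls => h1 h2; exfalso.
  have : (2 ^ (3 * m) <= 2 ^ (3 * s0))%N by rewrite leq_exp2l// leq_mul2l ms orbT.
  by move: h1 h2; clear; lia.
suff H l : (s0 + l <= m)%N -> \sum_(z <- balls u (2 ^ (3 * (s0 + l))) | (2 ^ (3 * s0) < dist z u)%N) F z <=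
    10 * 2 ^+ (3 * d - 7) * (half ^+ s0 - half ^+ (s0 + l)) * g.
  have := H (m - s0)%N; rewrite subnKC; last exact: ltnW.
  move=> /(_ (leqnn _)) h; apply: (le_trans h); rewrite ler_wpM2r// ler_wpM2l//.
  by rewrite lerBlDr lerDl.
elim: l => [|l IH] lm.
  rewrite addn0 subrr mulr0 mul0r big_seq_cond big1// => z /andP[]; rewrite mem_balls => h.
  by rewrite ltnNge h.
have le3 : (2 ^ (3 * (s0 + l)) <= 2 ^ (3 * (s0 + l.+1)))%N by rewrite leq_exp2l// leq_mul2l leq_add2l leqnSn orbT.
apply: (le_trans (@sum_shell u F _ _ (2 ^ (3 * s0)) F0 le3)).
have -> : half ^+ s0 - half ^+ (s0 + l.+1) = half ^+ s0 - half ^+ (s0 + l) + half * half ^+ (s0 + l).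
  by rewrite addnS exprS; lra.
rewrite mulrDr mulrDl; apply: lerD; first by apply: IH; rewrite addnS in lm; exact: ltnW.
set i := (s0 + l)%N; rewrite addnS -/i in lm *.
have hi : (s0 < i.+1 <= m)%N by rewrite lm andbT ltnS /i leq_addr.
have [h1 h2 h3 h4] := hII _ hi.
have is1 : (i0 <= i.+1)%N by rewrite (leq_trans is0)// (leq_trans _ (leqnSn _))// /i leq_addr.
have h5 := hJ i.+1 (II i.+1) N u y A O W0 W is1 h1 h2 h3 Oy h4.
have k5 : 0 <= half ^+ (3 * i * (d - 2)) by [].
apply: (@le_trans _ _ (half ^+ (3 * i * (d - 2)) * \sum_(z <- balls u (2 ^ (3 * i.+1)))
   Pr p (EI 0 N) (fun w => joined_set w O y W0 /\ joined_set w A z W))).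
  rewrite mulr_sumr [leRHS](bigID (fun z => (2 ^ (3 * i) < dist z u)%N)) /=; apply: ler_wpDr.
    by apply: sumr_ge0 => z _; rewrite mulr_ge0// Pr_ge0.
  apply: ler_sum => z hz; rewrite /F ler_wpM2r ?Pr_ge0//.
  apply: (le_trans (kap_far R (r := 2 ^ (3 * i)) _)); first by rewrite distC ltnW.
  rewrite exprVn lef_pV2 ?posrE ?exprn_gt0 ?ltr0n// exprM lerXn2r ?nnegrE ?exprn_ge0//.
  by rewrite -natrX ler_nat.
apply: (le_trans (ler_wpM2l k5 (le_trans h5 (ler_wpM2l g0 (lerD (lexx _) (hA _ hi)))))).
rewrite mulrCA mulrC ler_wpM2r//.
have -> : 4 * 2 ^+ (i.+1 * (3 * d - 7)) + 2 ^+ (i.+1 * (3 * d - 7)) = 5 * 2 ^+ (i.+1 * (3 * d - 7)) :> R by lra.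
have -> : 10 * 2 ^+ (3 * d - 7) * (half * half ^+ i) = 5 * 2 ^+ (3 * d - 7) * half ^+ i.
  by field.
have e1 : (3 * i * (d - 2) = i * (3 * d - 7) + i)%N.
  by rewrite -[X in (_ = _ + X)%N]muln1 -mulnDr -mulnA mulnCA; congr (_ * _)%N; move: d6; clear; lia.
rewrite e1 mulSn !exprD !exprVn le_eqVlt; apply/orP; left; apply/eqP.
have h6 n : 2 ^+ n != 0 :> R by rewrite expf_neq0// pnatr_eq0.
by field; rewrite !h6.
Qed.

End sums.

(** * Connections through an opened ball *)

Section links.
Context (R : realType) (d : nat) (p : R) (E : set (edge d)) (L0 : nat).
Context (hE : lattice_edges E L0) (p01 : 0 < p < 1).
Context (c C : R) (C0 : 0 < C) (tp : two_point p E c C).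
Implicit Types (x y z u v t : Zd d) (A B O W V : set (Zd d)) (w : set (edge d)).

Local Notation EI := (edges_in E).

Let p01' : 0 <= p <= 1. Proof. by case/andP: p01 => /ltW -> /ltW ->. Qed.
Let p0 : 0 < p. Proof. by case/andP: p01. Qed.

(** A path through [z] in [S] splits into two disjoint ones, so that by the BK inequality the loss
    is a convolution of two kernels over [S]. *)
Lemma sparse_connect N A (S : set (Zd d)) x y : A `<=` ball 0 N ->
  Pr p (EI 0 N) (fun w => joined w A x y) -
    C ^+ 2 * \sum_(z <- balls 0 N | `[< S z >]) kap x z * kap z y <=
  Pr p (EI 0 N) (fun w => joined w (A `\` S) x y).
Proof.
move=> AN; rewrite lerBlDr.
apply: (@le_trans _ _ (Pr p (EI 0 N) (fun w => joined w (A `\` S) x y) +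
   Pr p (EI 0 N) (fun w => exists2 z, z \in [seq z <- balls 0 N | `[< S z >]] &
      disj_occ (fun w => joined w A x z) (fun w => joined w A z y) w))).
  apply: Pr_split => // w _ /(joined_avoid S)[h|[z Sz h]]; first by left.
  right; exists z => //; rewrite mem_filter asboolT//= mem_balls.
  by have [w1 [w2 [_ _ _ /joined_inr /AN]]] := h.
rewrite lerD2l mulr_sumr -[leRHS]big_filter.
apply: (le_trans (Pr_union p01' (r := [seq z <- balls 0 N | `[< S z >]]) (Y := fun z => disj_occ (fun w => joined w A x z) (fun w => joined w A z y)) _)).
  by move=> w _ [z hz h]; exists z.
apply: ler_sum => z _; apply: (le_trans (BK p01' _ (@joined_incr _ _ _ _) (@joined_incr _ _ _ _))).
have -> : C ^+ 2 * (kap x z * kap z y) = (C * kap x z) * (C * kap z y) by ring.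
apply: ler_pM; rewrite ?Pr_ge0//.
  by apply: (le_trans _ (tp_up tp N x z)); apply: le_Pr => // w _; exact: joined_mono.
by apply: (le_trans _ (tp_up tp N z y)); apply: le_Pr => // w _; exact: joined_mono.
Qed.

Lemma all_open (I : eqType) (s l : seq I) : {subset l <= s} ->
  p ^+ size l <= Pr p s (fun w : set I => forall e, e \in l -> w e).
Proof.
elim: l => [|e l IH] sl; first by rewrite expr0 Pr_true// => w e; rewrite in_nil.
have inc (l' : seq I) : increasing (fun w : set I => forall e, e \in l' -> w e).
  by move=> w w' ww h e' he'; exact/ww/h.
rewrite /= exprS; apply: (@le_trans _ _ (Pr p s (fun w : set I => w e) * Pr p s (fun w : set I => forall e, e \in l -> w e))).
  apply: ler_pM; rewrite ?exprn_ge0 ?(ltW p0)//.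
    by apply: (Pr_edge p01); apply: sl; exact: mem_head.
  by apply: IH => e' he'; apply: sl; rewrite inE he' orbT.
have inc1 : increasing (fun w : set I => w e) by move=> w w' ww h; exact: ww.
have h := Pr_FKG p01' s inc1 (inc l).
apply: (le_trans h).
by apply: le_Pr => // w _ [h1 h2] e'; rewrite inE => /orP[/eqP ->|/h2].
Qed.

Definition opened q z w := forall e, e \in EI z q -> w e.

(** The nearest-neighbor edges already connect the ball: one moves towards [v] in one differing
    coordinate at a time. *)
Lemma opened_joined q z w x y : opened q z w -> ball z q x -> ball z q y -> joined w (ball z q) x y.
Proof.
move=> ho zx zy; suff H n (u v : Zd d) : ball z q u -> ball z q v ->
    (\sum_(i < d) `|u 0%R i - v 0%R i|)%N = n -> joined w (ball z q) u v by exact: H erefl.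
elim: n u v => [|n IH] u v zu zv hn.
  suff -> : u = v by exact: joined_refl.
  apply/rowP => i; move/eqP: hn; rewrite sum_nat_eq0 => /forallP/(_ i); rewrite absz_eq0 subr_eq0.
  by move/eqP.
have [i hi] : exists i : 'I_d, u 0 i != v 0 i.
  apply: contrapT => hno; move: hn; rewrite big1// => i _; apply/eqP.
  rewrite absz_eq0 subr_eq0; apply: contrapT => h; apply: hno; exists i; exact/negP.
pose u' : Zd d := u + axv i (if u 0 i < v 0 i then 1 else - 1).
have u'i : u' 0 i = u 0 i + (if u 0 i < v 0 i then 1 else - 1) by rewrite !mxE eqxx.
have u'j j : j != i -> u' 0 j = u 0 j by move=> ji; rewrite !mxE (negPf ji) addr0.
have zu' : ball z q u'.
  apply/distP => j; have [->|ji] := eqVneq j i; last by rewrite u'j//; exact: (iffLR (distP u z q) zu j).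
  rewrite u'i; have := iffLR (distP u z q) zu i; have := iffLR (distP v z q) zv i; move: hi.
  move: (u 0 i) (v 0 i) (z 0 i); clear => a b e; case: ltP; rewrite ?ler_norml; lia.
apply: (joined_trans (y := u')); last first.
  apply: IH => //; rewrite (bigD1 i)//= u'i.
  rewrite (eq_bigr (fun j => `|u 0%R j - v 0%R j|%N)); last by move=> j ji; rewrite u'j.
  move: hn; rewrite (bigD1 i)//=; move: hi; move: (u 0 i) (v 0 i) (\sum_(j < d | j != i) _)%N; clear.
  by move=> a b e; case: ltP; lia.
apply: joined1 => //; apply: ho; apply/(mem_edges_in hE); split; last by move=> t; rewrite !inE => /orP[]/eqP ->.
rewrite /u'; case: ifP => _.
  rewrite (_ : axv i 1 = delta_mx 0 i); first exact: (edge_axis hE).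
  by apply/rowP => j; rewrite !mxE eqxx; case: (j == i).
rewrite fsetUC {2}(_ : u = u + axv i (-1) + delta_mx 0 i); first exact: (edge_axis hE).
by apply/rowP => j; rewrite !mxE eqxx; case: (j == i); rewrite /= ?addr0 ?subrK.
Qed.

(** A connection from [z1] to [V] through the fully open ball around [z]. The near part avoids [S]
    and the whole cluster of [V] off the ball, so that off the ball it is not joined to [V]: the
    ball is a bottleneck. *)
Definition link N A V S k q z1 z v y w :=
  [/\ joined_set w (A `\` ball 0 k) y V, w [fset v; y]%fset, opened q z w &
    joined w (A `\` (S `|` [set` hull N (A `\` ball z q) V w])) z1 z].

Lemma link_exit w A V S k q z v y x : ball z q `<=` A `\` S -> ball z q `<=` ball 0 k -> S `<=` ball 0 k -> ball z q v ->
  joined_set w (A `\` ball 0 k) y V -> w [fset v; y]%fset -> opened q z w -> ball z q x ->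
  joined_set w (A `\` S) x V.
Proof.
move=> zA zk Sk zv [t Vt jt] wvy ho zx; exists t => //.
have jt' : joined w (A `\` S) y t by apply: joined_mono jt => // a [Aa na]; split=> // /Sk.
apply: (joined_trans (y := y)); last exact: jt'.
apply: (joined_trans (y := v)).
  by apply: joined_mono (opened_joined ho zx zv).
by apply: joined1 => //; [exact: zA|exact: joined_inl jt'].
Qed.

Lemma link_target N A V S k q z1 z v y w : ball z q `<=` A `\` S -> ball z q `<=` ball 0 k -> S `<=` ball 0 k ->
  ball z q v -> link N A V S k q z1 z v y w -> joined_set w (A `\` S) z1 V.
Proof.
move=> zA zk Sk zv [h1 h2 h3 h4]; have := link_exit zA zk Sk zv h1 h2 h3 (ball_center z q).
apply: joined_set_trans; apply: joined_mono h4 => // a [Aa na]; split=> // Sa; by apply: na; left.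
Qed.

(** Two bottlenecks must overlap. The path from [z1] first meets one of two disjoint balls off the
    other one, and from there it is joined to [V] without the other ball; then [z1] is in the hull
    that the other link has to avoid. *)
Lemma link_disjoint N A V S k q z1 z v y z' v' y' w : A `<=` ball 0 N ->
  ball z q `<=` A -> ball z q `<=` ball 0 k -> ball z q v ->
  ball z' q `<=` A -> ball z' q `<=` ball 0 k -> ball z' q v' ->
  link N A V S k q z1 z v y w -> link N A V S k q z1 z' v' y' w ->
  exists2 x, ball z q x & ball z' q x.
Proof.
move=> AN zA zk zv zA' zk' zv' [h1 h2 h3 h4] [h1' h2' h3' h4']; apply: contrapT => hno.
pose Q := ball z q; pose Q' := ball z' q.
(* [b] is the first vertex in either ball; it belongs to one of them and is reached off the
   other. *)
have [b [hb jb]] : exists b, (Q `|` Q') b /\ (joined w (A `\` Q) z1 b /\ ~ Q b \/ joined w (A `\` Q') z1 b /\ ~ Q' b).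
  have [hz1|nz1] := pselect ((Q `|` Q') z1).
    exists z1; split=> //; have Az1 : A z1 by have [] := joined_inl h4.
    have [Qz|nQ] := pselect (Q z1).
      right; have nQ' : ~ Q' z1 by move=> hQ'; apply: hno; exists z1.
      by split=> //; exact: joined_refl.
    by left; split=> //; exact: joined_refl.
  have nQz : ~ (~` (Q `|` Q')) z' by apply; right; exact: ball_center.
  have [a [b [ha hb wab [w1 [w2 [s1 s2 _ j1 j2]]]]]] := first_exit (B := ~` (Q `|` Q')) h4' nz1 nQz.
  have {}hb : (Q `|` Q') b by exact: contrapT.
  have Ab : A b by have [] := joined_inl j2.
  have Aa : A a by have [[]] := joined_inr j1.
  exists b; split=> //; have [Qb|nQ] := pselect (Q b).
    right; have nQ' : ~ Q' b by move=> hQ'; apply: hno; exists b.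
    split=> //; apply: (joined_trans (y := a)).
      by apply: joined_mono j1 => // t [[At _] nt]; split=> // Qt; apply: nt; right.
    by apply: joined1 => //; split=> // Qa; apply: ha; right.
  left; split=> //; apply: (joined_trans (y := a)).
    by apply: joined_mono j1 => // t [[At _] nt]; split=> // Qt; apply: nt; left.
  by apply: joined1 => //; split=> // Qa; apply: ha; left.
have sub : A `\` Q `<=` ball 0 N by move=> t [/AN].
have sub' : A `\` Q' `<=` ball 0 N by move=> t [/AN].
case: jb => -[jb nb].
  have Qb : Q' b by case: hb.
  have : joined_set w (A `\` Q) b V.
    apply: (link_exit _ zk' zk zv' h1' h2' h3' Qb) => t Qt; split; first exact: zA'.
    by move=> Qt'; apply: hno; exists t.
  move=> /(joined_set_trans jb) hh; have [_] := joined_inl h4; apply; right => /=.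
  by rewrite mem_hull//; apply/asboolP.
have Qb : Q b by case: hb.
have : joined_set w (A `\` Q') b V.
  apply: (link_exit _ zk zk' zv h1 h2 h3 Qb) => t Qt; split; first exact: zA.
  by move=> Qt'; apply: hno; exists t.
move=> /(joined_set_trans jb) hh; have [_] := joined_inl h4'; apply; right => /=.
by rewrite mem_hull//; apply/asboolP.
Qed.

(** Once the hull [D] off the ball is explored, the arm of [y] is known. The edge to [y], the edges
    of the ball and the connection avoiding [D] are unexplored, and positively correlated. *)
Lemma link_prob N A V S k q z1 z v y (good : seq (Zd d) -> Prop) (k0 : R) : A `<=` ball 0 N ->
  ball z q `<=` ball 0 k -> ball z q `<=` ball 0 N -> ball z q v -> ball 0 N y -> E [fset v; y]%fset -> 0 <= k0 ->
  (forall D, good D -> k0 <= Pr p (EI 0 N) (fun w => joined w (A `\` (S `|` [set` D])) z1 z)) ->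
  p ^+ (size (EI z q)).+1 * k0 *
    Pr p (EI 0 N) (fun w => joined_set w (A `\` ball 0 k) y V /\ good (hull N (A `\` ball z q) V w)) <=
  Pr p (EI 0 N) (link N A V S k q z1 z v y).
Proof.
move=> AN zk zN zv Ny Evy k00 hk.
pose B := A `\` ball z q; have BN : B `<=` ball 0 N by move=> t [/AN].
(* Edges with an end in the ball, the edge from [v] to [y] among them, are not in [inside B] and so
   remain unexplored. *)
pose U (D : seq (Zd d)) := touching [set` D] `&` inside B.
pose a (D : seq (Zd d)) w : R := `[< joined_set (w `&` U D) (A `\` ball 0 k) y V /\ good D >]%:R.
pose b (D : seq (Zd d)) w : R := `[< (w [fset v; y]%fset /\ opened q z w) /\ joined w (A `\` (S `|` [set` D])) z1 z >]%:R.
have aE w : `[< joined_set w (A `\` ball 0 k) y V /\ good (hull N B V w) >]%:R = a (hull N B V w) w.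
  congr (_%:R); congr nat_of_bool; apply: asbool_equiv_eq; split=> -[h1 h2]; split=> //; last first.
    by apply: joined_set_mono h1 => // ? [].
  have [t Vt /joinedP[r [r1 r2 r3]]] := h1; exists t => //; apply/joinedP; exists r; split=> // e he.
  have rB x : x \in y :: r -> B x by move=> /r3[Ax nx]; split=> // /zk.
  split; first exact: r1.
  split; last by move=> x xe; apply: rB; exact: pedges_vertex he xe.
  have [x xe xr] := pedges_vertex_tail he; exists x => //=; rewrite mem_hull//; apply/asboolP.
  have xyr : x \in y :: r by rewrite inE xr orbT.
  have hx : has (pred1 x) (y :: r) by apply/hasP; exists x => //=; exact: eqxx.
  have [a1 [a2 [aE' /eqP l1 _]]] := split_first hx; exists t => //; apply/joinedP; exists a2; split.
  - by apply: subset_trans r1; rewrite aE' pedges_cat l1; right.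
  - by rewrite -r2 aE' last_cat l1.
  - move=> b0 hb0; apply: rB; rewrite aE' -cat_cons mem_cat; move: hb0; rewrite inE => /orP[/eqP ->|->].
      by rewrite -l1 mem_last.
    by rewrite orbT.
have bE w : `[< link N A V S k q z1 z v y w >]%:R >= a (hull N B V w) w * b (hull N B V w) w.
  rewrite -aE -natrM mulnb ler_nat; case: asboolP => //= -[h1 _]; case: asboolP => //= -[[h2 h3] h4].
  by rewrite asboolT.
have Uvy D : ~ U D [fset v; y]%fset.
  by move=> [_ /(_ v)]; rewrite !inE eqxx => /(_ isT) [_]; apply.
have Uop D e : e \in EI z q -> ~ U D e.
  move=> /(mem_edges_in hE)[/(edge_range hE)[x [x' [-> _ _]]] ie] [_ /(_ x)].
  by rewrite !inE eqxx => /(_ isT) [_]; apply; apply: ie; rewrite !inE eqxx.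
have db D : depends_on (~` U D) (b D).
  move=> w; rewrite /b; congr (_%:R); congr nat_of_bool; apply: asbool_equiv_eq.
  have h1 : w [fset v; y]%fset <-> (w `&` ~` U D) [fset v; y]%fset.
    by split=> [h|[]//]; split=> //; exact: Uvy.
  have h2 : opened q z w <-> opened q z (w `&` ~` U D).
    by split=> h e he; [split; [exact: h|exact: Uop]|have [] := h e he].
  have h3 : joined w (A `\` (S `|` [set` D])) z1 z <-> joined (w `&` ~` U D) (A `\` (S `|` [set` D])) z1 z.
    split; last by apply: joined_mono => // ? [].
    rewrite joined_depends; apply: joined_mono => // e [we ie]; split=> // -[[t te Dt] _].
    by have [_] := ie _ te; apply; right.
  by rewrite h1 h2 h3.
have da D : depends_on (U D) (a D) by move=> w; rewrite /a -setIA setIid.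
have lb D : good D -> p ^+ (size (EI z q)).+1 * k0 <= Ex p (EI 0 N) (b D).
  move=> gD; rewrite -/(Pr p (EI 0 N) (fun w => (w [fset v; y]%fset /\ opened q z w) /\ joined w (A `\` (S `|` [set` D])) z1 z)).
  have inc1 : increasing (fun w => w [fset v; y]%fset /\ opened q z w).
    by move=> w w' ww [h1 h2]; split; [exact: ww|move=> e he; apply: ww; exact: h2].
  apply: (le_trans _ (Pr_FKG p01' _ inc1 (@joined_incr _ _ _ _))).
  apply: ler_pM => //; [by rewrite exprn_ge0// ltW| |exact: hk].
  have sl : {subset [fset v; y]%fset :: EI z q <= EI 0 N}.
    move=> e; rewrite inE => /orP[/eqP ->|]; last by move=> he; rewrite (edges_in_mono hE zN he).
    apply/(mem_edges_in hE); split=> // t; rewrite !inE => /orP[]/eqP ->//; exact: zN.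
  apply: (le_trans (all_open sl)); apply: le_Pr => // w _ h; split; first by apply: h; exact: mem_head.
  by move=> e he; apply: h; rewrite inE he orbT.
rewrite /Pr (eq_Ex p (fun w _ => aE w)).
apply: (le_trans _ (le_Ex p01' (fun w _ => bE w))).
rewrite (Ex_explore p (EI 0 N) (hulls_uniq _ N) (mem_hulls N B V) (U := U) _ da db); last by move=> D; exact: hull_depends.
rewrite (@eq_Ex _ _ p (EI 0 N) (fun w => a (hull N B V w) w) (fun w => a (hull N B V w) w * (fun _ _ => 1) (hull N B V w) w)); last by move=> w _; rewrite mulr1.
rewrite (Ex_explore p (EI 0 N) (hulls_uniq _ N) (mem_hulls N B V) (U := U) _ da (b := fun _ _ => 1)) //; last by move=> D; exact: hull_depends.
rewrite mulr_sumr; apply: ler_sum => D _; rewrite Ex_cst mulr1 mulrC.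
have [gD|ngD] := pselect (good D).
  by rewrite ler_wpM2l ?lb// Ex_ge0// => w _; rewrite mulr_ge0.
have a0 : Ex p (EI 0 N) (fun w => `[< hull N B V w = D >]%:R * a D w) = 0.
  rewrite -[RHS](Ex_cst p (EI 0 N)); apply: eq_Ex => w _.
  by rewrite (_ : a D w = 0) ?mulr0// /a asboolF// => -[_].
by rewrite a0 !mul0r.
Qed.

(** By position of z: points of [S] and points of [D] near the origin are far from [z'], other
    points of [D] within [m] of [z'] are far from [z1], and the rest is a convolution tail. Far
    kernels are replaced by k8^(2-d), which leaves the single sums [e1], [e3] and [e2]. *)
Lemma sparse_sum N k8 b m q z1 z' (S : set (Zd d)) (D : seq (Zd d)) (e1 e2 e3 : R) :
  (b <= k8)%N -> (q + L0 <= k8)%N -> (2 * dist z1 0 <= b)%N -> (8 * k8 <= dist z' 0 + (q + L0))%N ->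
  S `<=` ball 0 b -> (forall z, z \in D -> (b < dist z 0)%N) ->
  \sum_(z <- balls 0 b | `[< S z >]) kap z1 z <= e1 ->
  \sum_(z <- balls z' m | z \in D) kap z' z <= e2 ->
  \sum_(z <- balls 0 (8 * k8) | z \in D) kap 0 z <= e3 ->
  \sum_(z <- balls 0 N | `[< (S `|` [set` D]) z >]) kap z1 z * kap z z' <=
   (k8.+1%:R ^+ (d - 2))^-1 * (e1 + e2 + 2 ^+ (d - 2) * e3) +
   \sum_(z <- balls 0 N | (m < dist z z')%N) kap z' z * kap z z1.
Proof.
move=> bk qk z1b z'k Sb Db h1 h2 h3; set k0 := (_ ^+ _)^-1.
have k00 : 0 <= k0 by rewrite invr_ge0 exprn_ge0.
have kk0 (x y : Zd d) : 0 <= kap x y :> R := kap_ge0 _ _ _.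
pose f z : R := (if `[< S z >] then k0 * kap z1 z else 0) +
  (if (z \in D) && (dist z z' <= m)%N then k0 * kap z' z else 0) +
  (if (z \in D) && (dist z 0 <= 8 * k8)%N then k0 * (2 ^+ (d - 2) * kap 0 z) else 0) +
  (if (m < dist z z')%N then kap z' z * kap z z1 else 0).
have two0 : 0 <= 2 ^+ (d - 2) :> R by rewrite exprn_ge0.
have f0 z : 0 <= f z by rewrite /f !addr_ge0//; case: ifP => _ //; rewrite ?mulr_ge0.
apply: (@le_trans _ _ (\sum_(z <- balls 0 N) f z)).
  rewrite [leRHS](bigID (fun z => `[< (S `|` [set` D]) z >])) /=; apply: ler_wpDr; first exact: sumr_ge0.
  apply: ler_sum => z /asboolP hz.
  have t0 : (dist z' 0 <= dist z z' + dist z 0)%N by rewrite (distC z z'); exact: dist_triangle.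
  have t1 : (dist z 0 <= dist z1 z + dist z1 0)%N by rewrite (distC z1 z); exact: dist_triangle.
  have far1 : (k8 <= dist z z')%N -> kap z z' <= k0 by exact: kap_far.
  have far2 : (k8 <= dist z1 z)%N -> kap z1 z <= k0 by exact: kap_far.
  have [Sz|nS] := pselect (S z).
    apply: (@le_trans _ _ (k0 * kap z1 z)).
      rewrite mulrC ler_wpM2r//; apply: far1; have := Sb _ Sz; rewrite /ball /=.
      by move: bk qk z'k t0; clear; lia.
    rewrite /f asboolT// -!addrA lerDl !addr_ge0//; case: ifP => _ //; rewrite ?mulr_ge0//.
  have Dz : z \in D by case: hz.
  rewrite /f asboolF// add0r Dz /=.
  have [zm|mz] := leqP (dist z z') m; last first.
    rewrite add0r (kapC _ z1) (kapC _ z z') mulrC lerDr; case: ifP => _ //; rewrite ?mulr_ge0//.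
  have [zk|kz] := leqP (dist z 0) (2 * k8).
    have zk8 : (dist z 0 <= 8 * k8)%N by apply: leq_trans zk _; rewrite leq_mul2r orbT.
    rewrite zk8 addr0; apply: ler_wpDl; first by rewrite mulr_ge0.
    rewrite mulrC; apply: ler_pM => //.
      by apply: far1; move: bk qk z'k t0 zk; clear; lia.
    rewrite -[2 in leRHS]/(2%:R); apply: kap_comp; rewrite (distC 0).
    by have := Db _ Dz; rewrite (distC z 0) in t1 *; move: z1b t1; clear; lia.
  rewrite addr0; apply: ler_wpDr; first by case: ifP => _ //; rewrite ?mulr_ge0.
  rewrite (kapC _ z z') ler_wpM2r//; apply: far2.
  by move: bk z1b kz t1; clear; lia.
rewrite /f !big_split /= -!big_mkcond /= -!mulr_sumr lerD2r !mulrDr; apply: lerD; first apply: lerD.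
- rewrite ler_wpM2l//; apply: le_trans h1; apply: ler_sum_sub; rewrite ?balls_uniq// => z _ /asboolP Sz.
  by split; [rewrite mem_balls; exact: Sb|exact/asboolP].
- rewrite ler_wpM2l//; apply: le_trans h2; apply: ler_sum_sub; rewrite ?balls_uniq// => z _ /andP[h4 h5].
  by rewrite mem_balls.
- rewrite ler_wpM2l// ler_wpM2l//; apply: le_trans h3; apply: ler_sum_sub; rewrite ?balls_uniq// => z _ /andP[h4 h5].
  by rewrite mem_balls.
Qed.

End links.

(** * Tools for the lower bound on arms *)

Section outer_tools.
Context (R : realType) (d : nat) (p : R) (E : set (edge d)) (L0 : nat).
Context (hE : lattice_edges E L0) (p01 : 0 < p < 1) (d6 : (6 < d)%N).
Context (c C : R) (c0 : 0 < c) (cC : c < C) (tp : two_point p E c C).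
Implicit Types (x y z u v t : Zd d) (A B O W V : set (Zd d)) (w : set (edge d)).

Local Notation EI := (edges_in E).
Local Notation half := (2^-1 : R).

Let p01' : 0 <= p <= 1. Proof. by case/andP: p01 => /ltW -> /ltW ->. Qed.
Let C0 : 0 < C. Proof. exact: lt_trans c0 cC. Qed.

Lemma half_small (e : R) : 0 < e -> exists n0 : nat, forall n, (n0 <= n)%N -> half ^+ n <= e.
Proof.
move=> e0; have [n0 h] := half_pow e0; exists n0 => n hn; apply: le_trans h.
exact: half_pow_le.
Qed.

Lemma small_arm (e : R) (r : nat) : 0 < e -> exists R0 : nat, forall Rr N A V z,
  (R0 <= Rr)%N -> V `&` ball 0 Rr = set0 -> (dist z 0 <= r)%N ->
  Pr p (EI 0 N) (fun w => joined_set w A z V) <= e.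
Proof.
move=> e0; have [C1 [C2 C20 h]] := one_arm hE p01 d6 c0 cC tp.
have [t ht] := half_small (divr_gt0 e0 C20).
exists (r + 2 ^ (C1 * t.+1 ^ 2))%N => Rr N A V z hR VR zr.
apply: (@le_trans _ _ (C2 * 4^-1 ^+ t)).
  apply: (le_trans _ (h t N z _ (leqnn _))); apply: le_Pr => // w _ [v Vv jv].
  exists v; last by apply: joined_mono jv.
  move=> zv; have : (V `&` ball 0 Rr) v.
    split=> //; apply: leq_trans (dist_triangle z _ _) _; apply: leq_trans hR.
    by rewrite addnC leq_add.
  by rewrite VR.
rewrite mulrC -ler_pdivlMr//; apply: le_trans (ht t (leqnn _)); rewrite lerXn2r ?nnegrE ?invr_ge0//.
by rewrite lef_pV2 ?posrE// ler_nat.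
Qed.

(** Markov's inequality, with the inner radius [s] below which [D] has no point kept in the sum. *)
Lemma markov_dist N u (m s : nat) (D : set (edge d) -> seq (Zd d)) (X : set (edge d) -> Prop) A W (thr : R) :
  0 < thr -> (forall w z, z \in D w -> joined_set w A z W) ->
  Pr p (EI 0 N) (fun w => X w /\ ((forall z, z \in D w -> (dist z u <= m)%N -> (s < dist z u)%N) /\
     thr < \sum_(z <- balls u m | z \in D w) kap u z)) <=
  thr^-1 * \sum_(z <- balls u m | (s < dist z u)%N) kap u z * Pr p (EI 0 N) (fun w => X w /\ joined_set w A z W).
Proof.
move=> thr0 hD; rewrite ler_pdivlMl// -ExZ.
rewrite (eq_bigr (fun z => Ex p (EI 0 N) (fun w => kap u z * `[< X w /\ joined_set w A z W >]%:R))); last first.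
  by move=> z _; rewrite ExZ.
rewrite -Ex_sum; apply: le_Ex => // w _; case: asboolP => [[Xw [h1 h2]]|_]; last first.
  by rewrite mulr0; apply: sumr_ge0 => z _; rewrite mulr_ge0// kap_ge0.
rewrite mulr1; apply: (le_trans (ltW h2)).
rewrite big_seq_cond [leRHS]big_seq_cond.
apply: (@le_trans _ _ (\sum_(z <- balls u m | (z \in balls u m) && (z \in D w)) kap u z * `[< X w /\ joined_set w A z W >]%:R)).
  apply: ler_sum => z /andP[_ zD]; rewrite asboolT ?mulr1//; split=> //; exact: hD zD.
apply: ler_sum_sub; rewrite ?balls_uniq//.
  by move=> z zb /andP[_ zD]; split=> //; rewrite zb /=; apply: h1 => //; rewrite -mem_balls.
by move=> z; rewrite mulr_ge0// kap_ge0.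
Qed.

(** A sum of probabilities of events that imply [T] is useful only if few of them can occur at
    once. *)
Lemma Pr_sum_mult (J : eqType) (l : seq J) N (L : J -> set (edge d) -> Prop) (T : set (edge d) -> Prop) (M : nat) :
  (forall w e, w `<=` [set` EI 0 N] -> e \in l -> L e w -> T w) ->
  (forall w, w `<=` [set` EI 0 N] -> (count (fun e => `[< L e w >]) l <= M)%N) ->
  \sum_(e <- l) Pr p (EI 0 N) (L e) <= M%:R * Pr p (EI 0 N) T.
Proof.
move=> h1 h2; rewrite /Pr -Ex_sum -ExZ; apply: le_Ex => // w ws.
rewrite -natr_sum (_ : (\sum_(e <- l) _)%N = count (fun e => `[< L e w >]) l); last first.
  by rewrite -sum1_count [RHS]big_mkcond; apply: eq_bigr => e _; case: asboolP.
case: asboolP => hT; first by rewrite mulr1 ler_nat h2.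
rewrite mulr0 (_ : count _ _ = 0%N)//; apply/eqP; rewrite -leqn0 leqNgt -has_count; apply/hasPn => e el.
by apply/negP => /asboolP /(h1 _ _ ws el).
Qed.

Definition clamp (n : nat) x : Zd d :=
  \row_i (if n%:Z < x 0 i then n%:Z else if x 0 i < - n%:Z then - n%:Z else x 0 i).

Lemma clamp_in n x : ball 0 n (clamp n x).
Proof.
apply/distP => i; rewrite !mxE subr0; move: (x 0 i); clear => a.
by case: ltP => h; [|case: ltP => h']; rewrite ler_norml; lia.
Qed.

Lemma clamp_dist n q x : ball 0 (n + q) x -> ball (clamp n x) q x.
Proof.
move=> /distP hx; apply/distP => i; have := hx i; rewrite !mxE subr0; move: (x 0 i); clear => a.
by case: ltP => h; [|case: ltP => h']; rewrite !ler_norml; lia.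
Qed.

(** Pairs whose balls pairwise meet all lie within a bounded distance of a first one. *)
Lemma count_near_le (l : seq (Zd d * Zd d)) (P : pred (Zd d * Zd d)) (zc : Zd d * Zd d -> Zd d) q : uniq l ->
  (forall e, e \in l -> ball (zc e) q e.1 /\ (dist e.1 e.2 <= L0)%N) ->
  (forall e e', e \in l -> e' \in l -> P e -> P e' -> exists2 x, ball (zc e) q x & ball (zc e') q x) ->
  (count P l <= (3 * q).*2.+1 ^ d * (3 * q + L0).*2.+1 ^ d)%N.
Proof.
move=> ul hl hP; have [|no] := boolP (has P l); last first.
  by rewrite leqNgt; apply: contra no => h; rewrite has_count (leq_ltn_trans _ h).
move=> /hasP[e0 e0l Pe0]; rewrite -size_filter.
rewrite -(size_balls (zc e0) (3 * q)) -(size_balls (zc e0) (3 * q + L0)) -(size_allpairs pair).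
apply: uniq_leq_size; first exact: filter_uniq.
move=> [v y]; rewrite mem_filter => /andP[Pe el]; have [h1 /= h2] := hl _ el.
have [x x1 x2] := hP _ _ e0l el Pe0 Pe; rewrite /ball /= in h1 x1 x2.
have h3 : (dist v (zc e0) <= 3 * q)%N.
  rewrite (_ : (3 * q = q + (q + q))%N); last by clear; lia.
  apply: (leq_trans (dist_triangle (zc (v, y)) _ _)); rewrite leq_add//.
  by apply: (leq_trans (dist_triangle x _ _)); rewrite distC leq_add.
apply/allpairsP; exists (v, y); split=> //=; rewrite mem_balls//.
by apply: (leq_trans (dist_triangle v _ _)); rewrite addnC leq_add// distC.
Qed.

Lemma outer_ub N A V k : A `<=` ball 0 N -> V `&` ball 0 k = set0 ->
  Pr p (EI 0 N) (fun w => joined_set w A 0 V) <=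
  \sum_(vy <- exits E L0 0 k) C * kap 0 vy.1 * Pr p (EI 0 N) (fun w => joined_set w (A `\` ball 0 k) vy.2 V).
Proof.
move=> AN Vk; apply: (@le_trans _ _ (\sum_(vy <- exits E L0 0 k) Pr p (EI 0 N)
   (disj_occ (fun w => joined w setT 0 vy.1) (fun w => joined_set w (A `\` ball 0 k) vy.2 V)))).
  apply: Pr_union => // w /(edges_inE hE) wE [v Vv jv].
  have nv : ~ ball 0 k v by move=> kv; have : (V `&` ball 0 k) v by []; rewrite Vk.
  have [a [b [ha hb wab hd]]] := last_exit jv (ball_center 0 k) nv.
  exists (a, b); first by apply/(mem_exits hE); split=> //; exact: wE.
  by apply: disj_occ_mono hd => [w'|w' jb] /=; [exact: joined_mono|exists v].
apply: ler_sum => -[v y] _ /=.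
apply: (le_trans (BK p01' _ (@joined_incr _ _ _ _) (@joined_set_incr _ _ _ _))).
by rewrite ler_wpM2r ?Pr_ge0//; exact: (tp_up tp).
Qed.

Lemma exits_sum_le k (f : Zd d -> R) M : (forall y, 0 <= f y) -> (k + L0 <= M)%N ->
  \sum_(vy <- exits E L0 0 k) f vy.2 <= (L0.*2.+1 ^ d)%:R * \sum_(y <- balls 0 M) f y.
Proof.
move=> f0 kM; rewrite mulr_sumr.
apply: (@le_trans _ _ (\sum_(vy <- exits E L0 0 k) \sum_(y <- balls 0 M) (if vy.2 == y then f y else 0))).
  rewrite big_seq [leRHS]big_seq; apply: ler_sum => -[v y] /(mem_exits hE)[kv ky Evy] /=.
  rewrite (bigD1_seq y) ?balls_uniq//=; first by rewrite eqxx lerDl sumr_ge0// => z _; case: ifP.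
  rewrite mem_balls; apply: leq_trans kM; apply: (leq_trans (dist_triangle v _ _)).
  rewrite addnC leq_add//; by have := edge_dist hE Evy; rewrite distC.
rewrite exchange_big /=; apply: ler_sum => y _.
rewrite -big_mkcond /= big_const_seq iter_addr_0 -[leLHS]mulr_natl ler_wpM2r// ler_nat.
rewrite -size_filter -(size_balls y L0) -(size_map fst).
apply: uniq_leq_size.
  rewrite map_inj_in_uniq; first by rewrite filter_uniq// exits_uniq.
  by move=> [a b] [a' b']; rewrite !mem_filter /= => /andP[/eqP -> _] /andP[/eqP -> _] ->.
move=> v /mapP[[v' y'] + ->]; rewrite mem_filter => /andP[/eqP /= -> /(mem_exits hE)[_ _ Evy]].
by rewrite mem_balls; have := edge_dist hE Evy.
Qed.

Lemma size_EI u k : (size (EI u k) <= (k.*2.+1 ^ d) ^ 2)%N.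
Proof.
rewrite -(size_balls u k) (leq_trans (size_undup _))// size_filter (leq_trans (count_size _ _))// size_allpairs.
by rewrite mulnn.
Qed.

End outer_tools.

(** * Arms that start elsewhere and avoid a sparse set *)

Section outer_core.
Context (R : realType) (d : nat) (p : R) (E : set (edge d)) (L0 : nat).
Context (hE : lattice_edges E L0) (p01 : 0 < p < 1) (d6 : (6 < d)%N).
Context (c C : R) (c0 : 0 < c) (cC : c < C) (tp : two_point p E c C).
Implicit Types (x y z u v t : Zd d) (A B O W V S : set (Zd d)) (w : set (edge d)).

Local Notation EI := (edges_in E).
Local Notation half := (2^-1 : R).

Let p01' : 0 <= p <= 1. Proof. by case/andP: p01 => /ltW -> /ltW ->. Qed.
Let p0 : 0 < p. Proof. by case/andP: p01. Qed.
Let C0 : 0 < C. Proof. exact: lt_trans c0 cC. Qed.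

(** The admissible arm events in the box of radius [N]: [A] stands for the complement of D_n, and
    nothing is changed within distance [r] of the origin. *)
Definition target N r A V := [/\ A `<=` ball 0 N, ball 0 r `<=` A & V `&` ball 0 r = set0].

(** What a hull must satisfy to be avoidable on the way to [z]. The sum around [z] stops at radius
    [m], because the convolution tail covers the points beyond. *)
Definition sparse k b m (eta : R) z (D : seq (Zd d)) :=
  [/\ forall x, x \in D -> (b < dist x 0)%N,
      \sum_(x <- balls z m | x \in D) kap z x <= eta &
      \sum_(x <- balls 0 k | x \in D) kap 0 x <= eta].

Definition outside_sum N A V k : R :=
  \sum_(e <- exits E L0 0 k) Pr p (EI 0 N) (fun w => joined_set w (A `\` ball 0 k) e.2 V).

(** The exit vertex is projected to a slightly smaller box, so that the ball to be opened contains
    it and stays inside the box. *)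
Lemma exit_geometry k8 q v y : (q + L0 <= k8)%N -> (v, y) \in exits E L0 0 (8 * k8) ->
  let z := clamp (8 * k8 - q) v in
  [/\ ball z q v, ball z q `<=` ball 0 (8 * k8), (8 * k8 <= dist z 0 + (q + L0))%N,
      (dist y z <= q + L0)%N & (8 * k8 < dist v 0 + L0)%N].
Proof.
move=> qk /(mem_exits hE)[kv ky Evy] z.
have qk8 : (q <= 8 * k8)%N by move: qk; clear; lia.
have zv : ball z q v by apply: clamp_dist; rewrite subnK.
have vy : (dist v y <= L0)%N by have := edge_dist hE Evy.
have kv' : (8 * k8 < dist v 0 + L0)%N.
  have := dist_triangle v y 0; rewrite (distC y v); move: ky vy; rewrite /ball /=.
  by move=> /negP; rewrite -ltnNge; clear; lia.
split=> //.
- by apply: ball_sub; rewrite -[leqRHS](subnK qk8) leq_add2r; exact: clamp_in.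
- have := dist_triangle z v 0; move: zv kv'; rewrite /ball /=; clear; lia.
- by apply: (leq_trans (dist_triangle v _ _)); rewrite addnC leq_add// distC.
Qed.

(** Every link leads to [V] off [S], and by [link_disjoint] a bounded number of links occurs at
    once. Summing [link_prob] over the exits with a sparse hull, at least half of the outside sum,
    gives the bound. *)
Lemma outer_core N A V k8 b q m (eta k0 : R) z1 S : (q + L0 <= k8)%N -> (b <= k8)%N -> (2 * q + L0 < 7 * k8)%N ->
  target N (8 * k8 + L0) A V -> S `<=` ball 0 b -> 0 <= k0 ->
  \sum_(e <- exits E L0 0 (8 * k8)) Pr p (EI 0 N) (fun w => joined_set w (A `\` ball 0 (8 * k8)) e.2 V /\
     ~ sparse (8 * k8) b m eta (clamp (8 * k8 - q) e.1) (hull N (A `\` ball (clamp (8 * k8 - q) e.1) q) V w)) <=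
    half * outside_sum N A V (8 * k8) ->
  (forall v y D, (v, y) \in exits E L0 0 (8 * k8) -> sparse (8 * k8) b m eta (clamp (8 * k8 - q) v) D ->
     k0 <= Pr p (EI 0 N) (fun w => joined w (A `\` (S `|` [set` D])) z1 (clamp (8 * k8 - q) v))) ->
  p ^+ ((q.*2.+1 ^ d) ^ 2).+1 * k0 * (half * outside_sum N A V (8 * k8)) <=
  ((3 * q).*2.+1 ^ d * (3 * q + L0).*2.+1 ^ d)%N%:R * Pr p (EI 0 N) (fun w => joined_set w (A `\` S) z1 V).
Proof.
move=> qk bk qk7 [AN kA VA] Sb k00 hbad hk; set k := (8 * k8)%N.
pose zc (e : Zd d * Zd d) := clamp (k - q) e.1.
have kkA : ball 0 k `<=` A by apply: subset_trans kA; apply: ball_subr; rewrite leq_addr.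
pose X (e : Zd d * Zd d) w := joined_set w (A `\` ball 0 k) e.2 V.
pose good (e : Zd d * Zd d) w := sparse k b m eta (zc e) (hull N (A `\` ball (zc e) q) V w).
have geo e : e \in exits E L0 0 k -> [/\ ball (zc e) q e.1, ball (zc e) q `<=` ball 0 k,
    (8 * k8 <= dist (zc e) 0 + (q + L0))%N, (dist e.2 (zc e) <= q + L0)%N & (8 * k8 < dist e.1 0 + L0)%N].
  by case: e => v y; exact: exit_geometry.
have Sk : S `<=` ball 0 k by apply: subset_trans Sb _; apply: ball_subr; move: bk; rewrite /k; clear; lia.
have hlow : half * outside_sum N A V k <= \sum_(e <- exits E L0 0 k) Pr p (EI 0 N) (fun w => X e w /\ good e w).
  have : outside_sum N A V k <= \sum_(e <- exits E L0 0 k) Pr p (EI 0 N) (fun w => X e w /\ good e w) +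
      \sum_(e <- exits E L0 0 k) Pr p (EI 0 N) (fun w => X e w /\ ~ good e w).
    rewrite -big_split /=; apply: ler_sum => e _; apply: Pr_split => // w _ Xw.
    by have [g|ng] := pselect (good e w); [left|right].
  by move: hbad; rewrite -/k -/(outside_sum N A V k) /X /good /zc; lra.
pose L e := link E N A V S k q z1 (zc e) e.1 e.2.
have links e : e \in exits E L0 0 k -> p ^+ ((q.*2.+1 ^ d) ^ 2).+1 * k0 *
    Pr p (EI 0 N) (fun w => X e w /\ good e w) <= Pr p (EI 0 N) (L e).
  move=> he; have [g1 g2 g3 g4 g5] := geo _ he; have := he; case: e he g1 g2 g3 g4 g5 => v y /= he g1 g2 g3 g4 g5.
  move=> /(mem_exits hE)[kv ky Evy].
  have yN : ball 0 N y.
    apply: AN; apply: kA; apply: (leq_trans (dist_triangle v _ _)); rewrite addnC leq_add//.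
    by have := edge_dist hE Evy; rewrite distC.
  apply: (le_trans _ (link_prob hE p01 V AN g2 (subset_trans g2 (subset_trans kkA AN)) g1 yN Evy k00 (hk v y ^~ he))).
  rewrite ler_wpM2r ?Pr_ge0// ler_wpM2r//; apply: ler_wiXn2l; rewrite ?(ltW p0)//; first by case/andP: p01'.
  by rewrite ltnS; exact: (size_EI).
apply: (le_trans (ler_wpM2l _ hlow)); first by rewrite mulr_ge0// exprn_ge0// ltW.
rewrite mulr_sumr; apply: (@le_trans _ _ (\sum_(e <- exits E L0 0 k) Pr p (EI 0 N) (L e))).
  by rewrite big_seq [leRHS]big_seq; apply: ler_sum => e; exact: links.
have QA e : e \in exits E L0 0 k -> ball (zc e) q `<=` A `\` S.
  move=> he; have [g1 g2 g3 g4 g5] := geo _ he; move=> t ht; split; first by apply: kkA; exact: g2.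
  move=> /Sb; rewrite /ball /= => tb; move: ht; rewrite /ball /= => ht.
  have := dist_triangle t (zc e) 0; rewrite (distC (zc e) t); move: g3 tb ht bk qk7; clear; lia.
apply: (Pr_sum_mult p01 (T := fun w => joined_set w (A `\` S) z1 V)).
  move=> w e ws he Le; have [g1 g2 _ _ _] := geo _ he.
  exact: (link_target hE (QA _ he) g2 Sk g1 Le).
move=> w ws; apply: (count_near_le (zc := zc)); first exact: exits_uniq.
  move=> [v y] he; have [g1 _ _ _ _] := geo _ he; split=> //.
  by have /(mem_exits hE)[_ _ Evy] := he; have := edge_dist hE Evy.
move=> e e' he he' /asboolP Le /asboolP Le'.
have [g1 g2 _ _ _] := geo _ he; have [g1' g2' _ _ _] := geo _ he'.
have QA0 e0 : e0 \in exits E L0 0 k -> ball (zc e0) q `<=` A by move=> /QA h t /h[].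
exact: (link_disjoint hE AN (QA0 _ he) g2 g1 (QA0 _ he') g2' g1' Le Le').
Qed.

(** The unrestricted connection has probability at least t3 * kk; the sparse part and the tail of
    the convolution each cost at most a quarter of it. *)
Lemma sparse_connect_lb N A k8 b q m (eta Cv t3 kk : R) z1 S z D N0 :
  (b <= k8)%N -> (q + L0 <= k8)%N -> (2 * dist z1 0 <= b)%N -> (8 * k8 <= dist z 0 + (q + L0))%N -> ball 0 (8 * k8) z ->
  A `<=` ball 0 N -> ball 0 N0 `<=` A -> (N0 <= N)%N ->
  (forall x y, ball 0 (16 * k8) x -> ball 0 (16 * k8) y ->
     c * kap x y <= Pr p (EI 0 N) (fun w => joined w (ball 0 N0) x y)) ->
  S `<=` ball 0 b -> \sum_(x <- balls 0 b | `[< S x >]) kap z1 x <= eta ->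
  sparse (8 * k8) b m eta z D -> 0 <= eta ->
  (0 < k8)%N -> kk = ((8 * k8)%:R ^+ (d - 2))^-1 -> t3 = c / 3 ^+ (d - 2) ->
  C ^+ 2 * (8 ^+ (d - 2) * ((2 + 2 ^+ (d - 2)) * eta)) <= 4^-1 * t3 ->
  \sum_(x <- balls 0 N | (m < dist x z)%N) kap z x * kap x z1 <= Cv -> C ^+ 2 * Cv <= 4^-1 * t3 * kk ->
  half * t3 * kk <= Pr p (EI 0 N) (fun w => joined w (A `\` (S `|` [set` D])) z1 z).
Proof.
move=> bk qk z1b zk kz AN N0A N0N lo Sb hS [D1 D2 D3] eta0 k80 kkE t3E heta hfar hCv.
have k8R : 0 < k8%:R :> R by rewrite ltr0n.
have hs := sparse_sum N bk qk z1b zk Sb D1 hS D2 D3.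
apply: (le_trans _ (sparse_connect p01 tp (S `|` [set` D]) z1 z AN)).
have z1k : ball 0 (8 * k8) z1 by rewrite /ball /=; move: z1b bk; clear; lia.
have k16 x : ball 0 (8 * k8) x -> ball 0 (16 * k8) x by apply: ball_subr; rewrite leq_mul2r orbT.
have h1 : t3 * kk <= Pr p (EI 0 N) (fun w => joined w A z1 z).
  apply: (@le_trans _ _ (c * kap z1 z)).
    rewrite t3E -mulrA ler_pM2l// kkE -invfM -exprMn.
    apply: (le_trans _ (kap_near R (r := 16 * k8) _)); last first.
      by apply: (leq_trans (dist_triangle 0 _ _)); rewrite (distC 0); move: z1k kz; rewrite /ball /=; clear; lia.
    rewrite lef_pV2 ?posrE ?exprn_gt0 ?mulr_gt0 ?ltr0n ?muln_gt0//.
    by rewrite -natrM lerXn2r ?nnegrE// ler_nat; move: k80; clear; lia.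
  apply: (le_trans (lo _ _ (k16 _ z1k) (k16 _ kz))); apply: le_Pr => // w _.
  exact: joined_mono.
have h2 : (k8.+1%:R ^+ (d - 2))^-1 <= 8 ^+ (d - 2) * kk.
  rewrite kkE natrM exprMn invfM mulrA divff ?mul1r; last by rewrite expf_neq0// pnatr_eq0.
  by rewrite lef_pV2 ?posrE ?exprn_gt0 ?ltr0n// lerXn2r ?nnegrE// ler_nat.
have kk0 : 0 <= kk by rewrite kkE invr_ge0 exprn_ge0.
have e0 : 0 <= eta + eta + 2 ^+ (d - 2) * eta by rewrite !addr_ge0// mulr_ge0// exprn_ge0.
have h3 := le_trans hs (lerD (ler_wpM2r e0 h2) hfar).
have h4 : C ^+ 2 * \sum_(x <- balls 0 N | `[< (S `|` [set` D]) x >]) kap z1 x * kap x z <=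
    4^-1 * t3 * kk + 4^-1 * t3 * kk.
  apply: (le_trans (ler_wpM2l (sqr_ge0 _) h3)); rewrite mulrDr; apply: lerD => //.
  have -> : C ^+ 2 * (8 ^+ (d - 2) * kk * (eta + eta + 2 ^+ (d - 2) * eta)) =
     C ^+ 2 * (8 ^+ (d - 2) * ((2 + 2 ^+ (d - 2)) * eta)) * kk by ring.
  by rewrite ler_wpM2r.
move: h1 h4; lra.
Qed.

Lemma outer_ub_sum N A V k8 : A `<=` ball 0 N -> V `&` ball 0 (8 * k8) = set0 -> (L0 <= k8)%N -> (0 < k8)%N ->
  Pr p (EI 0 N) (fun w => joined_set w A 0 V) <=
  C * (2 ^+ (d - 2) * ((8 * k8)%:R ^+ (d - 2))^-1) * outside_sum N A V (8 * k8).
Proof.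
move=> AN Vk Lk k80; apply: (le_trans (outer_ub hE p01 tp AN Vk)).
rewrite /outside_sum mulr_sumr big_seq [leRHS]big_seq; apply: ler_sum => -[v y] /(mem_exits hE)[kv ky Evy] /=.
rewrite ler_wpM2r ?Pr_ge0// ler_pM2l//.
have vk : (4 * k8 <= dist 0 v)%N.
  have := dist_triangle v y 0; have := edge_dist hE Evy; rewrite (distC y v) (distC 0 v); move: ky; rewrite /ball /=.
  by move=> /negP; rewrite -ltnNge; move: Lk; clear; lia.
apply: (le_trans (kap_far R vk)).
rewrite (_ : (8 * k8 = 2 * (4 * k8))%N); last by clear; lia.
rewrite natrM exprMn invfM mulrA divff ?mul1r; last by rewrite expf_neq0// pnatr_eq0.
by rewrite lef_pV2 ?posrE ?exprn_gt0 ?ltr0n ?muln_gt0// lerXn2r ?nnegrE// ler_nat.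
Qed.

End outer_core.

(** * The hull rarely comes near the origin *)

Section outer_lb.
Context (R : realType) (d : nat) (p : R) (E : set (edge d)) (L0 : nat).
Context (hE : lattice_edges E L0) (p01 : 0 < p < 1) (d6 : (6 < d)%N).
Context (c C : R) (c0 : 0 < c) (cC : c < C) (tp : two_point p E c C).
Implicit Types (x y z u v t : Zd d) (A B O W V S : set (Zd d)) (w : set (edge d)).

Local Notation EI := (edges_in E).
Local Notation half := (2^-1 : R).

Let p01' : 0 <= p <= 1. Proof. by case/andP: p01 => /ltW -> /ltW ->. Qed.
Let p0 : 0 < p. Proof. by case/andP: p01. Qed.
Let C0 : 0 < C. Proof. exact: lt_trans c0 cC. Qed.
Let d2 : (2 < d)%N. Proof. by move: d6; clear; lia. Qed.

Lemma sum_arm_le1 N A V m (e : R) r u i : (i <= m)%N -> (dist u 0 <= r)%N ->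
  (forall z, (dist z 0 <= r + 2 ^ (3 * m))%N -> Pr p (EI 0 N) (fun w => joined_set w A z V) <= e) ->
  0 <= e -> (4 ^ d * 2 ^ (3 * m * d))%:R * e <= 1 ->
  \sum_(z <- balls u (2 ^ (3 * i))) Pr p (EI 0 N) (fun w => joined_set w A z V) <= 1.
Proof.
move=> im ur h e0 he; apply: le_trans he.
apply: (le_trans (sum_ge0_le (M := e) _)).
  move=> z; rewrite mem_balls => zu; apply: h; apply: (leq_trans (dist_triangle u _ _)).
  by rewrite addnC leq_add// (leq_trans zu)// leq_exp2l// leq_mul2l im orbT.
rewrite ler_wpM2r// ler_nat; apply: (leq_trans (size_balls_le p01' d2 u (3 * i))).
by rewrite leq_mul2l leq_exp2l// leq_mul2r leq_mul2l im !orbT.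
Qed.

Lemma archi_pow2 (a : R) : exists n : nat, a <= 2 ^+ n.
Proof.
have h0 : 0 <= `|a| by []; have := archi_boundP h0; set b := Num.bound _ => hb; exists b.
apply: le_trans (ler_norm _) _; apply: (le_trans (ltW hb)).
by rewrite -natrX ler_nat ltnW// ltn_expl.
Qed.

(** Here 7dh is the scale of the outer box. One scale there gains only (3d-6) - (3d-7) = 1, which
    must pay 3h(d-2) for moving an arm, 3hd for the number of points, and h for the smallness. This
    needs slightly less than 6dh, hence the factor 7d. *)
Lemma outer_exponent h : (3 * h * (d - 2) + 3 * h * d + (7 * d * h).+1 * (3 * d - 7) + h <=
  3 * d - 7 + 3 * (7 * d * h) * (d - 2))%N.
Proof.
have [d' ->] : exists d', d = (d' + 7)%N by exists (d - 7)%N; rewrite subnK.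
rewrite (_ : (d' + 7 - 2 = d' + 5)%N); last by clear; lia.
rewrite (_ : (3 * (d' + 7) - 7 = 3 * d' + 14)%N); last by clear; lia.
by clear; nia.
Qed.

(* [h] is the scale of the points to be avoided, [7 * d * h] that of the box through
   whose boundary the last exit is taken. *)
Lemma outer_bad_near : exists h0 : nat, forall h, (h0 <= h)%N -> exists R0 : nat, forall Rr N A V,
  (R0 <= Rr)%N -> target N Rr A V ->
  \sum_(e <- exits E L0 0 (2 ^ (3 * (7 * d * h)))) \sum_(z <- balls 0 (2 ^ (3 * h)))
     Pr p (EI 0 N) (fun w => joined_set w A z V /\ joined_set w A e.2 V) <=
  4^-1 * outside_sum p E L0 N A V (2 ^ (3 * (7 * d * h))).
Proof.
have [Kb hKb] := glue_ball hE p01 d6 c0 cC tp.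
have [i1 [J1 hR1]] := ring_bound hE p01 d6 c0 cC tp Kb.
pose K2 : R := (L0.*2.+1 ^ d)%:R * (4 ^ d)%:R * c^-1 * 2 ^+ (d - 2) * (5 * 2 ^+ (3 * d - 7)) * (C * 2 ^+ (d - 2)).
have K20 : 0 < K2.
  by rewrite /K2 !mulr_gt0 ?invr_gt0 ?exprn_gt0// ltr0n expn_gt0.
have q40 : 0 < 4^-1 / K2 by rewrite divr_gt0// invr_gt0.
have [n2 hn2] := half_small q40.
exists (n2 + i1 + L0 + 1)%N => h hh.
pose Hk := (7 * d * h)%N; pose k8 := (2 ^ (3 * Hk - 3))%N; pose b := (2 ^ (3 * h))%N.
have h1 : (1 <= h)%N by move: hh; clear; lia.
have Hkh : (h < Hk)%N by rewrite /Hk; move: d6 h1; clear; nia.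
have kE : (2 ^ (3 * Hk) = 8 * k8)%N.
  by rewrite /k8 -[8%N]/(2 ^ 3)%N -expnD; congr (2 ^ _)%N; move: Hkh; clear; lia.
have k80 : (0 < k8)%N by rewrite expn_gt0.
have bk8 : (b <= k8)%N by rewrite leq_exp2l//; move: Hkh; clear; lia.
have Lk8 : (L0 <= k8)%N.
  apply: (leq_trans (ltnW (ltn_expl L0 (ltnSn 1)))); rewrite leq_exp2l//.
  by move: hh Hkh; clear; lia.
rewrite -/Hk kE.
(* One scale above the box, so that the outer ends of its exits lie in the ball summed over. *)
pose i := Hk.+1; have iE : (2 ^ (3 * i) = 8 * (8 * k8))%N by rewrite -kE -[8%N]/(2 ^ 3)%N -expnD /i mulnS.
pose l := (J1 i + 3 * i.+1)%N.
have [N0 hN0] := tp_lo tp b.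
pose e0 : R := ((4 ^ d * 2 ^ (3 * i * d))%:R)^-1.
have e00 : 0 < e0 by rewrite invr_gt0 ltr0n muln_gt0 !expn_gt0.
have [RA hRA] := small_arm hE p01 d6 c0 cC tp (0 + 2 ^ (3 * i)) e00.
exists (RA + N0 + 2 ^ l + 2 ^ (3 * i) + b)%N => Rr N A V hR [AN RA' VR].
have sub r : (r <= RA + N0 + 2 ^ l + 2 ^ (3 * i) + b)%N -> ball (0 : Zd d) r `<=` A.
  by move=> hr; apply: subset_trans RA'; apply: ball_subr; exact: leq_trans hr hR.
have Vsub r : (r <= RA + N0 + 2 ^ l + 2 ^ (3 * i) + b)%N -> V `&` ball 0 r = set0.
  move=> hr; apply/seteqP; split=> // v [Vv rv]; rewrite -VR; split=> //.
  by apply: ball_subr rv; exact: leq_trans hr hR.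
have lA : ball (0 : Zd d) (2 ^ l) `<=` A by apply: sub; clear; lia.
have N0A : ball (0 : Zd d) N0 `<=` A by apply: sub; clear; lia.
have bA : ball (0 : Zd d) b `<=` A by apply: sub; clear; lia.
have Vk : V `&` ball 0 (8 * k8) = set0.
  by apply: Vsub; rewrite -kE; apply: (@leq_trans (2 ^ (3 * i))); [rewrite leq_exp2l// leq_mul2l leqnSn orbT|clear; lia].
set g0 := Pr p (EI 0 N) (fun w => joined_set w A 0 V).
set G := outside_sum _ _ _ _ _ _ _.
have ub : g0 <= C * (2 ^+ (d - 2) * ((8 * k8)%:R ^+ (d - 2))^-1) * G := outer_ub_sum hE p01 c0 cC tp AN Vk Lk8 k80.
have G0 : 0 <= G by apply: sumr_ge0 => e _; exact: Pr_ge0.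
have s1 z : \sum_(y <- balls 0 (2 ^ (3 * i))) Pr p (EI 0 N) (fun w => joined_set w A y V) <= 1.
  apply: (@sum_arm_le1 N A V i e0 0 0 i) => //; first by rewrite distxx.
  - by move=> y hy; apply: (hRA Rr) => //; apply: leq_trans hR; clear; lia.
  - exact: ltW.
  - by rewrite mulfV// pnatr_eq0 -lt0n muln_gt0 !expn_gt0.
pose Y := 2 ^+ (i * (3 * d - 7)) : R.
have Y1 : 1 <= Y by rewrite exprn_ege1// ler1n.
have ringz z : ball 0 b z -> \sum_(y <- balls 0 (2 ^ (3 * i))) Pr p (EI 0 N) (fun w => joined_set w A z V /\ joined_set w A y V) <=
    (c^-1 * (2 ^+ (d - 2) * b%:R ^+ (d - 2)) * g0) * (5 * Y).
  move=> bz.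
  have zi : ball 0 (2 ^ (3 * i.+1)) z.
    apply: (ball_subr _ bz); rewrite leq_exp2l// leq_mul2l /i; move: Hkh; clear; lia.
  have gl x j : A x -> ball 0 (2 ^ J1 i) x -> (dist z x <= 2 ^ j)%N -> (j <= (J1 i).+1)%N ->
      2^-1 ^+ (Kb * j.+1 ^ 2) <= Pr p (EI 0 N) (fun w => joined w A z x).
    move=> _ xJ zx _; apply: (le_trans (hKb j l 0 z x N _ _ _ zx)).
    - exact: subset_trans lA AN.
    - by apply: ball_subr zi; rewrite leq_exp2l// leq_addl.
    - by apply: ball_subr xJ; rewrite leq_exp2l// leq_addr.
    - by apply: le_Pr => // w _; exact: joined_mono.
  have i1i : (i1 <= i)%N by rewrite /i; move: hh Hkh; clear; lia.
  have ii : (i <= 7 * d * i)%N by rewrite leq_pmull// muln_gt0; move: d6; clear; lia.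
  apply: (le_trans (hR1 i i N 0 z A A V V i1i (leqnn _) ii zi (bA _ bz) gl)).
  apply: ler_pM; rewrite ?Pr_ge0//.
  - apply: addr_ge0; first by rewrite ?mulr_ge0 ?exprn_ge0.
    by apply: sumr_ge0 => y _; exact: Pr_ge0.
  (* An arm from [z] is turned into an arm from 0 by joining 0 to [z], at cost [kap 0 z]. *)
  - have : c * kap 0 z * Pr p (EI 0 N) (fun w => joined_set w A z V) <= g0.
      apply: le_trans (Pr_joined_set_trans p01 _ A 0 z V); rewrite ler_wpM2r ?Pr_ge0//.
      have N0N : (N0 <= N)%N.
        have d0 : (0 < d)%N by move: d6; clear; lia.
        have : ball 0 N (0 + axv (Ordinal d0) N0%:Z).
          by apply: AN; apply: N0A; rewrite /ball /= distC dist_axv.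
        by rewrite /ball /= distC dist_axv.
      apply: (le_trans (hN0 N N0N 0 z (ball_center _ _) bz)); apply: le_Pr => // w _; exact: joined_mono.
    have kz : (2 ^+ (d - 2) * b%:R ^+ (d - 2))^-1 <= kap 0 z :> R.
      apply: le_trans (kap_near R (r := b) _); last by rewrite distC.
      rewrite -exprMn lef_pV2 ?posrE ?exprn_gt0 ?mulr_gt0 ?ltr0n ?expn_gt0//.
      by rewrite -natrM lerXn2r ?nnegrE// ler_nat mul2n -addnn -addn1 leq_add2l expn_gt0.
    move=> hz; rewrite -mulrA ler_pdivlMl//; apply: le_trans (ler_wpM2l _ hz); last first.
      by rewrite mulr_ge0// exprn_ge0.
    set T := 2 ^+ (d - 2) * b%:R ^+ (d - 2) in kz *.
    have T0 : 0 < T by rewrite mulr_gt0// exprn_gt0// ltr0n expn_gt0.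
    have Tk : 1 <= T * kap 0 z by rewrite -ler_pdivrMl// mulr1.
    set Pz := Pr _ _ _.
    have -> : T * (c * kap 0 z * Pz) = (c * Pz) * (T * kap 0 z) by ring.
    by apply: ler_peMr => //; rewrite mulr_ge0 ?Pr_ge0// ltW.
  - apply: (le_trans (lerD (lexx _) (le_trans (s1 z) Y1))); rewrite -/Y.
    by rewrite (_ : 5 * Y = 4 * Y + Y)//; ring.
have f0 y : 0 <= \sum_(z <- balls 0 b) Pr p (EI 0 N) (fun w => joined_set w A z V /\ joined_set w A y V).
  by apply: sumr_ge0 => z _; exact: Pr_ge0.
have kM : (8 * k8 + L0 <= 2 ^ (3 * i))%N by rewrite iE; move: Lk8; clear; lia.
apply: (le_trans (exits_sum_le hE f0 kM)).
rewrite exchange_big /=.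
apply: (@le_trans _ _ ((L0.*2.+1 ^ d)%:R * ((4 ^ d * 2 ^ (3 * h * d))%:R * ((c^-1 * (2 ^+ (d - 2) * b%:R ^+ (d - 2)) * g0) * (5 * Y))))).
  apply: ler_wpM2l => //.
  apply: (le_trans (sum_ge0_le (M := (c^-1 * (2 ^+ (d - 2) * b%:R ^+ (d - 2)) * g0) * (5 * Y)) _)).
    by move=> z; rewrite mem_balls => bz; exact: ringz.
  apply: ler_wpM2r; last by rewrite ler_nat; exact: (size_balls_le p01' d2).
  rewrite !mulr_ge0 ?exprn_ge0 ?invr_ge0 ?Pr_ge0//; exact: ltW.
set P2 := (4 ^ d * _)%:R.
have cst0 : 0 <= (L0.*2.+1 ^ d)%:R * (P2 * ((c^-1 * (2 ^+ (d - 2) * b%:R ^+ (d - 2))) * (5 * Y))).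
  by rewrite !mulr_ge0 ?exprn_ge0 ?invr_ge0//; exact: ltW.
have -> : (L0.*2.+1 ^ d)%:R * (P2 * (c^-1 * (2 ^+ (d - 2) * b%:R ^+ (d - 2)) * g0 * (5 * Y))) =
  (L0.*2.+1 ^ d)%:R * (P2 * ((c^-1 * (2 ^+ (d - 2) * b%:R ^+ (d - 2))) * (5 * Y))) * g0 by ring.
apply: (le_trans (ler_wpM2l cst0 ub)); rewrite [leLHS]mulrA; apply: ler_wpM2r => //.
apply: (@le_trans _ _ (K2 * half ^+ h)); last first.
  have hn : (n2 <= h)%N by move: hh; clear; lia.
  by have := hn2 _ hn; rewrite ler_pdivlMr// mulrC.
rewrite /P2 /Y /b -kE natrM !natrX -!exprM.
have p2 n : 0 < 2 ^+ n :> R by rewrite exprn_gt0.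
have nz n : 2 ^+ n != 0 :> R by rewrite gt_eqF.
have key : 2 ^+ (3 * h * (d - 2)) * 2 ^+ (3 * h * d) * 2 ^+ (i * (3 * d - 7)) / 2 ^+ (3 * Hk * (d - 2)) <= 2 ^+ (3 * d - 7) * half ^+ h :> R.
  rewrite exprVn ler_pdivrMr// [leRHS]mulrAC ler_pdivlMr// -!exprD ler_eXn2l ?ltr1n//.
  exact: outer_exponent.
pose K3 : R := (L0.*2.+1 ^ d)%:R * (4 ^ d)%:R * c^-1 * 2 ^+ (d - 2) * 5 * (C * 2 ^+ (d - 2)).
have K30 : 0 <= K3 by rewrite /K3 !mulr_ge0 ?invr_ge0 ?exprn_ge0//; exact: ltW.
have -> : K2 * half ^+ h = K3 * (2 ^+ (3 * d - 7) * half ^+ h) by rewrite /K2 /K3; ring.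
apply: le_trans (ler_wpM2l K30 key); rewrite le_eqVlt; apply/orP; left; apply/eqP.
by rewrite /K3 !natrX; ring.
Qed.

End outer_lb.

(** * The comparison of arms, with constants independent of the scale *)

Section outer_final.
Context (R : realType) (d : nat) (p : R) (E : set (edge d)) (L0 : nat).
Context (hE : lattice_edges E L0) (p01 : 0 < p < 1) (d6 : (6 < d)%N).
Context (c C : R) (c0 : 0 < c) (cC : c < C) (tp : two_point p E c C).
Implicit Types (x y z u v t : Zd d) (A B O W V S : set (Zd d)) (w : set (edge d)).

Local Notation EI := (edges_in E).
Local Notation half := (2^-1 : R).

Let p01' : 0 <= p <= 1. Proof. by case/andP: p01 => /ltW -> /ltW ->. Qed.
Let p0 : 0 < p. Proof. by case/andP: p01. Qed.
Let C0 : 0 < C. Proof. exact: lt_trans c0 cC. Qed.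

(** The upper bound by the last exit and the lower bound by links carry the same outside sum and the
    same kernel at the scale of the box, so that their ratio is a constant. It depends neither on
    the scale [h] nor on A, V, [z1] and [S]. *)
Lemma outer_lb : exists eta c5 : R, exists h0 : nat, [/\ 0 < eta, 0 < c5 & forall h, (h0 <= h)%N ->
  exists R0 : nat, forall r N A V z1 S, (R0 <= r)%N -> target N r A V ->
  (2 * dist z1 0 <= 2 ^ (3 * h))%N -> S `<=` ball 0 (2 ^ (3 * h)) ->
  \sum_(x <- balls 0 (2 ^ (3 * h)) | `[< S x >]) kap z1 x <= eta ->
  c5 * Pr p (EI 0 N) (fun w => joined_set w A 0 V) <=
  Pr p (EI 0 N) (fun w => joined_set w (A `\` S) z1 V)].
Proof.
have [Ko hKo] := glue_out hE p01 d6 c0 cC tp.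
have [i2 [J2 hR2]] := ring_sum hE p01 d6 c0 cC tp Ko.
have [Cv Cv0 hCv] := conv_far p01 d6.
have [h1 hnear] := outer_bad_near hE p01 d6 c0 cC tp.
pose t3 : R := c / 3 ^+ (d - 2); have t30 : 0 < t3 by rewrite divr_gt0// exprn_gt0.
pose den : R := 4 * C ^+ 2 * (8 ^+ (d - 2) * (2 + 2 ^+ (d - 2))).
have den0 : 0 < den by rewrite /den !mulr_gt0 ?exprn_gt0// addr_gt0// exprn_gt0.
(* Makes the sparse part of the convolution equal to a quarter of the two-point lower bound. *)
pose eta := t3 / den; have eta0 : 0 < eta by rewrite divr_gt0.
pose Kr : R := 10 * 2 ^+ (3 * d - 7); have Kr0 : 0 < Kr by rewrite mulr_gt0// exprn_gt0.
have e80 : 0 < eta * 8^-1 / Kr by rewrite divr_gt0// mulr_gt0// invr_gt0.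
have [ns hns] := half_small e80.
have ns8 n : (ns <= n)%N -> eta^-1 * (Kr * half ^+ n) <= 8^-1.
  by move=> /hns; rewrite ler_pdivlMr// mulrC ler_pdivrMl.
(* The hull off the opened ball keeps distance [q] from its center, so that the kernel sums start at
   scale [s0] and are of order 2^(-s0); [q] is fixed once and for all. *)
pose s0 := (i2 + ns + L0)%N; pose q := (2 ^ (3 * s0))%N.
have e30 : 0 < t3 / 4 / (C ^+ 2 * Cv) by do ?[exact: t30|exact: Cv0|exact: C0|done|apply: divr_gt0|apply: mulr_gt0|apply: exprn_gt0].
have [n3 hn3] := half_small e30.
pose M := ((3 * q).*2.+1 ^ d * (3 * q + L0).*2.+1 ^ d)%N.
have M0 : 0 < M%:R :> R by rewrite ltr0n muln_gt0 !expn_gt0.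
pose pq : R := p ^+ ((q.*2.+1 ^ d) ^ 2).+1; have pq0 : 0 < pq by rewrite exprn_gt0.
(* Opening the ball, reaching it, and having a sparse hull, against the upper bound and the
   multiplicity; the kernel at the scale of the box has cancelled. *)
pose c5 := pq * (half * t3) * half / (C * 2 ^+ (d - 2)) / M%:R.
have C20 : 0 < C * 2 ^+ (d - 2) by rewrite mulr_gt0// exprn_gt0.
exists eta, c5, (h1 + s0 + 2 + n3)%N; split=> //.
  by rewrite /c5; do ?[exact: t30|exact: C20|exact: M0|exact: pq0|done|apply: divr_gt0|apply: mulr_gt0|rewrite invr_gt0].
move=> h hh; pose Hk := (7 * d * h)%N; pose k8 := (2 ^ (3 * Hk - 3))%N; pose b := (2 ^ (3 * h))%N.
have [hh1 hs0 hn3h] : [/\ (h1 <= h)%N, (s0 + 2 <= h)%N & (n3 <= h)%N] by split; move: hh; clear; lia.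
have Hkh : (h + 1 < Hk)%N by rewrite /Hk; move: d6 hs0; clear; nia.
have kE : (2 ^ (3 * Hk) = 8 * k8)%N.
  by rewrite /k8 -[8%N]/(2 ^ 3)%N -expnD; congr (2 ^ _)%N; move: Hkh; clear; lia.
have k80 : (0 < k8)%N by rewrite expn_gt0.
have bk8 : (b <= k8)%N by rewrite leq_exp2l//; move: Hkh; clear; lia.
have Lq : (L0 <= q)%N.
  apply: (leq_trans (ltnW (ltn_expl L0 (ltnSn 1)))); rewrite leq_exp2l// /s0; clear; lia.
have q4 : (4 * q <= k8)%N.
  by rewrite /q -[4%N]/(2 ^ 2)%N -expnD leq_exp2l//; move: hs0 Hkh; clear; lia.
have qk : (q + L0 <= k8)%N by move: Lq q4; clear; lia.
(* Radius up to which the sum around [z] is controlled: 2^(-3 Hm), the convolution tail, is at most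
   2^(-h) times the kernel at the scale of the box. *)
pose Hm := (d * Hk)%N; have HkHm : (Hk <= Hm)%N by rewrite leq_pmull//; move: d6; clear; lia.
have [N0 hN0] := tp_lo tp (16 * k8).
pose e0 : R := ((4 ^ d * 2 ^ (3 * Hm * d))%:R)^-1.
have e00 : 0 < e0 by rewrite invr_gt0 ltr0n muln_gt0 !expn_gt0.
have [RA hRA] := small_arm hE p01 d6 c0 cC tp (8 * k8 + 2 ^ (3 * Hm)) e00.
pose Jx := (\sum_(i < Hm.+1) J2 i)%N.
have JxP i : (i <= Hm)%N -> (J2 i <= Jx)%N.
  by move=> im; rewrite /Jx (bigD1 (Ordinal (im : (i < Hm.+1)%N))) //= leq_addr.
have [R1 hR1] := hnear _ hh1.
pose R2 := (8 * k8 + L0 + 2 ^ (Jx + 9))%N.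
exists (R1 + RA + N0 + R2)%N => r N A V z1 S hr hT z1b Sb hS; have [AN rA Vr] := hT.
have sub r0 : (r0 <= R1 + RA + N0 + R2)%N -> ball (0 : Zd d) r0 `<=` A.
  by move=> h2; apply: subset_trans rA; apply: ball_subr; exact: leq_trans h2 hr.
have Vsub r0 : (r0 <= R1 + RA + N0 + R2)%N -> V `&` ball 0 r0 = set0.
  move=> h2; apply/seteqP; split=> // v [Vv rv]; rewrite -Vr; split=> //.
  by apply: ball_subr rv; exact: leq_trans h2 hr.
have N0A : ball (0 : Zd d) N0 `<=` A by apply: sub; clear; lia.
have R2A : ball (0 : Zd d) R2 `<=` A by apply: sub; clear; lia.
have kA : ball (0 : Zd d) (8 * k8 + L0) `<=` A by apply: sub; rewrite /R2; clear; lia.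
have N0N : (N0 <= N)%N.
  have dg0 : (0 < d)%N by move: d6; clear; lia.
  have : ball 0 N (0 + axv (Ordinal dg0) N0%:Z) by apply: AN; apply: N0A; rewrite /ball /= distC dist_axv.
  by rewrite /ball /= distC dist_axv.
set k := (8 * k8)%N; pose O := A `\` ball 0 k.
set g0 := Pr p (EI 0 N) (fun w => joined_set w A 0 V).
set G := outside_sum p E L0 N A V k.
have Vk : V `&` ball 0 (8 * k8) = set0 by apply: Vsub; rewrite /R2; clear; lia.
have L8 : (L0 <= k8)%N by move: qk; clear; lia.
have ub := outer_ub_sum hE p01 c0 cC tp AN Vk L8 k80.
have s1 u i : (i <= Hm)%N -> (dist u 0 <= k)%N ->
    \sum_(z <- balls u (2 ^ (3 * i))) Pr p (EI 0 N) (fun w => joined_set w A z V) <= 2 ^+ (i * (3 * d - 7)).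
  move=> im uk; apply: (@le_trans _ _ 1); last by rewrite exprn_ege1// ler1n.
  apply: (sum_arm_le1 p01 d6 im uk (e := e0)); last by rewrite mulfV// pnatr_eq0 -lt0n muln_gt0 !expn_gt0.
    by move=> z hz; apply: (hRA r) => //; apply: leq_trans hr; clear; lia.
  exact: ltW.
have glue i u v y x j : (i <= Hm)%N -> (v, y) \in exits E L0 0 k -> O x -> (dist y x <= 2 ^ j)%N -> (j <= (J2 i).+1)%N ->
    half ^+ (Ko * j.+1 ^ 2) <= Pr p (EI 0 N) (fun w => joined w O y x) /\ ball u 0 u.
  move=> im /(mem_exits hE)[kv ky Evy] [Ax kx] yx ji; split; last exact: ball_center.
  apply: hKo => // t ht; have R2t : ball 0 R2 t.
    apply: (leq_trans (dist_triangle y _ _)); rewrite /R2 addnC leq_add//.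
      apply: (leq_trans (dist_triangle v _ _)); rewrite addnC leq_add//.
      by have := edge_dist hE Evy; rewrite distC.
    apply: (leq_trans ht); rewrite leq_exp2l//; have := JxP i im; move: ji; clear; lia.
  by split; [exact: R2A|exact/AN/R2A].
pose X (e : Zd d * Zd d) w := joined_set w O e.2 V.
pose zc (e : Zd d * Zd d) := clamp (k - q) e.1.
pose Dw (e : Zd d * Zd d) w := hull N (A `\` ball (zc e) q) V w.
have DwA e w z : z \in Dw e w -> joined_set w A z V.
  rewrite mem_hull; last by move=> t [/AN].
  by move=> /asboolP; apply: joined_set_mono => // t [].
have DwQ e w z : z \in Dw e w -> (q < dist z (zc e))%N.
  rewrite mem_hull; last by move=> t [/AN].
  by move=> /asboolP[t _ /joined_inl [_ nz]]; rewrite ltnNge; apply/negP.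
(* Around [z] the outer vertex [y] is close, within scale i for every i > [s0], so that [II] is the
   identity. *)
have B2 e : e \in exits E L0 0 k -> Pr p (EI 0 N) (fun w => X e w /\
     eta < \sum_(x <- balls (zc e) (2 ^ (3 * Hm)) | x \in Dw e w) kap (zc e) x) <=
   8^-1 * Pr p (EI 0 N) (X e).
  case: e => v y he; have [g1 g2 g3 g4 g5] := exit_geometry hE qk he.
  have /(mem_exits hE)[kv ky Evy] := he.
  apply: (@le_trans _ _ (Pr p (EI 0 N) (fun w => X (v, y) w /\ ((forall z, z \in Dw (v, y) w -> (dist z (zc (v, y)) <= 2 ^ (3 * Hm))%N -> (q < dist z (zc (v, y)))%N) /\
     eta < \sum_(x <- balls (zc (v, y)) (2 ^ (3 * Hm)) | x \in Dw (v, y) w) kap (zc (v, y)) x)))).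
    by apply: le_Pr => // w _ [h2 h3]; split=> //; split=> // z zD _; exact: DwQ zD.
  apply: (le_trans (markov_dist E p01 N _ _ _ _ eta0 (DwA (v, y)))).
  have Oy : O y by split=> //; apply: kA; apply: (leq_trans (dist_triangle v _ _)); rewrite addnC leq_add//; have := edge_dist hE Evy; rewrite distC.
  have i2s : (i2 <= s0)%N by rewrite /s0; clear; lia.
  have zk : (dist (zc (v, y)) 0 <= k)%N by apply: g2; exact: ball_center.
  apply: (le_trans (ler_wpM2l _ (hR2 s0 Hm id N (zc (v, y)) y A O V V i2s Oy _ _))).
  - by rewrite invr_ge0 ltW.
  - move=> i /andP[si im]; split=> //; first by rewrite leq_pmull// muln_gt0; move: d6; clear; lia.
      apply: (leq_trans g4); apply: (@leq_trans (q + q)); first by rewrite leq_add2l.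
      apply: (@leq_trans (2 ^ (3 * s0).+1)); first by rewrite expnS mul2n -addnn.
      by rewrite leq_exp2l//; move: si; clear; lia.
    by move=> x j Ox _ yx ji; have [] := glue i 0 v y x j im he Ox yx ji.
  - by move=> i /andP[si im]; exact: s1.
  - rewrite -/Kr mulrA ler_wpM2r ?Pr_ge0//; apply: ns8; rewrite /s0; clear; lia.
(* Around the origin [y] is at the fixed scale [Hk]. It is admissible for all i > h because Hk =
   7dh, the reason for the bound 7 * d * i on scales. *)
have B3 e : e \in exits E L0 0 k -> Pr p (EI 0 N) (fun w => X e w /\
     ((forall z, z \in Dw e w -> (dist z 0 <= k)%N -> (b < dist z 0)%N) /\ eta < \sum_(x <- balls 0 k | x \in Dw e w) kap 0 x)) <=
   8^-1 * Pr p (EI 0 N) (X e).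
  case: e => v y he; have /(mem_exits hE)[kv ky Evy] := he.
  apply: (le_trans (markov_dist E p01 N _ _ _ _ eta0 (DwA (v, y)))).
  have dyk : (dist y 0 <= 8 * k8 + L0)%N.
    by apply: (leq_trans (dist_triangle v _ _)); rewrite addnC leq_add//; have := edge_dist hE Evy; rewrite distC.
  have Oy : O y by split=> //; exact: kA.
  have i2h : (i2 <= h)%N by move: hs0; rewrite /s0; clear; lia.
  have := hR2 h Hk (fun=> Hk) N 0 y A O V V i2h Oy; rewrite kE => hs.
  apply: (le_trans (ler_wpM2l _ (hs _ _))).
  - by rewrite invr_ge0 ltW.
  - move=> i /andP[si im]; split=> //.
    + by rewrite /Hk leq_mul2l ltnW ?orbT.
    + by apply: (leq_trans dyk); rewrite mulnS expnD kE -[(2 ^ 3)%N]/8%N; move: L8; clear; lia.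
    + by move=> x j Ox _ yx ji; have [] := glue Hk 0 v y x j HkHm he Ox yx ji.
  - by move=> i /andP[si im]; apply: s1; [exact: leq_trans im HkHm|rewrite distxx].
  - rewrite -/Kr mulrA ler_wpM2r ?Pr_ge0//; apply: ns8; move: hs0; rewrite /s0; clear; lia.
(* 1/8 for the sum around [z], 1/8 for the sum around 0, and 1/4 for hulls that enter the small
   box. *)
have hbad : \sum_(e <- exits E L0 0 k) Pr p (EI 0 N) (fun w => joined_set w (A `\` ball 0 k) e.2 V /\
     ~ sparse k b (2 ^ (3 * Hm)) eta (clamp (k - q) e.1) (hull N (A `\` ball (clamp (k - q) e.1) q) V w)) <= half * G.
  apply: (@le_trans _ _ (\sum_(e <- exits E L0 0 k) (4^-1 * Pr p (EI 0 N) (X e) + \sum_(z <- balls 0 b)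
     Pr p (EI 0 N) (fun w => joined_set w A z V /\ joined_set w A e.2 V)))).
    rewrite big_seq [leRHS]big_seq; apply: ler_sum => e he.
    have q8 : (4^-1 : R) = 8^-1 + 8^-1 by lra.
    rewrite q8 mulrDl; apply: (le_trans _ (lerD (lerD (B2 _ he) (B3 _ he)) (lexx _))).
    apply: (@le_trans _ _ (Pr p (EI 0 N) (fun w => X e w /\
     eta < \sum_(x <- balls (zc e) (2 ^ (3 * Hm)) | x \in Dw e w) kap (zc e) x) + Pr p (EI 0 N) (fun w => X e w /\
     ((forall z, z \in Dw e w -> (dist z 0 <= k)%N -> (b < dist z 0)%N) /\ eta < \sum_(x <- balls 0 k | x \in Dw e w) kap 0 x)) +
     Pr p (EI 0 N) (fun w => exists2 z, z \in balls 0 b & joined_set w A z V /\ joined_set w A e.2 V))); last first.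
      by rewrite lerD2l; apply: Pr_union => // w _ [z hz h3]; exists z.
    rewrite -addrA; apply: (@le_trans _ _ (Pr p (EI 0 N) (fun w => X e w /\
     eta < \sum_(x <- balls (zc e) (2 ^ (3 * Hm)) | x \in Dw e w) kap (zc e) x) + Pr p (EI 0 N) (fun w => (X e w /\
     ((forall z, z \in Dw e w -> (dist z 0 <= k)%N -> (b < dist z 0)%N) /\ eta < \sum_(x <- balls 0 k | x \in Dw e w) kap 0 x)) \/
      exists2 z, z \in balls 0 b & joined_set w A z V /\ joined_set w A e.2 V))); last by rewrite lerD2l; exact: Pr_split.
    apply: Pr_split => // w _ [Xw nsp].
    have [h2|h2] := ltP eta (\sum_(x <- balls (zc e) (2 ^ (3 * Hm)) | x \in Dw e w) kap (zc e) x); first by left.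
    right; have [[z zD zb]|nz] := pselect (exists2 z, z \in Dw e w & (dist z 0 <= b)%N).
      right; exists z; first by rewrite mem_balls.
      split; first exact: DwA zD.
      by apply: joined_set_mono Xw => // t [].
    have Db z : z \in Dw e w -> (b < dist z 0)%N by move=> zD; rewrite ltnNge; apply/negP => zb; apply: nz; exists z.
    left; split=> //; split; first by move=> z zD _; exact: Db.
    by rewrite ltNge; apply/negP => h3; apply: nsp.
  rewrite big_split /= -mulr_sumr; have := hR1 r N A V (leq_trans _ hr) hT; rewrite -/Hk kE -/k => hb.
  have q4' : half = 4^-1 + 4^-1 by lra.
  rewrite q4' mulrDl; apply: lerD => //; apply: hb; clear; lia.
pose kk : R := (k%:R ^+ (d - 2))^-1.
have k00 : 0 <= half * t3 * kk by rewrite !mulr_ge0 ?invr_ge0 ?exprn_ge0// ltW.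
have kT : target N (8 * k8 + L0) A V.
  by split=> //; apply: Vsub; rewrite /R2; clear; lia.
have qk7 : (2 * q + L0 < 7 * k8)%N by move: Lq q4 k80; clear; lia.
have hk v y D : (v, y) \in exits E L0 0 (8 * k8) -> sparse (8 * k8) b (2 ^ (3 * Hm)) eta (clamp (8 * k8 - q) v) D ->
     half * t3 * kk <= Pr p (EI 0 N) (fun w => joined w (A `\` (S `|` [set` D])) z1 (clamp (8 * k8 - q) v)).
  move=> he sp; have [g1 g2 g3 g4 g5] := exit_geometry hE qk he.
  apply: (sparse_connect_lb p01 c0 tp bk8 qk z1b g3 (g2 _ (ball_center _ _)) AN N0A N0N (hN0 N N0N) Sb hS sp (ltW eta0) k80 erefl erefl (Cv := Cv * half ^+ (3 * Hm))).
  - have hal (a8 a2 t C' : R) : a8 != 0 -> 2 + a2 != 0 -> C' != 0 ->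
        C' ^+ 2 * (a8 * ((2 + a2) * (t / (4 * C' ^+ 2 * (a8 * (2 + a2)))))) = 4^-1 * t.
      by move=> n1 n2 n3'; field; rewrite n1 n2 n3'.
    by rewrite /eta /den hal// gt_eqF ?addr_gt0 ?exprn_gt0.
  - exact: hCv.
  - have hkk : half ^+ (3 * Hm) <= kk * half ^+ h.
      rewrite /kk /k -kE natrX -exprM !exprVn -invfM -exprD lef_pV2 ?posrE ?exprn_gt0//.
      rewrite ler_eXn2l ?ltr1n// /Hm.
      have [d' ->] : exists d', d = (d' + 7)%N by exists (d - 7)%N; rewrite subnK.
      by rewrite (_ : (d' + 7 - 2 = d' + 5)%N); [move: Hkh; clear; nia|clear; lia].
    have kk0 : 0 <= kk by rewrite invr_ge0 exprn_ge0.
    apply: (@le_trans _ _ (C ^+ 2 * (Cv * (kk * half ^+ h)))).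
      by rewrite ler_wpM2l ?sqr_ge0// ler_wpM2l// ltW.
    have -> : C ^+ 2 * (Cv * (kk * half ^+ h)) = (C ^+ 2 * Cv) * half ^+ h * kk by ring.
    rewrite ler_wpM2r//; have := hn3 _ hn3h; rewrite ler_pdivlMr; last by rewrite mulr_gt0// exprn_gt0.
    by rewrite mulrC [t3 / 4]mulrC.
have core := outer_core hE p01 qk bk8 qk7 kT Sb k00 hbad hk.
rewrite -/k -/G -/M -/pq in core.
have G0 : 0 <= G by apply: sumr_ge0 => e _; exact: Pr_ge0.
have c50 : 0 <= c5 by rewrite /c5 !divr_ge0 ?mulr_ge0 ?invr_ge0 ?exprn_ge0// ltW.
apply: (le_trans (ler_wpM2l c50 ub)); rewrite -/G -/k -/kk.
rewrite -(ler_pM2l M0); apply: le_trans core; rewrite le_eqVlt; apply/orP; left; apply/eqP.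
by rewrite /c5; field; rewrite !gt_eqF// exprn_gt0.
Qed.

End outer_final.

(** * Decoupling the inner and the outer part of an arm *)

Section contraction_tools.
Context (R : realType) (d : nat) (p : R) (E : set (edge d)) (L0 : nat).
Context (hE : lattice_edges E L0) (p01 : 0 < p < 1).
Implicit Types (x y z u v t : Zd d) (A B O W V S J : set (Zd d)) (w xi : set (edge d)) (D : seq (Zd d)).
Implicit Types (F Y : set (edge d) -> Prop).

Local Notation EI := (edges_in E).

Let p01' : 0 <= p <= 1. Proof. by case/andP: p01 => /ltW -> /ltW ->. Qed.
Let p0 : 0 < p. Proof. by case/andP: p01. Qed.

(* The form that an arm event of the box takes once the edges outside it are known. *)
Definition ratio_bounds n F (lo hi : R) := forall xi A J, xi `<=` E -> xi `&` inside (ball 0 n) = set0 ->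
  J `&` ball 0 n = set0 -> ball 0 n `<=` A ->
  lo * Pr p (EI 0 n) (fun w => joined_set (w `|` xi) A 0 J) <=
    Pr p (EI 0 n) (fun w => F w /\ joined_set (w `|` xi) A 0 J) /\
  Pr p (EI 0 n) (fun w => F w /\ joined_set (w `|` xi) A 0 J) <=
    hi * Pr p (EI 0 n) (fun w => joined_set (w `|` xi) A 0 J).

(** The path is stopped at its first vertex in [W]; before that no edge has both ends in [W]. *)
Lemma hit_outer w B x W : joined_set w B x W -> joined_set (w `\` inside W) B x W.
Proof.
move=> [v Wv /joinedP[q [q1 q2 q3]]].
have hv : has (fun t => `[< W t >]) (x :: q) by apply/hasP; exists v; [rewrite -q2 mem_last|apply/asboolP].
have [a1 [a2 [aE /asboolP l1 l2]]] := split_first hv; exists (last x a1) => //.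
apply/joinedP; exists a1; split=> // [e he|t ht]; last by apply: q3; rewrite aE -cat_cons mem_cat ht.
split; first by apply: q1; rewrite aE pedges_cat; left.
move: he; rewrite -pedges_rev => he; have [t te] := pedges_vertex_tail he; rewrite mem_rev => tb.
by move=> /(_ t te) Wt; have := l2 _ tb => /negP; apply; apply/asboolP.
Qed.

Lemma outer_split n N : (n <= N)%N ->
  perm_eq (EI 0 N) ([seq e <- EI 0 N | e \notin EI 0 n] ++ EI 0 n).
Proof.
move=> nN; have sub : ball (0 : Zd d) n `<=` ball 0 N by exact: ball_subr.
apply: uniq_perm; rewrite ?edges_in_uniq//.
  rewrite cat_uniq filter_uniq ?edges_in_uniq//= andbT; apply/hasPn => e es.
  by rewrite mem_filter es.
move=> e; rewrite mem_cat mem_filter; case: (boolP (e \in EI 0 n)) => //= es; last by rewrite orbF.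
by rewrite (edges_in_mono hE sub es).
Qed.

(** Conditionally on the edges [w1] outside the box, the weight is constant and [Y] becomes an arm
    event of the form met in [ratio_bounds]; the bounds are then averaged over [w1]. *)
Lemma cond_bounds n N F lo hi (phi : set (edge d) -> R) Y : (n <= N)%N -> depends_on (inside (ball 0 n)) F ->
  ratio_bounds n F lo hi -> (forall w, w `<=` [set` EI 0 N] -> 0 <= phi w) ->
  (forall w1 w2, w2 `<=` inside (ball 0 n) -> w2 `<=` E -> phi (w1 `|` w2) = phi w1) ->
  (forall w1, w1 `<=` E -> w1 `<=` inside (ball 0 N) -> w1 `&` inside (ball 0 n) = set0 -> phi w1 != 0 ->
    exists xi A J, [/\ xi `<=` E, xi `&` inside (ball 0 n) = set0, J `&` ball 0 n = set0, ball 0 n `<=` A &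
      forall w2, w2 `<=` inside (ball 0 n) -> w2 `<=` E -> (Y (w1 `|` w2) <-> joined_set (w2 `|` xi) A 0 J)]) ->
  lo * Ex p (EI 0 N) (fun w => phi w * `[< Y w >]%:R) <= Ex p (EI 0 N) (fun w => phi w * `[< F w /\ Y w >]%:R) /\
  Ex p (EI 0 N) (fun w => phi w * `[< F w /\ Y w >]%:R) <= hi * Ex p (EI 0 N) (fun w => phi w * `[< Y w >]%:R).
Proof.
move=> nN dF hF phi0 hphi hY; set so := [seq e <- EI 0 N | e \notin EI 0 n].
pose G w1 := Pr p (EI 0 n) (fun w2 => Y (w1 `|` w2)).
pose GF w1 := Pr p (EI 0 n) (fun w2 => F w2 /\ Y (w1 `|` w2)).
have inn w2 : w2 `<=` [set` EI 0 n] -> w2 `<=` inside (ball 0 n) /\ w2 `<=` E.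
  by move=> h; split=> e /h /(mem_edges_in hE)[].
have out w1 : w1 `<=` [set` so] -> [/\ w1 `<=` E, w1 `<=` inside (ball 0 N) & w1 `&` inside (ball 0 n) = set0].
  move=> h; split=> [e /h /=|e /h /=|]; rewrite ?mem_filter.
  - by move=> /andP[_ /(mem_edges_in hE)[]].
  - by move=> /andP[_ /(mem_edges_in hE)[]].
  - apply/seteqP; split=> // e [/h /=]; rewrite mem_filter => /andP[/negP ne /(mem_edges_in hE)[Ee _]] ie.
    by apply: ne; apply/(mem_edges_in hE).
have e1 : Ex p (EI 0 N) (fun w => phi w * `[< Y w >]%:R) = Ex p so (fun w1 => phi w1 * G w1).
  rewrite (Ex_perm _ _ (outer_split nN)) Ex_cat; apply: eq_Ex => w1 h1.
  rewrite -ExZ; apply: eq_Ex => w2 /inn[h2 h2']; by rewrite hphi.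
have e2 : Ex p (EI 0 N) (fun w => phi w * `[< F w /\ Y w >]%:R) = Ex p so (fun w1 => phi w1 * GF w1).
  rewrite (Ex_perm _ _ (outer_split nN)) Ex_cat; apply: eq_Ex => w1 /out[_ _ h1].
  rewrite -ExZ; apply: eq_Ex => w2 /inn[h2 h2']; rewrite hphi//; congr (_ * _%:R); congr nat_of_bool.
  apply: asbool_equiv_eq; rewrite dF (_ : (w1 `|` w2) `&` inside (ball 0 n) = w2)//.
  by rewrite setIUl h1 set0U; apply/seteqP; split=> e; [case|move=> h; split=> //; exact: h2].
have key w1 : w1 `<=` [set` so] -> lo * (phi w1 * G w1) <= phi w1 * GF w1 /\ phi w1 * GF w1 <= hi * (phi w1 * G w1).
  move=> ws1; have [u1 u2 u3] := out _ ws1; have p1 : 0 <= phi w1 by apply: phi0 => e /ws1 /=; rewrite mem_filter => /andP[].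
  have [->|nz] := eqVneq (phi w1) 0; first by rewrite !mul0r !mulr0.
  have [xi [A [J [x1 x2 x3 x5 x4]]]] := hY _ u1 u2 u3 nz.
  have -> : G w1 = Pr p (EI 0 n) (fun w => joined_set (w `|` xi) A 0 J).
    apply: eq_Ex => w2 /inn[h2 h2']; congr (_%:R); congr nat_of_bool; apply: asbool_equiv_eq; exact: x4.
  have -> : GF w1 = Pr p (EI 0 n) (fun w => F w /\ joined_set (w `|` xi) A 0 J).
    apply: eq_Ex => w2 /inn[h2 h2']; congr (_%:R); congr nat_of_bool; apply: asbool_equiv_eq.
    by rewrite x4.
  by have [h1 h2] := hF xi A J x1 x2 x3 x5; split; rewrite mulrCA ler_wpM2l.
by rewrite e1 e2 -!ExZ; split; apply: le_Ex => // w1 /key[].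
Qed.

Definition inner_hull N n q z w := hull N (ball 0 N `\` ball z q) (ball 0 n) w.

(** By [hit_outer], a vertex joined to the box is joined to it without the edges inside the box. *)
Lemma inner_hull_outer N n q z w1 w2 : w2 `<=` inside (ball 0 n) ->
  inner_hull N n q z (w1 `|` w2) = inner_hull N n q z w1.
Proof.
move=> h2; apply: eq_filter => x; apply: asbool_equiv_eq; split; last by apply: joined_set_mono => // e; left.
move=> /hit_outer; apply: joined_set_mono => // e [[//|/h2 ie] ne]; by case: (ne ie).
Qed.

Lemma mem_inner_hull N n q z w x : (x \in inner_hull N n q z w) =
  `[< joined_set w (ball 0 N `\` ball z q) x (ball 0 n) >].
Proof. by rewrite mem_hull// => t []. Qed.

Lemma inner_hull_step N n q z w a b : a \in inner_hull N n q z w -> w [fset a; b]%fset ->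
  ball 0 N b -> ~ ball z q b -> b \in inner_hull N n q z w.
Proof.
rewrite !mem_inner_hull => /asboolP[v nv jv] wab Nb zb; apply/asboolP; exists v => //.
have Ba := joined_inl jv; apply: (joined_trans (y := a)) => //.
by apply: joined1 => //; rewrite fsetUC.
Qed.

Lemma inner_hull_joined N n q z w a b : a \in inner_hull N n q z w ->
  joined w (ball 0 N `\` ball z q) a b -> b \in inner_hull N n q z w.
Proof.
rewrite !mem_inner_hull => /asboolP ha jb; apply/asboolP.
exact: joined_set_trans (joined_sym jb) ha.
Qed.

Definition core n ell q b (eta : R) z y v D w :=
  [/\ forall x, x \in D -> ball 0 b x, \sum_(x <- balls 0 b | x \in D) kap z x <= eta,
      forall x, ball 0 n x -> x \in D, forall x, x \in D -> ~ ball z q x &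
      w [fset y; v]%fset /\ joined_set w (ball 0 ell) y (ball 0 n)].

Definition via q z D w := joined_set (w `&` touching [set` D]) setT 0 (ball z q).

Definition tail A V q z D w := opened E q z w /\ joined_set w (A `\` [set` D]) z V.

Section one_exit.
Context (N n ell q b : nat) (eta : R) (z y v : Zd d) (A V : set (Zd d)).
Context (nell : (n <= ell)%N) (ellN : (ell <= N)%N) (zell : ball z q `&` ball 0 ell = set0).
Context (zv : ball z q v) (zN : ball z q `<=` ball 0 N).
Context (AN : A `<=` ball 0 N) (bA : ball 0 b `<=` A) (zA : ball z q `<=` A) (Vb : V `&` ball 0 b = set0).

Let H w := inner_hull N n q z w.

Lemma ell_sub : ball 0 ell `<=` ball 0 N `\` ball z q.
Proof.
move=> t ht; split; first exact: (ball_subr ellN ht).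
by move=> zt; have : (ball z q `&` ball 0 ell) t by []; rewrite zell.
Qed.

Lemma hull_inner w x : ball 0 n x -> x \in H w.
Proof.
move=> nx; rewrite mem_inner_hull; apply/asboolP; exists x => //; apply: joined_refl.
by apply: ell_sub; exact: (ball_subr nell nx).
Qed.

Lemma hull_off w x : x \in H w -> ~ ball z q x.
Proof. by rewrite mem_inner_hull => /asboolP[t _ /joined_inl []]. Qed.

(** The cluster [D] does not reach V, and a path can leave it only into the ball. So an arm enters
    the ball; conversely the open ball is joined to V. The arm event therefore splits into [via],
    seen by the explored edges, and [tail], seen by the others. *)
Lemma via_iff w : w `<=` E -> w `<=` inside (ball 0 N) ->
  core n ell q b eta z y v (H w) (w `&` touching [set` H w]) -> tail A V q z (H w) w ->
  (joined_set w A 0 V <-> via q z (H w) w).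
Proof.
move=> wE wN [c1 c2 c3 c4 c5] [ho [t Vt jt]].
have H0 : 0 \in H w by apply: c3; exact: ball_center.
split.
  move=> [t' Vt' jt']; have nt : ~ [set` H w] t'.
    by move=> /c1 bt; have : (V `&` ball 0 b) t' by []; rewrite Vb.
  have [a [b' [ha hb wab [w1 [w2 [h1 h2 _ j1 j2]]]]]] := first_exit (B := [set` H w]) jt' H0 nt.
  have Ab : A b' by exact: joined_inl j2.
  have zb : ball z q b'.
    by apply: contrapT => nz; apply: hb => /=; apply: (inner_hull_step ha wab) => //; exact: AN.
  exists b' => //; apply: (joined_trans (y := a)).
    rewrite joined_depends in j1; apply: joined_mono j1 => // e [/h1 we ie]; split=> //.
    have [x [x' [eE _ _]]] := edge_range hE (wE _ we); exists x; first by rewrite eE !inE eqxx.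
    by have [] := ie x; [rewrite eE !inE eqxx|].
  apply: joined1 => //; split=> //; exists a => //; by rewrite !inE eqxx.
move=> [x zx jx]; have nx : ~ [set` H w] x by move=> /hull_off.
have [a [b' [ha hb [wab _] [w1 [w2 [h1 h2 _ j1 j2]]]]]] := first_exit (B := [set` H w]) jx H0 nx.
have Nb : ball 0 N b' by apply: (wN _ wab); rewrite !inE eqxx orbT.
have zb : ball z q b'.
  by apply: contrapT => nz; apply: hb => /=; exact: (inner_hull_step ha wab).
exists t => //; apply: (joined_trans (y := a)).
  apply: joined_mono j1 => [e /h1[]//|x' [_ /c1 h]]; exact: bA.
apply: (joined_trans (y := b')).
  by apply: joined1 => //; [apply: bA; exact: c1|exact: zA].
apply: (joined_trans (y := z)).
  by apply: joined_mono (opened_joined hE ho zb (ball_center z q)).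
by apply: joined_mono jt => // ? [].
Qed.

End one_exit.

(** If the balls were disjoint, each would belong to the cluster found off the other one, through
    its entrance. The tail from [z] avoids [D], which contains the ball of [z'], so it lies in [D'];
    then [D'] would meet V, which lies outside the ball of radius [b]. *)
Lemma tails_meet N n ell q b eta A V w z y v z' y' v' : (n <= ell)%N -> (ell <= N)%N ->
  ball z q `&` ball 0 ell = set0 -> ball z' q `&` ball 0 ell = set0 -> ball z q v -> ball z' q v' ->
  ball z q `<=` ball 0 N -> ball z' q `<=` ball 0 N -> A `<=` ball 0 N -> V `&` ball 0 b = set0 ->
  let D := inner_hull N n q z w in let D' := inner_hull N n q z' w in
  core n ell q b eta z y v D (w `&` touching [set` D]) -> tail A V q z D w ->
  core n ell q b eta z' y' v' D' (w `&` touching [set` D']) -> tail A V q z' D' w ->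
  exists2 x, ball z q x & ball z' q x.
Proof.
move=> nell ellN zell zell' zv zv' zN zN' AN Vb D D' [c1 c2 c3 c4 [[c5 _] c6]] [ho [t Vt jt]].
move=> [c1' c2' c3' c4' [[c5' _] c6']] [ho' _]; apply: contrapT => hno.
have yD' : y \in D'.
  rewrite mem_inner_hull; apply/asboolP; apply: joined_set_mono c6 => //.
  exact: (ell_sub ellN zell').
have y'D : y' \in D.
  rewrite mem_inner_hull; apply/asboolP; apply: joined_set_mono c6' => //.
  exact: (ell_sub ellN zell).
have QD' x : ball z q x -> x \in D'.
  move=> zx; have vD' : v \in D'.
    by apply: (inner_hull_step yD' c5); [exact: zN|move=> zv0; apply: hno; exists v].
  apply: (inner_hull_joined vD'); apply: joined_mono (opened_joined hE ho zv zx) => // s zs.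
  by split; [exact: zN|move=> zs'; apply: hno; exists s].
have Q'D x : ball z' q x -> x \in D.
  move=> zx; have vD : v' \in D.
    by apply: (inner_hull_step y'D c5'); [exact: zN'|move=> zv0; apply: hno; exists v'].
  apply: (inner_hull_joined vD); apply: joined_mono (opened_joined hE ho' zv' zx) => // s zs.
  by split; [exact: zN'|move=> zs'; apply: hno; exists s].
have tD' : t \in D'.
  apply: (inner_hull_joined (QD' _ (ball_center z q))); apply: joined_mono jt => // s [As nD].
  by split; [exact: AN|move=> zs'; apply: nD; exact: Q'D].
have : (V `&` ball 0 b) t by split=> //; exact: c1'.
by rewrite Vb.
Qed.

End contraction_tools.

(** * One contraction step *)

Section contraction_step.
Context (R : realType) (d : nat) (p : R) (E : set (edge d)) (L0 : nat).
Context (hE : lattice_edges E L0) (p01 : 0 < p < 1).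
Implicit Types (x y z u v t : Zd d) (A B O W V S J : set (Zd d)) (w xi : set (edge d)) (D : seq (Zd d)).
Implicit Types (F X Y : set (edge d) -> Prop).

Local Notation EI := (edges_in E).

Let p01' : 0 <= p <= 1. Proof. by case/andP: p01 => /ltW -> /ltW ->. Qed.
Let p0 : 0 < p. Proof. by case/andP: p01. Qed.

(** The inner factor: no trace of A or V is left in it. *)
Definition exit_weight N n ell q b (eta : R) z y v X D := Pr p (EI 0 N) (fun w =>
  [/\ inner_hull N n q z w = D, X (w `&` touching [set` D]),
      core n ell q b eta z y v D (w `&` touching [set` D]) & via q z D w]).

Definition exit_event N n ell q b (eta : R) z y v A V w :=
  core n ell q b eta z y v (inner_hull N n q z w) (w `&` touching [set` inner_hull N n q z w]) /\
  tail E A V q z (inner_hull N n q z w) w.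

Lemma inside_touching n D w : (forall x, ball 0 n x -> x \in D) -> w `<=` E -> w `&` inside (ball 0 n) `<=` touching [set` D].
Proof.
move=> nD wE e [/wE we ie]; have [x [x' [eE _ _]]] := edge_range hE we.
by exists x; [rewrite eE !inE eqxx|apply: nD; apply: ie; rewrite eE !inE eqxx].
Qed.

Section one_exit.
Context (N n ell q b : nat) (eta : R) (z y v : Zd d).
Context (nell : (n <= ell)%N) (ellN : (ell <= N)%N) (zell : ball z q `&` ball 0 ell = set0).
Context (zv : ball z q v) (zN : ball z q `<=` ball 0 N).

Let off t : ball z q t -> ~ ball 0 n t.
Proof.
move=> zt nt; have : (ball z q `&` ball 0 ell) t by split=> //; exact: (ball_subr nell nt).
by rewrite zell.
Qed.

Lemma core_outer D w1 w2 T : w2 `<=` inside (ball 0 n) ->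
  core n ell q b eta z y v D ((w1 `|` w2) `&` T) <-> core n ell q b eta z y v D (w1 `&` T).
Proof.
move=> h2; split=> [[c1 c2 c3 c4 [[c5 T5] c6]]|[c1 c2 c3 c4 [[c5 T5] c6]]]; split=> //; split.
- split=> //; case: c5 => // /h2 ie; exfalso; apply: (off zv); apply: ie.
  by rewrite !inE eqxx orbT.
- apply: joined_set_mono (hit_outer c6) => // e [[[we|/h2 ie] Te] ne]; last by case: (ne ie).
  by split.
- by split=> //; left.
- by apply: joined_set_mono c6 => // e [we Te]; split=> //; left.
Qed.

(** The edges of the opened ball and of a path off [D] do not touch [D]. *)
Lemma tail_off A V D w U : U `<=` touching [set` D] -> (forall x, x \in D -> ~ ball z q x) ->
  tail E A V q z D w -> tail E A V q z D (w `\` U).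
Proof.
move=> UD Dz [ho jt]; split.
  move=> e he; split; first exact: ho.
  move=> /UD [x xe xD]; have [_ ie] := iffLR (mem_edges_in hE _ _ _) he; exact: Dz xD (ie _ xe).
rewrite (joined_set_depends (A `\` [set` D])) in jt; apply: joined_set_mono jt => // e [we ie].
by split=> // /UD [x xe xD]; have [_] := ie _ xe.
Qed.

Lemma tail_mono A V D w w' : w `<=` w' -> tail E A V q z D w -> tail E A V q z D w'.
Proof. by move=> ww [h1 h2]; split; [move=> e /h1 /ww|exact: joined_set_mono h2]. Qed.

Lemma exit_event_outer A V w1 w2 : w2 `<=` inside (ball 0 n) -> w2 `<=` E ->
  exit_event N n ell q b eta z y v A V (w1 `|` w2) <-> exit_event N n ell q b eta z y v A V w1.
Proof.
move=> h2 w2E; rewrite /exit_event inner_hull_outer//; set D := inner_hull _ _ _ _ _.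
rewrite core_outer//; split=> -[c1 t1]; split=> //; last first.
  by apply: tail_mono t1 => e; left.
have [_ _ c3 c4 _] := c1.
have w2T : w2 `<=` touching [set` D].
  by move=> e we; apply: (inside_touching c3 w2E); split=> //; exact: h2.
apply: tail_mono (tail_off w2T c4 t1) => e [[]//].
Qed.

(** [via_iff] replaces the arm event by [via], and the exploration of [D] makes inner and outer
    factors independent. *)
Lemma exit_factor A V X : A `<=` ball 0 N -> ball 0 b `<=` A -> ball z q `<=` A -> V `&` ball 0 b = set0 ->
  depends_on (inside (ball 0 n)) X ->
  Pr p (EI 0 N) (fun w => (X w /\ joined_set w A 0 V) /\ exit_event N n ell q b eta z y v A V w) =
  \sum_(D <- hulls d N) exit_weight N n ell q b eta z y v X D *
     Pr p (EI 0 N) (fun w => tail E A V q z D (w `\` touching [set` D])).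
Proof.
move=> AN bA zA Vb dX.
pose a D w : R := `[< [/\ X (w `&` touching [set` D]), core n ell q b eta z y v D (w `&` touching [set` D]) & via q z D w] >]%:R.
pose g D w : R := `[< tail E A V q z D (w `\` touching [set` D]) >]%:R.
have e1 : Pr p (EI 0 N) (fun w => (X w /\ joined_set w A 0 V) /\ exit_event N n ell q b eta z y v A V w) =
    Ex p (EI 0 N) (fun w => a (inner_hull N n q z w) w * g (inner_hull N n q z w) w).
  apply: eq_Ex => w ws; have wE := edges_inE hE ws.
  have wN : w `<=` inside (ball 0 N) by move=> e /ws /(mem_edges_in hE)[].
  rewrite /a /g -natrM mulnb -asbool_and; congr (_%:R); congr nat_of_bool; apply: asbool_equiv_eq.
  have dXw (D := inner_hull N n q z w) : (forall x, ball 0 n x -> x \in D) -> X (w `&` touching [set` D]) = X w.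
    move=> nD; apply: (dependsE dX); apply/seteqP; split=> e [h1 h2]; split=> //; first by case: h1.
    by split=> //; apply: (inside_touching nD wE).
  have VI := @via_iff R d E L0 hE N n ell q b eta z y v A V AN bA zA Vb w wE wN.
  split.
    move=> [[Xw jw] [c1 t1]]; have [_ _ c3 c4 _] := c1.
    by split; [split=> //; [rewrite dXw|apply/(VI c1 t1)]|exact: tail_off].
  move=> [[Xw c1 vw] t1]; have [_ _ c3 c4 _] := c1.
  have t2 : tail E A V q z (inner_hull N n q z w) w by apply: tail_mono t1 => e [].
  split; last by split.
  by split; [rewrite dXw in Xw|apply/(VI c1 t2)].
rewrite e1 (@Ex_explore _ _ _ p (EI 0 N) (inner_hull N n q z) (hulls d N) (fun D => touching [set` D]) a g).
- apply: eq_bigr => D _; congr (_ * _); apply: eq_Ex => w _.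
  rewrite /a -natrM mulnb -asbool_and; congr (_%:R); congr nat_of_bool; apply: asbool_equiv_eq.
  by split=> [[h1 [h2 h3 h4]]|[h1 h2 h3 h4]].
- exact: hulls_uniq.
- by move=> w; exact: mem_hulls.
- move=> D; apply: (depends_sub (U := touching [set` D] `&` inside (ball 0 N `\` ball z q))); first by move=> e [].
  by apply: hull_depends => // t [].
- by move=> D w; rewrite /a /via -!setIA setIid.
- by move=> D w; rewrite /g !setDE -setIA setIid.
Qed.

Lemma tail_prob A V D (g : R) : 0 <= g -> (forall x, x \in D -> ~ ball z q x) ->
  g <= Pr p (EI 0 N) (fun w => joined_set w (A `\` [set` D]) z V) ->
  p ^+ size (EI z q) * g <= Pr p (EI 0 N) (fun w => tail E A V q z D (w `\` touching [set` D])).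
Proof.
move=> g0 Dz hg; have sl : {subset EI z q <= EI 0 N} by move=> e; apply: (edges_in_mono hE).
apply: (@le_trans _ _ (Pr p (EI 0 N) (fun w => opened E q z w) * Pr p (EI 0 N) (fun w => joined_set w (A `\` [set` D]) z V))).
  by apply: ler_pM => //; [rewrite exprn_ge0// ltW|exact: (all_open p01 sl)].
apply: (le_trans (Pr_FKG p01' _ _ _)).
- by move=> w w' ww h e /h /ww.
- exact: joined_set_incr.
- by apply: le_Pr => // w _ [h1 h2]; exact: tail_off.
Qed.

(** For given edges outside the box of radius [n], entering the ball from [D] is an arm event of the
    box, so that the inner weights inherit the bounds [lo] and [hi]. *)
Lemma weight_bounds F lo hi D : depends_on (inside (ball 0 n)) F -> ratio_bounds p E n F lo hi ->
  lo * exit_weight N n ell q b eta z y v (fun=> True) D <= exit_weight N n ell q b eta z y v F D /\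
  exit_weight N n ell q b eta z y v F D <= hi * exit_weight N n ell q b eta z y v (fun=> True) D.
Proof.
move=> dF hF; pose G w := inner_hull N n q z w = D /\ core n ell q b eta z y v D (w `&` touching [set` D]).
have nN : (n <= N)%N by exact: leq_trans nell ellN.
have := @cond_bounds R d p E L0 hE p01 n N F lo hi (fun w => `[< G w >]%:R) (via q z D) nN dF hF.
move=> /(_ (fun w _ => ler0n _ _)) [].
- move=> w1 w2 h2 w2E; congr (_%:R); congr nat_of_bool; apply: asbool_equiv_eq.
  by rewrite /G inner_hull_outer// core_outer.
- move=> w1 w1E w1N w1n; rewrite pnatr_eq0; case: asboolP => // -[_ [_ _ c3 _ _]] _.
  exists (w1 `&` touching [set` D]), setT, (ball z q); split.
  + by move=> e [/w1E].
  + by rewrite setIAC w1n set0I.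
  + by apply/seteqP; split=> // t [/off].
  + by [].
  + move=> w2 h2 w2E; rewrite /via setIUl setUC (_ : w2 `&` _ = w2)//.
    apply/seteqP; split=> e; first by case.
    by move=> we; split=> //; apply: (inside_touching c3 w2E); split=> //; exact: h2.
have e0 : Ex p (EI 0 N) (fun w => `[< G w >]%:R * `[< via q z D w >]%:R) =
    exit_weight N n ell q b eta z y v (fun=> True) D.
  apply: eq_Ex => w _; rewrite -natrM mulnb -asbool_and; congr (_%:R); congr nat_of_bool; apply: asbool_equiv_eq.
  by split=> [[[h1 h2] h3]|[h1 _ h2 h3]].
have e1 : Ex p (EI 0 N) (fun w => `[< G w >]%:R * `[< F w /\ via q z D w >]%:R) =
    exit_weight N n ell q b eta z y v F D.
  apply: eq_Ex => w ws; have wE := edges_inE hE ws.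
  rewrite -natrM mulnb -asbool_and; congr (_%:R); congr nat_of_bool; apply: asbool_equiv_eq.
  have dFw : (forall x, ball 0 n x -> x \in D) -> F (w `&` touching [set` D]) = F w.
    move=> nD; apply: (dependsE dF); apply/seteqP; split=> e [h1 h2]; split=> //; first by case: h1.
    by split=> //; apply: (inside_touching nD wE).
  split=> [[[h1 c1] [h2 h3]]|[h1 h2 c1 h3]]; have [_ _ c3 _ _] := c1; first by split=> //; rewrite dFw.
  by split=> //; split=> //; rewrite -dFw.
by rewrite e0 e1.
Qed.

End one_exit.

(** A Doeblin minorization. The outer factors are at least kk * g, so that kk / M times the inner
    weights, which do not depend on A and V, is a common part of all conditional laws. What is left
    of the arm event still has ratios in [lo, hi]; hence the width shrinks by 1 minus the common
    mass. *)
Lemma contract_step N n ell q b M (eta kk lo hi : R) (l : seq (Zd d * Zd d)) (zc : Zd d * Zd d -> Zd d) F :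
  (n <= ell)%N -> (ell <= b)%N -> (b <= N)%N ->
  uniq l -> (forall e, e \in l -> [/\ ball (zc e) q `&` ball 0 ell = set0, ball (zc e) q e.2,
     ball (zc e) q `<=` ball 0 N & (dist e.1 e.2 <= L0)%N]) ->
  ((3 * q).*2.+1 ^ d * (3 * q + L0).*2.+1 ^ d <= M)%N -> (0 < M)%N -> 0 <= kk ->
  depends_on (inside (ball 0 n)) F -> ratio_bounds p E n F lo hi ->
  let S X := \sum_(e <- l) \sum_(D <- hulls d N) exit_weight N n ell q b eta (zc e) e.1 e.2 X D in
  forall A V, A `<=` ball 0 N -> ball 0 b `<=` A -> (forall e, e \in l -> ball (zc e) q `<=` A) ->
  V `&` ball 0 b = set0 ->
  let g := Pr p (EI 0 N) (fun w => joined_set w A 0 V) in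
  let gF := Pr p (EI 0 N) (fun w => F w /\ joined_set w A 0 V) in
  (forall e D, e \in l -> (forall x, x \in D -> ball 0 b x) -> \sum_(x <- balls 0 b | x \in D) kap (zc e) x <= eta ->
     (forall x, x \in D -> ~ ball (zc e) q x) ->
     kk * g <= Pr p (EI 0 N) (fun w => tail E A V q (zc e) D (w `\` touching [set` D]))) ->
  [/\ kk / M%:R * S (fun=> True) * g <= g,
      (lo * (1 - kk / M%:R * S (fun=> True)) + kk / M%:R * S F) * g <= gF &
      gF <= (hi * (1 - kk / M%:R * S (fun=> True)) + kk / M%:R * S F) * g].
Proof.
move=> nell ellb bN ul geo hM M0 kk0 dF hF S A V AN bA zA Vb g gF hlb.
have ellN := leq_trans ellb bN; have M0' : 0 < M%:R :> R by rewrite ltr0n.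
pose L (e : Zd d * Zd d) w := exit_event N n ell q b eta (zc e) e.1 e.2 A V w.
pose T X := \sum_(e <- l) Pr p (EI 0 N) (fun w => (X w /\ joined_set w A 0 V) /\ L e w).
pose wt (e : Zd d * Zd d) X D := exit_weight N n ell q b eta (zc e) e.1 e.2 X D.
pose hh (e : Zd d * Zd d) D := Pr p (EI 0 N) (fun w => tail E A V q (zc e) D (w `\` touching [set` D])).
have TE X : depends_on (inside (ball 0 n)) X -> T X = \sum_(e <- l) \sum_(D <- hulls d N) wt e X D * hh e D.
  move=> dX; rewrite /T [LHS]big_seq [RHS]big_seq; apply: eq_bigr => e el; have [g1 g2 g3 g4] := geo _ el.
  by apply: exit_factor => //; exact: zA.
have dT : depends_on (inside (ball (0 : Zd d) n)) (fun _ : set (edge d) => True) by [].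
have wt0 a D : wt a (fun=> True) D != 0 -> (forall x, x \in D -> ball 0 b x) /\
    \sum_(x <- balls 0 b | x \in D) kap (zc a) x <= eta /\ (forall x, x \in D -> ~ ball (zc a) q x).
  move=> h; apply: contrapT => hno; move: h; rewrite /wt /exit_weight Pr_false ?eqxx// => w [_ _ [c1 c2 c3 c4 _] _].
  by apply: hno.
have wtge0 e X D : 0 <= wt e X D by exact: Pr_ge0.
have wtF e D : e \in l -> lo * wt e (fun=> True) D <= wt e F D /\ wt e F D <= hi * wt e (fun=> True) D.
  by move=> el; have [g1 g2 g3 g4] := geo _ el; exact: weight_bounds.
have hk e D : e \in l -> wt e (fun=> True) D != 0 -> 0 <= hh e D - kk * g.
  by move=> el /wt0[h1 [h2 h3]]; rewrite subr_ge0; exact: hlb.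
(* The common part kk * g is taken out of every outer factor; the remainders are nonnegative
   wherever the weight is not 0. *)
have Tk X : depends_on (inside (ball 0 n)) X -> T X = \sum_(e <- l) \sum_(D <- hulls d N) wt e X D * (hh e D - kk * g) + kk * g * S X.
  move=> dX; rewrite TE// mulr_sumr -big_split; apply: eq_bigr => e _ /=; rewrite mulr_sumr -big_split.
  by apply: eq_bigr => D _ /=; rewrite -/(wt e X D); ring.
have cnt w : w `<=` [set` EI 0 N] -> (count (fun e => `[< L e w >]) l <= M)%N.
  move=> ws; apply: leq_trans hM; pose sw (e : Zd d * Zd d) := (e.2, e.1).
  have swK : cancel sw sw by case.
  have -> : count (fun e => `[< L e w >]) l = count (fun e => `[< L (sw e) w >]) (map sw l).
    by rewrite count_map; apply: eq_count => e /=; rewrite swK.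
  apply: (count_near_le (zc := zc \o sw)).
  - by rewrite map_inj_uniq//; exact: can_inj swK.
  - by move=> _ /mapP[e el ->] /=; rewrite swK; have [g1 g2 g3 g4] := geo _ el; rewrite distC.
  - move=> _ _ /mapP[e el ->] /mapP[e' el' ->]; rewrite /= !swK => /asboolP[c1 t1] /asboolP[c1' t1'].
    have [g1 g2 g3 g4] := geo _ el; have [g1' g2' g3' g4'] := geo _ el'.
    exact: (tails_meet hE nell ellN g1 g1' g2 g2' g3 g3' AN Vb c1 t1 c1' t1').
(* By [tails_meet] at most [M] exit events occur at once; the division by [M] keeps this remaining
   weight nonnegative. *)
pose phi w : R := 1 - M%:R^-1 * \sum_(e <- l) `[< L e w >]%:R.
have phi0 w : w `<=` [set` EI 0 N] -> 0 <= phi w.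
  move=> ws; rewrite subr_ge0 ler_pdivrMl// mulr1 -natr_sum ler_nat.
  have -> : (\sum_(e <- l) `[< L e w >] = count (fun e => `[< L e w >]) l)%N.
    by rewrite -sum1_count [RHS]big_mkcond; apply: eq_bigr => e _; case: asboolP.
  exact: cnt.
have exphi X : Ex p (EI 0 N) (fun w => phi w * `[< X w /\ joined_set w A 0 V >]%:R) =
    Pr p (EI 0 N) (fun w => X w /\ joined_set w A 0 V) - M%:R^-1 * T X.
  rewrite /T /Pr -Ex_sum -ExZ -ExB; apply: eq_Ex => w ws; rewrite /phi mulrBl mul1r -mulrA mulr_suml.
  congr (_ - _ * _); apply: eq_bigr => e _; rewrite -natrM mulnb -asbool_and.
  congr (_%:R); congr nat_of_bool; apply: asbool_equiv_eq; tauto.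
have exphiT : Ex p (EI 0 N) (fun w => phi w * `[< joined_set w A 0 V >]%:R) = g - M%:R^-1 * T (fun=> True).
  have -> : g = Pr p (EI 0 N) (fun w => True /\ joined_set w A 0 V).
    by apply: eq_Ex => w _; congr (_%:R); congr nat_of_bool; apply: asbool_equiv_eq; tauto.
  rewrite -exphi; apply: eq_Ex => w _; congr (_ * _%:R); congr nat_of_bool; apply: asbool_equiv_eq; tauto.
have nN := leq_trans nell ellN.
have [b1 b2] : lo * (g - M%:R^-1 * T (fun=> True)) <= gF - M%:R^-1 * T F /\
    gF - M%:R^-1 * T F <= hi * (g - M%:R^-1 * T (fun=> True)).
  rewrite -exphi -exphiT; apply: (cond_bounds hE p01 nN dF hF).
  - exact: phi0.
  - move=> w1 w2 h2 w2E; congr (_ - _ * _); rewrite [LHS]big_seq [RHS]big_seq; apply: eq_bigr => e el.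
    have [g1 g2 g3 g4] := geo _ el; congr (_%:R); congr nat_of_bool; apply: asbool_equiv_eq.
    exact: exit_event_outer.
  - move=> w1 w1E w1N w1n _; exists w1, A, V; split=> //; last by move=> w2 _ _; rewrite setUC.
      by rewrite -subset0 => t [Vt nt]; rewrite -Vb; split=> //; exact: (ball_subr (leq_trans nell ellb) nt).
    by apply: subset_trans bA; exact: ball_subr (leq_trans nell ellb).
have wF0 e D : e \in l -> wt e (fun=> True) D = 0 -> wt e F D = 0.
  by move=> el w0; have [] := wtF e D el; rewrite w0 !mulr0 => h1 h2; apply/eqP; rewrite eq_le h1 h2.
set Q := fun X => \sum_(e <- l) \sum_(D <- hulls d N) wt e X D * (hh e D - kk * g).
have [Q1 Q2] : lo * Q (fun=> True) <= Q F /\ Q F <= hi * Q (fun=> True).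
  rewrite /Q !mulr_sumr; split; rewrite big_seq [leRHS]big_seq; apply: ler_sum => e el; rewrite mulr_sumr;
    apply: ler_sum => D _; (have [w0|wn] := eqVneq (wt e (fun=> True) D) 0; first by rewrite wF0// w0 !mul0r mulr0);
    have [h1 h2] := wtF e D el; have h3 := hk e D el wn; rewrite mulrA; exact: ler_wpM2r.
have Q0 : 0 <= Q (fun=> True).
  rewrite /Q big_seq; apply: sumr_ge0 => e el; apply: sumr_ge0 => D _.
  by have [->|wn] := eqVneq (wt e (fun=> True) D) 0; [rewrite mul0r|rewrite mulr_ge0// hk].
have MT : M%:R^-1 * T (fun=> True) <= g.
  by rewrite -subr_ge0 -exphiT; apply: Ex_ge0 => // w ws; rewrite mulr_ge0// phi0.
have TT := Tk _ dT; have TF := Tk _ dF.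
have Mi0 : 0 <= M%:R^-1 :> R by rewrite invr_ge0 ltW.
move: b1 b2 MT; rewrite TT TF -/(Q (fun=> True)) -/(Q F); move: (Q _) (Q F) (S _) (S F) Q1 Q2 Q0 => Qt QF St SF Q1 Q2 Q0.
move: M%:R^-1 Mi0 => m m0 b1 b2 MT; split.
- have : 0 <= m * Qt by rewrite mulr_ge0.
  by move: MT; rewrite mulrDr; clear; lra.
- have := ler_wpM2l m0 Q1; move: b1; clear; lra.
- have := ler_wpM2l m0 Q2; move: b2; clear; lra.
Qed.

End contraction_step.

(** * The cluster of the box is bounded and sparse *)

Section exit_mass.
Context (R : realType) (d : nat) (p : R) (E : set (edge d)) (L0 : nat).
Context (hE : lattice_edges E L0) (p01 : 0 < p < 1) (d6 : (6 < d)%N).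
Context (c C : R) (c0 : 0 < c) (cC : c < C) (tp : two_point p E c C).
Implicit Types (x y z u v t : Zd d) (A B O W V S J : set (Zd d)) (w xi : set (edge d)) (D : seq (Zd d)).
Implicit Types (F X Y : set (edge d) -> Prop).

Local Notation EI := (edges_in E).
Local Notation half := (2^-1 : R).

Let p01' : 0 <= p <= 1. Proof. by case/andP: p01 => /ltW -> /ltW ->. Qed.
Let p0 : 0 < p. Proof. by case/andP: p01. Qed.
Let C0 : 0 < C. Proof. exact: lt_trans c0 cC. Qed.
Let d2 : (2 < d)%N. Proof. by move: d6; clear; lia. Qed.

Lemma arm_kap N A x n :
  Pr p (EI 0 N) (fun w => joined_set w A x (ball 0 n)) <= C * \sum_(a <- balls 0 n) kap x a.
Proof.
apply: (le_trans (Pr_union p01' (r := balls 0 n) (Y := fun a w => joined w setT x a) _)).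
  by move=> w _ [a na ja]; exists a; [rewrite mem_balls|exact: joined_mono ja].
by rewrite mulr_sumr; apply: ler_sum => a _; exact: tp_up tp _ _ _.
Qed.

(** At large scales the kernel sum 4^(3i) = 2^(6i) is below 2^(i(3d-7)), constants included from i
    >= K on. At the finitely many smaller scales the ball is far from the origin and every term is
    small. *)
Lemma far_arm_sum n : exists l0 : nat, forall l N z A i, (l0 <= l)%N -> (2 ^ l < dist z 0)%N ->
  \sum_(x <- balls z (2 ^ (3 * i))) Pr p (EI 0 N) (fun w => joined_set w A x (ball 0 n)) <= 2 ^+ (i * (3 * d - 7)).
Proof.
have [K hK] := archi_pow2 (C * ((size (balls (0 : Zd d) n))%:R * (8 ^+ d * 16))).
pose M := (4 ^ d * 2 ^ (3 * K * d))%N; have M0 : 0 < M%:R :> R by rewrite ltr0n muln_gt0 !expn_gt0.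
have sz0 : 0 <= (size (balls (0 : Zd d) n))%:R :> R by [].
have [n0 hn0] : exists n0 : nat, forall m, (n0 <= m)%N -> half ^+ m <= (M%:R * (C * (size (balls (0 : Zd d) n)).+1%:R))^-1.
  by apply: half_small; rewrite invr_gt0 !mulr_gt0.
exists (n0 + n + 3 * K + 3)%N => l N z A i hl zl.
have [Ki|iK] := leqP K i.
  apply: (@le_trans _ _ (\sum_(x <- balls z (2 ^ (3 * i))) C * \sum_(a <- balls 0 n) kap x a)).
    by apply: ler_sum => x _; exact: arm_kap.
  rewrite -mulr_sumr exchange_big /=.
  apply: (@le_trans _ _ (C * ((size (balls (0 : Zd d) n))%:R * (8 ^+ d * 16 * 4 ^+ (3 * i))))).
    rewrite ler_pM2l//; apply: sum_ge0_le => a _; rewrite (eq_bigr (fun x => kap a x)); last by move=> x _; exact: kapC.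
    exact: (kap_sum p01' d2).
  rewrite (_ : C * _ = (C * ((size (balls (0 : Zd d) n))%:R * (8 ^+ d * 16))) * 4 ^+ (3 * i)); last by ring.
  apply: (@le_trans _ _ (2 ^+ K * 4 ^+ (3 * i))); first by rewrite ler_wpM2r// exprn_ge0.
  rewrite (_ : 4 = 2 ^+ 2 :> R); last by ring.
  rewrite -exprM -exprD; apply: ler_weXn2l; first by rewrite ler1n.
  have : (7 * i <= i * (3 * d - 7 - 6))%N by rewrite mulnC leq_mul2l; move: d6; clear; lia.
  move: Ki d6; clear; nia.
apply: (@le_trans _ _ 1); last by rewrite exprn_ege1// ler1n.
apply: (le_trans (sum_ge0_le (M := M%:R^-1) _)); last first.
  rewrite ler_pdivrMr// mul1r ler_nat /M; apply: (leq_trans (size_balls_le p01' d2 z (3 * i))).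
  by rewrite leq_mul2l leq_exp2l// leq_mul2r; move: iK; clear; lia.
move=> x; rewrite mem_balls => xz; apply: (le_trans (arm_kap _ _ _ _)).
pose r := (2 ^ l - 2 ^ (3 * i) - n)%N.
have nl : (2 ^ (3 * i) + n <= 2 ^ l.-1)%N.
  apply: (@leq_trans (2 ^ (3 * i + n))); last by rewrite leq_exp2l//; move: hl iK; clear; lia.
  rewrite expnD; have := ltn_expl n (ltnSn 1); have : (0 < 2 ^ (3 * i))%N by rewrite expn_gt0.
  move: (2 ^ n)%N (2 ^ (3 * i))%N; clear; nia.
have l1 : (2 ^ l = 2 ^ l.-1 + 2 ^ l.-1)%N by rewrite addnn -mul2n -expnS prednK//; move: hl; clear; lia.
apply: (@le_trans _ _ (C * ((size (balls (0 : Zd d) n)).+1%:R * half ^+ l.-1))); last first.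
  rewrite mulrA; set T := C * _.
  have T0 : 0 < T by rewrite mulr_gt0.
  rewrite mulrC; apply: (@le_trans _ _ ((M%:R * T)^-1 * T)); last by rewrite invfM -mulrA mulVf ?mulr1// gt_eqF.
  rewrite ler_pM2r//; apply: hn0; move: hl; clear; lia.
rewrite ler_pM2l//; apply: (@le_trans _ _ ((size (balls (0 : Zd d) n))%:R * half ^+ l.-1)); last first.
  by apply: ler_wpM2r; [rewrite exprn_ge0// invr_ge0|rewrite ler_nat].
apply: sum_ge0_le => a; rewrite mem_balls => an.
have ra : (2 ^ l.-1 <= dist x a)%N.
  have := dist_triangle x z 0; have := dist_triangle a x 0; rewrite (distC z x).
  move: xz an zl nl l1; clear; lia.
apply: (le_trans (kap_far R ra)); rewrite exprVn lef_pV2 ?posrE ?exprn_gt0//.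
rewrite -!natrX ler_nat; apply: (@leq_trans ((2 ^ l.-1).+1 ^ 1)); first by rewrite expn1.
by rewrite leq_exp2l//; move: d6; clear; lia.
Qed.

Lemma hull_bounded n (e : R) : 0 < e -> exists b0 : nat, forall b N q z, (b0 <= b)%N ->
  Pr p (EI 0 N) (fun w => ~ forall x, x \in inner_hull N n q z w -> ball 0 b x) <= e.
Proof.
move=> e0; set m := size (balls (0 : Zd d) n); have e1 : 0 < e / m.+1%:R by rewrite divr_gt0.
have [R0 hR0] := small_arm hE p01 d6 c0 cC tp n e1; exists R0 => b N q z hb.
apply: (@le_trans _ _ (\sum_(a <- balls 0 n) Pr p (EI 0 N) (fun w => joined_set w setT a (~` ball 0 b)))).
  apply: Pr_union => // w _ /existsNP[x /not_implyP[]].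
  rewrite mem_inner_hull => /asboolP[a na ja] nb; exists a; first by rewrite mem_balls.
  by exists x => //; apply: joined_sym; exact: joined_mono ja.
apply: (le_trans (sum_ge0_le (M := e / m.+1%:R) _)).
  move=> a; rewrite mem_balls => an; apply: (hR0 b) => //; exact: setICl.
by rewrite -/m mulrCA -[leRHS]mulr1 ler_pM2l// ler_pdivrMr// mul1r ler_nat.
Qed.

(** [ring_sum] with the connection from [y] to 0 as first arm and the connections to the box as
    further arms; the loss is relative to the probability of the first. *)
Lemma hull_sparse (eta th : R) : 0 < eta -> 0 < th -> exists s1 : nat, forall s0 n, (s1 <= s0)%N ->
  exists l0 : nat, forall l h N y v z, (l0 <= l)%N -> (2 ^ l <= N)%N -> (dist z 0 <= 2 ^ (3 * h))%N ->
  ball z (2 ^ (3 * s0)) `&` ball 0 (2 ^ l) = set0 -> ball z (2 ^ (3 * s0)) v -> (dist y v <= L0)%N -> ball 0 (2 ^ l) y ->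
  Pr p (EI 0 N) (fun w => joined w (ball 0 (2 ^ l)) 0 y /\
     eta < \sum_(x <- balls 0 (2 ^ (3 * h)) | x \in inner_hull N n (2 ^ (3 * s0)) z w) kap z x) <=
  th * Pr p (EI 0 N) (fun w => joined w (ball 0 (2 ^ l)) 0 y).
Proof.
move=> eta0 th0; have [K hK] := glue_ball hE p01 d6 c0 cC tp.
have [i0 [J hR]] := ring_sum hE p01 d6 c0 cC tp K.
pose Kr : R := 10 * 2 ^+ (3 * d - 7); have Kr0 : 0 < Kr by rewrite mulr_gt0// exprn_gt0.
have [ns hns] : exists ns : nat, forall n, (ns <= n)%N -> half ^+ n <= eta * th / Kr.
  by apply: half_small; rewrite divr_gt0// mulr_gt0.
exists (i0 + ns + L0)%N => s0 n hs; have [l0 hl0] := far_arm_sum n.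
exists l0 => l h N y v z hl lN zh zl zv yv ly; set q := (2 ^ (3 * s0))%N; set O := ball (0 : Zd d) (2 ^ l).
pose A : set (Zd d) := ball 0 N `\` ball z q.
have jE w : joined w O 0 y <-> joined_set w O y [set (0 : Zd d)].
  by split=> [/joined_sym j|[t -> /joined_sym]//]; exists 0.
have sub : {subset balls (0 : Zd d) (2 ^ (3 * h)) <= balls z (2 ^ (3 * h.+1))}.
  move=> x; rewrite !mem_balls => x0; apply: (leq_trans (dist_triangle 0 _ _)); rewrite (distC 0 z).
  apply: (leq_trans (leq_add x0 zh)); rewrite mulnS expnD; move: (2 ^ (3 * h))%N; clear; lia.
have zfar : (2 ^ l < dist z 0)%N.
  rewrite ltnNge; apply/negP => h1; have : (ball z q `&` O) z by split=> //; exact: ball_center.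
  by rewrite zl.
apply: (@le_trans _ _ (Pr p (EI 0 N) (fun w => joined_set w O y [set (0 : Zd d)] /\
   ((forall x, x \in inner_hull N n q z w -> (dist x z <= 2 ^ (3 * h.+1))%N -> (q < dist x z)%N) /\
    eta < \sum_(x <- balls z (2 ^ (3 * h.+1)) | x \in inner_hull N n q z w) kap z x)))).
  apply: le_Pr => // w _ [/jE h1 h2]; split=> //; split.
    by move=> x /hull_off nx _; rewrite ltnNge; apply/negP.
  apply: (lt_le_trans h2); apply: ler_sum_sub => //; rewrite ?balls_uniq//.
  - by move=> x xb xH; split=> //; exact: sub.
  - by move=> x; exact: kap_ge0.
have hW w x : x \in inner_hull N n q z w -> joined_set w A x (ball 0 n).
  by rewrite mem_inner_hull => /asboolP.
apply: (le_trans (markov_dist E p01 N z (2 ^ (3 * h.+1)) q (fun w => joined_set w O y [set (0 : Zd d)]) eta0 hW)).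
have -> : Pr p (EI 0 N) (fun w => joined w O 0 y) = Pr p (EI 0 N) (fun w => joined_set w O y [set (0 : Zd d)]).
  by apply: eq_Ex => w _; congr (_%:R); congr nat_of_bool; exact: asbool_equiv_eq.
have i0s : (i0 <= s0)%N by move: hs; clear; lia.
have Lq : (L0 <= q)%N.
  by apply: (leq_trans (ltnW (ltn_expl L0 (ltnSn 1)))); rewrite leq_exp2l//; move: hs; clear; lia.
apply: (le_trans (ler_wpM2l _ (hR s0 h.+1 id N z y A O [set (0 : Zd d)] (ball 0 n) i0s ly _ _))).
- by rewrite invr_ge0 ltW.
- move=> i /andP[si im]; split=> //; first by rewrite leq_pmull// muln_gt0; move: d6; clear; lia.
    apply: (leq_trans (dist_triangle v _ _)); apply: (leq_trans (leq_add yv zv)).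
    apply: (leq_trans (leq_add Lq (leqnn _))); apply: (@leq_trans (2 ^ (3 * s0).+1)); first by rewrite expnS mul2n -addnn.
    by rewrite leq_exp2l//; move: si; clear; lia.
  by move=> x j Ox _ yx _; apply: hK => //; exact: ball_subr.
- by move=> i _; exact: (hl0 l N z A i hl zfar).
rewrite -/Kr mulrA ler_wpM2r ?Pr_ge0// ler_pdivrMl//.
rewrite mulrC -ler_pdivlMr//; apply: hns; move: hs; clear; lia.
Qed.

End exit_mass.

(** * Contraction of the oscillation *)

Section contraction.
Context (R : realType) (d : nat) (p : R) (E : set (edge d)) (L0 : nat).
Context (hE : lattice_edges E L0) (p01 : 0 < p < 1) (d6 : (6 < d)%N).
Context (c C : R) (c0 : 0 < c) (cC : c < C) (tp : two_point p E c C).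
Implicit Types (x y z u v t : Zd d) (A B O W V S J : set (Zd d)) (w xi : set (edge d)) (D : seq (Zd d)).
Implicit Types (F X Y : set (edge d) -> Prop).

Local Notation EI := (edges_in E).
Local Notation half := (2^-1 : R).

Let p01' : 0 <= p <= 1. Proof. by case/andP: p01 => /ltW -> /ltW ->. Qed.
Let p0 : 0 < p. Proof. by case/andP: p01. Qed.
Let C0 : 0 < C. Proof. exact: lt_trans c0 cC. Qed.

(** If 0 is joined to [y] inside the ball of radius [ell] and the edge to [v] is open, the
    requirements of [core] and [via] can fail only because the hull is not sparse or not bounded.
    The edge leaves the ball and is independent of the connection. *)
Lemma weight_mass N n ell q b (eta : R) z y v : (n <= ell)%N -> (ell <= N)%N -> ball z q `&` ball 0 ell = set0 ->
  ball z q v -> ball 0 ell y -> ball 0 N v -> E [fset y; v]%fset ->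
  p * Pr p (EI 0 N) (fun w => joined w (ball 0 ell) 0 y) -
    Pr p (EI 0 N) (fun w => joined w (ball 0 ell) 0 y /\ eta < \sum_(x <- balls 0 b | x \in inner_hull N n q z w) kap z x) -
    Pr p (EI 0 N) (fun w => ~ forall x, x \in inner_hull N n q z w -> ball 0 b x) <=
  \sum_(D <- hulls d N) exit_weight p E N n ell q b eta z y v (fun=> True) D.
Proof.
move=> nell ellN zell zv yl vN Eyv.
have vl : ~ ball 0 ell v by move=> h; have : (ball z q `&` ball 0 ell) v by []; rewrite zell.
have yN : ball 0 N y by exact: (ball_subr ellN yl).
have es : [fset y; v]%fset \in EI 0 N.
  by apply/(mem_edges_in hE); split=> // t; rewrite !inE => /orP[]/eqP ->.
have e1 : p * Pr p (EI 0 N) (fun w => joined w (ball 0 ell) 0 y) =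
    Pr p (EI 0 N) (fun w => joined w (ball 0 ell) 0 y /\ w [fset y; v]%fset).
  rewrite (@Pr_indep _ _ p (EI 0 N) (inside (ball 0 ell)) [set [fset y; v]%fset]).
  - by rewrite mulrC [Pr _ _ (fun w => w _)]/Pr Pr_edgeE//; exact: edges_in_uniq.
  - by apply/seteqP; split=> // e [ie /= ee]; apply: vl; apply: ie; rewrite ee !inE eqxx orbT.
  - exact: joined_depends.
  - by move=> w; apply: propext; split=> [h|[]].
rewrite e1 -addrA -opprD lerBlDr.
apply: (le_trans (Pr_split p01' (Y := fun w => exists2 D, D \in hulls d N & [/\ inner_hull N n q z w = D, True,
   core n ell q b eta z y v D (w `&` touching [set` D]) & via q z D w])
   (Z := fun w => joined w (ball 0 ell) 0 y /\ eta < \sum_(x <- balls 0 b | x \in inner_hull N n q z w) kap z x \/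
     ~ forall x, x \in inner_hull N n q z w -> ball 0 b x) _)); last first.
  apply: lerD; first exact: Pr_union.
  by apply: Pr_split.
move=> w ws [j0 wyv]; have wN e : w e -> inside (ball 0 N) e by move=> /ws /(mem_edges_in hE)[].
have [hb|nb] := pselect (forall x, x \in inner_hull N n q z w -> ball 0 b x); last by right; right.
have [hs|hs] := ltP eta (\sum_(x <- balls 0 b | x \in inner_hull N n q z w) kap z x); first by right; left.
left; set D := inner_hull N n q z w in hb hs *.
exists D; first exact: mem_hulls.
have nD x : ball 0 n x -> x \in D by apply: hull_inner; [exact: nell|exact: ellN|exact: zell].
have D0 : 0 \in D by apply: nD; exact: ball_center.
have jD t : joined w (ball 0 ell) 0 t -> t \in D.
  move=> jt; apply: (inner_hull_joined D0); apply: joined_mono jt => // s.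
  by apply: (ell_sub ellN zell).
have jT t : joined w (ball 0 ell) 0 t -> joined (w `&` touching [set` D]) (ball 0 ell) 0 t.
  move=> /joinedP[s [s1 s2 s3]]; apply/joinedP; exists s; split=> // e he; split; first exact: s1.
  have [a ae as_] := pedges_vertex_tail he; exists a => //=; apply: jD.
  have ha : has (pred1 a) (0 :: s) by apply/hasP; exists a => //=; rewrite inE as_ orbT.
  have [a1 [a2 [aE /eqP l1 _]]] := split_first ha.
  apply/joinedP; exists a1; split=> //; first by apply: subset_trans s1; rewrite aE pedges_cat; left.
  by move=> b' hb'; apply: s3; rewrite aE -cat_cons mem_cat hb'.
have yD : y \in D by exact: jD.
have wT : (w `&` touching [set` D]) [fset y; v]%fset by split=> //; exists y; rewrite ?inE ?eqxx.
split=> //; last first.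
  exists v => //; apply: (joined_trans (y := y)); last exact: joined1.
  by apply: joined_mono (jT _ j0).
split=> //; first by move=> x /hull_off.
by split=> //; exists 0; [exact: ball_center|apply: joined_sym; exact: jT].
Qed.

(** What matters is that [delta] is chosen before [n] and [F]: the outer constant comes from
    [outer_lb], and the inner mass from [exit_sum], which bounds the expected number of exits below
    uniformly in the radius. *)
Lemma contraction : exists2 delta : R, 0 < delta <= 1 & forall n F lo hi, depends_on (inside (ball 0 n)) F ->
  ratio_bounds p E n F lo hi -> lo <= hi -> exists R0 : nat, forall r N, (R0 <= r)%N -> exists lo' hi' : R,
  [/\ lo' <= hi', hi' - lo' <= (1 - delta) * (hi - lo) & forall A V, target N r A V ->
    lo' * Pr p (EI 0 N) (fun w => joined_set w A 0 V) <= Pr p (EI 0 N) (fun w => F w /\ joined_set w A 0 V) /\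
    Pr p (EI 0 N) (fun w => F w /\ joined_set w A 0 V) <= hi' * Pr p (EI 0 N) (fun w => joined_set w A 0 V)].
Proof.
have [eta [c5 [h0 [eta0 c50 hout]]]] := outer_lb hE p01 d6 c0 cC tp.
have p40 : 0 < p / 4 by rewrite divr_gt0.
have [s1 hsp] := hull_sparse hE p01 d6 c0 cC tp eta0 p40.
pose s0 := (s1 + L0)%N; pose q := (2 ^ (3 * s0))%N.
pose M := ((3 * q).*2.+1 ^ d * (3 * q + L0).*2.+1 ^ d)%N.
have M0 : (0 < M)%N by rewrite muln_gt0 !expn_gt0.
pose cx : R := c / (C * 2 ^+ (d - 2)); have cx0 : 0 < cx by rewrite divr_gt0// mulr_gt0// exprn_gt0.
pose pq : R := p ^+ ((q.*2.+1 ^ d) ^ 2); have pq0 : 0 < pq by rewrite exprn_gt0.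
pose kk := pq * c5; have kk0 : 0 < kk by rewrite mulr_gt0.
(* Lower bound of the common mass: the constant of the outer factor times half of p * cx, the least
   mass of the entrances. *)
pose de := kk / M%:R * (p * cx / 2); have de0 : 0 < de by rewrite /de; do ?[exact: kk0|exact: p0|exact: cx0|done|apply: divr_gt0|apply: mulr_gt0|rewrite ltr0n].
exists (Num.min de 1); first by rewrite lt_min de0 ltr01 ge_min lexx orbT.
move=> n F lo hi dF hF lohi.
have s1s : (s1 <= s0)%N by rewrite /s0; clear; lia.
have [l0 hl0] := hsp s0 n s1s; pose l := (l0 + n)%N; pose ell := (2 ^ l)%N.
have nell : (n <= ell)%N by apply: (leq_trans (ltnW (ltn_expl n (ltnSn 1)))); rewrite leq_exp2l// leq_addl.
pose ex := exits E L0 0 ell.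
have e20 : 0 < p * cx / 4 / (size ex).+1%:R by rewrite !divr_gt0// mulr_gt0.
have [b0 hb0] := hull_bounded hE p01 d6 c0 cC tp n e20.
pose h := (h0 + b0 + l + 3 * s0 + 3 + L0)%N; pose b := (2 ^ (3 * h))%N.
have [RA hRA] := hout h ltac:(rewrite /h; clear; lia).
exists (RA + b)%N => r N hr.
have Lq : (L0 <= q)%N.
  by apply: (leq_trans (ltnW (ltn_expl L0 (ltnSn 1)))); rewrite leq_exp2l// /s0; clear; lia.
have hbb : (2 * (ell + L0 + q + q) <= b)%N.
  have -> : b = (2 ^ 3 * 2 ^ (3 * h - 3))%N by rewrite -expnD; congr (2 ^ _)%N; rewrite /h; clear; lia.
  have h1 : (ell <= 2 ^ (3 * h - 3))%N by rewrite leq_exp2l// /h; clear; lia.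
  have h2 : (q <= 2 ^ (3 * h - 3))%N by rewrite leq_exp2l// /h; clear; lia.
  move: h1 h2 Lq; rewrite /ell /q; move: (2 ^ (3 * h - 3))%N (2 ^ l)%N (2 ^ (3 * s0))%N; clear; lia.
(* In so small a box there is no admissible target, and any bounds serve. *)
have [Nb|bN] := ltnP N b.
  exists 0, 0; split=> //; first by rewrite subrr mulr_ge0 ?subr_ge0// ge_min lexx orbT.
  move=> A V [AN rA _]; exfalso.
  have d0 : (0 < d)%N by move: d6; clear; lia.
  have : ball 0 N (0 + axv (Ordinal d0) r%:Z) by apply: AN; apply: rA; rewrite /ball /= distC dist_axv.
  by rewrite /ball /= distC dist_axv /=; move: Nb hr; clear; lia.
have [zc hzc] : exists zc : Zd d * Zd d -> Zd d, forall e, e \in ex ->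
    [/\ ball (zc e) q `&` ball 0 ell = set0, ball (zc e) q e.2, ball 0 ell e.1, E [fset e.1; e.2]%fset & (dist (zc e) 0 <= ell + L0 + q)%N].
  suff : forall e : Zd d * Zd d, exists z : Zd d, e \in ex -> [/\ ball z q `&` ball 0 ell = set0, ball z q e.2,
      ball 0 ell e.1, E [fset e.1; e.2]%fset & (dist z 0 <= ell + L0 + q)%N].
    by move=> /choice[zc hzc]; exists zc.
  move=> -[y v]; have [he|nhe] := pselect ((y, v) \in ex); last by exists (0 : Zd d).
  have /(mem_exits hE)[yl vl Eyv] := he.
  (* The center is [v] moved outwards by [q] across the face that it lies beyond: the ball contains
     [v] and misses the ball of radius [ell]. *)
  have [i [s hs]] := notin_ball p01 d6 c0 cC vl; exists (v + axv i (sgv s q)) => _.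
  have qa : `|sgv s q|%N = q by rewrite /sgv; case: s {hs}; rewrite ?abszN.
  split=> //=.
  - apply/seteqP; split=> // t [tz t0]; exfalso; have := sgv_add p01 d6 c0 cC q hs.
    have := iffLR (distP _ _ _) tz i; have := iffLR (distP _ _ _) t0 i; rewrite !mxE eqxx /=.
    move: (t 0 i) (v 0 i) (sgv s q) => a e f; clear; case: s; rewrite !ler_norml; lia.
  - by rewrite /ball /= dist_axv qa.
  - apply: (leq_trans (dist_triangle v _ _)); rewrite distC dist_axv qa addnC leq_add2r.
    apply: (leq_trans (dist_triangle y _ _)); rewrite distC addnC leq_add//.
    by have := edge_dist hE Eyv.
have zb e t : e \in ex -> ball (zc e) q t -> (2 * dist t 0 <= b)%N.
  move=> he zt; have [_ _ _ _ z1] := hzc _ he; apply: leq_trans hbb; rewrite leq_mul2l/=.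
  apply: (leq_trans (dist_triangle (zc e) _ _)); rewrite addnC leq_add//.
have zbb e : e \in ex -> ball (zc e) q `<=` ball 0 b.
  by move=> he t /(zb _ _ he) h2; rewrite /ball /=; move: h2; clear; lia.
have zdist e : e \in ex -> (2 * dist (zc e) 0 <= b)%N by move=> he; apply: (zb e) => //; exact: ball_center.
have ellb : (ell <= b)%N by apply: leq_trans hbb; clear; lia.
have geo e : e \in ex -> [/\ ball (zc e) q `&` ball 0 ell = set0, ball (zc e) q e.2,
     ball (zc e) q `<=` ball 0 N & (dist e.1 e.2 <= L0)%N].
  move=> he; have [g1 g2 g3 g4 g5] := hzc _ he; split=> //; last exact: (edge_dist hE g4).
  by apply: (subset_trans (zbb _ he)); exact: ball_subr.
pose S X := \sum_(e <- ex) \sum_(D <- hulls d N) exit_weight p E N n ell q b eta (zc e) e.1 e.2 X D.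
(* Sparsity costs a quarter of each term and unboundedness a quarter of the total. *)
have mass : p * cx / 2 <= S (fun=> True).
  pose P0 (e : Zd d * Zd d) := Pr p (EI 0 N) (fun w => joined w (ball 0 ell) 0 e.1).
  have ellN := leq_trans ellb bN.
  apply: (@le_trans _ _ (\sum_(e <- ex) (p * P0 e - p / 4 * P0 e - p * cx / 4 / (size ex).+1%:R))); last first.
    rewrite /S big_seq [leRHS]big_seq; apply: ler_sum => e he; have [g1 g2 g3 g4] := geo _ he.
    have [_ _ k1 k2 k3] := hzc _ he; have v_N : ball 0 N e.2 by exact: g3.
    apply: le_trans (weight_mass b eta nell ellN g1 g2 k1 v_N k2).
    apply: lerB; last by apply: hb0; rewrite /b; apply: (@leq_trans h); [rewrite /h; clear; lia|apply: ltnW; apply: (@leq_trans (2 ^ h)); [exact: ltn_expl|rewrite leq_exp2l//; clear; lia]].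
    apply: lerB => //; apply: (hl0 l h N e.1 e.2 (zc e)) => //.
    + by rewrite /l; clear; lia.
    + by have := zdist _ he; rewrite -/b; clear; lia.
  have hs : cx <= \sum_(e <- ex) P0 e.
    apply: (le_trans (exit_sum hE p01 d6 c0 cC tp ell)); rewrite le_eqVlt; apply/orP; left; apply/eqP.
    apply: eq_bigr => e _; rewrite /P0 (Pr_local_eq p hE (ball_subr ellN))//; exact: joined_depends.
  set e2 := p * cx / 4 / (size ex).+1%:R in e20 *.
  have pc0 : 0 < p * cx / 4 by apply: divr_gt0 => //; apply: mulr_gt0.
  have e4 (f g k : R) : f * g - f / 4 * g - k = 3 / 4 * f * g - k by field.
  have he2 : \sum_(e <- ex) e2 <= p * cx / 4.
    apply: (le_trans (sum_ge0_le (M := e2) _)) => //; rewrite /e2 mulrCA -[leRHS]mulr1 ler_pM2l; last exact: pc0.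
    by rewrite ler_pdivrMr// mul1r ler_nat.
  rewrite (eq_bigr (fun e => 3 / 4 * p * P0 e - e2)); last by move=> e _; exact: e4.
  rewrite sumrB -mulr_sumr; have h34 : 0 <= 3 / 4 * p by apply: mulr_ge0; [rewrite divr_ge0|exact: ltW].
  by have := ler_wpM2l h34 hs; move: he2; clear; lra.
have lb e D A V : target N r A V -> e \in ex -> (forall x, x \in D -> ball 0 b x) -> \sum_(x <- balls 0 b | x \in D) kap (zc e) x <= eta ->
     (forall x, x \in D -> ~ ball (zc e) q x) ->
     kk * Pr p (EI 0 N) (fun w => joined_set w A 0 V) <= Pr p (EI 0 N) (fun w => tail E A V q (zc e) D (w `\` touching [set` D])).
  move=> hT he D1 D2 D3; have [g1 g2 g3 g4] := geo _ he.
  have RAr : (RA <= r)%N by move: hr; clear; lia.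
  have hD2 : \sum_(x <- balls 0 b | `[< [set` D] x >]) kap (zc e) x <= eta.
    by apply: le_trans D2; rewrite le_eqVlt; apply/orP; left; apply/eqP; apply: eq_bigl => x; rewrite /= asboolb.
  have := hRA r N A V (zc e) [set` D] RAr hT (zdist _ he) D1 hD2 => h5.
  apply: le_trans (tail_prob hE p01 g3 (mulr_ge0 (ltW c50) (Pr_ge0 p01' _ _)) D3 h5).
  rewrite /kk -mulrA; apply: ler_wpM2r; first by rewrite mulr_ge0 ?Pr_ge0// ltW.
  by apply: ler_wiXn2l; [exact: ltW|by case/andP: p01 => _ /ltW|exact: size_EI].
pose th := kk / M%:R * S (fun=> True); pose lo' := lo * (1 - th) + kk / M%:R * S F.
pose hi' := hi * (1 - th) + kk / M%:R * S F.
have key A V : target N r A V -> let g := Pr p (EI 0 N) (fun w => joined_set w A 0 V) in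
    let gF := Pr p (EI 0 N) (fun w => F w /\ joined_set w A 0 V) in [/\ th * g <= g, lo' * g <= gF & gF <= hi' * g].
  move=> hT g gF; have [AN rA Vr] := hT; have br : (b <= r)%N by move: hr; clear; lia.
  have bA : ball 0 b `<=` A by apply: subset_trans rA; exact: ball_subr.
  apply: (contract_step hE p01 nell ellb bN (exits_uniq E L0 0 ell) geo (leqnn M) M0 (ltW kk0) dF hF AN bA).
  - by move=> e he; apply: subset_trans bA; exact: zbb.
  - by rewrite -subset0 => t [Vt tb]; rewrite -Vr; split=> //; exact: (ball_subr br tb).
  - by move=> e D he; exact: lb.
have dth : de <= th by rewrite /de /th; apply: ler_wpM2l mass; rewrite divr_ge0// ltW.
(* The order lo' <= hi' is read off an arm event of positive probability; if there is none, 0 and 0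
   are taken. *)
have [[A [V [hT g0]]]|hno] := pselect (exists A V, target N r A V /\ 0 < Pr p (EI 0 N) (fun w => joined_set w A 0 V)).
  have [k1 k2 k3] := key _ _ hT; exists lo', hi'; split.
  - by rewrite -(ler_pM2r g0); exact: le_trans k3.
  - have -> : hi' - lo' = (1 - th) * (hi - lo) by rewrite /hi' /lo'; ring.
    by apply: ler_wpM2r; [rewrite subr_ge0|rewrite lerB// ge_min dth].
  - by move=> A' V' /key[].
exists 0, 0; split=> //; first by rewrite subrr mulr_ge0 ?subr_ge0// ge_min lexx orbT.
move=> A V hT; rewrite !mul0r; have g0 : Pr p (EI 0 N) (fun w => joined_set w A 0 V) = 0.
  apply/eqP; rewrite eq_le Pr_ge0// andbT leNgt; apply/negP => g0; apply: hno; by exists A, V.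
split; first exact: Pr_ge0.
by rewrite -g0; apply: le_Pr => // w _ [].
Qed.

End contraction.

Lemma ratio_perturb (R : realType) (eps lo hi a' e a f f' : R) : 0 < eps -> lo * a' <= f' -> f' <= hi * a' ->
  e <= eps * a' -> a' <= a -> a <= a' + e -> f' <= f -> f <= f' + e -> f' <= a' -> 0 <= f' ->
  (lo - eps) * a <= f /\ f <= (hi + eps) * a.
Proof.
move=> eps0 c1 c2 c3 c4 c5 c6 c7 c8 c9.
have a0 : 0 <= a' by exact: le_trans c8.
have [a'0|a'p] := leP a' 0.
  have a'E : a' = 0 by apply/eqP; rewrite eq_le a'0 a0.
  move: c3 c4 c5 c8; rewrite a'E mulr0 => c3 c4 c5 c8.
  have aE : a = 0 by move: c3 c4 c5; clear; lra.
  have fE : f = 0 by move: c3 c6 c7 c8 c9; clear; lra.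
  by rewrite aE fE !mulr0.
have hi0 : 0 <= hi by rewrite -(pmulr_lge0 _ a'p); exact: le_trans c2.
have lo1 : lo <= 1 by rewrite -(ler_pM2r a'p) mul1r; exact: le_trans c8.
split; last first.
  apply: (le_trans c7); apply: (le_trans (lerD c2 c3)); by rewrite -mulrDl ler_wpM2l// addr_ge0// ltW.
have [le0|gt0] := leP (lo - eps) 0.
  by apply: (@le_trans _ _ 0); [apply: mulr_le0_ge0 => //; exact: le_trans c4|exact: le_trans c6].
apply: (le_trans (ler_wpM2l (ltW gt0) (le_trans c5 (lerD (lexx _) c3)))).
apply: le_trans (le_trans c1 c6).
have -> : (lo - eps) * (a' + eps * a') = (lo * eps - eps - eps ^+ 2 + lo) * a' by ring.
rewrite ler_pM2r// gerDr.
have : 0 <= eps * (1 - lo) + eps ^+ 2 by rewrite addr_ge0 ?mulr_ge0 ?exprn_ge0 ?subr_ge0// ltW.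
by rewrite -oppr_le0; congr (_ <= 0); ring.
Qed.

(** * Iteration over scales *)

Section iteration.
Context (R : realType) (d : nat) (p : R) (E : set (edge d)) (L0 : nat).
Context (hE : lattice_edges E L0) (p01 : 0 < p < 1) (d6 : (6 < d)%N).
Context (c C : R) (c0 : 0 < c) (cC : c < C) (tp : two_point p E c C).
Implicit Types (x y z u v : Zd d) (A B O W V S J : set (Zd d)) (w xi : set (edge d)) (D : seq (Zd d)).
Implicit Types (F X Y : set (edge d) -> Prop).

Local Notation EI := (edges_in E).
Local Notation half := (2^-1 : R).

Let p01' : 0 <= p <= 1. Proof. by case/andP: p01 => /ltW -> /ltW ->. Qed.
Let p0 : 0 < p. Proof. by case/andP: p01. Qed.

Lemma Pr_equiv (s : seq (edge d)) X Y : (forall w, w `<=` [set` s] -> X w <-> Y w) -> Pr p s X = Pr p s Y.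
Proof. by move=> XY; apply: eq_Ex => w ws; congr (_%:R); congr nat_of_bool; apply: asbool_equiv_eq; exact: XY. Qed.

Lemma Pr_eq0 (s : seq (edge d)) X : (forall w, w `<=` [set` s] -> ~ X w) -> Pr p s X = 0.
Proof.
move=> nX; transitivity (Pr p s (fun=> False)); last by apply: Pr_false => w.
by apply: Pr_equiv => w /nX nXw; split.
Qed.

(** By induction (1 - t)^k (1 + k t) <= 1. *)
Lemma pow_small (t eps : R) : 0 < t -> t < 1 -> 0 < eps -> exists k, (1 - t) ^+ k <= eps.
Proof.
move=> t0 t1 eps0; have u0 : 0 < 1 - t by rewrite subr_gt0.
have H k : (1 - t) ^+ k * (1 + k%:R * t) <= 1.
  elim: k => [|k IH]; first by rewrite expr0 mul0r addr0 mulr1.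
  apply: le_trans IH; rewrite exprSr -mulrA ler_pM2l ?exprn_gt0// -natr1.
  have : 0 <= k%:R * t ^+ 2 + t ^+ 2 by rewrite addr_ge0 ?mulr_ge0 ?exprn_ge0// ltW.
  by rewrite -subr_ge0; congr (0 <= _); ring.
have h0 : 0 <= (eps * t)^-1 by rewrite invr_ge0 mulr_ge0// ltW.
exists (Num.bound (eps * t)^-1); set k := Num.bound _.
have hk : 1 <= eps * (k%:R * t).
  have := archi_boundP h0; rewrite -/k -div1r ltr_pdivrMr ?mulr_gt0// => /ltW; by rewrite mulrCA.
have kt0 : 0 < 1 + k%:R * t by rewrite ltr_wpDr// mulr_ge0// ltW.
rewrite -(ler_pM2r kt0); apply: (le_trans (H k)); apply: (le_trans hk).
by rewrite ler_pM2l// lerDr.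
Qed.

Section outside_exploration.
Context (m : nat) (xi : set (edge d)) (B J : set (Zd d)).

(** [xi] are the edges already revealed outside the box of radius [m]; the set explored is the
    cluster of [J] off a smaller ball, which may leave the box and come back. *)
Definition reaching w x := joined_set ((w `&` inside (ball 0 m)) `|` xi) B x J.
Definition trace w := [seq x <- balls (0 : Zd d) m | `[< reaching w x >]].

Lemma mem_trace w x : (x \in trace w) = `[< ball 0 m x /\ reaching w x >].
Proof. by rewrite mem_filter mem_balls asbool_and andbC; congr (_ && _); apply/idP/asboolP. Qed.

Lemma trace_depends D : depends_on (touching [set` D]) (fun w => trace w = D).
Proof.
move=> w; set U := touching _; have sub : (w `&` U) `&` inside (ball 0 m) `|` xi `<=` w `&` inside (ball 0 m) `|` xi.
  by move=> e [[[we _] ie]|xe]; [left|right].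
have mono x : reaching (w `&` U) x -> reaching w x by exact: joined_set_mono.
apply: propext; split=> DE; rewrite -[RHS]DE; apply: eq_filter => z; apply: asbool_equiv_eq; split; try exact: mono.
- move=> [v Wv /joinedP[q [q1 q2 q3]]]; exists v => //; apply/joinedP; exists q; split=> // e he.
  have [[we ie]|xe] := q1 _ he; last by right.
  left; split; last exact: ie.
  split; first exact: we.
  have [t te tq] := pedges_vertex_tail he; exists t => //=.
  rewrite -DE mem_trace; apply/asboolP; split; first exact: ie.
  have ht : has (pred1 t) (z :: q) by apply/hasP; exists t => //=; rewrite inE tq orbT.
  have [a1 [a2 [aE /eqP l1 _]]] := split_first ht.
  exists v => //; apply/joinedP; exists a2; split.
  + by apply: subset_trans q1; rewrite aE pedges_cat l1; right.
  + by rewrite -q2 aE last_cat l1.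
  + move=> b hb; apply: q3; rewrite aE -cat_cons mem_cat; move: hb; rewrite inE => /orP[/eqP ->|->].
      by rewrite -l1 mem_last.
    by rewrite orbT.
- move=> [v Wv jv]; apply: contrapT => nz.
  have Kv : reaching (w `&` U) v by exists v => //; apply: joined_refl; exact: joined_inr jv.
  have [a [b [na nb wab [w1 [w2 [_ _ _ j1 j2]]]]]] :=
    first_exit (B := ~` [set x | reaching (w `&` U) x]) jv nz (fun f => f Kv).
  have Kb : reaching (w `&` U) b by exact: contrapT.
  have Ba : B a by have [] := joined_inr j1.
  apply: na => /=; have [v' Wv' j3] := Kb; exists v' => //; apply: (joined_trans (y := b)) => //.
  apply: joined1 => //; first exact: joined_inl j3.
  case: wab => [[we ie]|xe]; last by right.
  left; split; last exact: ie.
  split; first exact: we.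
  exists b; first by rewrite !inE eqxx orbT.
  by rewrite /= -DE mem_trace; apply/asboolP; split=> //; apply: ie; rewrite !inE eqxx orbT.
Qed.

End outside_exploration.

(** The vertices of the smaller ball from which one open edge leads into the explored set. *)
Definition door w D rr := [seq a <- balls (0 : Zd d) rr | has (fun b => `[< w [fset a; b]%fset >]) D].

Lemma door_touching w D rr : door (w `&` touching [set` D]) D rr = door w D rr.
Proof.
apply: eq_filter => a; apply/hasP/hasP => -[b bD /asboolP wab]; exists b => //; apply/asboolP; first by case: wab.
by split=> //; exists b => //; rewrite !inE eqxx orbT.
Qed.

Lemma filter_hulls (P : pred (Zd d)) k : [seq x <- balls (0 : Zd d) k | P x] \in hulls d k.
Proof.
rewrite mem_undup; apply/mapP; exists (map_tuple P (in_tuple (balls 0 k))); first by rewrite mem_enum.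
by rewrite /= filter_mask.
Qed.

(** [contraction] speaks of arms within the box, [ratio_bounds] of arms that may leave it through
    arbitrary revealed edges. Exploring the cluster of [J] off a ball of radius [rr] turns such an
    arm into one from 0 to the doors within the box, an admissible target. The exception is an
    escape to the boundary of the box before the cluster is met, which is rare even against the
    probability of reaching a door. *)
Lemma reduction r n F eps : 0 < eps -> depends_on (inside (ball 0 n)) F -> (n <= r)%N ->
  exists m0 : nat, forall m lo hi, (m0 <= m)%N -> (forall A V, target m r A V ->
    lo * Pr p (EI 0 m) (fun w => joined_set w A 0 V) <= Pr p (EI 0 m) (fun w => F w /\ joined_set w A 0 V) /\
    Pr p (EI 0 m) (fun w => F w /\ joined_set w A 0 V) <= hi * Pr p (EI 0 m) (fun w => joined_set w A 0 V)) ->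
  ratio_bounds p E m F (lo - eps) (hi + eps).
Proof.
move=> eps0 dF nr; have [K hK] := glue_ball hE p01 d6 c0 cC tp.
(* [rr] exceeds r + L0, so that a door, within [L0] of a point off the ball of radius [rr], lies off
   the ball of radius [r]; [cr] is the cost of joining 0 to it. *)
pose l := (r + L0)%N; pose rr := (2 ^ l)%N; pose cr := half ^+ (K * l.+1 ^ 2).
have cr0 : 0 < cr by rewrite exprn_gt0// invr_gt0.
have rl : (r + L0 <= rr)%N by rewrite ltnW// ltn_expl.
have ec0 : 0 < eps * cr by exact: mulr_gt0.
have [R0 hR0] := small_arm hE p01 d6 c0 cC tp 0 ec0.
exists (rr + L0 + R0 + L0)%N => m lo hi hm hyp xi A J xiE xim Jm mA.
set H := fun w => joined_set (w `|` xi) A 0 J.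
have [rm rm' R0m] : [/\ (rr <= m)%N, (rr + L0 <= m)%N & (R0 <= m - L0)%N] by split; move: hm; clear; lia.
pose B := A `\` ball 0 rr; pose Dw w := trace m xi B J w.
pose Hp w := joined_set w (ball 0 m `\` [set` Dw w]) 0 [set` door w (Dw w) rr].
pose Esc w := door w (Dw w) rr <> [::] /\ joined_set w (ball 0 m `\` [set` Dw w]) 0 (~` ball 0 (m - L0)).
have win w : w `<=` [set` EI 0 m] -> w `&` inside (ball 0 m) = w.
  by move=> ws; apply/seteqP; split=> e; [case|move=> we; split=> //; have /(mem_edges_in hE)[] := ws _ we].
have DwE w x : w `<=` [set` EI 0 m] -> (x \in Dw w) <-> ball 0 m x /\ joined_set (w `|` xi) B x J.
  by move=> ws; rewrite mem_trace /reaching win//; split=> [/asboolP|h]; last exact/asboolP.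
have Dout w x : x \in Dw w -> ~ ball 0 rr x.
  by rewrite mem_trace => /asboolP[_ [t _ /joined_inl[]]].
have doorP w D a : a \in door w D rr <-> ball 0 rr a /\ exists2 b, b \in D & w [fset a; b]%fset.
  rewrite mem_filter mem_balls; split=> [/andP[/hasP[b bD /asboolP wb] ra]|[ra [b bD wb]]]; first by split=> //; exists b.
  apply/andP; split; last exact: ra.
  by apply/hasP; exists b => //; apply/asboolP.
have zr : ball (0 : Zd d) rr 0 by exact: ball_center.
have HpH w : w `<=` [set` EI 0 m] -> Hp w -> H w.
  move=> ws [a /doorP[ra [b bD wab]] ja]; have /(DwE _ _ ws)[mb [t Jt jt]] := bD.
  exists t => //; apply: (joined_trans (y := a)).
    by apply: joined_mono ja => [e|x [/mA]//]; left.
  apply: (joined_trans (y := b)); last by apply: joined_mono jt => // x [].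
  by apply: joined1; [apply/mA/(ball_subr rm)|have [] := joined_inl jt|left].
(* The last vertex before the path meets the explored set must be a door: off the ball of radius
   [rr] it would itself be explored. *)
have HHp w : w `<=` [set` EI 0 m] -> H w -> Hp w \/ Esc w.
  move=> ws [t Jt jt]; pose Kt := [set x | joined_set (w `|` xi) B x J].
  have WE : w `|` xi `<=` E by move=> e [/ws /(mem_edges_in hE)[]|/xiE].
  have K0 : (~` Kt) 0 by move=> [s _ /joined_inl[_]].
  have nrt : ~ ball 0 rr t.
    move=> rt; have : (J `&` ball 0 m) t by split=> //; exact: (ball_subr rm rt).
    by rewrite Jm.
  have Kt' : ~ (~` Kt) t by apply; exists t => //; apply: joined_refl; split=> //; exact: joined_inr jt.
  have [a [b [na nb wab [w1 [w2 [s1 s2 _ j1 j2]]]]]] := first_exit jt K0 Kt'.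
  have {}nb : Kt b by exact: contrapT.
  have Aa : A a by have [] := joined_inr j1.
  have Ab : A b by exact: joined_inl j2.
  have ra : ball 0 rr a.
    apply: contrapT => nra; apply: na; have [s Js js] := nb; exists s => //.
    by apply: (joined_trans (y := b)) => //; apply: joined1 => //; exact: joined_inl js.
  have bm : ball 0 m b.
    have := dist_triangle a b 0; have := edge_dist hE (WE _ wab); rewrite (distC b a).
    by move: ra rm'; rewrite /ball /=; clear; lia.
  have wwab : w [fset a; b]%fset.
    case: wab => // xab; have : (xi `&` inside (ball 0 m)) [fset a; b]%fset.
      split=> // s; rewrite !inE => /orP[]/eqP -> //; exact: (ball_subr rm ra).
    by rewrite xim.
  have ad : a \in door w (Dw w) rr by apply/doorP; split=> //; exists b => //; apply/(DwE _ _ ws).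
  have j1w : joined (w `|` xi) (A `&` ~` Kt) 0 a by exact: joined_mono j1.
  have inw v : joined (w `|` xi) ((A `&` ~` Kt) `&` ball 0 m) 0 v -> joined w (ball 0 m `\` [set` Dw w]) 0 v.
    rewrite joined_depends; apply: joined_mono => [e [[//|xe] ie]|x [[Ax nx] mx]]; last by split=> // /(DwE _ _ ws)[].
    have : (xi `&` inside (ball 0 m)) e by split=> // s /ie[].
    by rewrite xim.
  have [js|] := joined_stay (ball 0 m) j1w.
    by left; exists a => //; exact: inw.
  move=> [v' nv jv']; right; split; first by move=> dE; move: ad; rewrite dE.
  have m0' : ball (0 : Zd d) m 0 by exact: ball_center.
  have [a' [b' [ma nb' wab' [w3 [w4 [s3 _ _ j3 _]]]]]] := first_exit jv' m0' nv.
  exists a'; last by apply: inw; exact: joined_mono j3.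
  move=> /= ha; apply: nb'; have := dist_triangle a' b' 0; have := edge_dist hE (WE _ wab').
  by rewrite (distC a' b') /ball /=; move: ha R0m hm; rewrite /ball /=; clear; lia.
pose dat w := (Dw w, door w (Dw w) rr).
pose Ds := [seq (a, b) | a <- hulls d m, b <- hulls d rr].
pose U (t : seq (Zd d) * seq (Zd d)) := touching [set` t.1].
have good (t : seq (Zd d) * seq (Zd d)) w : w `<=` [set` EI 0 m] -> dat w = t -> (forall x, x \in t.1 -> ~ ball 0 rr x) /\ (forall x, x \in t.2 -> ball 0 rr x /\ ~ ball 0 r x).
  move=> ws <-; split; first by move=> x; exact: Dout.
  move=> x /doorP[rx [b bD wxb]]; split=> // rx'; apply: (Dout _ _ bD); apply: leq_trans rl.
  apply: (leq_trans (dist_triangle x _ _)); rewrite distC addnC leq_add//.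
  by have /(mem_edges_in hE)[Ee _] := ws _ wxb; have := edge_dist hE Ee.
have UF w (t : seq (Zd d) * seq (Zd d)) : (forall x, x \in t.1 -> ~ ball 0 rr x) -> F (w `\` U t) = F w.
  move=> ht; apply: (dependsE dF); apply/seteqP; split=> e [we ie]; first by split=> //; case: we.
  split=> //; split=> // -[x xe xD]; apply: (ht _ xD); have := ie _ xe; apply: ball_subr; move: nr rl; clear; lia.
have UJ w (t : seq (Zd d) * seq (Zd d)) B0 : joined_set (w `\` U t) (ball 0 m `\` [set` t.1]) 0 B0 <-> joined_set w (ball 0 m `\` [set` t.1]) 0 B0.
  split; first by apply: joined_set_mono => // e [].
  rewrite [X in X -> _]joined_set_depends; apply: joined_set_mono => // e [we ie]; split=> // -[x xe xD].
  by have [] := ie _ xe.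
have explore (X : set (edge d) -> Prop) (Z : seq (Zd d) -> Prop) (B0 : seq (Zd d) -> set (Zd d)) :
    (forall w (t : seq (Zd d) * seq (Zd d)), (forall x, x \in t.1 -> ~ ball 0 rr x) -> X (w `\` U t) = X w) ->
    Pr p (EI 0 m) (fun w => Z (dat w).2 /\ (X w /\ joined_set w (ball 0 m `\` [set` (dat w).1]) 0 (B0 (dat w).2))) =
    \sum_(t <- Ds) Pr p (EI 0 m) (fun w => dat w = t /\ Z t.2) *
      Pr p (EI 0 m) (fun w => X w /\ joined_set w (ball 0 m `\` [set` t.1]) 0 (B0 t.2)).
  move=> UX; pose a (t : seq (Zd d) * seq (Zd d)) (w : set (edge d)) : R := `[< Z t.2 >]%:R.
  pose b (t : seq (Zd d) * seq (Zd d)) (w : set (edge d)) : R := `[< X (w `\` U t) /\ joined_set (w `\` U t) (ball 0 m `\` [set` t.1]) 0 (B0 t.2) >]%:R.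
  transitivity (Ex p (EI 0 m) (fun w => a (dat w) w * b (dat w) w)).
    apply: eq_Ex => w ws; rewrite /a /b -natrM mulnb -asbool_and; congr (_%:R); congr nat_of_bool.
    apply: asbool_equiv_eq; have [g1 g2] := good _ _ ws erefl.
    by rewrite UX//; split=> -[h1 [h2 h3]]; (split=> //; split=> //); apply/(UJ w (dat w) _).
  rewrite (@Ex_explore _ _ _ p (EI 0 m) dat Ds U a b).
  - apply: eq_bigr => t _.
    have -> : Ex p (EI 0 m) (fun w => `[< dat w = t >]%:R * a t w) = Pr p (EI 0 m) (fun w => dat w = t /\ Z t.2).
      by apply: eq_Ex => w _; rewrite /a -natrM mulnb -asbool_and.
    have [[w [ws wt]]|nt] := pselect (exists w, w `<=` [set` EI 0 m] /\ dat w = t); last first.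
      by rewrite Pr_eq0 ?mul0r// => w ws [wt _]; apply: nt; exists w.
    have [g1 g2] := good _ _ ws wt; congr (_ * _); apply: eq_Ex => w' _; congr (_%:R); congr nat_of_bool.
    by apply: asbool_equiv_eq; rewrite UX//; split=> -[h2 h3]; split=> //; apply/(UJ w' t _).
  - by apply: allpairs_uniq; [exact: hulls_uniq|exact: hulls_uniq|move=> [? ?] [? ?] _ _].
  - by move=> w; apply/allpairsP; exists (dat w); split; rewrite ?filter_hulls.
  - move=> t w; have tE := trace_depends m xi B J t.1 w.
    have dE s : trace m xi B J w = s -> door (w `&` touching [set` s]) s rr = door w s rr by move=> _; exact: door_touching.
    apply: propext; split=> ht.
      have h1 : trace m xi B J (w `&` U t) = t.1 by rewrite -tE -ht.
      by rewrite /dat /Dw h1 /U door_touching; move: ht; rewrite /dat => <-.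
    have h1 : trace m xi B J (w `&` U t) = t.1 by exact: (congr1 fst ht).
    have h2 : trace m xi B J w = t.1 by rewrite tE; exact: h1.
    by rewrite -[RHS]ht /dat /Dw h1 h2 door_touching.
  - by [].
  - by move=> t w; rewrite /b !setDE -setIA setIid.
pose wt t := Pr p (EI 0 m) (fun w => dat w = t /\ True).
pose wn t := Pr p (EI 0 m) (fun w => dat w = t /\ t.2 <> [::]).
pose h (X : set (edge d) -> Prop) (t : seq (Zd d) * seq (Zd d)) :=
  Pr p (EI 0 m) (fun w => X w /\ joined_set w (ball 0 m `\` [set` t.1]) 0 [set` t.2]).
pose es (t : seq (Zd d) * seq (Zd d)) :=
  Pr p (EI 0 m) (fun w => True /\ joined_set w (ball 0 m `\` [set` t.1]) 0 (~` ball 0 (m - L0))).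
have HpE X : (forall w (t : seq (Zd d) * seq (Zd d)), (forall x, x \in t.1 -> ~ ball 0 rr x) -> X (w `\` U t) = X w) ->
    Pr p (EI 0 m) (fun w => X w /\ Hp w) = \sum_(t <- Ds) wt t * h X t.
  move=> UX; have := explore X (fun=> True) (fun s => [set` s]) UX => ex; rewrite -[RHS]ex.
  by apply: Pr_equiv => w _; rewrite /Hp /dat /=; split=> [[? ?]|[_ [? ?]]].
have UT w (t : seq (Zd d) * seq (Zd d)) : (forall x, x \in t.1 -> ~ ball 0 rr x) -> True = True by [].
have EscE : Pr p (EI 0 m) Esc = \sum_(t <- Ds) wn t * es t.
  have := explore (fun=> True) (fun s => s <> [::]) (fun=> ~` ball 0 (m - L0)) UT => ex; rewrite -[RHS]ex.
  by apply: Pr_equiv => w _; rewrite /Esc /dat /=; split=> [[? ?]|[? [_ ?]]].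
have wit t (Z : Prop) : Pr p (EI 0 m) (fun w => dat w = t /\ Z) != 0 -> Z /\ exists w, w `<=` [set` EI 0 m] /\ dat w = t.
  move=> nz; apply: contrapT => hno; move/eqP: nz; apply; apply: Pr_eq0 => w ws [wt' z].
  by apply: hno; split=> //; exists w.
have tgt t : wt t != 0 -> target m r (ball 0 m `\` [set` t.1]) [set` t.2].
  move=> /wit[_ [w [ws wE]]]; have [g1 g2] := good _ _ ws wE; split.
  - by move=> x [].
  - move=> x rx; have rx' : ball 0 rr x by apply: ball_subr rx; move: rl; clear; lia.
    by split; [exact: (ball_subr rm)|move=> /g1].
  - by rewrite -subset0 => x [/g2[_ nx] rx].
have wt0 t : 0 <= wt t by exact: Pr_ge0.
have bnd t : lo * (wt t * h (fun=> True) t) <= wt t * h F t /\ wt t * h F t <= hi * (wt t * h (fun=> True) t).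
  have [->|nz] := eqVneq (wt t) 0; first by rewrite !mul0r !mulr0.
  have [b1 b2] := hyp _ _ (tgt _ nz).
  have hT : h (fun=> True) t = Pr p (EI 0 m) (fun w => joined_set w (ball 0 m `\` [set` t.1]) 0 [set` t.2]).
    by apply: Pr_equiv => w _; split=> [[]|].
  by rewrite hT; split; rewrite mulrCA ler_wpM2l.
(* The threshold eps * cr for escapes was chosen against [cr], the least probability of reaching a
   given door. *)
have ebnd t : wn t * es t <= eps * (wt t * h (fun=> True) t).
  have [->|nz] := eqVneq (wn t) 0; first by rewrite mul0r !mulr_ge0 ?Pr_ge0// ltW.
  have [t2 [w [ws wE]]] := wit _ _ nz; have [g1 g2] := good _ _ ws wE.
  have le1 : wn t <= wt t by apply: le_Pr => // w' _ [].
  have le2 : es t <= eps * cr.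
    apply: (@le_trans _ _ (Pr p (EI 0 m) (fun w => joined_set w (ball 0 m `\` [set` t.1]) 0 (~` ball 0 (m - L0))))).
      by apply: le_Pr => // w' _ [].
    by apply: (hR0 (m - L0)%N); [exact: R0m|exact: setICl|rewrite distxx].
  have le3 : cr <= h (fun=> True) t.
    have [a ta] : exists a, a \in t.2 by case: (t.2) t2 => [//|a s] _; exists a; exact: mem_head.
    have [ra _] := g2 _ ta.
    apply: (le_trans (hK l l 0 0 a m (ball_subr rm) zr ra _)); first by rewrite distC.
    apply: le_Pr => // w' _ j; split=> //; exists a => //; apply: joined_mono j => // x rx.
    by split; [exact: (ball_subr rm)|move=> /g1].
  apply: (le_trans (ler_pM (Pr_ge0 p01' _ _) (Pr_ge0 p01' _ _) le1 le2)).
  by rewrite mulrCA ler_pM2l// ler_wpM2l.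
have eT : Pr p (EI 0 m) Hp = \sum_(t <- Ds) wt t * h (fun=> True) t.
  by rewrite -HpE//; apply: Pr_equiv => w _; split=> [|[]].
have eF := HpE _ UF.
have c1 : lo * Pr p (EI 0 m) Hp <= Pr p (EI 0 m) (fun w => F w /\ Hp w).
  by rewrite eT eF mulr_sumr; apply: ler_sum => t _; have [] := bnd t.
have c2 : Pr p (EI 0 m) (fun w => F w /\ Hp w) <= hi * Pr p (EI 0 m) Hp.
  by rewrite eT eF mulr_sumr; apply: ler_sum => t _; have [] := bnd t.
have c3 : Pr p (EI 0 m) Esc <= eps * Pr p (EI 0 m) Hp.
  by rewrite eT EscE mulr_sumr; apply: ler_sum => t _; exact: ebnd.
have c4 : Pr p (EI 0 m) Hp <= Pr p (EI 0 m) H by apply: le_Pr.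
have c5 : Pr p (EI 0 m) H <= Pr p (EI 0 m) Hp + Pr p (EI 0 m) Esc by apply: Pr_split.
have c6 : Pr p (EI 0 m) (fun w => F w /\ Hp w) <= Pr p (EI 0 m) (fun w => F w /\ H w).
  by apply: le_Pr => // w ws [Fw /(HpH _ ws)].
have c7 : Pr p (EI 0 m) (fun w => F w /\ H w) <= Pr p (EI 0 m) (fun w => F w /\ Hp w) + Pr p (EI 0 m) Esc.
  by apply: Pr_split => // w ws [Fw /(HHp _ ws)[]]; [left|right].
have c8 : Pr p (EI 0 m) (fun w => F w /\ Hp w) <= Pr p (EI 0 m) Hp by apply: le_Pr => // w _ [].
have c9 : 0 <= Pr p (EI 0 m) (fun w => F w /\ Hp w) by exact: Pr_ge0.
rewrite -/H; exact: (ratio_perturb eps0 c1 c2 c3 c4 c5 c6 c7 c8 c9).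
Qed.

(** Each round contracts the width by 1 - de and loses 2 * ep in [reduction]. With ep = (de/4) rho^k
    the width still decreases by the factor rho = 1 - de/2. *)
Lemma ratio_converges n F eps : 0 < eps -> depends_on (inside (ball 0 n)) F ->
  exists m : nat, exists lo hi : R, [/\ (n <= m)%N, hi - lo <= eps & ratio_bounds p E m F lo hi].
Proof.
move=> eps0 dF; have [de /andP[de0 de1] hc] := contraction hE p01 d6 c0 cC tp.
pose rho := 1 - de / 2; have rho0 : 0 < rho by rewrite subr_gt0 ltr_pdivrMr// mul1r (le_lt_trans de1)// ltr1n.
have rho1 : rho < 1 by rewrite gtrBl divr_gt0.
have step k : exists m : nat, exists lo hi : R, [/\ (n <= m)%N, lo <= hi, hi - lo <= rho ^+ k & ratio_bounds p E m F lo hi].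
  elim: k => [|k [m [lo [hi [nm lohi hl hr]]]]].
    exists n, 0, 1; split=> //; first by rewrite subr0 expr0.
    by move=> xi A J _ _ _ _; rewrite mul0r mul1r; split; [exact: Pr_ge0|apply: le_Pr => // w _ []].
  have dFm : depends_on (inside (ball 0 m)) F.
    by apply: depends_sub dF => e ie t /ie; exact: ball_subr.
  have [R0 hR0] := hc _ _ _ _ dFm hr lohi.
  pose ep := de / 4 * rho ^+ k; have ep0 : 0 < ep by rewrite /ep mulr_gt0 ?exprn_gt0 ?divr_gt0.
  have mr : (m <= R0 + m)%N by rewrite leq_addl.
  have [m0 hm0] := reduction ep0 dFm mr.
  have [lo' [hi' [lh hl' ht]]] := hR0 (R0 + m)%N (m0 + m)%N (leq_addr _ _).
  exists (m0 + m)%N, (lo' - ep), (hi' + ep); split.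
  - by rewrite (leq_trans nm)// leq_addl.
  - by rewrite lerD// ?(le_trans _ (ltW ep0))// oppr_le0 ltW.
  - apply: (@le_trans _ _ ((1 - de) * (hi - lo) + de / 2 * rho ^+ k)).
      have -> : hi' + ep - (lo' - ep) = (hi' - lo') + de / 2 * rho ^+ k by rewrite /ep; field.
      by rewrite lerD2r.
    apply: (@le_trans _ _ ((1 - de) * rho ^+ k + de / 2 * rho ^+ k)); first by rewrite lerD2r ler_wpM2l// subr_ge0.
    by rewrite exprS /rho -mulrDl le_eqVlt; apply/orP; left; apply/eqP; congr (_ * _); field.
  - exact: (hm0 _ lo' hi' (leq_addr _ _) ht).
have [k hk] : exists k, rho ^+ k <= eps.
  have de20 : 0 < de / 2 by rewrite divr_gt0.
  have de21 : de / 2 < 1 by rewrite ltr_pdivrMr// mul1r (le_lt_trans de1)// ltr1n.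
  exact: pow_small.
have [m [lo [hi [h1 h2 h3 h4]]]] := step k; exists m, lo, hi; split=> //; exact: le_trans h3 hk.
Qed.

Lemma arm_ratio n F eps : 0 < eps -> depends_on (inside (ball 0 n)) F ->
  exists m : nat, exists lo hi : R, hi - lo <= eps /\ forall N A V, (m <= N)%N -> ball 0 m `<=` A -> V `&` ball 0 m = set0 ->
    lo * Pr p (EI 0 N) (fun w => joined_set w A 0 V) <= Pr p (EI 0 N) (fun w => F w /\ joined_set w A 0 V) /\
    Pr p (EI 0 N) (fun w => F w /\ joined_set w A 0 V) <= hi * Pr p (EI 0 N) (fun w => joined_set w A 0 V).
Proof.
move=> eps0 dF; have [m [lo [hi [nm hl hr]]]] := ratio_converges eps0 dF.
have dFm : depends_on (inside (ball 0 m)) F.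
  by apply: depends_sub dF => e ie t /ie; exact: ball_subr.
exists m, lo, hi; split=> // N A V mN mA Vm.
have := @cond_bounds R d p E L0 hE p01 m N F lo hi (fun=> 1) (fun w => joined_set w A 0 V) mN dFm hr.
move=> /(_ (fun _ _ => ler01) (fun _ _ _ _ => erefl)) []; last first.
  have e1 X : Ex p (EI 0 N) (fun w => 1 * `[< X w >]%:R) = Pr p (EI 0 N) X by apply: eq_Ex => w _; rewrite mul1r.
  by rewrite !e1.
by move=> w1 w1E w1N w1n _; exists w1, A, V; split=> // w2 _ _; rewrite setUC.
Qed.

End iteration.

(** * Configurations as bit sequences *)

Definition ecode d (e : {fset Zd d}) : nat :=
  choice.pickle ([seq [seq (x : Zd d) 0 i | i <- enum 'I_d] | x <- enum_fset e] : seq (seq int)).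

Lemma ecode_inj d : injective (@ecode d).
Proof.
move=> e e' /(pcan_inj choice.pickleK) /inj_map ee'; apply/fsetP => x; change (x \in enum_fset e = (x \in enum_fset e')); rewrite ee'// => y z yz.
apply/rowP => i; move/eq_in_map: yz => /(_ i); by rewrite mem_enum => ->.
Qed.

Section bits.
Context (d : nat) (E : set {fset Zd d}).
Local Notation T := (config E).

(** Numbers that are the code of no edge give the bit [false]. *)
Definition bit (om : T) (i : nat) : bool := `[< exists2 e : E, ecode (val e) = i & om e >].
Fixpoint prefix_of (om : T) k : seq bool := if k is k'.+1 then bit om k' :: prefix_of om k' else [::].
Definition cyl (s : seq bool) : set T := [set om | prefix_of om (size s) = s].

Lemma bitE (om : T) (e : E) : bit om (ecode (val e)) = om e.
Proof.
apply/asboolP/idP => [[e' /ecode_inj /val_inj ->]//|h].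
by exists e.
Qed.

Lemma size_prefix_of om k : size (prefix_of om k) = k.
Proof. by elim: k => //= k ->. Qed.

Lemma cyl_self om k : cyl (prefix_of om k) om.
Proof. by rewrite /cyl /= size_prefix_of. Qed.

Lemma cyl_cons b s om : cyl (b :: s) om <-> bit om (size s) = b /\ cyl s om.
Proof. by rewrite /cyl /=; split=> [[-> ->]|[-> ->]]. Qed.

Lemma cyl0 : cyl [::] = setT. Proof. by apply/seteqP; split. Qed.

Lemma prefix_le om om' k l : (k <= l)%N -> prefix_of om l = prefix_of om' l -> prefix_of om k = prefix_of om' k.
Proof.
by elim: l => [|l IH]; [rewrite leqn0 => /eqP ->|rewrite leq_eqVlt => /orP[/eqP ->//|kl /= [_ /(IH kl)]]].
Qed.

Lemma open_cyl s : open (cyl s).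
Proof.
have ob i b : open [set om : T | bit om i = b].
  have [[e ei]|ne] := pselect (exists e : E, ecode (val e) = i).
    rewrite (_ : mkset _ = (fun om : T => om e) @^-1` [set b]).
      apply: open_comp; last exact: discrete_open.
      by move=> om _; exact: (@proj_continuous _ (fun _ : E => bool) e).
    by apply/seteqP; split=> om /=; rewrite -ei bitE.
  have nb om : bit om i = false by apply/asboolP => -[e ei _]; apply: ne; exists e.
  case: b; [rewrite (_ : mkset _ = set0)|rewrite (_ : mkset _ = setT)]; try exact: open0; try exact: openT.
    by apply/seteqP; split=> om //=; rewrite nb.
  by apply/seteqP; split=> om //=; rewrite nb.
elim: s => [|b s IH]; first by rewrite cyl0; exact: openT.
rewrite (_ : cyl (b :: s) = [set om : T | bit om (size s) = b] `&` cyl s); first exact: openI.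
by apply/seteqP; split=> om /cyl_cons.
Qed.

(** In the product topology it suffices to treat one coordinate, and the coordinate of [e] is fixed
    by any prefix longer than its code. *)
Lemma nbhs_cyl (om : T) U : nbhs om U -> exists k, cyl (prefix_of om k) `<=` U.
Proof.
pose F : set_system T := [set A | exists k, cyl (prefix_of om k) `<=` A].
have FF : Filter F.
  split.
  - by exists 0%N.
  - move=> A B [k kA] [l lB]; exists (maxn k l) => om' h; split.
      apply: kA; move: h; rewrite /cyl /= !size_prefix_of => h; apply: prefix_le h; exact: leq_maxl.
    apply: lB; move: h; rewrite /cyl /= !size_prefix_of => h; apply: prefix_le h; exact: leq_maxr.
  - by move=> A B AB [k kA]; exists k; exact: subset_trans AB.
suff cF : F --> (om : {ptws E -> bool}) by exact: cF.
apply/cvg_sup => e; rewrite cvg_image; last first.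
  by rewrite eqEsubset; split=> v // _; exists (fun=> v).
move=> W /= /nbhs_singleton We; exists (@^~ e @^-1` W).
  exists (ecode (val e)).+1 => om'; rewrite /cyl /= size_prefix_of => -[h _].
  by move: h; rewrite !bitE => ->.
by rewrite eqEsubset; split => [j [om' + <-//]|j Wj]; exists (fun=> j).
Qed.

Lemma config_compact : compact [set: T].
Proof.
have cb : compact [set: bool].
  rewrite (_ : [set: bool] = [set true] `|` [set false]); last by apply/seteqP; split=> // -[] _; [left|right].
  by apply: compactU; exact: compact_set1.
have h := @tychonoff E (fun=> bool : topologicalType) (fun=> setT) (fun _ => cb).
suff -> : [set: T] = [set f : E -> bool | forall i, [set: bool] (f i)] by exact: h.
by apply/seteqP; split.
Qed.

Lemma open_cover_cyl (U : set T) : open U -> U = \bigcup_(s in [set s | cyl s `<=` U]) cyl s.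
Proof.
move=> oU; apply/seteqP; split=> [om Uom|om [s sU /sU]//].
have [k kU] := nbhs_cyl (open_nbhs_nbhs (conj oU Uom)).
by exists (prefix_of om k) => //; exact: cyl_self.
Qed.

(** An open set is a union of cylinders, and there are only countably many cylinders. *)
Lemma measurable_config dX (X : measurableType dX) (f : X -> borel T) :
  (forall s, measurable (f @^-1` cyl s)) -> measurable_fun setT f.
Proof.
move=> mf; apply: (@measurability _ _ X (borel T) setT f open) => // _ [U oU <-].
rewrite setTI (open_cover_cyl oU) preimage_bigcup bigcup_mkcond.
apply: countable_bigcupT_measurable => // s; case: ifPn => // _; exact: mf.
Qed.

Lemma measurable_cyl s : measurable (cyl s : set (borel T)).
Proof. by apply: sub_sigma_algebra; exact: open_cyl. Qed.

(** Uniform continuity from compactness: finitely many cylinders on which [f] varies little cover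
    the space, and the longest of their prefixes serves. *)
Lemma osc_cyl (R : realType) (f : T -> R) (eps : R) : continuous f -> 0 < eps ->
  exists k, forall om om', prefix_of om k = prefix_of om' k -> `|f om - f om'| <= eps.
Proof.
move=> cf eps0; pose U k := [set om : T | forall om', prefix_of om k = prefix_of om' k -> `|f om - f om'| < eps / 2].
have cov : [set: T] `<=` cover [set: nat] (fun k => \bigcup_(o in U k) cyl (prefix_of o k)).
  move=> om _; have e20 : 0 < eps / 2 by rewrite divr_gt0.
  have := cf om _ (nbhsx_ballx (f om) (eps / 2) e20).
  move=> /nbhs_cyl[k hk]; exists k => //; exists om; last exact: cyl_self.
  by move=> om' h; apply: hk; rewrite /cyl /= size_prefix_of.
have := config_compact; rewrite compact_cover => /(_ nat setT _ _ cov) [].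
  by move=> k _; apply: bigcup_open => ? _; exact: open_cyl.
move=> D _ hD; pose m := (\max_(i <- D) i)%N; exists m => om om' h.
have [k kD [om1 Uo]] := hD om I; rewrite /cyl /= size_prefix_of => co.
have km : (k <= m)%N by rewrite /m; apply: leq_bigmax_seq.
have h1 := Uo _ (esym co); have h2 := Uo om' (esym (etrans (esym (prefix_le km h)) co)).
rewrite (splitr eps); apply: le_trans (ler_distD (f om1) _ _) _; rewrite lerD// ltW//.
by rewrite distrC.
Qed.

End bits.

(** * The limit measure *)

Section image_measure.
Context (R : realType) (dX dY : measure_display) (X : measurableType dX) (Y : measurableType dY).
Context (m : {measure set X -> \bar R}) (f : X -> Y) (mf : measurable_fun setT f) (mT : m setT = 1%E).

Definition image_of (_ : measurable_fun setT f) (_ : m setT = 1%E) (A : set Y) : \bar R := m (f @^-1` A).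
Local Notation mu := (image_of mf mT).

Let mu0 : mu set0 = 0%E. Proof. by rewrite /image_of preimage_set0 measure0. Qed.

Let mu_ge0 A : (0 <= mu A)%E. Proof. exact: measure_ge0. Qed.

Let mu_sigma_additive : semi_sigma_additive mu.
Proof.
move=> F mF tF mUF; have mpre A : measurable A -> measurable (f @^-1` A).
  by move=> mA; rewrite -[X in measurable X]setTI; exact: mf.
rewrite /image_of preimage_bigcup; apply: measure_semi_sigma_additive.
- by move=> n; exact: mpre.
- apply/trivIsetP => i j _ _ ij; rewrite -preimage_setI.
  by move/trivIsetP : tF => /(_ _ _ _ _ ij) ->//; rewrite preimage_set0.
- by rewrite -preimage_bigcup; exact: mpre.
Qed.

HB.instance Definition _ := isMeasure.Build _ _ _ mu mu0 mu_ge0 mu_sigma_additive.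

Let mu_setT : mu setT = 1%E. Proof. by rewrite /image_of preimage_setT. Qed.

HB.instance Definition _ := Measure_isProbability.Build _ _ _ mu mu_setT.

End image_measure.

Section limit_measure.
Context (R : realType) (d : nat) (E : set {fset Zd d}).
Local Notation T := (config E).
Context (q : seq bool -> R) (q0 : forall s, 0 <= q s) (q1 : q [::] = 1).
Context (qD : forall s, q s = q (false :: s) + q (true :: s)).
Context (qN : forall s, (forall e : E, ecode (val e) <> size s) -> q (true :: s) = 0).

(* [lft s, lft s + q s) is the interval of [0, 1) attached to the prefix s; q is read on prefixes whose
   most recent bit comes first. *)
Fixpoint lft (s : seq bool) : R := if s is b :: s' then lft s' + (if b then q (false :: s') else 0) else 0.
Fixpoint digits (u : R) k : seq bool :=
  if k is k'.+1 then let s := digits u k' in (lft s + q (false :: s) <= u) :: s else [::].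
Definition from_unit (u : R) : borel T := (fun e : E => head false (digits u (ecode (val e)).+1)) : T.

Lemma size_digits u k : size (digits u k) = k. Proof. by elim: k => //= k ->. Qed.

Lemma digitsP u s : 0 <= u < 1 -> digits u (size s) = s <-> lft s <= u < lft s + q s.
Proof.
move=> u01; elim: s => [|b s IH] /=; first by rewrite q1 add0r; split.
have fq := q0 (false :: s); have tq := q0 (true :: s).
split=> [[h1 h2]|h].
  move: h1; rewrite h2; have /andP[l1 l2] := iffLR IH h2; case: b => [h1|/negbT h1].
    by rewrite h1 -addrA -qD.
  by rewrite addr0 l1 ltNge.
have hs : digits u (size s) = s.
  apply/IH; move: h; rewrite [q s]qD; case: b => /andP[h1 h2]; apply/andP; split.
  - by apply: le_trans h1; rewrite lerDl.
  - by rewrite addrA.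
  - by move: h1; rewrite addr0.
  - by apply: lt_le_trans h2 _; rewrite addr0 lerD2l lerDl.
rewrite hs; congr (_ :: _); move: h; case: b => /andP[h1 h2]; first exact: h1.
by apply/negbTE; rewrite -ltNge; move: h2; rewrite addr0.
Qed.

Lemma prefix_from_unit u k : 0 <= u < 1 -> prefix_of (from_unit u : T) k = digits u k.
Proof.
move=> u01; elim: k => //= k IH; rewrite IH; congr (_ :: _).
have [[e ek]|ne] := pselect (exists e : E, ecode (val e) = k).
  by rewrite -ek bitE.
have -> : bit (from_unit u : T) k = false by apply/asboolP => -[e ek _]; apply: ne; exists e.
apply/esym/negbTE; rewrite -ltNge; set s := digits u k.
have hs : digits u (size s) = s by rewrite size_digits.
have /andP[_] := iffLR (digitsP s u01) hs; rewrite qD [q (true :: s)]qN ?addr0//.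
by move=> e; rewrite size_digits => ek; apply: ne; exists e.
Qed.

Let unit_itv : set R := `[0, 1[.

Lemma from_unit_cyl s : from_unit @^-1` cyl s `&` unit_itv = [set` `[lft s, lft s + q s[] `&` unit_itv.
Proof.
apply/seteqP; split=> u [h1 h2]; split=> //; move: h2; rewrite /unit_itv /= in_itv /= => u01.
  by rewrite in_itv /=; apply/digitsP => //; move: h1; rewrite /preimage /cyl /= prefix_from_unit.
by move: h1; rewrite /= in_itv /= /preimage /cyl /= prefix_from_unit// => /digitsP; exact.
Qed.

Lemma lft_bounds s : 0 <= lft s /\ lft s + q s <= 1.
Proof.
elim: s => [|b s [h1 h2]] /=; first by rewrite q1 add0r.
have fq := q0 (false :: s); have tq := q0 (true :: s); move: h2; rewrite (qD s) => h2.
case: b; split; first exact: addr_ge0.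
- by rewrite -addrA.
- by rewrite addr0.
- by rewrite addr0; apply: le_trans h2; rewrite lerD2l lerDl.
Qed.

(** A uniform number in [0, 1) falls into the interval of the prefix [s] with probability [q s], so
    no extension theorem is used. *)
Lemma exists_limit_measure :
  exists nu : probability (borel T) R, forall s, nu (cyl s) = (q s)%:E.
Proof.
have mI : measurable unit_itv by exact: measurable_itv.
(* Outside [0, 1) the map is made constant; the measure used does not charge that part. *)
pose h (u : measurableTypeR R) : borel T := if (0 <= u < 1) then from_unit u else from_unit 0.
have hs s : h @^-1` cyl s `&` unit_itv = [set` `[lft s, lft s + q s[].
  have [l0 l1] := lft_bounds s.
  have -> : h @^-1` cyl s `&` unit_itv = from_unit @^-1` cyl s `&` unit_itv.
    by apply/seteqP; split=> u [h1 h2]; split=> //; move: h2 h1; rewrite /unit_itv /= in_itv /= /preimage /h /= => ->.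
  rewrite from_unit_cyl; apply/setIidPl => u; rewrite /unit_itv /= !in_itv /= => /andP[h1 h2].
  by rewrite (le_trans l0 h1) (lt_le_trans h2 l1).
have mh : measurable_fun setT h.
  apply: measurable_config => s.
  rewrite (_ : h @^-1` cyl s = (h @^-1` cyl s `&` unit_itv) `|` (h @^-1` cyl s `&` ~` unit_itv)); last first.
    by rewrite -setIUr setUv setIT.
  apply: measurableU; first by rewrite hs; exact: measurable_itv.
  have [c0|nc0] := pselect (cyl s (from_unit 0)).
    rewrite (_ : _ `&` _ = ~` unit_itv); first exact: measurableC.
    apply/seteqP; split=> u; first by case.
    move=> nu; split=> //; rewrite /preimage /h /=; case: ifP => // u01; by exfalso; apply: nu.
  rewrite (_ : _ `&` _ = set0); first exact: measurable0.
  apply/seteqP; split=> // u [h1 nu]; apply: nc0; move: h1; rewrite /preimage /h /=; case: ifP => // u01 _; by exfalso; apply: nu.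
have mT : mrestr (@lebesgue_measure R) mI setT = 1%E.
  by rewrite /mrestr setTI lebesgue_measure_itv /= lte_fin ltr01 oppr0 adde0.
exists (image_of mh mT) => s.
transitivity (@lebesgue_measure R (h @^-1` cyl s `&` unit_itv)); first by [].
rewrite hs lebesgue_measure_itv /= lte_fin.
case: ifPn => [_|]; first by rewrite -EFinB addrAC subrr add0r.
by rewrite -leNgt gerDl => qs; congr (_%:E); apply/eqP; rewrite eq_le q0 qs.
Qed.

End limit_measure.

(** * Weak convergence from cylinders *)

Section weak_limit.
Context (R : realType) (d : nat) (E : set {fset Zd d}).
Local Notation T := (config E).

Fixpoint words k : seq (seq bool) :=
  if k is k'.+1 then [seq b :: s | b <- [:: false; true], s <- words k'] else [:: [::]].

Lemma words_uniq k : uniq (words k).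
Proof.
elim: k => //= k IH; rewrite cats0 cat_uniq !map_inj_uniq ?IH//; try by move=> ? ? [].
by rewrite andbT; apply/hasPn => _ /mapP[s _ ->]; apply/mapP => -[].
Qed.

Lemma mem_words k s : (s \in words k) = (size s == k).
Proof.
elim: k s => [|k IH] [|b s] //=; rewrite cats0 mem_cat.
  by apply/negbTE; rewrite negb_or; apply/andP; split; apply/mapP => -[].
rewrite eqSS -IH; apply/orP/idP => [[]/mapP[? ? [_ ->]]//|sk]; case: b; [right|left]; apply/mapP; by exists s.
Qed.

Lemma continuous_measurable (f : T -> R) : continuous f -> measurable_fun setT (f : borel T -> R).
Proof.
move=> cf.
apply: (@measurability _ _ (borel T) (measurableTypeR R) setT f _ (measurable_realfun.RGenOInfty.measurableE R)) => _ [_ [x ->] <-].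
rewrite setTI; apply: sub_sigma_algebra; move/continuousP : cf; apply.
by rewrite set_itvoy; exact: open_gt.
Qed.

(** The length [k] and the values [v] depend on [f] only, so that one local approximation serves all
    measures at once. *)
Lemma integral_cyl (f : T -> R) (M eps : R) : continuous f -> (forall x, 0 <= f x <= M) -> 0 < eps ->
  exists k, exists v : seq bool -> R, forall mu : probability (borel T) R,
  ((\int[mu]_x (f x)%:E)%E <= (\sum_(s <- words k) v s * fine (mu (cyl s : set T)) + eps)%:E)%E /\
  ((\sum_(s <- words k) v s * fine (mu (cyl s : set T)))%:E <= (\int[mu]_x (f x)%:E) + eps%:E)%E.
Proof.
move=> cf fM eps0; have [k hk] := osc_cyl cf eps0.
(* The value of [f] at some configuration of the cylinder, and 0 if the cylinder is empty, which
   happens when a bit that codes no edge is [true]. *)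
pose v s : R := if pselect (exists om : T, cyl s om) is left h then f (sval (cid h)) else 0.
exists k, v => mu; pose g (om : T) := v (prefix_of om k).
have v0 s : 0 <= v s by rewrite /v; case: pselect => // h; case/andP: (fM (sval (cid h))).
have gf om : `|f om - g om| <= eps.
  rewrite /g /v; case: pselect => [h|]; last by case; exists om; exact: cyl_self.
  have hc := svalP (cid h); move: (sval _) hc => om' hc; apply: hk.
  by move: hc; rewrite /cyl /= size_prefix_of => /esym.
have mfR := continuous_measurable cf.
have mf : @measurable_fun _ _ (borel T) _ setT (fun x => (f x)%:E : \bar R) by exact/measurable_EFinP.
have gE om : (g om)%:E = (\sum_(s <- words k) (v s)%:E * (\1_(cyl s : set (borel T)) om)%:E)%E.
  have pw : prefix_of om k \in words k by rewrite mem_words size_prefix_of.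
  rewrite (bigD1_seq _ pw (words_uniq k)) /= indicE mem_set ?mule1; last exact: cyl_self.
  rewrite big_seq_cond big1 ?adde0// => s /andP[]; rewrite mem_words => /eqP sk so.
  rewrite indicE memNset ?mule0// /cyl /= sk => h; by rewrite h eqxx in so.
have mi s : @measurable_fun _ _ (borel T) _ setT (fun om => (\1_(cyl s : set (borel T)) om)%:E).
  by apply/measurable_EFinP; apply: measurable_indic; exact: measurable_cyl.
have mt s : @measurable_fun _ _ (borel T) _ setT (fun om => ((v s)%:E * (\1_(cyl s : set (borel T)) om)%:E)%E).
  exact: measurable_funeM.
have ig : (\int[mu]_x (g x)%:E)%E = (\sum_(s <- words k) v s * fine (mu (cyl s : set T)))%:E.
  under eq_integral do rewrite gE.
  rewrite ge0_integral_sum//; last by move=> s x _; rewrite mule_ge0// lee_fin.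
  rewrite -sumEFin; apply: eq_bigr => s _; rewrite ge0_integralZl_EFin//.
  rewrite integral_indic//; last exact: measurable_cyl.
  by rewrite setIT EFinM fineK// fin_num_measure//; exact: measurable_cyl.
have mg : @measurable_fun _ _ (borel T) _ setT (fun x => (g x)%:E : \bar R).
  rewrite (_ : (fun _ => _) = fun om : borel T => (\sum_(s <- words k) (v s)%:E * (\1_(cyl s : set (borel T)) om)%:E)%E); last first.
    by apply/funext => om; rewrite gE.
  exact: emeasurable_sum.
have ic : (\int[mu]_x (cst eps%:E x) = eps%:E)%E by rewrite integral_cst// -[RHS]mule1; congr (_ * _)%E; exact: probability_setT.
have fe0 om : 0 <= f om by case/andP: (fM om).
split.
- rewrite EFinD -ig -ic -ge0_integralD//; last 2 first.
  + by move=> x _; rewrite lee_fin; exact: v0.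
  + by move=> x _; rewrite lee_fin ltW.
  apply: ge0_le_integral => //.
  + by move=> x _; rewrite lee_fin.
  + exact: emeasurable_funD.
  + move=> x _; rewrite -EFinD lee_fin -lerBlDl; apply: le_trans (gf x); exact: ler_norm.
- rewrite -ig -ic -ge0_integralD//; last 2 first.
  + by move=> x _; rewrite lee_fin.
  + by move=> x _; rewrite lee_fin ltW.
  apply: ge0_le_integral => //.
  + by move=> x _; rewrite lee_fin; exact: v0.
  + exact: emeasurable_funD.
  + move=> x _; rewrite -EFinD lee_fin -lerBlDl; apply: le_trans (gf x); rewrite distrC; exact: ler_norm.
Qed.

(** Adding a bound of |f| reduces everything to integrals of nonnegative functions. *)
Lemma integral_shift (mu : probability (borel T) R) (f : T -> R) (M : R) :
  continuous f -> (forall x, `|f x| <= M) ->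
  (\int[mu]_x (f x)%:E = \int[mu]_x (f x + M)%:E - M%:E)%E /\ (\int[mu]_x (f x + M)%:E)%E \is a fin_num.
Proof.
move=> cf fM; have mT : (mu setT < +oo)%E by rewrite (_ : mu setT = 1%E) ?ltry//; exact: probability_setT.
have bdd (g : T -> R) K : (forall x, `|g x| <= K) -> [bounded g x | x in [set: T]].
  by move=> gK; exists K; split; [exact: num_real|move=> y Ky x _; apply: (le_trans (gK x)); exact: ltW].
have i1 : mu.-integrable setT (EFin \o (f : borel T -> R)).
  by apply: measurable_bounded_integrable => //; [exact: continuous_measurable|exact: bdd fM].
have i2 : mu.-integrable setT (EFin \o (cst M : borel T -> R)).
  apply: measurable_bounded_integrable => //; apply: (bdd (cst M) `|M|) => x; exact: lexx.
have e : (\int[mu]_x (f x + M)%:E = \int[mu]_x (f x)%:E + M%:E)%E.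
  have -> : M%:E = (\int[mu]_x (cst M x)%:E)%E.
    rewrite (_ : (fun x : borel T => (cst M x)%:E) = cst M%:E)// integral_cst//.
    by rewrite -[LHS]mule1; congr (_ * _)%E; apply/esym; exact: probability_setT.
  rewrite -integralD_EFin//; by apply: eq_integral.
have ff : (\int[mu]_x (f x)%:E)%E \is a fin_num by exact: integrable_fin_num.
by rewrite e addeK// fin_numD ff.
Qed.

Lemma weak_cvg_cyl (mu : nat -> probability (borel T) R) (nu : probability (borel T) R) :
  (forall s, fine (mu n (cyl s : set T)) @[n --> \oo] --> fine (nu (cyl s : set T))) -> weak_cvg mu nu.
Proof.
move=> hmu f cf [M0 [_ hM]]; pose M := M0 + 1.
have fM x : `|f x| <= M by apply: hM => //; rewrite ltrDl.
pose g x := f x + M.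
have g0 x : 0 <= g x <= M + M.
  by have := fM x; rewrite ler_norml => /andP[h1 h2]; rewrite /g lerD2r h2 andbT -lerBlDr sub0r.
have cg : continuous (g : T -> R) by move=> x; apply: cvgD; [exact: cf|exact: cvg_cst].
have fin (m : probability (borel T) R) : (\int[m]_x (g x)%:E)%E \is a fin_num by have [] := integral_shift m cf fM.
have hf (m : probability (borel T) R) : (\int[m]_x (f x)%:E = (fine (\int[m]_x (g x)%:E) - M)%:E)%E.
  by have [-> _] := integral_shift m cf fM; rewrite EFinB fineK// fin.
rewrite hf; under eq_fun do rewrite hf.
apply: cvg_EFin; first by apply: nearW.
apply: cvgB; last exact: cvg_cst.
apply/cvgrPdist_le => e e0; have e30 : 0 < e / 3 by rewrite divr_gt0.
have [k [v hv]] := integral_cyl cg g0 e30.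
pose Sv (m : probability (borel T) R) := \sum_(s <- words k) v s * fine (m (cyl s : set T)).
have hS : Sv (mu n) @[n --> \oo] --> Sv nu.
  rewrite /Sv; elim: (words k) => [|s r IH].
    by rewrite big_nil; under eq_fun do rewrite big_nil; exact: cvg_cst.
  rewrite big_cons; under eq_fun do rewrite big_cons.
  by apply: cvgD IH; apply: cvgM; [exact: cvg_cst|exact: hmu].
have close (m : probability (borel T) R) : `|fine (\int[m]_x (g x)%:E)%E - Sv m| <= e / 3.
  have [] := hv m; rewrite -(fineK (fin m)) -EFinD !lee_fin -/(Sv m) => h1 h2.
  by rewrite ler_norml; apply/andP; split; [move: h2|move: h1]; clear; lra.
move/cvgrPdist_le : hS => /(_ _ e30); apply: filterS => n hn.
have c1 := close nu; have c2 := close (mu n).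
rewrite (_ : _ - _ = (fine (\int[nu]_x (g x)%:E) - Sv nu) + (Sv nu - Sv (mu n)) - (fine (\int[mu n]_x (g x)%:E) - Sv (mu n))); last by ring.
apply: (le_trans (ler_normB _ _)); apply: (le_trans (lerD (ler_normD _ _) (lexx _))).
by apply: (le_trans (lerD (lerD c1 hn) c2)); lra.
Qed.

End weak_limit.

(** * From finite boxes to the measure on configurations *)

Section transfer.
Context (R : realType) (d : nat) (E : set (edge d)) (p : R) (P : probability (borel (config E)) R).
Context (p01 : 0 <= p <= 1) (hP : is_bernoulli_product p P).
Local Notation T := (config E).
Local Notation EI := (edges_in E).
Implicit Types (w : set (edge d)) (A V : set (Zd d)).

(** The coordinates of [s] are moved one by one to the fixed coordinates [K], where the hypothesis
    on rectangles applies; this mirrors the recursion defining [Ex]. *)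
Lemma finite_event (s : seq E) (K : {fset E}) (b : E -> bool) (X : set E -> Prop) :
  uniq s -> (forall e, e \in s -> e \notin K) ->
  let ev := [set om : T | (forall e, e \in K -> om e = b e) /\ X [set e | om e /\ e \in s]] in
  measurable (ev : set (borel T)) /\ P ev = ((\prod_(e <- K) (if b e then p else 1 - p)) * Pr p s X)%:E.
Proof.
elim: s K b X => [|e0 s IH] K b X; last first.
  move=> /= /andP[es us] hK; set ev := mkset _.
  have e0K : e0 \notin K by apply: hK; exact: mem_head.
  pose bc c e := if e == e0 then c else b e.
  pose Xc c (w : set E) := if c then X (e0 |` w) else X w.
  pose ec c := [set om : T | (forall e, e \in (e0 |` K)%fset -> om e = bc c e) /\ Xc c [set e | om e /\ e \in s]].
  have hs c := IH (e0 |` K)%fset (bc c) (Xc c) us.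
  have {}hs c : measurable (ec c : set (borel T)) /\ P (ec c) = ((\prod_(e <- (e0 |` K)%fset) (if bc c e then p else 1 - p)) * Pr p s (Xc c))%:E.
    apply: hs => e he; rewrite !inE negb_or hK ?inE ?he ?orbT// andbT.
    by apply: contraNneq es => <-.
  have XE (om : T) : [set e | om e /\ e \in e0 :: s] = if om e0 then e0 |` [set e : E | om e /\ e \in s] else [set e | om e /\ e \in s].
    apply/seteqP; split=> e; rewrite /= inE.
      by move=> [oe /orP[/eqP ee|he]]; [rewrite -ee oe; left|case: ifP => _; [right|]].
    case: ifP => o0; first by case=> [->|[-> ->]]; rewrite ?o0 ?eqxx ?orbT.
    by move=> [-> ->]; rewrite orbT.
  have evE : ev = ec false `|` ec true.
    apply/seteqP; split=> om.
      move=> [h1]; rewrite XE => h2; case o0: (om e0) h2 => h2; [right|left]; split=> //.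
        by move=> e; rewrite !inE /bc => /orP[/eqP ->|eK]; rewrite ?eqxx// ifN ?h1//; apply: contraNneq e0K => <-.
      by move=> e; rewrite !inE /bc => /orP[/eqP ->|eK]; rewrite ?eqxx// ifN ?h1//; apply: contraNneq e0K => <-.
    case=> -[h1 h2]; have o0 := h1 e0 (fset1U1 _ _); rewrite /bc eqxx in o0.
      split; last by rewrite XE o0.
      by move=> e eK; rewrite h1 ?inE ?eK ?orbT// /bc ifN//; apply: contraNneq e0K => <-.
    split; last by rewrite XE o0.
    by move=> e eK; rewrite h1 ?inE ?eK ?orbT// /bc ifN//; apply: contraNneq e0K => <-.
  have [[mf Pf] [mt Pt]] := (hs false, hs true).
  have prE c : \prod_(e <- (e0 |` K)%fset) (if bc c e then p else 1 - p) = (if c then p else 1 - p) * \prod_(e <- K) (if b e then p else 1 - p).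
    rewrite big_fsetU1//= /bc eqxx; congr (_ * _); rewrite big_seq [RHS]big_seq; apply: eq_bigr => e eK.
    have ne : e != e0 by apply: contraNneq e0K => <-.
    by rewrite (negbTE ne).
  split; first by rewrite evE; exact: measurableU.
  have -> : P ev = (P (ec false) + P (ec true))%E.
    rewrite evE; apply: measureU => //.
    rewrite -subset0 => om [[h1 _] [h2 _]]; have := h1 e0 (fset1U1 _ _); have := h2 e0 (fset1U1 _ _).
    by rewrite /bc eqxx => -> .
  rewrite Pf Pt !prE -EFinD; congr (_%:E); rewrite /Pr /= /Xc; ring.
move=> _ _ ev; have s0 (om : T) : [set e : E | om e /\ e \in [::]] = set0 by apply/seteqP; split=> // e [].
have [X0|nX0] := pselect (X set0).
  have -> : ev = [set om : T | forall e, e \in K -> [set b e] (om e)].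
    by apply/seteqP; split=> om; [case|move=> h; split=> //; rewrite s0].
  split.
    have key (r : seq E) : measurable ([set om : T | forall e, e \in r -> om e = b e] : set (borel T)).
      elim: r => [|e r IHr]; first by rewrite (_ : mkset _ = setT) //; apply/seteqP; split.
      rewrite (_ : mkset _ = [set om : T | om e = b e] `&` [set om : T | forall e, e \in r -> om e = b e]).
        apply: measurableI => //; apply: sub_sigma_algebra.
        rewrite (_ : mkset _ = (fun om : T => om e) @^-1` [set b e])//.
        apply: open_comp; last exact: discrete_open.
        by move=> om _; exact: (@proj_continuous _ (fun _ : E => bool) e).
      apply/seteqP; split=> om /=; last by move=> [h1 h2] e'; rewrite inE => /orP[/eqP ->|/h2].
      by move=> h; split=> [|e' he']; apply: h; rewrite inE ?eqxx// he' orbT.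
    exact: (key K).
  transitivity (\prod_(e <- K) fine (bernoulli_prob p [set b e]))%:E; first exact: (hP K (fun e => [set b e])).
  congr (_%:E); rewrite [Pr _ _ _]/Pr /= asboolT// mulr1; apply: eq_bigr => e _.
  by rewrite bernoulli_probE// !diracE !classical_sets.in_set1; case: (b e); rewrite /= -?EFinM -?EFinD /= ?mulr1 ?mulr0 ?addr0 ?add0r.
have -> : ev = set0 by apply/seteqP; split=> // om [_]; rewrite s0 => /nX0.
by split=> //; rewrite measure0 /Pr /= asboolF// mulr0.
Qed.

Context (L0 : nat) (hE : lattice_edges E L0).

Let sub_edges N : seq E := pmap insub (EI 0 N).

Let sub_edgesK N : map val (sub_edges N) = EI 0 N.
Proof.
rewrite (pmap_filter (insubK _)); apply/all_filterP/allP => e /(mem_edges_in hE)[Ee _].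
by rewrite /=; case: insubP => // /negP[]; exact: mem_set.
Qed.

Lemma box_event N (Y : set (edge d) -> Prop) :
  let ev := [set om : T | Y (open_edges om `&` [set` EI 0 N])] in
  measurable (ev : set (borel T)) /\ P ev = (Pr p (EI 0 N) Y)%:E.
Proof.
move=> ev; have u : uniq (sub_edges N) by apply: pmap_sub_uniq; exact: edges_in_uniq.
have [m1 m2] := @finite_event (sub_edges N) fset0 (fun=> true) (fun w : set E => Y (val @` w)) u (fun _ _ => isT).
have oE (om : T) : open_edges om `&` [set` EI 0 N] = val @` [set e : E | om e /\ e \in sub_edges N].
  rewrite -sub_edgesK; apply/seteqP; split=> e.
    by move=> [[e' oe' <-] /mapP[e2 he2 /val_inj ee]]; exists e' => //; rewrite ee /=; split=> //; rewrite -ee.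
  by move=> [e' [oe' he'] <-]; split; [exists e'|apply/mapP; exists e'].
have evE : ev = [set om : T | (forall e, e \in fset0 -> om e = true) /\ Y (val @` [set e : E | om e /\ e \in sub_edges N])].
  by apply/seteqP; split=> om; rewrite /ev /= oE; [move=> h; split|case].
rewrite evE; split; first exact: m1.
by rewrite m2 big_seq_fset0 mul1r -sub_edgesK /Pr Ex_map.
Qed.

Lemma open_edges_sub (om : T) : open_edges om `<=` E.
Proof. by move=> _ [e _ <-]; exact: set_valP. Qed.

Lemma pedges_box (w : set (edge d)) x q : w `<=` E -> pedges x q `<=` w ->
  exists N, forall M, (N <= M)%N -> pedges x q `<=` w `&` [set` EI 0 M].
Proof.
move=> wE qw; exists (\sum_(t <- x :: q) dist t 0)%N => M hM e he; split; first exact: qw.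
apply/(mem_edges_in hE); split; first exact/wE/qw.
move=> t te; have tq := pedges_vertex he te; apply: leq_trans hM.
by rewrite (big_rem t tq) /= leq_addr.
Qed.

Lemma local_open (om : T) n N F : depends_on (inside (ball 0 n)) F -> (n <= N)%N ->
  F (open_edges om `&` [set` EI 0 N]) = F (open_edges om) :> Prop.
Proof.
move=> dF nN; apply: (dependsE dF); apply/seteqP; split=> e [h1 h2]; first by split=> //; case: h1.
split=> //; split=> //; apply/(mem_edges_in hE); split; first exact: open_edges_sub h1.
by move=> t /h2; exact: ball_subr.
Qed.

(** The arm events in growing boxes increase to the arm event, as a path uses finitely many edges.
    The shift by [n] makes every box large enough to decide [F]. *)
Lemma arm_limit n F A V : depends_on (inside (ball 0 n)) F ->
  (Pr p (EI 0 (N + n)) (fun w => F w /\ joined_set w A 0 V)) @[N --> \oo] -->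
  fine (P ([set om : T | F (open_edges om)] `&` joined_to E A V 0)).
Proof.
move=> dF; pose G N := [set om : T | F (open_edges om `&` [set` EI 0 (N + n)]) /\ joined_set (open_edges om `&` [set` EI 0 (N + n)]) A 0 V].
have FE (om : T) N : F (open_edges om `&` [set` EI 0 (N + n)]) = F (open_edges om).
  by apply: (local_open om dF); rewrite leq_addl.
have mono (om : T) N M : (N <= M)%N -> open_edges om `&` [set` EI 0 (N + n)] `<=` open_edges om `&` [set` EI 0 (M + n)].
  move=> NM e [h1 h2]; split=> //; apply: (edges_in_mono hE _ h2); apply: ball_subr; by rewrite leq_add2r.
have GE : \bigcup_N G N = [set om : T | F (open_edges om)] `&` joined_to E A V 0.
  apply/seteqP; split=> om.
    move=> [N _ [h1 h2]]; split; first by rewrite /= -(FE om N).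
    by apply: joined_set_mono h2 => // e [].
  move=> [h1 [v Vv /joinedP[q [q1 q2 q3]]]]; have [N hN] := pedges_box (@open_edges_sub om) q1.
  exists N => //; split; first by rewrite FE.
  by exists v => //; apply/joinedP; exists q; split=> //; apply: hN; rewrite leq_addr.
have mG N : measurable (G N : set (borel T)) by have [] := box_event (N + n) (fun w => F w /\ joined_set w A 0 V).
have mU : measurable (\bigcup_N G N : set (borel T)) by apply: bigcupT_measurable.
have nd : nondecreasing_seq G.
  move=> N M NM; apply/subsetPset => om [h1 h2]; split; first by rewrite FE; rewrite FE in h1.
  by apply: joined_set_mono h2 => //; exact: mono.
have fin : P ([set om : T | F (open_edges om)] `&` joined_to E A V 0) \is a fin_num by apply: fin_num_measure; rewrite -GE.
have h : (P \o G) N @[N --> \oo] --> (fine (P ([set om : T | F (open_edges om)] `&` joined_to E A V 0)))%:E.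
  rewrite fineK// -GE; exact: nondecreasing_cvg_mu.
have e : (fun N => Pr p (EI 0 (N + n)) (fun w => F w /\ joined_set w A 0 V)) = fine \o (P \o G).
  by apply/funext => N /=; have [_ ->] := box_event (N + n) (fun w => F w /\ joined_set w A 0 V).
by rewrite e; exact: fine_cvg h.
Qed.

End transfer.

Lemma fset2_eq (K : choiceType) (a b x y : K) : [fset a; b]%fset = [fset x; y]%fset ->
  (a = x /\ b = y) \/ (a = y /\ b = x).
Proof.
move=> h; have ha : a \in [fset x; y]%fset by rewrite -h !inE eqxx.
have hb : b \in [fset x; y]%fset by rewrite -h !inE eqxx orbT.
have hx : x \in [fset a; b]%fset by rewrite h !inE eqxx.
have hy : y \in [fset a; b]%fset by rewrite h !inE eqxx orbT.
move: ha hb hx hy; rewrite !inE => /orP[]/eqP -> /orP[]/eqP ->; rewrite ?eqxx ?orbT; try by [left|right].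
  by rewrite orbb => _ /eqP ->; left.
by rewrite orbb => /eqP ->; left.
Qed.

(** * The two edge sets and the norms *)

Section lattices.
Context (d : nat).
Implicit Types (x y t : Zd d).

(** Both edge sets have this form, with [Q] symmetric; translation invariance is then immediate. *)
Definition difference_edges (Q : Zd d -> Prop) : set (edge d) :=
  [set [fset x.1; x.2]%fset | x in [set x : Zd d * Zd d | Q (x.1 - x.2)]].

Lemma mem_difference_edges Q x y : (forall z, Q z -> Q (- z)) ->
  difference_edges Q [fset x; y]%fset <-> Q (x - y).
Proof.
move=> Qs; split=> [[[a b] /= Qab /fset2_eq[[<- <-]//|[<- <-]]]|Qxy]; last by exists (x, y).
by rewrite -opprB; exact: Qs.
Qed.

Lemma linfnormN x : linfnorm (- x) = linfnorm x.
Proof. by rewrite /linfnorm; apply: eq_bigr => i _; rewrite mxE abszN. Qed.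

Lemma l1normN x : l1norm (- x) = l1norm x.
Proof. by rewrite /l1norm; apply: eq_bigr => i _; rewrite mxE abszN. Qed.

Lemma signed_permB s b x y : signed_perm s b x - signed_perm s b y = signed_perm s b (x - y).
Proof. by apply/rowP => i; rewrite !mxE; case: (b i) => //; rewrite opprD. Qed.

Lemma l1norm_signed s b x : involutive s -> l1norm (signed_perm s b x) = l1norm x.
Proof.
move=> ss; rewrite /l1norm [RHS](reindex_inj (inv_inj ss)); apply: eq_bigr => i _ /=.
by rewrite mxE; case: (b i); rewrite ?abszN.
Qed.

Lemma dist0 x : dist x 0 = linfnorm x. Proof. by rewrite /dist subr0. Qed.

Lemma linfnorm_signed s b x : involutive s -> linfnorm (signed_perm s b x) = linfnorm x.
Proof.
move=> ss; rewrite /linfnorm [RHS](reindex_inj (inv_inj ss)); apply: eq_bigr => i _ /=.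
by rewrite mxE; case: (b i); rewrite ?abszN.
Qed.

Lemma linfnorm_ge x i : (`|x 0%R i| <= linfnorm x)%N.
Proof. exact: (leq_bigmax_cond (F := fun i => `|x 0%R i|%N)). Qed.

Lemma linfnorm_delta i : linfnorm (delta_mx 0 i : Zd d) = 1%N.
Proof.
apply/eqP; rewrite eqn_leq; apply/andP; split.
  by apply/bigmax_leqP => j _; rewrite mxE; case: (_ && _).
by have := linfnorm_ge (delta_mx 0 i : Zd d) i; rewrite mxE !eqxx.
Qed.

Lemma linfnorm_l1 x : (linfnorm x <= l1norm x)%N.
Proof. by apply/bigmax_leqP => i _; rewrite /l1norm (bigD1 i)//= leq_addr. Qed.

Lemma difference_lattice Q L0 : (0 < L0)%N -> (forall z, Q z -> Q (- z)) ->
  (forall s b z, involutive s -> Q z -> Q (signed_perm s b z)) -> (forall i, Q (delta_mx 0 i)) ->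
  (forall z, Q z -> (0 < linfnorm z <= L0)%N) -> lattice_edges (difference_edges Q) L0.
Proof.
move=> L00 Qs Qp Qd Qb; split=> //.
- move=> _ [[x y] /= Qxy <-]; exists x, y; split=> //; last by have /andP[] := Qb _ Qxy.
  by apply/eqP => xy; have := Qb _ Qxy; rewrite xy subrr -dist0 distxx.
- move=> x y t /(mem_difference_edges _ _ Qs) h; apply/(mem_difference_edges _ _ Qs).
  by rewrite opprD addrACA subrr addr0.
- move=> s b x y ss /(mem_difference_edges _ _ Qs) h; apply/(mem_difference_edges _ _ Qs).
  by rewrite signed_permB; exact: Qp.
- move=> x i; apply/(mem_difference_edges _ _ Qs).
  by rewrite opprD addrA subrr sub0r; apply: Qs; exact: Qd.
Qed.

Lemma nn_lattice : lattice_edges (nn_edges d) 1.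
Proof.
apply: (difference_lattice (Q := fun z => l1norm z = 1%N)) => //.
- by move=> z; rewrite l1normN.
- by move=> s b z ss; rewrite l1norm_signed.
- move=> i; rewrite /l1norm (bigD1 i)//= mxE !eqxx big1// => j ji.
  by rewrite mxE (negPf ji) andbF.
- move=> z z1; rewrite -{2}z1 linfnorm_l1 andbT lt0n; apply/eqP => z0; move: z1; rewrite /l1norm big1// => i _.
  by have := linfnorm_ge z i; rewrite z0 leqn0 => /eqP.
Qed.

Lemma spread_out_lattice (R : realType) (La : R) : 1 <= La -> exists L0, lattice_edges (spread_out_edges d La) L0.
Proof.
move=> La1; have La0 : 0 <= La by exact: le_trans La1.
exists (Num.bound La); apply: (difference_lattice (Q := fun z => (0 < linfnorm z)%N /\ (linfnorm z)%:R <= La)).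
- have := le_lt_trans La1 (archi_boundP La0); by case: (Num.bound La) => //; rewrite ltr10.
- by move=> z; rewrite linfnormN.
- by move=> s b z ss; rewrite linfnorm_signed.
- by move=> i; rewrite linfnorm_delta.
- move=> z [-> h] /=; have := le_lt_trans h (archi_boundP La0); by rewrite ltr_nat => /ltnW.
Qed.

Section norms.
Context (R : realType).

Lemma linf_enorm x : (linfnorm x)%:R <= enorm R x.
Proof.
have -> : (linfnorm x)%:R = Num.sqrt ((linfnorm x)%:R ^+ 2) :> R by rewrite sqrtr_sqr ger0_norm.
have [l0|lp] := posnP (linfnorm x); first by rewrite l0 expr0n /= sqrtr0 sqrtr_ge0.
have d0 : (0 < #|'I_d|)%N.
  rewrite card_ord lt0n; apply: contraTneq lp => d0; rewrite /linfnorm big1// => i.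
  by have := ltn_ord i; rewrite {2}d0.
have [i hi] := @bigop.eq_bigmax _ (fun i => `|x 0%R i|%N) d0.
apply: ler_wsqrtr; have s0 j : 0 <= ((x 0 j)%:~R ^+ 2 : R) by exact: sqr_ge0.
have -> : linfnorm x = `|x 0%R i|%N by exact: hi.
rewrite (bigD1 i)//= -[leLHS]addr0 lerD ?sumr_ge0//.
by rewrite -[(`|x 0%R i|)%N%:R]/((`|x 0%R i|%N : int)%:~R) abszE intr_norm real_normK// num_real.
Qed.

Lemma enorm_linf x : enorm R x <= d%:R * (linfnorm x)%:R.
Proof.
have m0 : 0 <= d%:R * (linfnorm x)%:R :> R by rewrite mulr_ge0.
rewrite -[leRHS](ger0_norm m0) -sqrtr_sqr; apply: ler_wsqrtr.
apply: (@le_trans _ _ (\sum_(i < d) (linfnorm x)%:R ^+ 2)).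
  apply: ler_sum => i _; rewrite -[leLHS]real_normK ?num_real// -intr_norm -abszE.
  by rewrite ler_pXn2r ?nnegrE// ler_nat linfnorm_ge.
rewrite sumr_const card_ord -[leLHS]mulr_natl exprMn ler_wpM2r ?exprn_ge0//.
by rewrite -natrX ler_nat; case: d => // n; rewrite expnS leq_pmulr// expn_gt0.
Qed.

Lemma enorm_powE x : (2 < d)%N -> x != 0 -> enorm_pow R x (2 - d%:Z) = (enorm R x ^+ (d - 2))^-1.
Proof.
move=> d2 x0; rewrite /enorm_pow (negPf x0) (_ : 2 - d%:Z = - (d - 2)%N%:Z) ?exprnN ?exprzN//.
by rewrite -subzn 1?ltnW// opprB.
Qed.

Lemma linf_gt0 x : x != 0 -> (0 < linfnorm x)%N.
Proof. by move=> x0; rewrite lt0n -dist0 dist_eq0. Qed.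

Lemma enorm_pow_le x : (2 < d)%N -> enorm_pow R x (2 - d%:Z) <= 2 ^+ (d - 2) * (kap (0 : Zd d) x : R).
Proof.
move=> d2; have [->|x0] := eqVneq x 0.
  by rewrite /enorm_pow eqxx /kap distxx expr1n invr1 mulr1 exprn_ege1// ler1n.
have n0 := linf_gt0 x0; rewrite enorm_powE// /kap distC dist0.
rewrite -[2 ^+ _]invrK -invfM lef_pV2 ?posrE; last 2 first.
- by rewrite exprn_gt0//; apply: lt_le_trans (linf_enorm x); rewrite ltr0n.
- by rewrite mulr_gt0 ?invr_gt0 ?exprn_gt0// ltr0n.
have e0 : 0 <= enorm R x := sqrtr_ge0 _.
have a0 : 0 <= 2^-1 * (linfnorm x).+1%:R :> R by rewrite mulr_ge0// invr_ge0.
rewrite -exprVn -exprMn ler_pXn2r ?nnegrE ?subn_gt0//.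
apply: le_trans (linf_enorm x); rewrite ler_pdivrMl// -natrM ler_nat; move: n0; clear; lia.
Qed.

Lemma enorm_pow_ge x : (2 < d)%N -> (d%:R ^+ (d - 2))^-1 * (kap (0 : Zd d) x : R) <= enorm_pow R x (2 - d%:Z).
Proof.
move=> d2; have d0 : 0 < d%:R :> R by rewrite ltr0n (ltn_trans _ d2).
have [->|x0] := eqVneq x 0.
  rewrite /enorm_pow eqxx /kap distxx expr1n invr1 mulr1 invf_le1 ?exprn_gt0//.
  by rewrite exprn_ege1// ler1n (ltn_trans _ d2).
have n0 := linf_gt0 x0; rewrite enorm_powE// /kap distC dist0 -invfM lef_pV2 ?posrE; last 2 first.
- by rewrite mulr_gt0 ?exprn_gt0// ltr0n.
- by rewrite exprn_gt0//; apply: lt_le_trans (linf_enorm x); rewrite ltr0n.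
have e0 : 0 <= enorm R x := sqrtr_ge0 _.
have a0 : 0 <= d%:R * (linfnorm x).+1%:R :> R by rewrite mulr_ge0// ltW.
rewrite -exprMn ler_pXn2r ?nnegrE ?subn_gt0//.
by apply: (le_trans (enorm_linf x)); rewrite ler_pM2l// ler_nat.
Qed.

End norms.
End lattices.

Lemma Ex_p0 (R : realType) (I : eqType) (s : seq I) (f : set I -> R) : Ex 0 s f = f set0.
Proof. by elim: s f => //= e s IH f; rewrite mul0r addr0 subr0 mul1r IH. Qed.

Lemma Ex_p1 (R : realType) (I : eqType) (s : seq I) (f : set I -> R) : Ex 1 s f = f [set` s].
Proof.
elim: s f => [|e s IH] f /=; first by congr f; apply/seteqP; split.
rewrite subrr mul0r add0r mul1r IH; congr f; apply/seteqP; split=> x /=; rewrite inE.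
  by move=> [->|->]; rewrite ?eqxx ?orbT.
by move=> /orP[/eqP ->|]; [left|right].
Qed.

(** * The two-point hypotheses in finite volume *)

Section critical.
Context (R : realType) (d : nat) (hd : (6 < d)%N) (E : set (edge d)) (L0 : nat) (hE : lattice_edges E L0).
Context (p : R) (P : probability (borel (config E)) R) (p01' : 0 <= p <= 1) (hP : is_bernoulli_product p P).
Context (c C : R) (c0 : 0 < c) (cC : c < C).
Context (h2 : forall x : Zd d, ((c * enorm_pow R x (2 - d%:Z))%:E <= P (connected_to E 0 x)
  <= (C * enorm_pow R x (2 - d%:Z))%:E)%E).
Local Notation T := (config E).
Local Notation EI := (edges_in E).
Implicit Types (x y z : Zd d) (w : set (edge d)) (A V : set (Zd d)).

Let d2 : (2 < d)%N. Proof. exact: leq_trans hd. Qed.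
Let C0 : 0 < C. Proof. exact: lt_trans c0 cC. Qed.

Let tau x := fine (P (connected_to E 0 x)).

Lemma tau_bounds x : c * enorm_pow R x (2 - d%:Z) <= tau x <= C * enorm_pow R x (2 - d%:Z).
Proof.
have /andP[h1 h3] := h2 x; have fin : P (connected_to E 0 x) \is a fin_num.
  by rewrite fin_numE; case: (P _) h1 h3.
by rewrite -!lee_fin /tau fineK// h1 h3.
Qed.

Lemma joined_set1 w A x y : joined_set w A x [set y] <-> joined w A x y.
Proof. by split=> [[_ ->]|j] //; exists y. Qed.

Lemma tau_limit x : Pr p (EI 0 N) (fun w => joined w setT 0 x) @[N --> \oo] --> tau x.
Proof.
have dT : depends_on (inside (ball (0 : Zd d) 0)) (fun _ : set (edge d) => True) by [].
have := @arm_limit R d E p P p01' hP L0 hE 0 (fun=> True) setT [set x] dT.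
have -> : [set om : T | True] `&` joined_to E setT [set x] 0 = connected_to E 0 x.
  apply/seteqP; split=> om; first by move=> [_ [_ -> ]].
  by move=> j; split=> //; exists x.
rewrite (_ : (fun N => Pr p (EI 0 (N + 0)) _) = fun N => Pr p (EI 0 N) (fun w => joined w setT 0 x))//.
apply/funext => N; rewrite addn0; apply: Pr_equiv => w _.
by split=> [[_ /joined_set1]//|/joined_set1].
Qed.

Lemma joined_inc x y : increasing (fun w => joined w setT x y).
Proof. exact: joined_incr. Qed.

Lemma tau_ge N x : Pr p (EI 0 N) (fun w => joined w setT 0 x) <= tau x.
Proof.
have nd : nondecreasing_seq (fun N => Pr p (EI 0 N) (fun w => joined w setT 0 x)).
  by move=> n m nm; apply: (Pr_mono hE p01'); [exact: ball_subr|exact: joined_inc].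
have := nondecreasing_cvgn_le nd (cvgP _ (@tau_limit x)) N.
by rewrite (cvg_lim _ (@tau_limit x)).
Qed.

(** Translate [x] to the origin, enlarge the box to a centered one, and let it grow. *)
Lemma tau_up N x y : Pr p (EI 0 N) (fun w => joined w setT x y) <= C * 2 ^+ (d - 2) * kap x y.
Proof.
have h1 := Pr_joined_shift hE p01' (- x) 0 N setT x y.
apply: (le_trans h1); rewrite subrr.
have sub : ball (0 - x) N `<=` ball 0 (N + dist x 0).
  apply: ball_sub; rewrite sub0r distC /dist sub0r opprK -[linfnorm x]/(linfnorm x) addnC leq_add2l subr0//.
apply: (le_trans (Pr_mono hE p01' sub (@joined_incr _ _ _ _))).
apply: (@le_trans _ _ (tau (y - x))).
  apply: le_trans (tau_ge (N + dist x 0) (y - x)); apply: le_Pr => // w _; exact: joined_mono.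
have /andP[_ h3] := tau_bounds (y - x); apply: (le_trans h3); rewrite -mulrA ler_pM2l//.
apply: (le_trans (enorm_pow_le R _ d2)); rewrite ler_pM2l ?exprn_gt0//.
by rewrite /kap (_ : dist 0 (y - x) = dist x y)// distC /dist subr0 -linfnormN opprB.
Qed.

Lemma joined_box w N x : w `<=` [set` EI 0 N] -> joined w setT 0 x -> joined w (ball 0 N) 0 x.
Proof.
move=> ws /joinedP[q [q1 q2 q3]]; apply/joinedP; exists q; split=> // t; rewrite inE => /orP[/eqP ->|tq].
  exact: ball_center.
have [e he te] : exists2 e, pedges 0 q e & t \in e.
  elim: q (0 : Zd d) tq {q1 q2 q3} => // a q IH u; rewrite inE => /orP[/eqP ->|tq].
    by exists [fset u; a]%fset; [left|rewrite !inE eqxx orbT].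
  by have [e h1 h3] := IH a tq; exists e => //; right.
by have /(mem_edges_in hE)[_] := ws _ (q1 _ he); apply.
Qed.

(** The factor 1/2 makes the bound strict in the limit, hence valid in a large enough box; d^(d-2)
    compares the norms. *)
Let c' := c * (d%:R ^+ (d - 2))^-1 / 2.
Let c'0 : 0 < c'.
Proof. by rewrite divr_gt0// mulr_gt0// invr_gt0 exprn_gt0// ltr0n (leq_trans _ d2). Qed.

(** Points of a fixed box have finitely many differences, so that one box serves for all of them. *)
Lemma tau_lo M : exists N0, forall N, (N0 <= N)%N -> forall x y, ball 0 M x -> ball 0 M y ->
  c' * kap x y <= Pr p (EI 0 N) (fun w => joined w (ball 0 N0) x y).
Proof.
have conv z : exists Nz : nat, forall N, (Nz <= N)%N -> c' * kap 0 z <= Pr p (EI 0 N) (fun w => joined w setT 0 z).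
  have lt : c' * kap 0 z < tau z.
    have /andP[h1 _] := tau_bounds z; apply: lt_le_trans h1.
    apply: (@lt_le_trans _ _ (c * ((d%:R ^+ (d - 2))^-1 * kap 0 z))); last by rewrite ler_pM2l// enorm_pow_ge.
    rewrite /c' -!mulrA ltr_pM2l// ltr_pM2l ?invr_gt0 ?exprn_gt0 ?ltr0n ?(leq_trans _ d2)//.
    by rewrite gtr_pMl ?kap_gt0// invf_lt1// ltr1n.
  have /cvgrPdist_lt/(_ _ (eqbRL (subr_gt0 _ _) lt)) := @tau_limit z.
  move=> [Nz _ hNz]; exists Nz => N /hNz /=; rewrite ltr_distlC => /andP[h _]; apply: ltW.
  by move: h; rewrite opprB addrC subrK.
have [f hf] : exists f : Zd d -> nat, forall z N, (f z <= N)%N -> c' * kap 0 z <= Pr p (EI 0 N) (fun w => joined w setT 0 z).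
  by have [f hf] := choice conv; exists f.
pose Ns := (\max_(z <- balls 0 (M + M)) f z)%N; exists (Ns + M)%N => N hN x y xM yM.
have zM : y - x \in balls 0 (M + M).
  rewrite mem_balls dist0 -/(dist y x); apply: (leq_trans (dist_triangle 0 _ _)); rewrite (distC 0); exact: leq_add.
have fz : (f (y - x)%R <= Ns)%N by rewrite /Ns; exact: leq_bigmax_seq.
have := hf _ _ fz; rewrite (_ : kap 0 (y - x) = kap x y); last first.
  by rewrite /kap (_ : dist 0 (y - x) = dist x y)// distC /dist subr0 -linfnormN opprB.
move=> h; apply: (le_trans h).
apply: (@le_trans _ _ (Pr p (EI 0 Ns) (fun w => joined w (ball 0 Ns) 0 (y - x)))).
  by apply: le_Pr => // w ws; exact: joined_box.
apply: (le_trans (Pr_joined_ball_shift hE p01' x 0 Ns 0 (y - x))); rewrite !add0r subrK.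
have sub : ball x Ns `<=` ball 0 (Ns + M) by apply: ball_sub; rewrite addnC leq_add2l.
have sub2 : ball x Ns `<=` ball 0 N by apply: subset_trans sub _; exact: ball_subr.
apply: (le_trans (Pr_mono hE p01' sub2 (@joined_incr _ _ _ _))).
by apply: le_Pr => // w _; exact: joined_mono.
Qed.

Lemma critical_two_point : two_point p E c' (C * 2 ^+ (d - 2)).
Proof. by split; [exact: tau_up|exact: tau_lo]. Qed.

Lemma critical_consts : 0 < c' /\ c' < C * 2 ^+ (d - 2).
Proof.
split=> //; apply: (@lt_le_trans _ _ C); last by rewrite ler_peMr ?exprn_ege1 ?ler1n// ltW.
apply: le_lt_trans cC; rewrite /c' -mulrA ger_pMr// mulr_ile1 ?invr_ge0 ?exprn_ge0//.
  by rewrite invf_le1 ?exprn_gt0 ?exprn_ege1 ?ler1n ?ltr0n// (leq_trans _ d2).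
by rewrite invf_le1// ler1n.
Qed.

(** At p = 0 the lower bound fails at a unit vector; at p = 1 the upper bound fails at large
    distance. *)
Lemma critical_interior : 0 < p < 1.
Proof.
case/andP: p01' => p0 p1; have d0 : (0 < d)%N by exact: leq_trans d2.
pose i0 := Ordinal d0; pose X k : Zd d := 0 + axv i0 k%:Z.
have dX k : dist (X k) 0 = k by rewrite distC /X dist_axv.
rewrite !lt_neqAle p0 p1 !andbT; apply/andP; split; apply/eqP => pE.
  have x0 : X 1%N != 0 by rewrite -dist_eq0 dX.
  have /andP[h1 _] := tau_bounds (X 1%N).
  have t0 : tau (X 1%N) = 0.
    have := @tau_limit (X 1%N); rewrite (_ : (fun N => _) = cst 0); last first.
      apply/funext => N; rewrite /Pr -pE Ex_p0 asboolF// => -[q [q1 q2 q3]].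
      case: q q1 q2 q3 => [|a q] /=; first by move=> _ /esym x1 _; rewrite x1 eqxx in x0.
      by case/andP => /asboolP.
    by move=> h; apply: (cvg_unique _ h) => //; exact: cvg_cst.
  move: h1; rewrite t0 pmulr_rle0// leNgt enorm_powE// invr_gt0 exprn_gt0//.
  by apply: lt_le_trans (linf_enorm R _); rewrite ltr0n linf_gt0.
pose k := (Num.bound (C * 2 ^+ (d - 2))).+1.
have ck : C * 2 ^+ (d - 2) < k%:R.
  have h0 : 0 <= C * 2 ^+ (d - 2) by rewrite mulr_ge0// ?ltW// exprn_gt0.
  by apply: (lt_le_trans (archi_boundP h0)); rewrite ler_nat.
have := tau_up k 0 (X k); rewrite /Pr pE Ex_p1 asboolT; last first.
  have ho : opened E k 0 [set` EI 0 k] by [].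
  by apply: joined_mono (opened_joined hE ho (ball_center 0 k) _) => //; rewrite /ball /= dX.
rewrite leNgt => /negP; apply; rewrite /kap distC dX ltr_pdivrMr ?exprn_gt0// mul1r.
apply: (lt_le_trans ck); rewrite -natrX ler_nat; apply: (@leq_trans (k.+1 ^ 1)); first by rewrite expn1.
by rewrite leq_exp2l// subn_gt0.
Qed.

End critical.

Lemma cvg_of_brackets (R : realType) (u : nat -> R) :
  (forall eps, 0 < eps -> exists m lo hi, hi - lo <= eps /\ forall n, (m <= n)%N -> lo <= u n <= hi) ->
  cvgn u.
Proof.
move=> hu; apply/cauchy_cvgP/cauchy_exP => e e0; have e20 : 0 < e / 2 by rewrite divr_gt0.
have [m [lo [hi [hl hb]]]] := hu _ e20; exists lo; exists m => // n /hb /andP[h1 h2].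
change (`|lo - u n| < e); rewrite ltr_norml; apply/andP; split; move: e0 hl h1 h2; clear; lra.
Qed.

Lemma mnormalizeE (R : realType) (dX : measure_display) (X : measurableType dX) (m : {measure set X -> \bar R})
  (Q : probability X R) A : m setT != 0%E -> m setT != +oo%E -> mnormalize m Q A = (m A * (fine (m setT))^-1%:E)%E.
Proof. by move=> h1 h2; rewrite /mnormalize (negbTE h1) (negbTE h2). Qed.

(** A cylinder written as an event of the set of open edges, the form that the finite-volume
    estimates take. *)
Fixpoint word_event d (s : seq bool) (w : set (edge d)) : Prop :=
  if s is b :: s' then `[< exists2 e, w e & ecode e = size s' >] = b /\ word_event s' w else True.

(** * Convergence of the conditional measures *)

Section cond_limit.
Context (R : realType) (d : nat) (hd : (6 < d)%N) (E : set (edge d)) (L0 : nat) (hE : lattice_edges E L0).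
Context (p : R) (P : probability (borel (config E)) R) (p01 : 0 < p < 1) (hP : is_bernoulli_product p P).
Context (c C : R) (c0 : 0 < c) (cC : c < C) (tp : two_point p E c C).
Context (V D : nat -> set (Zd d)).
Context (hB : forall n, (1 <= n)%N -> (V n `|` D n) `&` box d n = set0).
Context (hVD : forall n, (1 <= n)%N -> exists2 v, V n v & joined E (~` D n) 0 v).
Local Notation T := (config E).
Local Notation EI := (edges_in E).
Implicit Types (w : set (edge d)) (A : set (Zd d)) (s : seq bool).

Let p01' : 0 <= p <= 1. Proof. by case/andP: p01 => /ltW -> /ltW ->. Qed.

Let H n := joined_to E (~` D n) (V n) 0.
Let mu n := conditional P (measurable_joined_to E (~` D n) (V n) 0).

Lemma word_eventE s (om : T) : word_event s (open_edges om) <-> cyl s om.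
Proof.
elim: s => [|b s IH] /=; first by rewrite cyl0.
rewrite cyl_cons IH; suff -> : `[< exists2 e, open_edges om e & ecode e = size s >] = bit om (size s) by [].
apply: asbool_equiv_eq; split=> [[_ [e oe <-] ee]|[e ee oe]]; first by exists e.
by exists (val e) => //; exists e.
Qed.

Lemma code_bounded k : exists n, forall e : edge d, (ecode e < k)%N -> inside (ball 0 n) e.
Proof.
elim: k => [|k [n hn]]; first by exists 0%N.
have [[e0 ek]|ne] := pselect (exists e0 : edge d, ecode e0 = k); last first.
  exists n => e; rewrite ltnS leq_eqVlt => /orP[/eqP ee|]; last exact: hn.
  by exfalso; apply: ne; exists e.
exists (n + \sum_(t <- enum_fset e0) dist t 0)%N => e; rewrite ltnS leq_eqVlt => /orP[/eqP ee|/hn h].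
  have -> : e = e0 by apply: ecode_inj; rewrite ee.
  move=> t te; rewrite /ball /= (big_rem t te) /=; clear; lia.
by move=> t /h; apply: ball_subr; rewrite leq_addr.
Qed.

Lemma word_event_local s : exists n, depends_on (inside (ball (0 : Zd d) n)) (@word_event d s).
Proof.
have [n hn] := code_bounded (size s); exists n; elim: s hn => // b s IH hn w /=.
have h : forall e : edge d, (ecode e < size s)%N -> inside (ball 0 n) e.
  by move=> e he; apply: hn; rewrite /= ltnW.
rewrite -(IH h w); congr (_ = b /\ _); apply: asbool_equiv_eq; split=> -[e we ee]; exists e => //; last by case: we.
by split=> //; apply: hn; rewrite ee /=.
Qed.

(** The hypothesis provides a finite path, and all edges of a box that contains it are open with
    positive probability. *)
Lemma H_pos n : (1 <= n)%N -> 0 < fine (P (H n)).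
Proof.
move=> n1; have [v Vv /joinedP[q [q1 q2 q3]]] := hVD n1.
have [N hN] := pedges_box hE (fun _ h => h) q1.
have [m Pm] := box_event p01' hP hE N (fun w => joined_set w (~` D n) 0 (V n)).
have sub : [set om : T | joined_set (open_edges om `&` [set` EI 0 N]) (~` D n) 0 (V n)] `<=` H n.
  by move=> om; apply: joined_set_mono => // e [].
have mH : measurable (H n : set (borel T)) by exact: measurable_joined_to.
have := le_measure P (mem_set m) (mem_set mH) sub; rewrite [leLHS]Pm => h.
have fin : P (H n) \is a fin_num by exact: fin_num_measure.
apply: (@lt_le_trans _ _ (Pr p (EI 0 N) (fun w => joined_set w (~` D n) 0 (V n)))); last by rewrite -lee_fin fineK.
apply: (@lt_le_trans _ _ (p ^+ size (EI 0 N))); first by rewrite exprn_gt0//; case/andP: p01.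
apply: (le_trans (all_open p01 (fun _ h => h))); apply: le_Pr => // w _ hw.
by exists v => //; apply/joinedP; exists q; split=> // e he; apply: hw; have [_] := hN N (leqnn N) e he.
Qed.

Lemma muE n s : (1 <= n)%N -> fine (mu n (cyl s : set T)) = fine (P (cyl s `&` H n)) / fine (P (H n)).
Proof.
move=> n1; have hp := H_pos n1; have mH : measurable (H n : set (borel T)) by exact: measurable_joined_to.
have fin : P (H n) \is a fin_num by exact: fin_num_measure.
have eT : P (setT `&` H n) = P (H n) by rewrite setTI.
have e : mu n (cyl s : set T) = (P (cyl s `&` H n) * (fine (P (H n)))^-1%:E)%E.
  rewrite -eT; apply: mnormalizeE.
    by change (P (setT `&` H n) != 0%E); apply/eqP => h1; move: hp; rewrite -eT h1 ltxx.
  by change (P (setT `&` H n) != +oo%E); apply/eqP => h1; move: hp; rewrite -eT h1 ltxx.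
have mC : measurable (cyl s `&` H n : set (borel T)) by apply: measurableI => //; exact: measurable_cyl.
by rewrite e fineM//; exact: fin_num_measure.
Qed.

(** For n large, V_n and D_n are disjoint from the ball of [arm_ratio], whose bounds do not depend
    on them; they pass to the limit of growing boxes and enclose the conditional probability in an
    interval of length at most [eps]. *)
Lemma mu_cvg s : cvgn (fun n => fine (mu n (cyl s : set T))).
Proof.
apply: cvg_of_brackets => eps eps0; have [n0 dF] := word_event_local s.
have [m [lo [hi [hl hb]]]] := arm_ratio hE p01 hd c0 cC tp eps0 dF.
exists m.+1, lo, hi; split=> // n mn; have n1 : (1 <= n)%N by exact: leq_trans mn.
have hp := H_pos n1; rewrite muE//.
have bE : ball (0 : Zd d) n `<=` box d n.
  by move=> x /(iffLR (distP _ _ _)) h i; have := h i; rewrite mxE subr0 ler_norml.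
have mA : ball 0 m `<=` ~` D n.
  move=> x mx Dx; have : ((V n `|` D n) `&` box d n) x.
    by split; [right|apply/bE/(ball_subr _ mx)/ltnW].
  by rewrite hB.
have Vm : V n `&` ball 0 m = set0.
  rewrite -subset0 => x [Vx mx]; rewrite -(hB n1); split; [by left|apply/bE/(ball_subr _ mx)/ltnW].
  exact: mn.
have l1 := @arm_limit R d E p P p01' hP L0 hE n0 (@word_event d s) (~` D n) (V n) dF.
have dT : depends_on (inside (ball (0 : Zd d) n0)) (fun _ : set (edge d) => True) by [].
have l2 := @arm_limit R d E p P p01' hP L0 hE n0 (fun=> True) (~` D n) (V n) dT.
have e1 : [set om : T | word_event s (open_edges om)] `&` joined_to E (~` D n) (V n) 0 = cyl s `&` H n.
  by apply/seteqP; split=> om [h1 h2']; split=> //; apply/word_eventE.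
have e2 : [set om : T | True] `&` joined_to E (~` D n) (V n) 0 = H n by rewrite (_ : mkset _ = setT) ?setTI//; apply/seteqP; split.
rewrite e1 in l1; rewrite e2 in l2.
have key N : (m <= N + n0)%N -> let a := Pr p (EI 0 (N + n0)) (fun w => word_event s w /\ joined_set w (~` D n) 0 (V n)) in
   let b := Pr p (EI 0 (N + n0)) (fun w => True /\ joined_set w (~` D n) 0 (V n)) in lo * b <= a /\ a <= hi * b.
  move=> mN a b; rewrite /a /b (@Pr_equiv _ _ p _ (fun w => True /\ _) (fun w => joined_set w (~` D n) 0 (V n))); last by move=> w _; tauto.
  exact: hb.
have ev : \forall N \near \oo, (m <= N + n0)%N by exists m => // N /= /leq_trans; apply; rewrite leq_addr.
rewrite ler_pdivlMr// ler_pdivrMr//; apply/andP; split.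
  apply: (ler_cvg_to (cvgM (cvg_cst lo) l2) l1); apply: filterS ev => N /key[]//.
apply: (ler_cvg_to l1 (cvgM (cvg_cst hi) l2)); apply: filterS ev => N /key[]//.
Qed.

Lemma mu_cyl_add n s : fine (mu n (cyl s : set T)) = fine (mu n (cyl (false :: s) : set T)) + fine (mu n (cyl (true :: s) : set T)).
Proof.
have -> : cyl s = cyl (false :: s) `|` cyl (true :: s) :> set T.
  apply/seteqP; split=> om; last by case=> /cyl_cons[].
  by move=> h; case b: (bit om (size s)); [right|left]; apply/cyl_cons.
have mC s' : measurable (cyl s' : set (borel T)) by exact: measurable_cyl.
have -> : mu n (cyl (false :: s) `|` cyl (true :: s)) = (mu n (cyl (false :: s)) + mu n (cyl (true :: s)))%E.
  by apply: measureU => //; rewrite -subset0 => om [/cyl_cons[h _] /cyl_cons[]]; rewrite h.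
by rewrite fineD//; exact: fin_num_measure.
Qed.

(** The limits of cylinder probabilities are consistent because finite additivity passes to the
    limit. *)
Lemma cond_limit : exists nu : probability (borel T) R, weak_cvg mu nu.
Proof.
pose q s := limn (fun n => fine (mu n (cyl s : set T))).
have hq s : fine (mu n (cyl s : set T)) @[n --> \oo] --> q s by exact: mu_cvg.
have q0 s : 0 <= q s by apply: limr_ge; [exact: mu_cvg|apply: nearW => n; rewrite fine_ge0].
have q1 : q [::] = 1.
  apply: (cvg_unique _ (@hq [::])) => //; rewrite (_ : (fun n => _) = cst 1); first exact: cvg_cst.
  by apply/funext => n; rewrite cyl0 (_ : mu n setT = 1%E)//; exact: probability_setT.
have qD s : q s = q (false :: s) + q (true :: s).
  apply: (cvg_unique _ (@hq s)) => //.
  rewrite (_ : (fun n => _) = fun n => fine (mu n (cyl (false :: s) : set T)) + fine (mu n (cyl (true :: s) : set T))).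
    by apply: cvgD; exact: hq.
  by apply/funext => n; exact: mu_cyl_add.
have qN s : (forall e : E, ecode (val e) <> size s) -> q (true :: s) = 0.
  move=> hs; apply: (cvg_unique _ (@hq (true :: s))) => //; rewrite (_ : (fun n => _) = cst 0); first exact: cvg_cst.
  apply/funext => n; rewrite (_ : cyl (true :: s) = set0) ?measure0//.
  by apply/seteqP; split=> // om /cyl_cons[/asboolP[e ee _] _]; exact: (hs e).
have [nu hnu] := exists_limit_measure q0 q1 qD qN.
by exists nu; apply: weak_cvg_cyl => s; rewrite hnu /=; exact: hq.
Qed.

End cond_limit.

Theorem theorem1p1 (R : realType) (d : nat) (hd : (6 < d)%N)
    (E : set {fset Zd d})
    (hE : E = nn_edges d \/
          exists Lambda : R, 1 <= Lambda /\ E = spread_out_edges d Lambda)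
    (P : R -> probability (borel (config E)) R)
    (hP : forall p : R, 0 <= p <= 1 -> is_bernoulli_product p (P p))
    (h2pt : exists c C : R, [/\ 0 < c, c < C &
       forall x : Zd d,
         ((c * enorm_pow R x (2 - d%:Z))%:E
            <= P (critical_probability P) (connected_to E 0 x)
            <= (C * enorm_pow R x (2 - d%:Z))%:E)%E])
    (V D : nat -> set (Zd d))
    (hB : forall n, (1 <= n)%N -> (V n `|` D n) `&` box d n = set0)
    (hVD : forall n, (1 <= n)%N ->
       exists2 v, V n v & joined E (~` D n) 0 v) :
  exists nu : probability (borel (config E)) R,
    weak_cvg (fun n => conditional (P (critical_probability P))
                         (measurable_joined_to E (~` D n) (V n) 0)) nu.
Proof.
have [L0 lat] : exists L0, lattice_edges E L0.
  case: hE => [->|[La [La1 ->]]]; first by exists 1%N; exact: nn_lattice.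
  exact: spread_out_lattice.
have pc01 : 0 <= critical_probability P <= 1.
  rewrite /critical_probability; set S := mkset _.
  have lb : lbound S 0 by move=> x [/andP[]].
  (* The infimum of the empty set is 0 by convention, so that the critical parameter is in [0, 1] in
     either case. *)
  have [[x Sx]|nS] := pselect (exists x, S x); last first.
    have S0 : S = set0 by apply/seteqP; split=> // x Sx; apply: nS; exists x.
    by rewrite S0 inf0 lexx ler01.
  apply/andP; split; first by apply: lb_le_inf => //; exists x.
  have [/andP[_ x1] _] := Sx; apply: le_trans x1; apply: ge_inf => //; by exists 0.
have [c [C [c0 cC h2]]] := h2pt; have hPc := hP _ pc01.
have [k0 k1] := critical_consts hd c0 cC.
apply: (cond_limit hd lat (critical_interior hd lat pc01 hPc c0 cC h2) hPc k0 k1 _ hB hVD).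
exact: (critical_two_point hd lat pc01 hPc c0 cC h2).
Qed.
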